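(* Let $S$ be a unital inverse semigroup that acts on a $C^*$-algebra $A$ by Hilbert bimodules. Let $B$ be a $C^*$-algebra with surjective $*$-homomorphisms $A\rtimes S\twoheadrightarrow B\twoheadrightarrow A\rtimes_{\mathrm r}S$ that compose to the quotient map $A\rtimes S\twoheadrightarrow A\rtimes_{\mathrm r}S$. (1) A pure state $f\in P(A)$ belongs to $P_1(A\uparrow B)$ if and only if (the class of) the GNS representation of $f$ has trivial isotropy in the dual groupoid $\widehat A\rtimes S$. (2) The inclusion $A\hookrightarrow B$ has the almost extension property if and only if the dual groupoid $\widehat A\rtimes S$ is topologically principal. (3) The inclusion $A\hookrightarrow B$ has the extension property if and only if the dual groupoid is principal.
   Context: Ideals are closed and two-sided. A Hilbert $A$-bimodule is an $A$-bimodule $\mathcal E$ that is a right Hilbert $A$-module with inner product $\langle x\mid y\rangle$ and a left Hilbert $A$-module with inner product $\langle\!\langle x\mid y\rangle\!\rangle$ such that $\langle\!\langle x\mid y\rangle\!\rangle z=x\langle y\mid z\rangle$; $s(\mathcal E)$, $r(\mathcal E)$ are the closed ideals of $A$ generated by the right and left inner products. Actions and crossed products. Let $S$ be an inverse semigroup with unit $1$ and natural partial order $\le$. An action of $S$ on $A$ by Hilbert bimodules consists of Hilbert $A$-bimodules $\mathcal E_t$ and Hilbert bimodule isomorphisms $\mu_{t,u}\colon\mathcal E_t\otimes_A\mathcal E_u\to\mathcal E_{tu}$ that are associative, with $\mathcal E_1=A$ and $\mu_{1,t},\mu_{t,1}$ the canonical maps $a\otimes x\mapsto ax$, $x\otimes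 a\mapsto xa$. For an idempotent $e$ there is a unique bimodule isomorphism $j_{1,e}$ from $\mathcal E_e$ onto the ideal $s(\mathcal E_e)$ with $\mu_{e,e}(x\otimes y)=j_{1,e}(x)y$; for $v\le t$ let $j_{t,v}\colon\mathcal E_v\to\mathcal E_t$ be the isometric embedding $\mu_{t,v^*v}(x\otimes y)\mapsto x\,j_{1,v^*v}(y)$, with image $\mathcal E_t\cdot s(\mathcal E_v)$. Put $I_{1,t}=\overline{\sum_{v\le t,1}s(\mathcal E_v)}$; the maps $j_{1,v}\circ j_{t,v}^{-1}$ for $v\le t,1$ glue to an isomorphism $\theta_t\colon\mathcal E_t\cdot I_{1,t}\to I_{1,t}$. The full crossed product $A\rtimes S$ is the universal $C^*$-algebra generated by the images of linear maps $\pi_t\colon\mathcal E_t\to A\rtimes S$ with $\pi_t(x)\pi_u(y)=\pi_{tu}(\mu_{t,u}(x\otimes y))$, $\pi_t(x)^*\pi_t(y)=\pi_1(\langle x\mid y\rangle)$, $\pi_t(x)\pi_t(y)^*=\pi_1(\langle\!\langle x\mid y\rangle\!\rangle)$. There is a unique completely positive contraction $E_{\mathrm r}\colon A\rtimes S\to A''$ into the bidual such that $E_{\mathrm r}(\pi_t(x))$ is the weak-$*$ limit of $\theta_t(xu_i)$ for an approximate unit $(u_i)$ of $I_{1,t}$; the reduced crossed product $A\rtimes_{\mathrm r}S$ is the quotient of $A\rtimes S$ by the largest two-sided ideal contained in $\ker E_{\mathrm r}$. The algebra $A=\mathcal E_1$ embeds into $A\rtimes S$, $A\rtimes_{\mathrm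 r}S$, and hence into $B$. Dual groupoid. $\widehat A$ is the space of unitary equivalence classes of irreducible representations of $A$, with open subsets $\widehat J=\{[\varrho]:\varrho|_J\ne0\}$ for ideals $J$. A Hilbert $A$-bimodule $\mathcal E$ induces a homeomorphism $\widehat{\mathcal E}\colon\widehat{s(\mathcal E)}\to\widehat{r(\mathcal E)}$, $[\varrho]\mapsto[\mathcal E\otimes_\varrho\mathcal H]$. The dual groupoid $\widehat A\rtimes S$ has as arrows the germs $[t,[\varrho]]$ with $t\in S$, $[\varrho]\in\widehat{s(\mathcal E_t)}$, where $[t,[\varrho]]=[u,[\varrho']]$ iff $[\varrho]=[\varrho']$ and there is $v\le t,u$ with $[\varrho]\in\widehat{s(\mathcal E_v)}$; source $[\varrho]$, range $\widehat{\mathcal E_t}[\varrho]$, product $[t,\widehat{\mathcal E_u}[\varrho]]\cdot[u,[\varrho]]=[tu,[\varrho]]$; the sets $\{[t,[\varrho]]:[\varrho]\in V\}$, $V\subseteq\widehat{s(\mathcal E_t)}$ open, form a basis of its topology; the unit space is $\widehat A$. A unit $x$ of a groupoid has trivial isotropy if the only arrow with source and range $x$ is the unit arrow. A groupoid is principal if all units have trivial isotropy; a topological groupoid is topologically principal if the set of units with trivial isotropy is dense in the unit space. Extension properties. $P(A)$ is the set of pure states of $A$, and $P_1(A\uparrow B)$ is the set of pure states on $A$ that extend uniquely to a state on $B$. $A\subseteq B$ has the almost extension property if $P_1(A\uparrow B)$ is weak-$*$-dense in $P(A)$, and the extension property if $P_1(A\uparrow B)=P(A)$. *)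

(* Defs.v *)
From HB Require Import structures.
From mathcomp Require Import all_boot all_order all_algebra.
From mathcomp Require Import complex.
From mathcomp Require Import boolp classical_sets filter reals topology normedtype.

Set Implicit Arguments.
Unset Strict Implicit.
Unset Printing Implicit Defensive.

Import Order.TTheory GRing.Theory Num.Theory.
Import numFieldNormedType.Exports.

Local Open Scope classical_set_scope.
Local Open Scope ring_scope.
Local Open Scope complex_scope.

(** * Inverse semigroups with unit *)

(* That s |-> s^-1 is an involutive antiautomorphism, as recorded by starMonoidType,
   holds in every inverse semigroup. *)
HB.mixin Record StarMonoid_isInverseMonoid S of StarMonoid S := {
  mulgVg : forall s : S, (s * s^-1 * s = s)%g;
  mulVgV : forall s : S, (s^-1 * s * s^-1 = s^-1)%g;
  invg_unique : forall s t : S,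
    (s * t * s = s)%g -> (t * s * t = t)%g -> t = (s^-1)%g
}.

#[short(type="inverseMonoidType")]
HB.structure Definition InverseMonoid :=
  { S of StarMonoid_isInverseMonoid S & StarMonoid S }.

Definition nat_le (S : inverseMonoidType) (v t : S) : Prop :=
  exists e : S, (e * e = e)%g /\ v = (t * e)%g.

(** * Closed linear subspaces *)

Section Subspaces.
Variables (R : realType) (V : normedModType R[i]).

Definition is_subspace (L : set V) : Prop :=
  L 0 /\ forall (c : R[i]) x y, L x -> L y -> L (c *: x + y).

Definition closed_span (X : set V) : set V :=
  smallest [set L | is_subspace L /\ closed L] X.

End Subspaces.

(** * C*-algebras, not assumed unital *)

HB.mixin Record isCStarAlgebra (R : realType) A
    of CompleteNormedModule R[i] A := {
  cmul : A -> A -> A;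
  star : A -> A;
  cmulA : associative cmul;
  cmul_linearl : forall b, linear (cmul^~ b);
  cmul_linearr : forall a, linear (cmul a);
  cmul_norm : forall a b, `|cmul a b| <= `|a| * `|b|;
  star_semilinear :
    forall (c : R[i]) a b, star (c *: a + b) = conjc c *: star a + star b;
  starK : involutive star;
  starM : forall a b, star (cmul a b) = cmul (star b) (star a);
  cstar_identity : forall a, `|cmul (star a) a| = `|a| ^+ 2
}.

#[short(type="cstarAlgebra")]
HB.structure Definition CStarAlgebra (R : realType) :=
  { A of isCStarAlgebra R A & CompleteNormedModule R[i] A }.

Notation "a ** b" := (cmul a b) (at level 40, left associativity).

Section CStarTheory.
Variable R : realType.
Implicit Types A B : cstarAlgebra R.

Definition positive A (a : A) : Prop := exists b : A, a = star b ** b.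

Definition star_hom A B (f : A -> B) : Prop :=
  [/\ linear f, forall a b, f (a ** b) = f a ** f b
    & forall a, f (star a) = star (f a)].

Definition is_ideal A (J : set A) : Prop :=
  [/\ is_subspace J, closed J, forall a x, J x -> J (a ** x)
    & forall a x, J x -> J (x ** a)].

Definition ideal_gen A (X : set A) : set A := smallest (@is_ideal A) X.

(* Nets are rendered as maps u : T -> A with a proper filter F on T. *)
Definition approx_unit A (J : set A) (T : Type) (F : set_system T)
    (u : T -> A) : Prop :=
  [/\ ProperFilter F, forall i, [/\ J (u i), positive (u i) & `|u i| <= 1],
      forall a, J a -> (a ** u i) @[i --> F] --> a
    & forall a, J a -> (u i ** a) @[i --> F] --> a].

Definition bounded_functional A (f : A -> R[i]) : Prop :=
  scalar f /\ exists M : R[i], forall a, `|f a| <= M * `|a|.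

Definition is_state A (f : A -> R[i]) : Prop :=
  [/\ scalar f, forall a, 0 <= f (star a ** a), forall a, `|f a| <= `|a|
    & forall M : R, (forall a, `|f a| <= M%:C * `|a|) -> 1 <= M].

Definition pure_states A : set (A -> R[i]) :=
  [set f | is_state f /\
     forall (g h : A -> R[i]) (k : R), is_state g -> is_state h ->
       0 < k -> k < 1 -> (forall a, f a = k%:C * g a + (1 - k)%:C * h a) ->
       g = f /\ h = f].

Definition uniquely_extending A B (i : A -> B) : set (A -> R[i]) :=
  [set f | pure_states f /\
     exists! g : B -> R[i], is_state g /\ forall a, g (i a) = f a].

(* The weak-* topology is the topology of pointwise convergence. *)
Definition almost_extension_property A B (i : A -> B) : Prop :=
  @pure_states A `<=`
    @closure {ptws A -> R[i]^o} (uniquely_extending i).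

Definition extension_property A B (i : A -> B) : Prop :=
  uniquely_extending i = @pure_states A.

End CStarTheory.

(** * Hilbert bimodules *)

(* The norm is the one of the right Hilbert module; the compatibility axiom
   forces it to coincide with the norm of the left Hilbert module, so that
   [lip_norm] only makes the completeness of the latter explicit. *)
HB.mixin Record isHilbertBimodule (R : realType) (A : cstarAlgebra R) E
    of CompleteNormedModule R[i] E := {
  lact : A -> E -> E;
  ract : E -> A -> E;
  rip : E -> E -> A;
  lip : E -> E -> A;
  lact_linearl : forall x, linear (lact^~ x);
  lact_linearr : forall a, linear (lact a);
  ract_linearl : forall a, linear (ract^~ a);
  ract_linearr : forall x, linear (ract x);
  lactA : forall a b x, lact a (lact b x) = lact (a ** b) x;
  ractA : forall x a b, ract (ract x a) b = ract x (a ** b);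
  lractA : forall a x b, ract (lact a x) b = lact a (ract x b);
  rip_linearr : forall x, linear (rip x);
  rip_ract : forall x y a, rip x (ract y a) = rip x y ** a;
  rip_star : forall x y, star (rip x y) = rip y x;
  rip_positive : forall x, positive (rip x x);
  rip_norm : forall x, `|rip x x| = `|x| ^+ 2;
  lip_linearl : forall y, linear (lip^~ y);
  lip_lact : forall a x y, lip (lact a x) y = a ** lip x y;
  lip_star : forall x y, star (lip x y) = lip y x;
  lip_positive : forall x, positive (lip x x);
  lip_norm : forall x, `|lip x x| = `|x| ^+ 2;
  lip_rip : forall x y z, lact (lip x y) z = ract x (rip y z)
}.

#[short(type="hilbertBimodule")]
HB.structure Definition HilbertBimodule (R : realType) (A : cstarAlgebra R) :=
  { E of isHilbertBimodule R A E & CompleteNormedModule R[i] E }.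

Arguments rip {R A s} _ _.
Arguments lip {R A s} _ _.

Section Bimodules.
Variables (R : realType) (A : cstarAlgebra R).
Implicit Types E F G : hilbertBimodule A.

Definition sI E : set A := ideal_gen [set a | exists x y : E, a = rip x y].

Definition rI E : set A := ideal_gen [set a | exists x y : E, a = lip x y].

(* [m] induces a Hilbert bimodule isomorphism from the (completed) interior
   tensor product of E and F over A onto G, where m x y is the image of the
   elementary tensor of x and y: the inner products of elementary tensors are
   prescribed, and they are total. *)
Definition tensor_iso E F G (m : E -> F -> G) : Prop :=
  [/\ [/\ forall y, linear (m^~ y), forall x, linear (m x)
        & forall x a y, m (ract x a) y = m x (lact a y)],
      [/\ forall a x y, m (lact a x) y = lact a (m x y)
        & forall x y a, m x (ract y a) = ract (m x y) a],
      forall x y x' y', rip (m x y) (m x' y') = rip y (lact (rip x x') y'),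
      forall x y x' y', lip (m x y) (m x' y') = lip (ract x (lip y y')) x'
    & closed_span [set z | exists x y, z = m x y] = setT].

(* Identification of G with A, viewed as a Hilbert bimodule over itself. *)
Definition trivial_bimodule_iso G (i : A -> G) : Prop :=
  [/\ linear i /\ bijective i,
      forall a b, i (a ** b) = lact a (i b),
      forall a b, i (a ** b) = ract (i a) b,
      forall a b, rip (i a) (i b) = star a ** b
    & forall a b, lip (i a) (i b) = a ** star b].

(* By Cohen factorisation, for a closed ideal J this closed linear span is
   already the set of all products x . a with a in J. *)
Definition mod_ideal E (J : set A) : set E :=
  closed_span [set z | exists (x : E) (a : A), J a /\ z = ract x a].

End Bimodules.

Arguments mod_ideal {R A} E J _.

(** * Actions by Hilbert bimodules *)

(* Equations between elements of E s and E t, where s = t holds only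
   propositionally, are stated in the total space {t & E t}. *)
Record bimodule_action (R : realType) (S : inverseMonoidType)
    (A : cstarAlgebra R) := BimoduleAction {
  fiber :> S -> hilbertBimodule A;
  mu : forall t u, fiber t -> fiber u -> fiber (t * u)%g;
  unit_iso : A -> fiber 1%g;
  mu_tensor : forall t u, tensor_iso (@mu t u);
  unit_isoP : trivial_bimodule_iso unit_iso;
  mu_assoc : forall t u v (x : fiber t) (y : fiber u) (z : fiber v),
    Tagged fiber (mu (mu x y) z) = Tagged fiber (mu x (mu y z));
  mu_unitl : forall t a (x : fiber t),
    Tagged fiber (mu (unit_iso a) x) = Tagged fiber (lact a x);
  mu_unitr : forall t a (x : fiber t),
    Tagged fiber (mu x (unit_iso a)) = Tagged fiber (ract x a)
}.

Arguments unit_iso {R S A} b _.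

Section CrossedProducts.
Variables (R : realType) (S : inverseMonoidType) (A : cstarAlgebra R).
Variable E : bimodule_action S A.

(* [j1], [jmap] and [theta] are defined by description; [j1 e] is meaningful
   for e idempotent, [jmap t v] for v <= t, and [theta t] on E_t . I_{1,t}. *)

Definition is_j1 (e : S) (j : E e -> A) : Prop :=
  [/\ linear j /\ injective j,
      range j = sI (E e),
      forall a x, j (lact a x) = a ** j x,
      forall x a, j (ract x a) = j x ** a
    & forall x y : E e, Tagged (fiber E) (mu x y) = Tagged (fiber E) (lact (j x) y)].

Definition j1 (e : S) : E e -> A := get [set j | is_j1 j].

Definition is_jmap (t v : S) (j : E v -> E t) : Prop :=
  [/\ linear j, forall x, `|j x| = `|x|
    & forall (x : E t) (y : E (v^-1 * v)%g) (z : E v),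
        Tagged (fiber E) (mu x y) = Tagged (fiber E) z -> j z = ract x (j1 y)].

Definition jmap (t v : S) : E v -> E t := get [set j | is_jmap j].

Definition I1 (t : S) : set A :=
  closed_span (\bigcup_(v in [set v | nat_le v t /\ nat_le v 1%g]) sI (E v)).

Definition is_theta (t : S) (th : E t -> A) : Prop :=
  let D := mod_ideal (E t) (I1 t) in
  [/\ forall (c : R[i]) x y, D x -> D y -> th (c *: x + y) = c *: th x + th y,
      (forall x, D x -> `|th x| = `|x|) /\ th @` D = I1 t,
      forall a x, D x -> th (lact a x) = a ** th x,
      forall x a, D x -> th (ract x a) = th x ** a
    & forall v y, nat_le v t -> nat_le v 1%g -> th (jmap t y) = @j1 v y].

Definition theta (t : S) : E t -> A := get [set th | is_theta th].

Definition covariant (D : cstarAlgebra R) (pi : forall t, E t -> D) : Prop :=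
  [/\ forall t, linear (pi t),
      forall t u (x : E t) (y : E u), pi t x ** pi u y = pi (t * u)%g (mu x y),
      forall t (x y : E t),
        star (pi t x) ** pi t y = pi 1%g (unit_iso E (rip x y))
    & forall t (x y : E t),
        pi t x ** star (pi t y) = pi 1%g (unit_iso E (lip x y))].

Definition is_crossed_product (D : cstarAlgebra R) (pi : forall t, E t -> D) :
    Prop :=
  covariant pi /\
  forall (D' : cstarAlgebra R) (rho : forall t, E t -> D'), covariant rho ->
    exists! h : D -> D', star_hom h /\ forall t (x : E t), h (pi t x) = rho t x.

(* Elements of the bidual A'' are represented as functions on the dual of A,
   here on all functions A -> C, with only the values at bounded functionals
   being relevant.  Complete positivity: a positive functional on M_n(A) is a
   matrix phi of bounded functionals on A with
   sum_(i, j) phi_ij (a_i^* a_j) >= 0 for all a, the positive elements of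
   M_n(A'') = M_n(A)'' are those on which all these functionals are
   nonnegative, and the positive elements of M_n(D) are the sums of matrices
   (d_i^* d_j)_(i, j). *)
Definition is_Er (D : cstarAlgebra R) (pi : forall t, E t -> D)
    (Er : D -> (A -> R[i]) -> R[i]) : Prop :=
  [/\ forall d (c : R[i]) f g, bounded_functional f -> bounded_functional g ->
        Er d (fun a => c * f a + g a) = c * Er d f + Er d g,
      forall f, bounded_functional f -> scalar (Er^~ f),
      forall d f (M : R[i]), bounded_functional f -> 0 <= M ->
        (forall a, `|f a| <= M * `|a|) -> `|Er d f| <= M * `|d|,
      forall n (phi : 'I_n -> 'I_n -> A -> R[i]),
        (forall i j, bounded_functional (phi i j)) ->
        (forall a : 'I_n -> A,
           0 <= \sum_i \sum_j phi i j (star (a i) ** a j)) ->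
        forall d : 'I_n -> D, 0 <= \sum_i \sum_j Er (star (d i) ** d j) (phi i j)
    & forall t (x : E t) (T : Type) (F : set_system T) (u : T -> A),
        approx_unit (I1 t) F u ->
        forall f, bounded_functional f ->
          (f (theta (ract x (u i))) : R[i]^o) @[i --> F]
            --> (Er (pi t x) f : R[i]^o)].

Definition ker_Er (D : cstarAlgebra R) (Er : D -> (A -> R[i]) -> R[i]) :
    set D :=
  [set d | forall f, bounded_functional f -> Er d f = 0].

(* [q] exhibits Dr as the quotient of D by the largest ideal in ker Er. *)
Definition is_reduced_crossed_product (D : cstarAlgebra R)
    (pi : forall t, E t -> D) (Dr : cstarAlgebra R) (q : D -> Dr) : Prop :=
  [/\ star_hom q, range q = setT
    & exists Er, [/\ is_Er pi Er, [set d | q d = 0] `<=` ker_Er Er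
        & forall J : set D, is_ideal J -> J `<=` ker_Er Er ->
            J `<=` [set d | q d = 0]]].

End CrossedProducts.

(** * Irreducible representations and the spectrum *)

HB.mixin Record isHilbertSpace (R : realType) H
    of CompleteNormedModule R[i] H := {
  inner : H -> H -> R[i];
  inner_linear : forall x, scalar (inner x);
  inner_conj : forall x y, inner y x = conjc (inner x y);
  inner_norm : forall x, inner x x = `|x| ^+ 2
}.

#[short(type="hilbertSpace")]
HB.structure Definition HilbertSpace (R : realType) :=
  { H of isHilbertSpace R H & CompleteNormedModule R[i] H }.

Section Representations.
Variables (R : realType) (A : cstarAlgebra R).

Definition is_representation (H : hilbertSpace R) (rho : A -> H -> H) : Prop :=
  [/\ forall a, linear (rho a) /\ continuous (rho a),
      forall xi, linear (rho^~ xi),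
      forall a b xi, rho (a ** b) xi = rho a (rho b xi)
    & forall a xi eta, inner (rho (star a) xi) eta = inner xi (rho a eta)].

(* The zero representation on a one-dimensional space is not irreducible. *)
Definition is_irreducible (H : hilbertSpace R) (rho : A -> H -> H) : Prop :=
  (exists a xi, rho a xi <> 0) /\
  forall L : set H, is_subspace L -> closed L ->
    (forall a xi, L xi -> L (rho a xi)) -> L = [set 0] \/ L = setT.

Record irrep := Irrep {
  irrep_space : hilbertSpace R;
  irrep_map :> A -> irrep_space -> irrep_space;
  irrep_rep : is_representation irrep_map;
  irrep_irr : is_irreducible irrep_map
}.

Definition unitarily_equivalent (rho sigma : irrep) : Prop :=
  exists U : irrep_space rho -> irrep_space sigma,
    [/\ linear U, range U = setT,
        forall xi eta, inner (U xi) (U eta) = inner xi eta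
      & forall a xi, U (rho a xi) = sigma a (U xi)].

(* Subsets of irrep and of spectrum are plain predicates: these types live in a
   universe above that of the carriers of [set] and of topologicalType. *)
Definition irrep_class (rho : irrep) : irrep -> Prop :=
  unitarily_equivalent rho.

Definition spectrum : Type :=
  {x : irrep -> Prop | exists rho, x = irrep_class rho}.

(* The open subset of the spectrum given by a closed ideal J; these are all the
   open subsets. *)
Definition spectrum_open (J : set A) (x : spectrum) : Prop :=
  exists2 rho, sval x rho & exists a xi, J a /\ rho a xi <> 0.

Definition spectrum_dense (P : spectrum -> Prop) : Prop :=
  forall J : set A, is_ideal J -> (exists x, spectrum_open J x) ->
    exists x, spectrum_open J x /\ P x.

Definition is_GNS_class (f : A -> R[i]) (x : spectrum) : Prop :=
  exists rho, sval x rho /\ exists xi : irrep_space rho,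
    closed_span [set rho a xi | a in setT] = setT /\
    forall a, f a = inner xi (rho a xi).

(* The graph of the partial homeomorphism of the spectrum induced by a Hilbert
   bimodule: sigma is (a model of) the representation of A on the interior
   tensor product of E with the space of rho. *)
Definition induced (E : hilbertBimodule A) (x y : spectrum) : Prop :=
  spectrum_open (sI E) x /\
  exists rho sigma, [/\ sval x rho, sval y sigma
    & exists m : E -> irrep_space rho -> irrep_space sigma,
      [/\ forall xi, linear (m^~ xi), forall z, linear (m z),
          forall z xi z' xi',
            inner (m z xi) (m z' xi') = inner xi (rho (rip z z') xi'),
          forall a z xi, sigma a (m z xi) = m (lact a z) xi
        & closed_span [set eta | exists z xi, eta = m z xi] = setT]].

End Representations.

(** * The dual groupoid *)

Section DualGroupoid.
Variables (R : realType) (S : inverseMonoidType) (A : cstarAlgebra R).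
Variable E : bimodule_action S A.

(* The germ [t, x], as an equivalence class of pairs. *)
Definition germ (t : S) (x : spectrum A) : S * spectrum A -> Prop :=
  fun p => p.2 = x /\
    exists v, [/\ nat_le v t, nat_le v p.1 & spectrum_open (sI (E v)) x].

(* [g] is an arrow of the dual groupoid with source x and range y.  The unit
   arrow at x is [germ 1 x], and the unit space is the spectrum with its
   topology; multiplication and the topology on arrows are not involved in
   isotropy or topological principality, so they are not defined. *)
Definition is_arrow (g : S * spectrum A -> Prop) (x y : spectrum A) : Prop :=
  exists t, [/\ spectrum_open (sI (E t)) x, g = germ t x & induced (E t) x y].

Definition trivial_isotropy (x : spectrum A) : Prop :=
  forall g, is_arrow g x x -> g = germ 1%g x.

Definition principal : Prop := forall x, trivial_isotropy x.

Definition topologically_principal : Prop :=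
  spectrum_dense trivial_isotropy.

End DualGroupoid.

(* Main.v *)
Require Import Defs.
From HB Require Import structures.
From mathcomp Require Import all_boot all_order all_algebra.
From mathcomp Require Import complex.
From mathcomp Require Import boolp classical_sets filter reals topology normedtype.
From mathcomp Require Import ring lra.

Set Implicit Arguments.
Unset Strict Implicit.
Unset Printing Implicit Defensive.

Import Order.TTheory GRing.Theory Num.Theory.
Import numFieldNormedType.Exports.

Local Open Scope classical_set_scope.
Local Open Scope ring_scope.
Local Open Scope complex_scope.

(* The images of the fibres [E t] span the crossed product, so an extension [g]
   to [B] of a pure state [f] of [A] is determined by its values on the [E t].
   Let [x] be the class of the GNS representation [H] of [f], with cyclic vector
   [xi].  If [x] lies in the support of [E v] for some [v <= t, 1], then [xi] is
   almost fixed by the ideal [s(E v)], which multiplies [E t] into [A]; so the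
   values of [g] on [E t] are forced.  Otherwise suppose that [g] does not vanish
   on [E t], and look at the GNS representation of [g].  The closed
   [A]-invariant subspaces spanned by [A] and by [E t] applied to the cyclic
   vector are copies of [H] and of the interior tensor product of [E t] with [H];
   they are irreducible and not orthogonal, hence equivalent by Schur's lemma, and
   the germ of [t] at [x] is a nontrivial isotropy arrow.  Conversely, let [t]
   give such an arrow.  The expectation [Er] provides an extension of [f] that
   vanishes on [E t]; in its GNS representation, with cyclic vector [Om], the
   arrow yields a unit vector [eta], orthogonal to [A Om], on which [A] acts as on
   [xi].  The unit vectors [(c Om + eta) / sqrt 2] for [|c| = 1] all
   induce extensions of [f], and these are not all equal.

   Part (3) follows at once, and so does (2) once every pure state [f] is known to
   be a weak-* limit of vector states of the representations in a dense subset
   [D] of the spectrum.  If [a = a^*] and all these vector states are at most [s]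
   at [a], then [|a - s| + (a - s)] is killed by [D], hence by the GNS
   representation of [f], so that [f a <= s]; by separation, [f] is a limit of
   convex combinations of vector states.  If [f] were not a limit of vector
   states, then finitely many half planes avoiding [f] would cover them; grouping
   the convex combinations accordingly and passing to a limit along an
   ultrafilter writes [f] as a nontrivial convex combination of states, which
   contradicts purity.

   Absolute values and approximate units are obtained from square roots of
   contractions (Visser's iteration), without functional calculus. *)

(** * Norms and subspaces *)

(* The tactic [lmod] decides linear identities by comparing coefficients. *)

(** The algebras need not have a unit, so elements such as [1 - a] become operators on [A] that are
    self-adjoint for [star x ** y]. If two commuting ones satisfy [T^2 + S^2 = 1], then [T + i S]
    and [T - i S] are isometric; several norm bounds reduce to finding such a pair.

    About [B] only three facts enter: the images of the fibres form a covariant family, they span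
    [B], and each state of [A] has an extension that kills every fibre [E t] for which the state
    kills [I1 E t]. The last fact holds for every algebra between the two crossed products because
    the kernel of [p] lies in that of [q], on which [Er] vanishes.

    For unit phases [c], only the cross terms between [Om] and [eta] depend on [c]. Equality of the
    extensions for [c = 1, -1, i] would make [eta] orthogonal to the orbit of [Om], which is dense,
    while [eta] is a unit vector.

    Schur's lemma is needed for self-adjoint operators only: the comparison of two
    subrepresentations goes through the compression of one projection to the range of the other.

    Equalities of indices such as [t v = v] are propositional, so products in the fibres carry a
    transport. *)

Section LinearExpressions.
Variables (K : comNzRingType) (V : lmodType K).

Inductive lexpr :=
  | LVar of nat | LZero | LAdd of lexpr & lexpr | LOpp of lexpr
  | LScale of K & lexpr | LMuln of lexpr & nat.

Fixpoint leval (env : seq V) e : V :=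
  match e with
  | LVar n => nth 0 env n
  | LZero => 0
  | LAdd a b => leval env a + leval env b
  | LOpp a => - leval env a
  | LScale c a => c *: leval env a
  | LMuln a n => leval env a *+ n
  end.

(** The indices are compared by [Nat.eqb], which [cbn] evaluates on literals; the coefficients then
    become ring expressions. *)
Fixpoint lcoef e (i : nat) : K :=
  match e with
  | LVar n => if Nat.eqb n i then 1 else 0
  | LZero => 0
  | LAdd a b => lcoef a i + lcoef b i
  | LOpp a => - lcoef a i
  | LScale c a => c * lcoef a i
  | LMuln a n => lcoef a i * n%:R
  end.

Fixpoint lcoef_eq (n : nat) e1 e2 : Prop :=
  if n is m.+1 then lcoef e1 m = lcoef e2 m /\ lcoef_eq m e1 e2 else True.

Lemma leval_coef env e :
  leval env e = \sum_(i < size env) lcoef e i *: nth 0 env i.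
Proof.
elim: e => [n||a IHa b IHb|a IHa|c a IHa|a IHa n] /=.
- have [ltn|gen] := ltnP n (size env).
    rewrite (bigD1 (Ordinal ltn)) //= PeanoNat.Nat.eqb_refl scale1r.
    rewrite big1 ?addr0 // => i ni.
    have /PeanoNat.Nat.eqb_neq -> : n <> i by move=> e; case/eqP: ni; exact: val_inj.
    by rewrite scale0r.
  rewrite nth_default // big1 // => i _.
  have /PeanoNat.Nat.eqb_neq -> : n <> i.
    by move=> e; have := ltn_ord i; rewrite -e ltnNge gen.
  by rewrite scale0r.
- by rewrite big1 // => i _; rewrite scale0r.
- by rewrite IHa IHb -big_split; apply: eq_bigr => i _; rewrite scalerDl.
- by rewrite IHa -sumrN; apply: eq_bigr => i _; rewrite scaleNr.
- by rewrite IHa scaler_sumr; apply: eq_bigr => i _; rewrite scalerA.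
- rewrite IHa -scaler_nat scaler_sumr; apply: eq_bigr => i _.
  by rewrite scalerA mulrC.
Qed.

Lemma leval_eq env e1 e2 : lcoef_eq (size env) e1 e2 ->
  leval env e1 = leval env e2.
Proof.
move=> h; rewrite !leval_coef; apply: eq_bigr => i _; congr (_ *: _).
case: i => i /=; elim: (size env) h => //= m IH [hm h]; rewrite ltnS leq_eqVlt.
by case/orP => [/eqP->//|/(IH h)].
Qed.

End LinearExpressions.

Ltac lmod_index x env :=
  lazymatch env with
  | x :: _ => constr:(0%N)
  | _ :: ?env' => let n := lmod_index x env' in constr:(n.+1)
  end.

Ltac lmod_atoms K t env :=
  lazymatch t with
  | GRing.add ?a ?b => let env := lmod_atoms K a env in lmod_atoms K b env
  | GRing.opp ?a => lmod_atoms K a env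
  | GRing.scale ?c ?a => lmod_atoms K a env
  | GRing.natmul ?a ?n => lmod_atoms K a env
  | GRing.zero => env
  | _ => match env with
         | context [t :: _] => env
         | _ => constr:(t :: env)
         end
  end.

Ltac lmod_reify K t env :=
  lazymatch t with
  | GRing.add ?a ?b =>
      let a := lmod_reify K a env in let b := lmod_reify K b env in
      constr:(LAdd a b)
  | GRing.opp ?a => let a := lmod_reify K a env in constr:(LOpp a)
  | GRing.scale ?c ?a => let a := lmod_reify K a env in constr:(@LScale K c a)
  | GRing.natmul ?a ?n => let a := lmod_reify K a env in constr:(LMuln a n)
  | GRing.zero => constr:(@LZero K)
  | _ => let n := lmod_index t env in constr:(@LVar K n)
  end.

Ltac lmod_with K :=
  lazymatch goal with
  | |- @eq ?T ?a ?b =>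
      let env := lmod_atoms K a (@nil T) in
      let env := lmod_atoms K b env in
      let ea := lmod_reify K a env in
      let eb := lmod_reify K b env in
      refine (@leval_eq K _ env ea eb _);
      cbn [lcoef_eq lcoef size Nat.eqb];
      repeat match goal with |- _ /\ _ => split | |- True => exact I end;
      try ring; try field
  end.

Ltac lmod := lazymatch goal with R : realType |- _ => lmod_with (R[i] : comNzRingType) end.

Section Norm.
Variable R : realType.
Local Notation C := R[i].

Lemma re_real (c : C) : 0 <= c -> (complex.Re c)%:C = c.
Proof. by move=> c0; apply: RRe_real; rewrite ger0_real. Qed.

Lemma le_eps (a b M : R) : (forall e, 0 < e -> a <= b + M * e) -> a <= b.
Proof.
move=> h; rewrite leNgt; apply/negP => ltba.
have M0 : 0 < `|M| + 1 by rewrite ltr_wpDl.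
have d0 : 0 < (a - b) / (`|M| + 1) / 2 by rewrite !divr_gt0 // subr_gt0.
have := h _ d0; rewrite leNgt => /negP; apply.
rewrite -ltrBrDl.
apply: (@le_lt_trans _ _ ((`|M| + 1) * ((a - b) / (`|M| + 1) / 2))).
  by rewrite ler_wpM2r ?(ltW d0) // (le_trans (ler_norm M)) // lerDl.
have Mn : `|M| + 1 != 0 by rewrite gt_eqF.
rewrite [_ * _](_ : _ = (a - b) / 2); last by field.
by rewrite ltr_pdivrMr // ltr_pMr ?subr_gt0 // ltr1n.
Qed.

Lemma mul_lt_div (c x y d : R) : 0 <= c -> 0 <= x -> 0 <= y -> y <= c -> x < d / (c + 1) ->
  y * x < d.
Proof.
move=> c0 x0 y0 yc; rewrite ltr_pdivlMr ?ltr_wpDl // => h; apply: le_lt_trans h.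
by rewrite mulrC ler_wpM2l // (le_trans yc) // lerDl.
Qed.

(** The norm takes values in [R[i]], which is only partially ordered; its real part is accessible to
    [lra] and [nra]. *)
Definition nrm (V : normedZmodType C) (x : V) : R := complex.Re `|x|.

Section NormedZmod.
Variable V : normedZmodType C.
Implicit Types x y : V.

Lemma nrmE x : `|x| = (nrm x)%:C.
Proof. by rewrite re_real. Qed.

Lemma nrm_ge0 x : 0 <= nrm x.
Proof. by rewrite -ler0c -nrmE. Qed.

Lemma nrm0 : nrm (0 : V) = 0.
Proof. by rewrite /nrm normr0. Qed.

Lemma nrm_eq0 x : nrm x = 0 -> x = 0.
Proof. by move=> x0; apply: normr0_eq0; rewrite nrmE x0. Qed.

Lemma nrmD x y : nrm (x + y) <= nrm x + nrm y.
Proof. by rewrite -lecR rmorphD /= -!nrmE ler_normD. Qed.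

Lemma nrmN x : nrm (- x) = nrm x.
Proof. by rewrite /nrm normrN. Qed.

Lemma nrmBC x y : nrm (x - y) = nrm (y - x).
Proof. by rewrite -nrmN opprB. Qed.

Lemma nrmB x y : nrm (x - y) <= nrm x + nrm y.
Proof. by rewrite -(nrmN y) nrmD. Qed.

Lemma nrm_tri y x z : nrm (x - z) <= nrm (x - y) + nrm (y - z).
Proof. by have := nrmD (x - y) (y - z); rewrite addrA subrK. Qed.

Lemma nrm_muln x n : nrm (x *+ n) = n%:R * nrm x.
Proof. by rewrite /nrm normrMn (nrmE x) -rmorphMn /= mulr_natl. Qed.

Lemma nrm_small x : (forall e, 0 < e -> nrm x < e) -> x = 0.
Proof.
move=> h; apply/nrm_eq0/eqP; rewrite eq_le nrm_ge0 andbT leNgt.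
by apply/negP => /h; rewrite ltxx.
Qed.

End NormedZmod.

Lemma nrmC (x : R) : nrm (x%:C : C) = `|x|.
Proof.
by rewrite /nrm normc_def /= expr0n addr0 sqrtr_sqr.
Qed.

Lemma nrmM (x y : C) : nrm (x * y) = nrm x * nrm y.
Proof. by apply: complexI; rewrite rmorphM -!nrmE normrM. Qed.

Lemma nrm1 : nrm (1 : C) = 1.
Proof. by rewrite /nrm normr1. Qed.

Lemma conjcM (x y : C) : conjc (x * y) = conjc x * conjc y.
Proof. exact: rmorphM. Qed.
Lemma conjcD (x y : C) : conjc (x + y) = conjc x + conjc y.
Proof. exact: rmorphD. Qed.
Lemma conjcN (x : C) : conjc (- x) = - conjc x.
Proof. exact: rmorphN. Qed.
Lemma conjcB (x y : C) : conjc (x - y) = conjc x - conjc y.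
Proof. exact: rmorphB. Qed.

Lemma Re_realM (r : R) (x : C) : complex.Re (r%:C * x) = r * complex.Re x.
Proof. by case: x => a b /=; rewrite mul0r subr0. Qed.

Lemma ReD (x y : C) : complex.Re (x + y) = complex.Re x + complex.Re y.
Proof. by case: x; case: y. Qed.
Lemma ReN (x : C) : complex.Re (- x) = - complex.Re x.
Proof. by case: x. Qed.
Lemma ReB (x y : C) : complex.Re (x - y) = complex.Re x - complex.Re y.
Proof. by rewrite ReD ReN. Qed.

Lemma conjc_i : conjc ('i%C : C) = - 'i%C.
Proof. by apply/eqP; rewrite eq_complex /= oppr0 !eqxx. Qed.

Lemma nrmi : nrm ('i%C : C) = 1.
Proof. by rewrite /nrm normc_def /= expr0n add0r expr1n sqrtr1. Qed.

Lemma nrmJ (x : C) : nrm (conjc x) = nrm x.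
Proof. by rewrite /nrm normcJ. Qed.

Lemma nrm_sqr (x : C) : (nrm x ^+ 2)%:C = conjc x * x.
Proof. by rewrite rmorphXn /= -nrmE sqr_normc mulrC. Qed.

Lemma Re_le_nrm (x : C) : `|complex.Re x| <= nrm x.
Proof. by rewrite -lecR -nrmE normc_ge_Re. Qed.

Lemma Re_le (x : C) : complex.Re x <= nrm x.
Proof. exact: le_trans (ler_norm _) (Re_le_nrm x). Qed.

Lemma Im_le_nrm (x : C) : `|complex.Im x| <= nrm x.
Proof.
by have := Re_le_nrm (x * 'i%C); rewrite ReiNIm normrN nrmM nrmi mulr1.
Qed.

Lemma nrm_ge0E (x : C) : 0 <= x -> nrm x = complex.Re x.
Proof. by move=> x0; rewrite /nrm ger0_norm. Qed.

Lemma nrmZ (V : normedModType C) (c : C) (x : V) : nrm (c *: x) = nrm c * nrm x.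
Proof. by apply: complexI; rewrite rmorphM /= -[LHS]nrmE normrZ !nrmE. Qed.

Lemma half_half (V : lmodType C) (x : V) : 2^-1 *: (x + x) = x.
Proof. by rewrite -mulr2n -[x *+ 2]scaler_nat scalerA mulVf ?scale1r // pnatr_eq0. Qed.

Lemma nrm_half : nrm (2^-1 : C) = 2^-1.
Proof.
have -> : (2^-1 : C) = (2^-1 : R)%:C by rewrite fmorphV /= rmorph_nat.
by rewrite nrmC gtr0_norm // invr_gt0.
Qed.

End Norm.

Section Linear.
Variables (K : comNzRingType) (U V : lmodType K) (f : U -> V).
Hypothesis lf : linear f.

Lemma lin0 : f 0 = 0.
Proof. by have := lf (-1) 0 0; rewrite scaler0 addr0 scaleN1r addNr. Qed.

Lemma linD x y : f (x + y) = f x + f y.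
Proof. by have := lf 1 x y; rewrite !scale1r. Qed.

Lemma linZ c x : f (c *: x) = c *: f x.
Proof. by have := lf c x 0; rewrite !addr0 lin0 addr0. Qed.

Lemma linN x : f (- x) = - f x.
Proof. by rewrite -scaleN1r linZ scaleN1r. Qed.

Lemma linB x y : f (x - y) = f x - f y.
Proof. by rewrite linD linN. Qed.

End Linear.

Section Closure.
Variables (R : realType) (V : normedModType R[i]).
Implicit Types (L X : set V) (x y : V).

Definition adh L x := forall e : R, 0 < e -> exists2 y, L y & nrm (x - y) < e.

Lemma adhP L x : closure L x <-> adh L x.
Proof.
split=> [cl e e0|ad U].
  have e0' : 0 < e%:C by rewrite ltcR.
  have /cl[y [Ly yU]] : nbhs x (ball x e%:C) by exact: nbhsx_ballx.
  exists y => //; move: yU; rewrite -ball_normE /ball_ /=.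
  by rewrite nrmE ltcR.
move=> /nbhs_normP[e /= e0 sub].
have [r er] : exists r, e = r%:C.
  by exists (complex.Re e); rewrite re_real // ltW.
rewrite er in e0 sub; rewrite ltcR in e0.
have [y Ly yx] := ad _ e0; exists y; split=> //; apply: sub.
by rewrite /= nrmE ltcR.
Qed.

Lemma closedP L : closed L <-> forall x, adh L x -> L x.
Proof.
by split=> [cl x /adhP/cl //|h x /adhP/h].
Qed.

Lemma adh_sub L x : L x -> adh L x.
Proof. by move=> Lx e e0; exists x; rewrite // subrr nrm0. Qed.

Lemma adh_mono L X : L `<=` X -> adh L `<=` adh X.
Proof. by move=> LX x ax e /ax[y Ly ?]; exists y => //; exact: LX. Qed.

Lemma adh_idem L x : adh (adh L) x -> adh L x.
Proof.
move=> ax e e0; have e2 : 0 < e / 2 by rewrite divr_gt0.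
have [y ay xy] := ax _ e2; have [z Lz yz] := ay _ e2.
exists z => //; rewrite (le_lt_trans (nrm_tri y _ _)) //.
by rewrite (splitr e) ltrD.
Qed.

Lemma adh_closed L : closed (adh L).
Proof. by apply/closedP => x; exact: adh_idem. Qed.

Lemma subspace_adh L : is_subspace L -> is_subspace (adh L).
Proof.
move=> [L0 LZ]; split; first exact: adh_sub.
move=> c x y ax ay e e0.
have e1 : 0 < e / 2 / (nrm c + 1).
  by rewrite !divr_gt0 // ltr_wpDl // nrm_ge0.
have [x' Lx' xx'] := ax _ e1.
have [|y' Ly' yy'] := ay (e / 2); first by rewrite divr_gt0.
exists (c *: x' + y'); first exact: LZ.
rewrite opprD addrACA -scalerBr (le_lt_trans (nrmD _ _)) // (splitr e).
apply: ler_ltD => //; rewrite nrmZ.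
apply: (@le_trans _ _ (nrm c * (e / 2 / (nrm c + 1)))).
  by rewrite ler_wpM2l ?nrm_ge0 // ltW.
have n0 := nrm_ge0 c.
rewrite mulrA ler_pdivrMr ?ltr_wpDl // mulrC.
by rewrite ler_wpM2l ?divr_ge0 ?(ltW e0) // lerDl.
Qed.

Lemma subspace_span X : is_subspace (closed_span X).
Proof.
split; first by move=> L [[]] [].
by move=> c x y sx sy L [[sL cL] XL]; apply: sL.2; [apply: sx | apply: sy].
Qed.

Lemma closed_closed_span X : closed (closed_span X).
Proof.
apply/closedP => x ax L [[sL cL] XL]; have /closedP := cL; apply.
by apply: adh_mono ax => y sy; apply: sy.
Qed.

Lemma sub_closed_span X : X `<=` closed_span X.
Proof. by move=> x Xx L [_]; apply. Qed.

Lemma closed_span_ind X L : is_subspace L -> closed L -> X `<=` L ->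
  closed_span X `<=` L.
Proof. by move=> sL cL XL x; apply. Qed.

Lemma closed_span_adh X x : is_subspace X -> closed_span X x -> adh X x.
Proof.
move=> sX; apply: closed_span_ind; first exact: subspace_adh.
- exact: adh_closed.
- exact: adh_sub.
Qed.

Lemma subspace_zero : is_subspace ([set 0] : set V).
Proof. by split=> // c x y /= -> ->; rewrite scaler0 addr0. Qed.

Lemma closed_zero : closed ([set 0] : set V).
Proof.
apply/closedP => x x0; apply: nrm_small => e /x0[_ ->].
by rewrite subr0.
Qed.

Lemma subspaceD L x y : is_subspace L -> L x -> L y -> L (x + y).
Proof. by move=> [L0 LZ] Lx Ly; rewrite -(scale1r x); apply: LZ. Qed.

Lemma subspaceZ L c x : is_subspace L -> L x -> L (c *: x).
Proof. by move=> [L0 LZ] Lx; rewrite -(addr0 (_ *: _)); apply: LZ. Qed.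

Lemma subspaceN L x : is_subspace L -> L x -> L (- x).
Proof. by move=> sL Lx; rewrite -scaleN1r; apply: subspaceZ. Qed.

Lemma subspaceB L x y : is_subspace L -> L x -> L y -> L (x - y).
Proof. by move=> sL Lx Ly; apply: subspaceD => //; apply: subspaceN. Qed.

End Closure.

Section Preimage.
Variables (R : realType) (V W : normedModType R[i]) (f : V -> W) (M : R).
Hypotheses (lf : linear f) (bf : forall x, nrm (f x) <= M * nrm x).

Lemma adh_image (L : set V) (L' : set W) x :
  (forall y, L y -> L' (f y)) -> adh L x -> adh L' (f x).
Proof.
move=> LL' ax e e0.
have d0 : 0 < e / (`|M| + 1) by rewrite divr_gt0 // ltr_wpDl.
have [y Ly xy] := ax _ d0; exists (f y); first exact: LL'.
rewrite -linB // (le_lt_trans (bf _)) //.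
apply: (@le_lt_trans _ _ ((`|M| + 1) * nrm (x - y))).
  by rewrite ler_wpM2r ?nrm_ge0 // (le_trans (ler_norm M)) // lerDl.
by rewrite mulrC -ltr_pdivlMr // ltr_wpDl.
Qed.

Lemma subspace_preimage (L : set W) :
  is_subspace L -> is_subspace [set x | L (f x)].
Proof.
move=> [L0 LZ]; split=> [|c x y /= Lx Ly]; first by rewrite /= lin0.
by rewrite lf; exact: LZ.
Qed.

Lemma closed_preimage (L : set W) : closed L -> closed [set x | L (f x)].
Proof.
by move=> /closedP cL; apply/closedP => x ax; apply/cL; exact: adh_image ax.
Qed.

Lemma closed_span_image (X : set V) (L : set W) : is_subspace L -> closed L ->
  (forall x, X x -> L (f x)) -> forall x, closed_span X x -> L (f x).
Proof.
move=> sL cL XL; apply: closed_span_ind => //; first exact: subspace_preimage.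
exact: closed_preimage.
Qed.

End Preimage.

Section Sequences.
Variables (R : realType).

Definition cvs (V : normedZmodType R[i]) (u : nat -> V) (l : V) :=
  forall e : R, 0 < e -> exists N, forall n, (N <= n)%N -> nrm (l - u n) < e.

Definition cauchys (V : normedZmodType R[i]) (u : nat -> V) :=
  forall e : R, 0 < e ->
    exists N, forall m n, (N <= m)%N -> (N <= n)%N -> nrm (u m - u n) < e.

Lemma cauchys_cvs (V : completeNormedModType R[i]) (u : nat -> V) :
  cauchys u -> exists l, cvs u l.
Proof.
move=> cu; have : cvg (u @ \oo).
  apply: cauchy_cvg; apply/cauchy_ballP => e e0.
  have [r er] : exists r, e = r%:C by exists (complex.Re e); rewrite re_real // ltW.
  rewrite er in e0 *; rewrite ltcR in e0.
  have [N HN] := cu _ e0.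
  pose T := [set x | exists2 n, (N <= n)%N & x = u n].
  exists (T, T) => [|[x y] /= [[m Hm ->] [n Hn ->]]].
    by split; exists N => // n Nn; exists n.
  by rewrite -ball_normE /ball_ /= nrmE ltcR; exact: HN.
move=> /cvg_ex[l /cvgrPdist_lt ul]; exists l => e e0.
have /ul [N _ HN] : 0 < e%:C by rewrite ltcR.
by exists N => n /HN /=; rewrite nrmE ltcR.
Qed.

Lemma cvs_adh (V : normedModType R[i]) (u : nat -> V) l (L : set V) :
  cvs u l -> (forall n, L (u n)) -> adh L l.
Proof.
move=> ul Lu e e0; have [N HN] := ul _ e0.
by exists (u N) => //; exact: HN.
Qed.

Lemma invn_small (e : R) : 0 < e ->
  exists N, forall n, (N <= n)%N -> n.+1%:R^-1 < e.
Proof.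
move=> e0; exists (Num.truncn e^-1) => n Nn.
rewrite invf_plt ?posrE // (lt_le_trans (Num.Theory.truncnS_gt _)) //.
by rewrite ler_nat ltnS.
Qed.

End Sequences.

(** * Square roots of contractions *)

Section VisserSequence.
Variable R : realType.

(** The iteration [root_iter] below for the scalar [X = 1]. It increases to 1 and majorises the
    operator iteration, whose increments are bounded by those of [visser]. *)
Fixpoint visser (n : nat) : R := if n is m.+1 then (1 + visser m ^+ 2) / 2 else 0.

Lemma visser_bounds n : 0 <= visser n <= 1.
Proof.
elim: n => [|n /andP[h0 h1]] /=; first by rewrite lexx ler01.
by apply/andP; split; nra.
Qed.

Lemma visserS n : visser n <= visser n.+1.
Proof. by have /andP[h0 h1] := visser_bounds n; rewrite /=; nra. Qed.

(** A gap [d = 1 - visser n] becomes [d - d^2 / 2] at the next step, so it loses at least [e^2 / 2]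
    as long as it is at least [e]. *)
Lemma visser_to1 (e : R) : 0 < e -> exists n, 1 - visser n < e.
Proof.
move=> e0; apply: contrapT => /forallNP h.
have {}h n : e <= 1 - visser n by rewrite leNgt; apply/negP/h.
have bd n : 1 - visser n <= 1 - n%:R * (e ^+ 2 / 2).
  elim: n => [|n IH] /=; first by rewrite mul0r.
  have : e ^+ 2 <= (1 - visser n) ^+ 2 by rewrite ler_sqr ?nnegrE ?(le_trans (ltW e0) (h n)) ?(ltW e0) // h.
  by rewrite -(natr1 n); move: IH; lra.
have e2 : 0 < e ^+ 2 / 2 by rewrite divr_gt0 // exprn_gt0.
have := Num.Theory.truncnS_gt (e ^+ 2 / 2)^-1.
set m := (Num.truncn _).+1 => mlt.
have := bd m; have := h m; move: mlt; rewrite invf_plt ?posrE // => mlt.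
have : 1 < m%:R * (e ^+ 2 / 2) by rewrite -ltr_pdivrMl ?mulr1 // ltr0Sn.
by move=> *; lra.
Qed.

Lemma visser_small (M : R) (z : R) :
  (forall n, z <= (1 - visser n) * M) -> z <= 0.
Proof.
move=> h; apply: (@le_eps _ _ _ `|M|) => e /visser_to1[n ne].
have /andP[h0 h1] := visser_bounds n.
rewrite add0r mulrC (le_trans (h n)) //.
apply: (@le_trans _ _ ((1 - visser n) * `|M|)).
  by rewrite ler_wpM2l ?subr_ge0 // ler_norm.
by rewrite ler_wpM2r // ltW.
Qed.

End VisserSequence.

Section SquareRoot.
Variables (R : realType) (V : completeNormedModType R[i]) (X : V -> V).
Hypotheses (lX : linear X) (cX : forall v, nrm (X v) <= nrm v).

(* Visser's iteration for [1 - sqrt (1 - X)]. *)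
Fixpoint root_iter (n : nat) (v : V) : V :=
  if n is m.+1 then 2^-1 *: (X v + root_iter m (root_iter m v)) else 0.
Local Notation P := root_iter.
Local Notation y := (@visser R).

Let lP n : linear (P n).
Proof.
elim: n => [|n IH] c u v /=; first by rewrite scaler0 addr0.
by rewrite lX !IH; lmod.
Qed.

Let P_bound n v : nrm (P n v) <= y n * nrm v.
Proof.
elim: n v => [|n IH] v /=; first by rewrite nrm0 mul0r.
rewrite nrmZ nrm_half.
have := nrmD (X v) (P n (P n v)); have := IH (P n v); have := IH v.
have := cX v; have /andP[h0 h1] := visser_bounds R n.
move: (nrm _) (nrm (P n v)) (nrm _) (nrm (X v)) (nrm v) => a b c d f *.
by nra.
Qed.

Let P_step n v : nrm (P n.+1 v - P n v) <= (y n.+1 - y n) * nrm v.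
Proof.
elim: n v => [|n IH] v.
  have := P_bound 1 v; rewrite /= subr0; congr (_ <= _ * _).
  by rewrite expr0n /= addr0 subr0.
(* The operator form of [(a^2 - b^2) / 2 = (a (a - b) + (a - b) b) / 2]; it parallels the increment
   of [visser] and does not need [P n.+1] and [P n] to commute. *)
have -> : P n.+2 v - P n.+1 v = 2^-1 *: (P n.+1 (P n.+1 v - P n v)
    + (P n.+1 (P n v) - P n (P n v))).
  rewrite (linB (lP n.+1)).
  transitivity (2^-1 *: (X v + P n.+1 (P n.+1 v)) - 2^-1 *: (X v + P n (P n v))).
    by [].
  by lmod.
rewrite nrmZ nrm_half.
have := nrmD (P n.+1 (P n.+1 v - P n v)) (P n.+1 (P n v) - P n (P n v)).
have := IH (P n v); have := P_bound n.+1 (P n.+1 v - P n v); have := IH v.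
have := P_bound n v.
have /andP[h0 h1] := visser_bounds R n; have /andP[h2 h3] := visser_bounds R n.+1.
have := visserS R n.
have -> : y n.+2 = (1 + y n.+1 ^+ 2) / 2 by [].
have -> : y n.+1 - y n = (1 + y n.+1 ^+ 2) / 2 - (1 + y n.+1 ^+ 2) / 2 + (y n.+1 - y n) by lra.
have : y n.+1 = (1 + y n ^+ 2) / 2 by [].
move: (nrm_ge0 v) (nrm_ge0 (P n v)).
move: (y n.+1) (y n) => a b.
move: (nrm _) (nrm (P n v)) (nrm _) (nrm (P n.+1 _)) (nrm _) (nrm v) => *.
by nra.
Qed.

Let P_tail n m v : (n <= m)%N -> nrm (P m v - P n v) <= (y m - y n) * nrm v.
Proof.
elim: m => [|m IH]; first by rewrite leqn0 => /eqP->; rewrite !subrr mul0r nrm0.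
rewrite leq_eqVlt => /orP[/eqP->|]; first by rewrite !subrr mul0r nrm0.
rewrite ltnS => /IH h; apply: le_trans (nrm_tri (P m v) _ _) _.
by have := P_step m v; move: h; rewrite !mulrBl; lra.
Qed.

Let P_tail1 n m v : (n <= m)%N -> nrm (P m v - P n v) <= (1 - y n) * nrm v.
Proof.
move=> /P_tail h; apply: le_trans (h v) _.
rewrite ler_wpM2r ?nrm_ge0 // lerB //.
by case/andP: (visser_bounds R m).
Qed.

Let P_cauchy v : cauchys (P^~ v).
Proof.
move=> e e0.
have d0 : 0 < e / (2 * nrm v + 1).
  by rewrite divr_gt0 // ltr_wpDl // mulr_ge0 // nrm_ge0.
have [N HN] := visser_to1 d0; exists N => m n Nm Nn.
apply: le_lt_trans (nrm_tri (P N v) _ _) _.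
rewrite [nrm (P N v - _)]nrmBC.
apply: (@le_lt_trans _ _ ((1 - y N) * (2 * nrm v))).
  by have := P_tail1 v Nm; have := P_tail1 v Nn; lra.
have n0 := nrm_ge0 v; have /andP[_ y1] := visser_bounds R N.
apply: (@le_lt_trans _ _ ((1 - y N) * (2 * nrm v + 1))).
  by rewrite ler_wpM2l ?subr_ge0 // lerDl.
by rewrite -ltr_pdivlMr // ltr_wpDl // mulr_ge0.
Qed.

(** The equation says [(1 - Y)^2 = 1 - X]. The rate of convergence in the last clause transfers
    properties of the polynomials [root_iter] to [Y]. *)
Lemma root_op : exists Y : V -> V,
  [/\ linear Y, forall v, nrm (Y v) <= nrm v,
      forall v, Y v + Y v - Y (Y v) = X v
    & forall n v, nrm (Y v - P n v) <= (1 - visser R n) * nrm v].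
Proof.
have /choice[Y HY] v : exists l, cvs (P^~ v) l by apply: cauchys_cvs (P_cauchy v).
have YP n v : nrm (Y v - P n v) <= (1 - y n) * nrm v.
  apply: (@le_eps _ _ _ 1) => e e0; have [N HN] := HY v e e0.
  have := HN (maxn N n) (leq_maxl _ _); have := P_tail1 v (leq_maxr N n).
  by have := nrm_tri (P (maxn N n) v) (Y v) (P n v); rewrite mul1r; lra.
have yb n : 0 <= 1 - y n by rewrite subr_ge0; case/andP: (visser_bounds R n).
exists Y; split=> //.
- move=> c u v; apply/eqP; rewrite -subr_eq0; apply/eqP/nrm_eq0/le_anti.
  rewrite nrm_ge0 andbT.
  apply: (@visser_small R (nrm (c *: u + v) + nrm c * nrm u + nrm v)) => n.
  have -> : Y (c *: u + v) - (c *: Y u + Y v) =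
    (Y (c *: u + v) - P n (c *: u + v)) - c *: (Y u - P n u) - (Y v - P n v).
    rewrite lP scalerBr opprD !opprB.
    move: (Y _) (P n u) (P n v) (c *: Y u) => a b d f.
    lmod.
  have := nrmB ((Y (c *: u + v) - P n (c *: u + v)) - c *: (Y u - P n u)) (Y v - P n v).
  have := nrmB (Y (c *: u + v) - P n (c *: u + v)) (c *: (Y u - P n u)).
  have : nrm (c *: (Y u - P n u)) <= nrm c * ((1 - y n) * nrm u).
    by rewrite nrmZ ler_wpM2l ?nrm_ge0.
  by have := YP n (c *: u + v); have := YP n v; rewrite !mulrDr mulrCA; lra.
- move=> v; rewrite -subr_le0; apply: (@visser_small R (nrm v)) => n.
  have := YP n v; have := P_bound n v; have := nrmD (Y v - P n v) (P n v).
  have := yb n; have := nrm_ge0 v.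
  rewrite subrK; move: (nrm _) (nrm (P n v)) (nrm v) (nrm (Y v)) (y n) => *; nra.
- move=> v; apply/eqP; rewrite -subr_eq0; apply/eqP/nrm_eq0/le_anti.
  rewrite nrm_ge0 andbT.
  apply: (@visser_small R (3 * nrm v + nrm (Y v))) => n.
  have PE : X v = P n.+1 v + P n.+1 v - P n (P n v).
    by rewrite /= -scalerDr half_half addrK.
  have -> : Y v + Y v - Y (Y v) - X v = (Y v - P n.+1 v) + (Y v - P n.+1 v)
     - ((Y (Y v) - P n (Y v)) + P n (Y v - P n v)).
    by rewrite PE (linB (lP n)); lmod.
  have := YP n.+1 v; have := YP n (Y v).
  have := P_bound n (Y v - P n v); have := YP n v; have := yb n; have := visserS R n.
  have := nrmB (Y v - P n.+1 v + (Y v - P n.+1 v)) (Y (Y v) - P n (Y v) + P n (Y v - P n v)).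
  have := nrmD (Y v - P n.+1 v) (Y v - P n.+1 v).
  have := nrmD (Y (Y v) - P n (Y v)) (P n (Y v - P n v)).
  have := nrm_ge0 v; have := nrm_ge0 (Y v - P n v).
  have /andP[h0 h1] := visser_bounds R n.
  move: (y n.+1) (y n) => a b.
  move: (nrm _) (nrm _) (nrm _) (nrm _) (nrm _) (nrm _) (nrm _) (nrm _) => *.
  nra.
Qed.

Lemma root_iter_comm Z n v : linear Z -> (forall u, Z (X u) = X (Z u)) ->
  Z (P n v) = P n (Z v).
Proof.
move=> lZ ZX; elim: n v => [|n IH] v /=; first by rewrite lin0.
by rewrite (linZ lZ) (linD lZ) ZX !IH.
Qed.

Lemma root_iter_sub (L : set V) n v : is_subspace L ->
  (forall u, L u -> L (X u)) -> L v -> L (P n v).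
Proof.
move=> sL LX; elim: n v => [|n IH] v Lv /=; first exact: sL.1.
by apply: subspaceZ => //; apply: subspaceD => //; [exact: LX | exact/IH/IH].
Qed.

End SquareRoot.

(** The last three clauses express that [Y] is a limit of polynomials in [X]. The form [b] is only
    biadditive, so that [star x ** y] and the inner product of a Hilbert space are both instances,
    although they are conjugate linear in [x]. *)
Lemma square_root_op (R : realType) (V : completeNormedModType R[i]) (X : V -> V) :
  linear X -> (forall v, nrm (X v) <= nrm v) ->
  exists Y : V -> V,
  [/\ linear Y, forall v, nrm (Y v) <= nrm v & forall v, Y v + Y v - Y (Y v) = X v] /\
  [/\ forall Z (M : R), linear Z -> (forall v, nrm (Z v) <= M * nrm v) ->
        (forall v, Z (X v) = X (Z v)) -> forall v, Z (Y v) = Y (Z v),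
      forall (W : normedZmodType R[i]) (b : V -> V -> W),
        (forall x y z, b (x + y) z = b x z + b y z) ->
        (forall x y z, b x (y + z) = b x y + b x z) ->
        (forall x y, nrm (b x y) <= nrm x * nrm y) ->
        (forall x y, b (X x) y = b x (X y)) -> forall x y, b (Y x) y = b x (Y y)
    & forall L : set V, is_subspace L -> closed L ->
        (forall v, L v -> L (X v)) -> forall v, L v -> L (Y v)].
Proof.
move=> lX cX; have [Y [lY cY YX YP]] := root_op lX cX.
exists Y; split=> //; split.
- move=> Z M lZ bZ ZX v; apply/eqP; rewrite -subr_eq0; apply/eqP/nrm_eq0/le_anti.
  rewrite nrm_ge0 andbT.
  apply: (@visser_small R (`|M| * nrm v + nrm (Z v))) => n.
  have -> : Z (Y v) - Y (Z v) =
      Z (Y v - root_iter X n v) - (Y (Z v) - root_iter X n (Z v)).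
    by rewrite (linB lZ) (root_iter_comm _ _ lZ ZX); lmod.
  apply: le_trans (nrmB _ _) _; rewrite mulrDr lerD ?YP //.
  apply: le_trans (bZ _) _; rewrite mulrCA.
  apply: le_trans (ler_wpM2r (nrm_ge0 _) (ler_norm M)) _.
  by rewrite ler_wpM2l.
- move=> W b bl br bb bX x y.
  have b0l z : b 0 z = 0 by apply: (addIr (b 0 z)); rewrite -bl !add0r.
  have b0r z : b z 0 = 0 by apply: (addIr (b z 0)); rewrite -br !add0r.
  have bNl u z : b (- u) z = - b u z.
    by apply: (addIr (b u z)); rewrite -bl !addNr b0l.
  have bNr u z : b z (- u) = - b z u.
    by apply: (addIr (b z u)); rewrite -br !addNr b0r.
  have bP n u w : b (root_iter X n u) w = b u (root_iter X n w).
    elim: n u w => [|n IH] u w /=; first by rewrite b0l b0r.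
    set h := 2^-1; have hh (z : V) : z = h *: z + h *: z by rewrite -scalerDr half_half.
    (* [W] has no scalars, so the factor 1/2 in [root_iter] is removed by doubling. *)
    have tw (p q : W) : p + p = q + q -> p = q.
      move=> e; apply/eqP; rewrite -subr_eq0; apply/eqP/nrm_eq0.
      have : nrm ((p - q) *+ 2) = 0.
        by rewrite mulr2n addrACA -opprD e subrr nrm0.
      by rewrite nrm_muln => /eqP; rewrite mulf_eq0 pnatr_eq0 /= => /eqP.
    by apply: tw; rewrite -bl -br -!hh bl br bX !IH.
  apply/eqP; rewrite -subr_eq0; apply/eqP/nrm_eq0/le_anti; rewrite nrm_ge0 andbT.
  apply: (@visser_small R (nrm x * nrm y + nrm x * nrm y)) => n.
  have -> : b (Y x) y - b x (Y y) =
      b (Y x - root_iter X n x) y - b x (Y y - root_iter X n y).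
    by rewrite bl br bNl bNr bP opprD opprK addrACA addNr addr0.
  apply: le_trans (nrmB _ _) _; rewrite mulrDr lerD //.
    apply: le_trans (bb _ _) _; rewrite mulrA.
    by rewrite ler_wpM2r ?nrm_ge0.
  apply: le_trans (bb _ _) _; rewrite mulrCA.
  by rewrite ler_wpM2l ?nrm_ge0.
- move=> L sL /closedP cL LX v Lv; apply: cL => e e0.
  have d0 : 0 < e / (nrm v + 1) by rewrite divr_gt0 // ltr_wpDl ?nrm_ge0.
  have [n yn] := visser_to1 d0; exists (root_iter X n v).
    exact: root_iter_sub.
  apply: le_lt_trans (YP n v) _; have n0 := nrm_ge0 v.
  apply: (@le_lt_trans _ _ ((1 - visser R n) * (nrm v + 1))).
    by rewrite ler_wpM2l ?lerDl // subr_ge0; case/andP: (visser_bounds R n).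
  by rewrite -ltr_pdivlMr // ltr_wpDl.
Qed.

(** * Extension by continuity of densely defined linear relations *)

Section Extension.
Variables (R : realType) (V : normedModType R[i]) (W : completeNormedModType R[i]).
Variables (Rel : V -> W -> Prop) (M : R).
Hypothesis RelZ : forall c x x' y y',
  Rel x y -> Rel x' y' -> Rel (c *: x + x') (c *: y + y').
Hypothesis RelM : forall x y, Rel x y -> nrm y <= M * nrm x.

(** The closure of a graph. Maps such as [rho a x |-> tau a Om] are first given as relations,
    because [rho a x] does not determine [a]; the bound makes the closure single-valued. *)
Definition rel_closure x y := forall e : R, 0 < e ->
  exists x' y', [/\ Rel x' y', nrm (x - x') < e & nrm (y - y') < e].

Lemma rel_closure_sub x y : Rel x y -> rel_closure x y.
Proof. by move=> r e e0; exists x, y; rewrite !subrr !nrm0. Qed.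

Lemma rel_closureZ c x x' y y' : rel_closure x y -> rel_closure x' y' ->
  rel_closure (c *: x + x') (c *: y + y').
Proof.
move=> r r' e e0.
have n0 := nrm_ge0 c.
have d0 : 0 < e / (nrm c + 1) / 2 by rewrite !divr_gt0 // ltr_wpDl.
have [u [v [uv xu yv]]] := r _ d0.
have [|u' [v' [uv' xu' yv']]] := r' (e / 2); first by rewrite divr_gt0.
have cd : nrm c * (e / (nrm c + 1) / 2) <= e / 2.
  rewrite mulrA; apply: ler_wpM2r; first by rewrite invr_ge0.
  rewrite mulrA ler_pdivrMr ?ltr_wpDl // mulrC.
  by rewrite ler_wpM2l ?(ltW e0) // lerDl.
exists (c *: u + u'), (c *: v + v'); split; first exact: RelZ.
  have -> : c *: x + x' - (c *: u + u') = c *: (x - u) + (x' - u') by lmod.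
  apply: le_lt_trans (nrmD _ _) _; rewrite nrmZ (splitr e); apply: ler_ltD => //.
  by apply: le_trans cd; rewrite ler_wpM2l // ltW.
have -> : c *: y + y' - (c *: v + v') = c *: (y - v) + (y' - v') by lmod.
apply: le_lt_trans (nrmD _ _) _; rewrite nrmZ (splitr e); apply: ler_ltD => //.
by apply: le_trans cd; rewrite ler_wpM2l // ltW.
Qed.

Lemma rel_closureM x y : rel_closure x y -> nrm y <= `|M| * nrm x.
Proof.
move=> r; apply: (@le_eps _ _ _ (1 + `|M|)) => e /r[u [v [uv xu yv]]].
have := RelM uv; have := nrmD (y - v) v; have := nrmB x (x - u).
have -> : x - (x - u) = u by lmod.
rewrite subrK; have := ler_norm M; have := normr_ge0 M.
move: (nrm_ge0 u) xu yv; move: `|M| (nrm _) (nrm _) (nrm _) (nrm _) (nrm _) => *.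
by nra.
Qed.

Lemma rel_closure_uniq x y y' : rel_closure x y -> rel_closure x y' -> y = y'.
Proof.
move=> r r'; have := rel_closureM (rel_closureZ (-1) r r').
rewrite !scaleN1r addNr nrm0 mulr0 => h.
apply/esym/eqP; rewrite -subr_eq0 addrC; apply/eqP/nrm_eq0/le_anti.
by rewrite h nrm_ge0.
Qed.

Lemma rel_closure_total x : adh [set u | exists v, Rel u v] x ->
  exists y, rel_closure x y.
Proof.
move=> ax.
have /choice[u Hu] n : exists p : V * W, Rel p.1 p.2 /\ nrm (x - p.1) < n.+1%:R^-1.
  have [|a [b ab] xa] := ax n.+1%:R^-1; first by rewrite invr_gt0.
  by exists (a, b).
have small (e : R) : 0 < e -> exists N, forall n, (N <= n)%N -> nrm (x - (u n).1) < e.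
  move=> /invn_small[N HN]; exists N => n /HN; apply: lt_trans.
  by case: (Hu n).
have cau : cauchys (fun n => (u n).2).
  move=> e e0; have d0 : 0 < e / (`|M| + 1) / 2 by rewrite !divr_gt0 // ltr_wpDl.
  have [N HN] := small _ d0; exists N => m n /HN hm /HN hn.
  have := RelM (RelZ (-1) (Hu n).1 (Hu m).1); rewrite !scaleN1r ![- _ + _]addrC => h.
  apply: le_lt_trans h _.
  have := nrm_tri x (u m).1 (u n).1; rewrite [nrm ((u m).1 - x)]nrmBC => tri.
  apply: (@le_lt_trans _ _ ((`|M| + 1) * nrm ((u m).1 - (u n).1))).
    by rewrite ler_wpM2r ?nrm_ge0 // (le_trans (ler_norm M)) // lerDl.
  rewrite mulrC -ltr_pdivlMr ?ltr_wpDl //.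
  by move: tri hm hn; move: (e / _) (nrm _) (nrm _) (nrm _) => *; lra.
have [y Hy] := cauchys_cvs cau; exists y => e e0.
have [N HN] := small _ e0; have [N' HN'] := Hy _ e0.
exists (u (maxn N N')).1, (u (maxn N N')).2; split; first by case: (Hu (maxn N N')).
  by apply: HN; rewrite leq_maxl.
by apply: HN'; rewrite leq_maxr.
Qed.

Lemma extend_dense : (forall x, adh [set u | exists v, Rel u v] x) ->
  exists T : V -> W, [/\ linear T, forall x, rel_closure x (T x)
    & forall x y, Rel x y -> T x = y].
Proof.
move=> dense; have /choice[T HT] x := rel_closure_total (dense x).
exists T; split=> // [c x y|x y r].
  by apply: rel_closure_uniq (HT _) _; exact: rel_closureZ.
by apply: rel_closure_uniq (HT _) _; exact: rel_closure_sub.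
Qed.

End Extension.

(** * Units and self-adjoint multipliers of C*-algebras *)

Section FixedPoint.
Variables (R : realType) (V : completeNormedModType R[i]) (F : V -> V) (q : R).
Hypotheses (q0 : 0 <= q) (q1 : q < 1).
Hypothesis FC : forall x y, nrm (F x - F y) <= q * nrm (x - y).

Lemma geometric_small (e : R) : 0 < e -> exists N, q ^+ N < e.
Proof.
move=> e0; have [->|qn0] := eqVneq q 0; first by exists 1%N; rewrite expr1.
have qp : 0 < q by rewrite lt_neqAle eq_sym qn0.
set t := q^-1 - 1; have t0 : 0 < t by rewrite subr_gt0 invf_gt1.
have bern n : 1 + n%:R * t <= q ^- n.
  elim: n => [|n IH]; first by rewrite mul0r addr0 expr0 invr1.
  have -> : q ^- n.+1 = q ^- n * (1 + t) by rewrite exprSr invfM addrC subrK.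
  have n0 : (0 : R) <= n%:R by [].
  by rewrite -(natr1 n); move: (q ^- n) IH => a IH; nra.
have := Num.Theory.truncnS_gt (e^-1 / t); set m := (Num.truncn _).+1 => mlt.
exists m; have qm : 0 < q ^+ m by rewrite exprn_gt0.
rewrite -[q ^+ m]invrK invf_plt ?posrE ?invr_gt0 //.
apply: lt_le_trans (bern m); rewrite -ltrBlDl -ltr_pdivrMr //.
by apply: le_lt_trans mlt; rewrite ler_wpM2r ?invr_ge0 ?(ltW t0) // gerBl.
Qed.

(** Banach's fixed point theorem, iterating from 0. Invariant closed sets that contain 0 therefore
    contain the fixed point, which gives it self-adjointness and commutation relations without a
    separate argument. *)
Lemma fixed_point : exists x, F x = x /\
  forall L : set V, closed L -> L 0 -> (forall v, L v -> L (F v)) -> L x.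
Proof.
pose u n := iter n F 0.
have p1 : 0 < 1 - q by rewrite subr_gt0.
have ustep n : nrm (u n.+1 - u n) <= q ^+ n * nrm (u 1).
  elim: n => [|n IH]; first by rewrite expr0 mul1r subr0.
  by apply: le_trans (FC _ _) _; rewrite exprS -mulrA ler_wpM2l.
have utail n m : (n <= m)%N -> nrm (u m - u n) <= (q ^+ n - q ^+ m) / (1 - q) * nrm (u 1).
  elim: m => [|m IH]; first by rewrite leqn0 => /eqP->; rewrite !subrr !mul0r nrm0.
  rewrite leq_eqVlt => /orP[/eqP->|]; first by rewrite !subrr !mul0r nrm0.
  rewrite ltnS => /IH h; apply: le_trans (nrm_tri (u m) _ _) _.
  have := ustep m.
  have -> : (q ^+ n - q ^+ m.+1) / (1 - q) = q ^+ m + (q ^+ n - q ^+ m) / (1 - q).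
    by rewrite exprS; field; rewrite gt_eqF.
  by rewrite mulrDl; lra.
have utail1 n m : (n <= m)%N -> nrm (u m - u n) <= q ^+ n / (1 - q) * nrm (u 1).
  move=> /utail h; apply: le_trans h _; rewrite ler_wpM2r ?nrm_ge0 //.
  by rewrite ler_wpM2r ?invr_ge0 ?(ltW p1) // gerBl exprn_ge0.
have cau : cauchys u.
  move=> e e0.
  have d0 : 0 < e / 2 / (nrm (u 1) + 1) * (1 - q).
    by rewrite mulr_gt0 // !divr_gt0 // ltr_wpDl ?nrm_ge0.
  have [N HN] := geometric_small d0; exists N => m n /utail1 hm /utail1 hn.
  have n0 := nrm_ge0 (u 1).
  have : q ^+ N / (1 - q) * nrm (u 1) < e / 2.
    apply: (@le_lt_trans _ _ (q ^+ N / (1 - q) * (nrm (u 1) + 1))).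
      by rewrite ler_wpM2l ?lerDl // divr_ge0 ?exprn_ge0 // ltW.
    by rewrite -ltr_pdivlMr ?ltr_wpDl // ltr_pdivrMr.
  have := nrm_tri (u N) (u m) (u n); rewrite [nrm (u N - _)]nrmBC.
  by move: hm hn; lra.
have [x Hx] := cauchys_cvs cau; exists x; split.
  apply/eqP; rewrite -subr_eq0; apply/eqP/nrm_small => e e0.
  have e2 : 0 < e / 2 by rewrite divr_gt0.
  have [N HN] := Hx _ e2.
  have := HN N (leqnn _); have := HN N.+1 (leqnSn _); have := FC x (u N).
  have := nrm_tri (u N.+1) (F x) x; rewrite [nrm (u N.+1 - x)]nrmBC.
  have := nrm_ge0 (x - u N).
  have -> : F (u N) = u N.+1 by [].
  by move: (nrm (F x - x)) (nrm _) (nrm _) (nrm _) => *; nra.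
move=> L /closedP cL L0 LF; apply: cL; apply: cvs_adh Hx _.
by elim=> [|n IH] //=; exact: LF.
Qed.

End FixedPoint.

Section CStarBasics.
Variables (R : realType) (A : cstarAlgebra R).
Implicit Types a b c : A.

Lemma cmulDl a b c : (a + b) ** c = a ** c + b ** c.
Proof. exact: (linD (cmul_linearl c)). Qed.
Lemma cmulDr a b c : a ** (b + c) = a ** b + a ** c.
Proof. exact: (linD (cmul_linearr a)). Qed.
Lemma cmulNl a b : (- a) ** b = - (a ** b).
Proof. exact: (linN (cmul_linearl b)). Qed.
Lemma cmulNr a b : a ** (- b) = - (a ** b).
Proof. exact: (linN (cmul_linearr a)). Qed.
Lemma cmul0l b : 0 ** b = 0.
Proof. exact: (lin0 (cmul_linearl b)). Qed.
Lemma cmul0r a : a ** 0 = 0.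
Proof. exact: (lin0 (cmul_linearr a)). Qed.
Lemma cmulZl (k : R[i]) a b : (k *: a) ** b = k *: (a ** b).
Proof. exact: (linZ (cmul_linearl b)). Qed.
Lemma cmulZr (k : R[i]) a b : a ** (k *: b) = k *: (a ** b).
Proof. exact: (linZ (cmul_linearr a)). Qed.
Lemma cmulBr a b c : a ** (b - c) = a ** b - a ** c.
Proof. by rewrite cmulDr cmulNr. Qed.

Lemma star0 : star (0 : A) = 0.
Proof.
by have := star_semilinear (-1) (0 : A) 0; rewrite scaler0 addr0 rmorphN rmorph1 scaleN1r addNr.
Qed.
Lemma starD a b : star (a + b) = star a + star b.
Proof. by have := star_semilinear 1 a b; rewrite rmorph1 !scale1r. Qed.
Lemma starZ (k : R[i]) a : star (k *: a) = conjc k *: star a.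
Proof. by have := star_semilinear k a 0; rewrite !addr0 star0 addr0. Qed.
Lemma starN a : star (- a) = - star a.
Proof. by rewrite -scaleN1r starZ rmorphN rmorph1 scaleN1r. Qed.
Lemma starB a b : star (a - b) = star a - star b.
Proof. by rewrite starD starN. Qed.

Definition cexp := (cmulDl, cmulDr, cmulNl, cmulNr, cmulZl, cmulZr, cmul0l, cmul0r,
  @cmulA R A, starD, starN, starZ, @starM R A, @starK R A, star0).

Lemma nrm_cmul a b : nrm (a ** b) <= nrm a * nrm b.
Proof. by rewrite -lecR rmorphM /= -!nrmE; exact: cmul_norm. Qed.

Lemma nrm_cstar a : nrm (star a ** a) = nrm a ^+ 2.
Proof. by apply: complexI; rewrite rmorphXn /= -!nrmE cstar_identity. Qed.

Lemma nrm_star a : nrm (star a) = nrm a.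
Proof.
have le b : nrm b <= nrm (star b).
  have := nrm_cmul (star b) b; rewrite nrm_cstar => h.
  have [->|b0] := eqVneq (nrm b) 0; first exact: nrm_ge0.
  have bp : 0 < nrm b by rewrite lt_neqAle eq_sym b0 nrm_ge0.
  by rewrite -(ler_pM2r bp) -expr2.
by apply/le_anti; rewrite le andbT -{2}(starK a) le.
Qed.

Lemma nrm_cstar' a : nrm (a ** star a) = nrm a ^+ 2.
Proof. by rewrite -{1}(starK a) nrm_cstar nrm_star. Qed.

Lemma cstar_eq0 a : star a ** a = 0 -> a = 0.
Proof.
move=> h; apply: nrm_eq0; have := nrm_cstar a; rewrite h nrm0.
by move/esym/eqP; rewrite sqrf_eq0 => /eqP.
Qed.

Lemma cstar_eq0' a : a ** star a = 0 -> a = 0.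
Proof.
move=> h; rewrite -(starK a); have -> : star a = 0; last by rewrite star0.
by apply: cstar_eq0; rewrite starK.
Qed.

Lemma nrm_cmull_le a b c : nrm a <= 1 -> nrm b <= nrm c -> nrm (a ** b) <= nrm c.
Proof.
move=> a1 bc; apply: le_trans (nrm_cmul _ _) _; apply: le_trans _ bc.
by rewrite ler_piMl // nrm_ge0.
Qed.

(* Self-adjoint multipliers of [A]; they replace the functional calculus in a
   unitization. *)
Definition sa_op (T : A -> A) := forall a b, star (T a) ** b = star a ** T b.

(** For [k = i] or [k = -i], the operator [T + k S] is a unitary multiplier: the cross terms cancel
    because [T] and [S] commute. *)
Lemma unitary_cstar (T S : A -> A) (k : R[i]) : sa_op T -> sa_op S ->
  (forall a, T (S a) = S (T a)) -> (forall a, T (T a) + S (S a) = a) ->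
  conjc k = - k -> k * k = -1 ->
  forall a, star (T a + k *: S a) ** (T a + k *: S a) = star a ** a.
Proof.
move=> aT aS TS E kJ kk a.
have -> : star a ** a = star a ** T (T a) + star a ** S (S a) by rewrite -cmulDr E.
rewrite !cexp kJ !aT !aS TS scalerA.
have -> : - k * k = 1 by rewrite mulNr kk opprK.
by lmod.
Qed.

(** [T] is the average of the two isometries [T + i S] and [T - i S], and [S] is half their
    difference up to a factor of modulus 1. *)
Lemma unitary_bound (T S : A -> A) : sa_op T -> sa_op S ->
  (forall a, T (S a) = S (T a)) -> (forall a, T (T a) + S (S a) = a) ->
  forall a, nrm (T a) <= nrm a /\ nrm (S a) <= nrm a.
Proof.
move=> aT aS TS E a.
have W (k : R[i]) : conjc k = - k -> k * k = -1 -> nrm (T a + k *: S a) = nrm a.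
  move=> kJ kk; apply/eqP; rewrite -(@eqrXn2 _ 2) ?nrm_ge0 // -!nrm_cstar.
  by rewrite unitary_cstar.
have Wp : nrm (T a + 'i%C *: S a) = nrm a.
  by apply: W; [rewrite conjc_i | rewrite -expr2 sqr_i].
have Wm : nrm (T a + (- 'i%C) *: S a) = nrm a.
  by apply: W; [apply/eqP; rewrite eq_complex /= !oppr0 !eqxx | rewrite mulrNN -expr2 sqr_i].
split.
  have -> : T a = 2^-1 *: ((T a + 'i%C *: S a) + (T a + (- 'i%C) *: S a)) by lmod.
  rewrite nrmZ nrm_half.
  have := nrmD (T a + 'i%C *: S a) (T a + (- 'i%C) *: S a); rewrite Wp Wm.
  by lra.
have -> : S a = (2^-1 * - 'i%C) *: ((T a + 'i%C *: S a) - (T a + (- 'i%C) *: S a)).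
  have -> : T a + 'i%C *: S a - (T a + (- 'i%C) *: S a) = (2 * 'i%C) *: S a by lmod.
  rewrite scalerA mulrACA mulVf ?pnatr_eq0 // mul1r mulNr -expr2 sqr_i opprK.
  by rewrite scale1r.
rewrite nrmZ nrmM nrmN nrmi nrm_half mulr1.
have := nrmB (T a + 'i%C *: S a) (T a + (- 'i%C) *: S a); rewrite Wp Wm.
by lra.
Qed.

Lemma sa_root (X : A -> A) : linear X -> sa_op X -> (forall a, nrm (X a) <= nrm a) ->
  exists S : A -> A,
  [/\ linear S, sa_op S, forall a, S (S a) = a - X a
    & forall Z (M : R), linear Z -> (forall v, nrm (Z v) <= M * nrm v) ->
        (forall v, Z (X v) = X (Z v)) -> forall v, Z (S v) = S (Z v)].
Proof.
move=> lX aX cX; have [Y [[lY cY YX] [comm adj _]]] := square_root_op lX cX.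
have aY : sa_op Y.
  apply: (adj A (fun x y => star x ** y)) => //= *; rewrite ?starD ?cmulDl ?cmulDr //.
  by apply: le_trans (nrm_cmul _ _) _; rewrite nrm_star.
exists (fun a => a - Y a); split.
- by move=> k a b; rewrite lY; lmod.
- by move=> a b; rewrite !cexp aY.
- by move=> a; rewrite (linB lY) -YX; lmod.
- by move=> Z M lZ bZ ZX v; rewrite (linB lZ) (comm Z M).
Qed.

(* [S] is [sqrt (1 - T^2)]. *)
Lemma complementary_op (T : A -> A) : linear T -> sa_op T ->
  (forall a, nrm (T a) <= nrm a) ->
  exists S : A -> A,
  [/\ linear S, sa_op S, forall a, nrm (S a) <= nrm a, forall a, S (S a) = a - T (T a)
    & forall Z (M : R), linear Z -> (forall v, nrm (Z v) <= M * nrm v) ->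
        (forall v, Z (T v) = T (Z v)) -> forall v, Z (S v) = S (Z v)].
Proof.
move=> lT aT cT.
have [S [lS aS SS comm]] : exists S : A -> A,
  [/\ linear S, sa_op S, forall a, S (S a) = a - T (T a)
    & forall Z (M : R), linear Z -> (forall v, nrm (Z v) <= M * nrm v) ->
        (forall v, Z (T (T v)) = T (T (Z v))) -> forall v, Z (S v) = S (Z v)].
  apply: (@sa_root (fun a => T (T a))) => [k a b|a b|a]; first by rewrite !lT.
    by rewrite !aT.
  exact: le_trans (cT _) (cT _).
exists S; split=> //.
  have TS a : T (S a) = S (T a).
    by apply: (comm T 1) => // v; rewrite mul1r.
  move=> a; have [] := unitary_bound aT aS TS _ a => // b.
  by rewrite SS addrC subrK.
by move=> Z M lZ bZ ZT v; apply: (comm Z M) => // w; rewrite !ZT.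
Qed.

(* [P] is the absolute value of [T], and [Q] its square root. *)
Lemma abs_op (T : A -> A) : linear T -> sa_op T -> (forall a, nrm (T a) <= nrm a) ->
  exists P Q : A -> A,
  [/\ linear P, linear Q, sa_op Q, forall a, Q (Q a) = P a & forall a, P (P a) = T (T a)]
  /\ [/\ forall a, T (P a) = P (T a) & forall a, P (Q a) = Q (P a)].
Proof.
move=> lT aT cT; have [S [lS aS cS SS commS]] := complementary_op lT aT cT.
(* As [S^2 = 1 - T^2], the operator [Y = 1 - sqrt (1 - S^2)] is [1 - |T|], so [1 - Y] is the
   absolute value and [sa_root] at [Y] gives its square root. *)
have [Y [[lY cY YS] [comm adj _]]] : exists Y : A -> A,
    [/\ linear Y, forall v, nrm (Y v) <= nrm v & forall v, Y v + Y v - Y (Y v) = S (S v)] /\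
    [/\ forall Z (M : R), linear Z -> (forall v, nrm (Z v) <= M * nrm v) ->
        (forall v, Z (S (S v)) = S (S (Z v))) -> forall v, Z (Y v) = Y (Z v),
      forall (W : normedZmodType R[i]) (b : A -> A -> W),
        (forall x y z, b (x + y) z = b x z + b y z) ->
        (forall x y z, b x (y + z) = b x y + b x z) ->
        (forall x y, nrm (b x y) <= nrm x * nrm y) ->
        (forall x y, b (S (S x)) y = b x (S (S y))) -> forall x y, b (Y x) y = b x (Y y)
    & forall L : set A, is_subspace L -> closed L ->
        (forall v, L v -> L (S (S v))) -> forall v, L v -> L (Y v)].
  apply: (@square_root_op R A (fun a => S (S a))) => [k a b|a]; first by rewrite !lS.
  exact: le_trans (cS _) (cS _).
have aY : sa_op Y.
  apply: (adj A (fun x y => star x ** y)) => //= *; rewrite ?starD ?cmulDl ?cmulDr //.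
    by apply: le_trans (nrm_cmul _ _) _; rewrite nrm_star.
  by rewrite !aS.
have [Q [lQ aQ QQ commQ]] := sa_root lY aY cY.
exists (fun a => a - Y a), Q; split; split=> //.
- by move=> k a b; rewrite lY; lmod.
- move=> a; rewrite (linB lY).
  have -> : T (T a) = a - S (S a) by rewrite SS; lmod.
  by rewrite -YS; lmod.
- move=> a; rewrite (linB lT); congr (_ - _); apply: (comm T 1) => // [v|v].
    by rewrite mul1r.
  by rewrite !SS (linB lT).
- move=> a; rewrite (linB lQ); congr (_ - _); apply: (commQ Y 1 _ _ _ a) => // v.
  by rewrite mul1r.
Qed.

Lemma sa_lmul (k : A) : star k = k -> sa_op (cmul k).
Proof. by move=> sk a b; rewrite starM sk cmulA. Qed.

Lemma contr_sub_sqr (k : A) : star k = k -> nrm k <= 1 ->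
  forall a, nrm (a - k ** (k ** a)) <= nrm a.
Proof.
move=> sk k1 a.
have [S [_ _ cS SS _]] : exists S : A -> A,
  [/\ linear S, sa_op S, forall a, nrm (S a) <= nrm a, forall a, S (S a) = a - k ** (k ** a)
    & forall Z (M : R), linear Z -> (forall v, nrm (Z v) <= M * nrm v) ->
        (forall v, Z (k ** v) = k ** Z v) -> forall v, Z (S v) = S (Z v)].
  apply: complementary_op; [exact: cmul_linearr | exact: sa_lmul |].
  by move=> b; exact: nrm_cmull_le.
by rewrite -SS; exact: le_trans (cS _) (cS _).
Qed.

(* The element [k^2 / (r^2 + k^2)]. *)
Lemma resolvent (k : A) (r : R) : star k = k -> 0 < r ->
  exists u : A, [/\ star u = u, k ** u = u ** k & (r ^+ 2)%:C *: u + k ** k ** u = k ** k].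
Proof.
move=> sk r0; set n := nrm k + 1.
have n0 : 0 < n by rewrite ltr_wpDl ?nrm_ge0.
pose h := n^-1%:C *: k; pose t := r / n; pose q := (1 + t ^+ 2)^-1.
have t0 : 0 < t by rewrite divr_gt0.
have q1 : 1 < 1 + t ^+ 2 by rewrite ltrDl exprn_gt0.
have sh : star h = h by rewrite starZ sk conjc_real.
have nh : nrm h <= 1.
  by rewrite nrmZ nrmC gtr0_norm ?invr_gt0 // mulrC ler_pdivrMr // mul1r lerDl.
have kh : k = n%:C *: h.
  by rewrite scalerA -rmorphM mulfV ?gt_eqF // scale1r.
clearbody h.
(* A fixed point satisfies [(1 + t^2) u = h^2 + (1 - h^2) u], that is [(t^2 + h^2) u = h^2]. Since
   [1 - h^2] is contractive, [F] contracts by [q = 1 / (1 + t^2)]. *)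
pose F u := q%:C *: (h ** h + (u - h ** (h ** u))).
have FC x y : nrm (F x - F y) <= q * nrm (x - y).
  have -> : F x - F y = q%:C *: ((x - y) - h ** (h ** (x - y))).
    by rewrite /F !cmulBr; lmod.
  rewrite nrmZ nrmC ger0_norm ?invr_ge0 ?(ltW (lt_trans ltr01 q1)) //.
  rewrite ler_wpM2l ?contr_sub_sqr //.
  by rewrite invr_ge0 (ltW (lt_trans ltr01 q1)).
have [u [Fu uL]] : exists x, F x = x /\
  forall L : set A, closed L -> L 0 -> (forall v, L v -> L (F v)) -> L x.
  apply: fixed_point FC; first by rewrite invr_ge0 (ltW (lt_trans ltr01 q1)).
  by rewrite invf_lt1 // (lt_trans ltr01).
have [su ku] : star u = u /\ h ** u = u ** h.
  apply: (uL [set v | star v = v /\ h ** v = v ** h]).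
  - apply/closedP => x ax; split; apply/eqP; rewrite -subr_eq0; apply/eqP/nrm_small => e e0.
      have [|y [sy _] xy] := ax (e / 2); first by rewrite divr_gt0.
      have -> : star x - x = star (x - y) + (y - x) by rewrite starB sy; lmod.
      apply: le_lt_trans (nrmD _ _) _; rewrite nrm_star (nrmBC y x).
      by move: xy; lra.
    have [|y [_ hy] xy] := ax (e / 2); first by rewrite divr_gt0.
    have -> : h ** x - x ** h = h ** (x - y) - (x - y) ** h by rewrite !cexp hy; lmod.
    apply: le_lt_trans (nrmB _ _) _.
    have := nrm_cmul h (x - y); have := nrm_cmul (x - y) h; move: nh xy.
    have := nrm_ge0 (x - y); have := nrm_ge0 h.
    by move: (nrm h) (nrm (x - y)) (nrm _) (nrm _) => *; nra.
  - by split; rewrite ?star0 ?cmul0l ?cmul0r.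
  - move=> v [sv hv]; split; rewrite /F.
      rewrite !cexp conjc_real sh sv; congr (_ *: (_ + (_ - _))).
      by rewrite -hv -!cmulA -hv.
    by rewrite !cexp -hv -!cmulA -hv; lmod.
exists u; split=> //; first by rewrite kh !cexp ku.
have rt : r = t * n by rewrite divfK // gt_eqF.
have E : (1 + t ^+ 2)%:C *: u = h ** h + (u - h ** (h ** u)).
  rewrite -{1}Fu /F scalerA -rmorphM mulfV ?scale1r //.
  by rewrite gt_eqF // (lt_trans ltr01).
have {}E : (t ^+ 2)%:C *: u + h ** h ** u = h ** h.
  have e2 : h ** h = (1 + t ^+ 2)%:C *: u - u + h ** (h ** u) by rewrite E; lmod.
  by rewrite [RHS]e2 rmorphD rmorph1 /= cmulA; lmod.
by rewrite kh rt !cexp !scalerA exprMn rmorphM /= -[in RHS]E; lmod.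
Qed.

Lemma contr_lmul (x : A) : (forall a, nrm (x ** a) <= nrm a) -> nrm x <= 1.
Proof.
move=> h; have := h (star x); rewrite nrm_cstar' nrm_star.
have [->//|x0] := eqVneq (nrm x) 0.
have xp : 0 < nrm x by rewrite lt_neqAle eq_sym x0 nrm_ge0.
by rewrite expr2 -{3}(mul1r (nrm x)) ler_pM2r.
Qed.

(** For [u = k^2 / (r^2 + k^2)] one has [k^2 (1 - u) = r^2 u]; multiply by [1 - u]. *)
Lemma resolvent_sqr (k u : A) (r : R) :
  k ** u = u ** k -> (r ^+ 2)%:C *: u + k ** k ** u = k ** k ->
  (r ^+ 2)%:C *: (u - u ** u) = (k - k ** u) ** (k - k ** u).
Proof.
move=> ku E.
have -> : (k - k ** u) ** (k - k ** u) = k ** k - k ** k ** u - (k ** k - k ** k ** u) ** u.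
  by rewrite !cexp -[k ** u ** k]cmulA -ku !cexp; lmod.
have -> : k ** k - k ** k ** u = (r ^+ 2)%:C *: u by rewrite -[X in X - _]E addrK.
by rewrite !cexp; lmod.
Qed.

(** With [x = (2 / r) (k - k u)], the preceding identity reads [x^2 + (1 - 2 u)^2 = 1], so
    [unitary_bound] makes [x] and [1 - 2 u] contractive; [u] and [1 - u] are averages of 1 with
    [-(1 - 2 u)] and with [1 - 2 u]. *)
Lemma resolvent_bounds (k u : A) (r : R) : star k = k -> 0 < r -> star u = u ->
  k ** u = u ** k -> (r ^+ 2)%:C *: u + k ** k ** u = k ** k ->
  [/\ nrm (k - k ** u) <= r / 2, forall a, nrm (a - u ** a) <= nrm a & nrm u <= 1].
Proof.
move=> sk r0 su ku E.
pose x := (2 / r)%:C *: (k - k ** u).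
have sx : star x = x by rewrite /x !cexp conjc_real sk su -ku.
have E2 := resolvent_sqr ku E.
have xx : x ** x = 4%:R *: (u - u ** u).
  rewrite /x cmulZl cmulZr scalerA -E2 scalerA -!rmorphM /=.
  congr (_ *: _); rewrite -(rmorph_nat (real_complex R)); congr (_%:C).
  by field; rewrite gt_eqF.
have ux : u ** x = x ** u by rewrite /x !cexp -ku.
have xE : x = (2 / r)%:C *: (k - k ** u) by [].
clearbody x.
have [x1 u1] : (forall a, nrm (x ** a) <= nrm a) /\ (forall a, nrm (a - (u + u) ** a) <= nrm a).
  have B := @unitary_bound (cmul x) (fun a => a - (u + u) ** a).
  have {}B a : nrm (x ** a) <= nrm a /\ nrm (a - (u + u) ** a) <= nrm a.
    apply: B; [exact: sa_lmul | | |].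
    - by move=> b c; rewrite !cexp su.
    - by move=> b; rewrite !cexp ux.
    - by move=> b; rewrite cmulA xx !cexp; lmod.
  by split=> a; case: (B a).
split.
  have := contr_lmul x1; rewrite xE nrmZ nrmC ger0_norm ?divr_ge0 ?(ltW r0) //.
  by rewrite mulrAC ler_pdivrMr // mul1r ler_pdivlMr // mulrC.
2: apply: contr_lmul => a; have -> : u ** a = 2^-1 *: (a - (a - (u + u) ** a)).
2: by rewrite !cexp; lmod.
2: by rewrite nrmZ nrm_half; have := nrmB a (a - (u + u) ** a); have := u1 a; lra.
move=> a; have -> : a - u ** a = 2^-1 *: (a + (a - (u + u) ** a)) by rewrite !cexp; lmod.
rewrite nrmZ nrm_half; have := nrmD a (a - (u + u) ** a); have := u1 a; lra.
Qed.

Lemma nrm_rmul1B (v : A) : (forall a, nrm (a - v ** a) <= nrm a) ->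
  forall a, nrm (a - a ** star v) <= nrm a.
Proof. by move=> h a; rewrite -nrm_star !cexp (le_trans (h _)) // nrm_star. Qed.

(** For [k = star a ** a], take [u = k^2 / (r^2 + k^2)] with [r = e^2]: then
    [|a - a u|^2 <= |k - k u| <= r / 2]. The factor [star a ** a] puts [u] into every ideal that
    contains [a]. *)
Lemma approx_right_unit (a : A) (e : R) : 0 < e ->
  exists u c : A, [/\ star u = u, u = star a ** a ** c, nrm u <= 1,
    forall b, nrm (b - u ** b) <= nrm b & nrm (a - a ** u) < e].
Proof.
move=> e0; pose k := star a ** a.
have sk : star k = k by rewrite /k !cexp.
have e2 : 0 < e ^+ 2 by rewrite exprn_gt0.
have [u [su ku E]] := resolvent sk e2.
have [b1 b2 b3] := resolvent_bounds sk e2 su ku E.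
exists u, ((e ^+ 2 ^+ 2)^-1%:C *: (k - k ** u)); split=> //.
- rewrite -/k cmulZr cmulBr cmulA -[X in X - _]E addrK scalerA -rmorphM mulVf ?scale1r //.
  by rewrite gt_eqF // exprn_gt0.
- rewrite -(ltr_pXn2r (n := 2)) ?nnegrE ?nrm_ge0 ?(ltW e0) //.
  rewrite -nrm_cstar.
  have -> : star (a - a ** u) ** (a - a ** u) = (k - k ** u) - u ** (k - k ** u).
    by rewrite /k !cexp su; lmod.
  apply: le_lt_trans (b2 _) _; apply: le_lt_trans b1 _.
  by rewrite ltr_pdivrMr // ltr_pMr // ltr1n.
Qed.

(** The new [v] is chosen so that [1 - v] is multiplied on the right by a contractive [1 - u]:
    earlier elements of the list stay good, and [u] is adapted to the remainder [a - a ** v] of the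
    new one. *)
Lemma ideal_units (J : set A) (l : seq A) (e : R) : is_ideal J -> 0 < e ->
  (forall a, a \in l -> J a) ->
  exists v, [/\ J v, J (star v), forall b, nrm (b - v ** b) <= nrm b,
    forall b, nrm (b - b ** v) <= nrm b & forall a, a \in l -> nrm (a - a ** v) < e].
Proof.
move=> iJ e0; have [sJ cJ Jl Jr] := iJ.
elim: l => [|a l IH] lJ.
  by exists 0; rewrite star0; split=> // [||b|b]; rewrite ?cmul0l ?cmul0r ?subr0 //; apply: sJ.1.
have [|v [Jv Jv' vl vr lv]] := IH.
  by move=> b bl; apply: lJ; rewrite in_cons bl orbT.
have Ja : J a by apply: lJ; rewrite in_cons eqxx.
have [u [c [su uE _ ul au]]] := approx_right_unit (a - a ** v) e0.
have Ju : J u by rewrite uE; apply: Jr; apply: (Jl _ _); apply: subspaceB => //; apply: Jl.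
have ur b : nrm (b - b ** u) <= nrm b by rewrite -{1}su; exact: nrm_rmul1B.
exists (v + u - v ** u); split.
- by apply: subspaceB => //; [apply: subspaceD | apply: Jl].
- rewrite !cexp su; apply: subspaceB => //; [exact: subspaceD | exact: Jl].
- move=> b; have -> : b - (v + u - v ** u) ** b = (b - u ** b) - v ** (b - u ** b).
    by rewrite !cexp; lmod.
  exact: le_trans (vl _) (ul _).
- move=> b; have -> : b - b ** (v + u - v ** u) = (b - b ** v) - (b - b ** v) ** u.
    by rewrite !cexp; lmod.
  exact: le_trans (ur _) (vr _).
- move=> b bl; have -> : b - b ** (v + u - v ** u) = (b - b ** v) - (b - b ** v) ** u.
    by rewrite !cexp; lmod.
  move: bl; rewrite in_cons => /orP[/eqP->//|/lv]; exact: le_lt_trans (ur _).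
Qed.

(** [star a] is the limit of [u ** star a] with self-adjoint [u] in [J]. *)
Lemma ideal_star (J : set A) a : is_ideal J -> J a -> J (star a).
Proof.
move=> iJ Ja; have [sJ /closedP cJ Jl Jr] := iJ.
apply: cJ => e e0; have [u [c [su uE _ _ au]]] := approx_right_unit a e0.
have Ju : J u by rewrite uE; apply/Jr/Jl.
exists (u ** star a); first exact: Jr.
by rewrite -nrm_star !cexp su.
Qed.

(** The [v] of [ideal_units] is not positive. Put [1 - b = (1 - v) (1 - star v)] and
    [c = 2 b / (1 + b^2)]: then [c] is a self-adjoint contraction, [1 - c = (1 - b)^2 / (1 + b^2)]
    is as small as needed on the list, and [c^2] is positive. *)
Lemma ideal_approx (J : set A) (l : seq A) (e : R) : is_ideal J -> 0 < e ->
  (forall a, a \in l -> J a) ->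
  exists u, [/\ J u, positive u, nrm u <= 1 &
     forall a, a \in l -> nrm (a - a ** u) < e].
Proof.
move=> iJ e0 lJ; have [sJ cJ Jl Jr] := iJ.
have d0 : 0 < e / 2 by rewrite divr_gt0.
have [v [Jv Jv' vl vr lv]] := ideal_units iJ d0 lJ.
pose b := v + star v - v ** star v.
have sb : star b = b by rewrite /b !cexp; lmod.
have Jb : J b.
  by apply: subspaceB => //; [apply: subspaceD | apply: Jl].
have br y : nrm (y - y ** b) <= nrm (y - y ** v).
  have -> : y - y ** b = (y - y ** v) - (y - y ** v) ** star v by rewrite /b !cexp; lmod.
  exact: nrm_rmul1B.
clearbody b.
have [u [su bu E]] := resolvent sb ltr01.
have [b1 ul _] := resolvent_bounds sb ltr01 su bu E.
rewrite expr1n rmorph1 scale1r in E.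
pose c := (b - b ** u) + (b - b ** u).
have sc : star c = c by rewrite /c !cexp sb su -bu.
have Jc : J c by rewrite /c; apply: subspaceD => //; apply: subspaceB => //; apply: Jr.
have c1 : nrm c <= 1 by rewrite (le_trans (nrmD _ _)) //; move: b1; lra.
have cE a : a - a ** c = (a - a ** b) - (a - a ** b) ** b
    - ((a - a ** b) - (a - a ** b) ** b) ** u.
  have Eb : a ** u = a ** b ** b - a ** b ** b ** u.
    by rewrite -{1}cmulA -{1}E cmulDr !cmulA addrK.
  by rewrite /c !cexp Eb; lmod.
have ur y : nrm (y - y ** u) <= nrm y by rewrite -{1}su; exact: nrm_rmul1B.
exists (c ** c); split.
- exact: Jl.
- by exists c; rewrite sc.
- by rewrite (le_trans (nrm_cmul _ _)) // -[1]mul1r ler_pM ?nrm_ge0.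
move=> a al.
have h : nrm (a - a ** c) < e / 2.
  rewrite cE; apply: le_lt_trans (ur _) _; apply: le_lt_trans (br _) _.
  apply: le_lt_trans (vr _) _; apply: le_lt_trans (br _) _; exact: lv.
have -> : a - a ** (c ** c) = (a - a ** c) + (a - a ** c) ** c by rewrite !cexp; lmod.
apply: le_lt_trans (nrmD _ _) _; have := nrm_cmul (a - a ** c) c.
have := nrm_ge0 (a - a ** c); have := nrm_ge0 c.
by move: (nrm (a - a ** c)) (nrm c) (nrm _) h c1 => *; nra.
Qed.

Lemma approx_unit_exists (J : set A) : is_ideal J ->
  exists (T : Type) (F : set_system T) (u : T -> A), approx_unit J F u.
Proof.
move=> iJ; pose T := {x : A | [/\ J x, positive x & nrm x <= 1]}.
pose good (l : seq A) (e : R) (t : T) := forall a, a \in l ->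
  nrm (a - a ** sval t) < e /\ nrm (a - sval t ** a) < e.
pose F : set_system T := [set X | exists (l : seq A) (e : R),
  [/\ forall a, a \in l -> J a, 0 < e & forall t, good l e t -> X t]].
have FF : ProperFilter F.
  apply: Build_ProperFilter_ex.
    move=> X [l [e [lJ e0 lX]]].
    have [|u [Ju pu u1 hu]] := @ideal_approx J (l ++ map (@star _ A) l) e iJ e0.
      move=> a; rewrite mem_cat => /orP[/lJ//|/mapP[b /lJ Jb ->]]; exact: ideal_star.
    exists (exist _ u (And3 Ju pu u1)); apply: lX => a al /=; split.
      by apply: hu; rewrite mem_cat al.
    rewrite -nrm_star; have [b bE] := pu.
    have su : star u = u by rewrite bE !cexp.
    by rewrite !cexp su; apply: hu; rewrite mem_cat map_f ?orbT.
  split.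
  + by exists [::], 1; split.
  + move=> X Y [l [e [lJ e0 lX]]] [l' [e' [lJ' e0' lX']]].
    exists (l ++ l'), (Num.min e e'); split.
    * by move=> a; rewrite mem_cat => /orP[/lJ|/lJ'].
    * by rewrite lt_min e0 e0'.
    * move=> t gt; split; [apply: lX | apply: lX'] => a al.
        by have [] := gt a; rewrite ?mem_cat ?al // !lt_min => /andP[? _] /andP[? _].
      by have [] := gt a; rewrite ?mem_cat ?al ?orbT // !lt_min => /andP[_ ?] /andP[_ ?].
  + by move=> X Y XY [l [e [lJ e0 lX]]]; exists l, e; split=> // t /lX/XY.
exists T, F, (@sval _ _); split=> //.
- by move=> [x [Jx px x1]] /=; split=> //; rewrite nrmE -[1]/(1%:C) lecR.
- move=> a Ja; apply/cvgrPdist_lt => e e0.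
  have [r er] : exists r, e = r%:C by exists (complex.Re e); rewrite re_real // ltW.
  rewrite er in e0 *; rewrite ltcR in e0.
  exists [:: a], r; split=> // [b|t g]; first by rewrite inE => /eqP->.
  by rewrite /= nrmE ltcR; have [] := g a; rewrite ?inE.
- move=> a Ja; apply/cvgrPdist_lt => e e0.
  have [r er] : exists r, e = r%:C by exists (complex.Re e); rewrite re_real // ltW.
  rewrite er in e0 *; rewrite ltcR in e0.
  exists [:: a], r; split=> // [b|t g]; first by rewrite inE => /eqP->.
  by rewrite /= nrmE ltcR; have [] := g a; rewrite ?inE.
Qed.

End CStarBasics.

(** * Positive functionals *)

Section SemiInner.
Variables (R : realType) (V : lmodType R[i]).

Section Scalar.
Variable f : V -> R[i].
Hypothesis lf : scalar f.

Lemma scl0 : f 0 = 0.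
Proof. by have := lf (-1) 0 0; rewrite scaler0 addr0 mulN1r addNr. Qed.
Lemma sclD x y : f (x + y) = f x + f y.
Proof. by have := lf 1 x y; rewrite scale1r mul1r. Qed.
Lemma sclZ c x : f (c *: x) = c * f x.
Proof. by have := lf c x 0; rewrite !addr0 scl0 addr0. Qed.
Lemma sclN x : f (- x) = - f x.
Proof. by rewrite -scaleN1r sclZ mulN1r. Qed.
Lemma sclB x y : f (x - y) = f x - f y.
Proof. by rewrite sclD sclN. Qed.
Lemma scl_sum (I : Type) (r : seq I) (F : I -> V) :
  f (\sum_(i <- r) F i) = \sum_(i <- r) f (F i).
Proof. exact: (big_morph f sclD scl0). Qed.
End Scalar.

Definition semi_inner (b : V -> V -> R[i]) :=
  [/\ forall x, scalar (b x), forall x y, b y x = conjc (b x y)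
    & forall x, 0 <= b x x].

(** Polarisation: the imaginary parts of [b] at [x + y] and [x + i y] vanish, which are the two real
    equations contained in the symmetry. *)
Lemma hermitian_of_positive (b : V -> V -> R[i]) : (forall x, scalar (b x)) ->
  (forall c x y z, b (c *: x + y) z = conjc c * b x z + b y z) ->
  (forall x, 0 <= b x x) -> semi_inner b.
Proof.
move=> lr ll b0; split=> // x y.
have bD u v z : b (u + v) z = b u z + b v z.
  by have := ll 1 u v z; rewrite scale1r rmorph1 mul1r.
have bZ c u z : b (c *: u) z = conjc c * b u z.
  have b0l : b 0 z = 0 by apply: (addIr (b 0 z)); rewrite -bD !add0r.
  by have := ll c u 0 z; rewrite !addr0 b0l addr0.
have := ger0_Im (b0 (x + y)); have := ger0_Im (b0 (x + 'i%C *: y)).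
rewrite !bD !bZ !(sclD (lr _)) !(sclZ (lr _)) conjc_i.
have := ger0_Im (b0 x); have := ger0_Im (b0 y).
case: (b x x) (b y y) (b x y) (b y x) => [xr xi] [yr yi] [pr pi] [qr qi] /= *.
by apply/eqP; rewrite eq_complex /=; apply/andP; split; apply/eqP; lra.
Qed.

Variable b : V -> V -> R[i].
Hypothesis sb : semi_inner b.

Lemma si_scalar x : scalar (b x). Proof. by case: sb. Qed.
Lemma si_conj x y : b y x = conjc (b x y). Proof. by case: sb. Qed.
Lemma si_ge0 x : 0 <= b x x. Proof. by case: sb. Qed.

Lemma siDr x y z : b x (y + z) = b x y + b x z.
Proof. exact: sclD (si_scalar x) _ _. Qed.
Lemma siZr c x y : b x (c *: y) = c * b x y.
Proof. exact: sclZ (si_scalar x) _ _. Qed.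
Lemma siNr x y : b x (- y) = - b x y.
Proof. exact: sclN (si_scalar x) _. Qed.
Lemma siBr x y z : b x (y - z) = b x y - b x z.
Proof. exact: sclB (si_scalar x) _ _. Qed.
Lemma si0r x : b x 0 = 0. Proof. exact: scl0 (si_scalar x). Qed.
Lemma siDl x y z : b (x + y) z = b x z + b y z.
Proof. by rewrite si_conj siDr rmorphD /= -!si_conj. Qed.
Lemma siZl c x y : b (c *: x) y = conjc c * b x y.
Proof. by rewrite si_conj siZr rmorphM /= -!si_conj. Qed.
Lemma siNl x y : b (- x) y = - b x y.
Proof. by rewrite si_conj siNr rmorphN /= -si_conj. Qed.
Lemma siBl x y z : b (x - y) z = b x z - b y z.
Proof. by rewrite siDl siNl. Qed.
Lemma si0l x : b 0 x = 0. Proof. by rewrite si_conj si0r rmorph0. Qed.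

Lemma si_real x : (complex.Re (b x x))%:C = b x x.
Proof. by rewrite re_real // si_ge0. Qed.
Lemma si_Re_ge0 x : 0 <= complex.Re (b x x).
Proof. by rewrite -ler0c si_real si_ge0. Qed.

Lemma cauchy_schwarz x y :
  nrm (b x y) ^+ 2 <= complex.Re (b x x) * complex.Re (b y y).
Proof.
have key (t : R) : 0 <= complex.Re (b x x) - t * nrm (b x y) ^+ 2 *+ 2
    + t ^+ 2 * nrm (b x y) ^+ 2 * complex.Re (b y y).
  have := si_ge0 (x - (t%:C * b y x) *: y).
  rewrite siBr siZr !siBl !siZl conjcM conjc_real.
  have zz : conjc (b y x) * b y x = (nrm (b x y) ^+ 2)%:C.
    by rewrite -nrm_sqr (si_conj x y) nrmJ.
  have -> : b x x - t%:C * conjc (b y x) * b y x -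
      t%:C * b y x * (b x y - t%:C * conjc (b y x) * b y y) =
      b x x - t%:C * (conjc (b y x) * b y x) - t%:C * (b x y * b y x)
      + t%:C ^+ 2 * (conjc (b y x) * b y x) * b y y by ring.
  have zz2 : b x y * b y x = (nrm (b x y) ^+ 2)%:C by rewrite -zz -si_conj.
  rewrite zz zz2 -(si_real x) -(si_real y) -rmorphXn -!rmorphM -!rmorphB -!rmorphD /=.
  rewrite ler0c mulr2n => h; apply: le_trans h _.
  by rewrite le_eqVlt; apply/orP; left; apply/eqP; ring.
have x0 := si_Re_ge0 x; have y0 := si_Re_ge0 y.
move: (nrm (b x y) ^+ 2) (exprn_ge0 2 (nrm_ge0 (b x y))) key => n n0 key.
move: (complex.Re (b x x)) (complex.Re (b y y)) x0 y0 key => p q p0 q0 key.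
have [q00|qn0] := eqVneq q 0.
  rewrite q00 mulr0; have := key ((p + 1) / (n + 1)); rewrite q00 mulr0 addr0 => h.
  rewrite leNgt; apply/negP => np.
  have := key ((p + 1) / n); rewrite q00 mulr0 addr0 divfK ?gt_eqF //.
  by lra.
have qp : 0 < q by rewrite lt_neqAle eq_sym qn0.
have := key q^-1.
have -> : q^-1 ^+ 2 * n * q = q^-1 * n by field.
rewrite mulr2n => h; rewrite -ler_pdivrMr // mulrC; lra.
Qed.

End SemiInner.

Section PositiveFunctionals.
Variables (R : realType) (A : cstarAlgebra R).
Implicit Types a b c : A.

Definition positive_functional (g : A -> R[i]) :=
  scalar g /\ forall a, 0 <= g (star a ** a).

Lemma functional_form g : positive_functional g ->
  semi_inner (fun a b => g (star a ** b)).
Proof.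
move=> [lg pg]; apply: hermitian_of_positive => //.
  by move=> x c y z; rewrite !cexp lg.
by move=> c x y z; rewrite !cexp lg.
Qed.

Lemma state_positive g : is_state g -> positive_functional g.
Proof. by case. Qed.

Lemma state_nrm g : is_state g -> forall a, nrm (g a) <= nrm a.
Proof. by move=> [_ _ h _] a; have := h a; rewrite !nrmE lecR. Qed.

Lemma state_max g (M : R) : is_state g -> (forall a, nrm (g a) <= M * nrm a) -> 1 <= M.
Proof. by move=> [_ _ _ h] hM; apply: h => a; rewrite !nrmE -rmorphM lecR. Qed.

Lemma is_state_nrm (g : A -> R[i]) : positive_functional g ->
  (forall a, nrm (g a) <= nrm a) ->
  (forall M : R, (forall a, nrm (g a) <= M * nrm a) -> 1 <= M) -> is_state g.
Proof.
move=> [lg pg] cg mg; split=> //; first by move=> a; rewrite !nrmE lecR.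
by move=> M hM; apply: mg => a; have := hM a; rewrite !nrmE -rmorphM lecR.
Qed.

Section Bounded.
Variable g : A -> R[i].
Hypotheses (pg : positive_functional g) (cg : forall a, nrm (g a) <= nrm a).

Lemma functional_star a : g (star a) = conjc (g a).
Proof.
have [lg _] := pg; have F := functional_form pg.
apply/eqP; rewrite -subr_eq0; apply/eqP/nrm_small => e e0.
have [|u [c [su _ _ _ au]]] := approx_right_unit a (e := e / 2); first by rewrite divr_gt0.
have gu : g (u ** star a) = conjc (g (a ** u)).
  by have := si_conj F (star a) u; rewrite /= su starK.
have -> : g (star a) - conjc (g a) =
    g (star (a - a ** u)) - conjc (g (a - a ** u)).
  by rewrite !cexp su !(sclB lg) rmorphB /= gu; ring.
have := nrmB (g (star (a - a ** u))) (conjc (g (a - a ** u))).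
have := cg (star (a - a ** u)); have := cg (a - a ** u).
by rewrite nrmJ nrm_star; move: au; lra.
Qed.

(** Cauchy-Schwarz against [1], whose place is taken by a contraction [u] with [u ** a] close to
    [a]. *)
Lemma functional_cs a : nrm (g a) ^+ 2 <= complex.Re (g (star a ** a)).
Proof.
have [lg _] := pg; have F := functional_form pg.
have p0 := si_Re_ge0 F a; rewrite /= in p0.
set p := complex.Re _ in p0 *.
suff : nrm (g a) <= Num.sqrt p.
  rewrite -(ler_pXn2r (n := 2)) ?nnegrE ?nrm_ge0 ?sqrtr_ge0 //.
  by rewrite sqr_sqrtr.
apply: (@le_eps _ _ _ 1) => e e0; rewrite mul1r.
have [u [c [su _ u1 _ au]]] := approx_right_unit (star a) e0.
have {}au : nrm (a - u ** a) < e by rewrite -nrm_star !cexp su.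
have := cauchy_schwarz F u a; rewrite /= su -/p => cs.
have uu : complex.Re (g (u ** u)) <= 1.
  apply: le_trans (Re_le _) _; apply: le_trans (cg _) _.
  by apply: le_trans (nrm_cmul _ _) _; rewrite -[1]mulr1 ler_pM ?nrm_ge0.
have gua : nrm (g (u ** a)) <= Num.sqrt p.
  rewrite -(ler_pXn2r (n := 2)) ?nnegrE ?nrm_ge0 ?sqrtr_ge0 // sqr_sqrtr //.
  by apply: le_trans cs _; rewrite ler_piMl.
have := cg (a - u ** a); rewrite (sclB lg).
have := nrmD (g a - g (u ** a)) (g (u ** a)); rewrite subrK.
by move: gua au; lra.
Qed.

End Bounded.

(** After scaling [c] to a contraction [d], the multiplier [1 - star d ** d] is the square of a
    self-adjoint one. This is the bound for the operators of the GNS construction. *)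
Lemma functional_conj_le g a c : positive_functional g ->
  complex.Re (g (star (c ** a) ** (c ** a))) <= nrm c ^+ 2 * complex.Re (g (star a ** a)).
Proof.
move=> pg; have [lg p0] := pg; have F := functional_form pg.
have [c0|cn0] := eqVneq (nrm c) 0.
  by rewrite (nrm_eq0 c0) !cexp (scl0 lg) nrm0 expr0n mul0r.
have cp : 0 < nrm c by rewrite lt_neqAle eq_sym cn0 nrm_ge0.
pose d := (nrm c)^-1%:C *: c.
have d1 : nrm d <= 1 by rewrite nrmZ nrmC gtr0_norm ?invr_gt0 // mulVf.
have cd : c = (nrm c)%:C *: d by rewrite scalerA -rmorphM mulfV // scale1r.
have [S [lS aS SS _]] : exists S : A -> A,
  [/\ linear S, sa_op S, forall a, S (S a) = a - star d ** d ** a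
    & forall Z (M : R), linear Z -> (forall v, nrm (Z v) <= M * nrm v) ->
        (forall v, Z (star d ** d ** v) = star d ** d ** Z v) ->
        forall v, Z (S v) = S (Z v)].
  apply: sa_root; [exact: cmul_linearr | by apply: sa_lmul; rewrite !cexp |].
  move=> b; apply: nrm_cmull_le => //; rewrite nrm_cstar.
  by rewrite expr2 -[1]mulr1 ler_pM ?nrm_ge0.
have := p0 (S a); rewrite aS SS cmulBr (sclB lg) => h.
clearbody d; rewrite {1 2}cd !cexp !(sclZ lg) conjc_real -!cmulA.
have -> : (nrm c)%:C * ((nrm c)%:C * g (star a ** (star d ** (d ** a)))) =
  (nrm c ^+ 2)%:C * g (star a ** (star d ** (d ** a))).
  by rewrite mulrA -rmorphM.
rewrite Re_realM ler_wpM2l ?exprn_ge0 ?nrm_ge0 //.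
by move: h; rewrite lecE ReB -!cmulA subr_ge0 => /andP[].
Qed.

(* [k = T x] with [x = 2 k / (1 + k^2)] and [T = (1 + k^2) / 2]; the element
   [1 - x^2] is a square. *)
Lemma functional_contr g : positive_functional g ->
  (forall a, nrm (g a) ^+ 2 <= complex.Re (g (star a ** a))) ->
  forall a, nrm (g a) <= nrm a.
Proof.
move=> pg cs; have [lg p0] := pg; have F := functional_form pg.
have K k : star k = k -> nrm k <= 1 -> complex.Re (g (k ** k)) <= 1.
  move=> sk k1.
  have [u [su ku E]] := resolvent sk ltr01; rewrite expr1n rmorph1 scale1r in E.
  have ukk : k ** k - k ** k ** u = u by rewrite -[X in X - _]E addrK.
  have := resolvent_sqr (r := 1) ku; rewrite expr1n rmorph1 !scale1r => /(_ E) E2.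
  pose x := (k - k ** u) + (k - k ** u).
  have sx : star x = x by rewrite /x !cexp sk su -ku.
  have xx : x ** x = 4%:R *: (u - u ** u) by rewrite E2 /x cmulDl !cmulDr; lmod.
  pose T a := 2^-1 *: (a + k ** k ** a).
  have Tx : T x = k.
    have -> : T x = (k - k ** u) + k ** (k ** k - k ** k ** u) by rewrite /T /x !cexp; lmod.
    by rewrite ukk; lmod.
  have lT : linear T by move=> c a b; rewrite /T !cexp; lmod.
  have cv : conjc (2^-1 : R[i]) = 2^-1.
    by rewrite -(rmorph_nat (real_complex R)) -fmorphV conjc_real.
  have aT : sa_op T by move=> a b; rewrite /T !cexp sk cv.
  have cT a : nrm (T a) <= nrm a.
    rewrite nrmZ nrm_half; have := nrmD a (k ** k ** a).
    have : nrm (k ** k ** a) <= nrm a by rewrite -cmulA; apply: nrm_cmull_le => //; exact: nrm_cmull_le.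
    lra.
  have [S [lS aS _ SS _]] := complementary_op lT aT cT.
  (* With [t = Re (g u)], positivity at [S x] gives [g (k^2) <= g (x^2) = 4 (g u - g (u^2)) <= 4 (t
     - t^2) <= 1]. *)
  have := p0 (S x); rewrite aS SS cmulBr (sclB lg) -aT Tx sx sk xx (sclZ lg) (sclB lg).
  have := cs u; rewrite su; have := Re_le_nrm (g u).
  rewrite lecE ReB => h1 h2 /andP[_]; rewrite subr_ge0 => h3.
  apply: le_trans h3 _.
  have -> : 4%:R = (4%:R : R)%:C by rewrite rmorph_nat.
  rewrite Re_realM ReB.
  have : complex.Re (g u) ^+ 2 <= complex.Re (g (u ** u)).
    apply: le_trans h2; rewrite -real_normK ?num_real //.
    by rewrite ler_pXn2r ?nnegrE ?nrm_ge0.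
  move: (complex.Re (g (u ** u))) (complex.Re _) => p t tp.
  have := sqr_ge0 (2 * t - 1); rewrite sqrrB expr1n; lra.
move=> a; have [a0|an0] := eqVneq (nrm a) 0.
  by rewrite (nrm_eq0 a0) (scl0 lg) !nrm0.
have ap : 0 < nrm a by rewrite lt_neqAle eq_sym an0 nrm_ge0.
pose d := (nrm a)^-1%:C *: a.
have d1 : nrm d <= 1 by rewrite nrmZ nrmC gtr0_norm ?invr_gt0 // mulVf.
have ad : a = (nrm a)%:C *: d by rewrite scalerA -rmorphM mulfV // scale1r.
rewrite {1}ad (sclZ lg) nrmM nrmC ger0_norm ?nrm_ge0 // ler_piMr ?nrm_ge0 //.
have sdd : star (star d ** d) = star d ** d by rewrite !cexp.
have := K _ sdd; rewrite nrm_cstar expr_le1 ?nrm_ge0 // => /(_ d1).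
have := cs (star d ** d); rewrite sdd; have := cs d; have := Re_le (g (star d ** d)).
have := nrm_ge0 (g d); have := nrm_ge0 (g (star d ** d)).
move: (nrm (g d)) (nrm _) (complex.Re _) (complex.Re _) => n m r r1 *.
have m1 : m <= 1 by nra.
by nra.
Qed.

(** For a self-adjoint contraction [k], the element [k^2] is the average of [k^2 + i S k] and
    [k^2 - i S k] with [S = sqrt (1 - k^2)]. Both have [k^2] as their value of [star y ** y], so
    their images have the norm of [f k], and [|f k|^2 <= |f k|]. *)
Lemma star_hom_contr (B : cstarAlgebra R) (f : A -> B) : star_hom f ->
  forall a, nrm (f a) <= nrm a.
Proof.
move=> [lf mf sf].
have K k : star k = k -> nrm k <= 1 -> nrm (f k) <= 1.
  move=> sk k1.
  have lk : linear (cmul k) by exact: cmul_linearr.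
  have ak := sa_lmul sk.
  have ck a : nrm (k ** a) <= nrm a by exact: nrm_cmull_le.
  have [S [lS aS _ SS comm]] := complementary_op lk ak ck.
  have kS a : k ** S a = S (k ** a).
    by apply: (comm (cmul k) 1) => // v; rewrite mul1r.
  have E a : k ** (k ** a) + S (S a) = a by rewrite SS addrC subrK.
  have W (c : R[i]) : conjc c = - c -> c * c = -1 -> nrm (f (k ** k + c *: S k)) = nrm (f k).
    move=> cJ cc; apply/eqP; rewrite -(@eqrXn2 _ 2) ?nrm_ge0 // -!nrm_cstar -!sf -!mf.
    by rewrite unitary_cstar.
  have Wp : nrm (f (k ** k + 'i%C *: S k)) = nrm (f k).
    by apply: W; [rewrite conjc_i | rewrite -expr2 sqr_i].
  have Wm : nrm (f (k ** k + (- 'i%C) *: S k)) = nrm (f k).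
    by apply: W; [rewrite conjcN conjc_i | rewrite mulrNN -expr2 sqr_i].
  have : nrm (f k) ^+ 2 <= nrm (f k).
    rewrite -nrm_cstar -sf -mf sk.
    have -> : k ** k = 2^-1 *: ((k ** k + 'i%C *: S k) + (k ** k + (- 'i%C) *: S k)) by lmod.
    rewrite (linZ lf) (linD lf) nrmZ nrm_half.
    have := nrmD (f (k ** k + 'i%C *: S k)) (f (k ** k + (- 'i%C) *: S k)).
    by rewrite Wp Wm; lra.
  have := nrm_ge0 (f k); move: (nrm _) => t t0; nra.
move=> a; have [a0|an0] := eqVneq (nrm a) 0.
  by rewrite (nrm_eq0 a0) (lin0 lf) !nrm0.
have ap : 0 < nrm a by rewrite lt_neqAle eq_sym an0 nrm_ge0.
pose d := (nrm a)^-1%:C *: a.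
have d1 : nrm d <= 1 by rewrite nrmZ nrmC gtr0_norm ?invr_gt0 // mulVf.
have ad : a = (nrm a)%:C *: d by rewrite scalerA -rmorphM mulfV // scale1r.
rewrite {1}ad (linZ lf) nrmZ nrmC ger0_norm ?nrm_ge0 // ler_piMr ?nrm_ge0 //.
have sdd : star (star d ** d) = star d ** d by rewrite !cexp.
have := K _ sdd; rewrite nrm_cstar expr_le1 ?nrm_ge0 // => /(_ d1).
by rewrite mf sf nrm_cstar expr_le1 ?nrm_ge0.
Qed.

End PositiveFunctionals.

(** * Completions of semi-inner product spaces *)

Section Limits.
Variable R : realType.

Lemma seq_complete (V : normedModType R[i]) :
  (forall u : nat -> V, cauchys u -> exists l, cvs u l) ->
  forall F : set_system V, ProperFilter F -> cauchy F -> cvg F.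
Proof.
move=> compl F FF /cauchyP cF.
have /choice[u Hu] n : exists x : V, F (ball x (n.+1%:R^-1%:C)).
  by apply: cF; rewrite ltcR invr_gt0.
have near2 m n : nrm (u m - u n) < m.+1%:R^-1 + n.+1%:R^-1.
  have [z [zm zn]] := filter_ex (filterI (Hu m) (Hu n)).
  rewrite -!ball_normE /ball_ /= !nrmE !ltcR in zm zn.
  by rewrite (le_lt_trans (nrm_tri z _ _)) // ltrD // nrmBC.
have cu : cauchys u.
  move=> e e0; have [|N HN] := @invn_small R (e / 2); first by rewrite divr_gt0.
  exists N => m n /HN hm /HN hn; have := near2 m n; move: hm hn; move: (m.+1%:R^-1) (n.+1%:R^-1) => *; lra.
have [l Hl] := compl _ cu; apply/cvg_ex; exists l.
apply/fcvgrPdist_lt => e e0.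
have [r er] : exists r, e = r%:C by exists (complex.Re e); rewrite re_real // ltW.
rewrite er in e0 *; rewrite ltcR in e0.
have e2 : 0 < r / 2 by rewrite divr_gt0.
have [N HN] := invn_small e2; have [N' HN'] := Hl _ e2.
apply: filterS (Hu (maxn N N')) => z; rewrite -ball_normE /ball_ /= !nrmE !ltcR => hz.
have := HN _ (leq_maxl N N'); have := HN' _ (leq_maxr N N').
have := nrm_tri (u (maxn N N')) l z; move: hz.
by move: ((maxn N N').+1%:R^-1) => *; lra.
Qed.

Lemma cauchy_real (v : nat -> R) :
  (forall e, 0 < e -> exists N, forall m n, (N <= m)%N -> (N <= n)%N -> `|v m - v n| < e) ->
  exists l, forall e, 0 < e -> exists N, forall n, (N <= n)%N -> `|l - v n| < e.
Proof.
move=> cv; have : cvg (v @ \oo).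
  apply: R_complete; apply/cauchy_ballP => e e0.
  have [N HN] := cv _ e0.
  pose T := [set x | exists2 n, (N <= n)%N & x = v n].
  exists (T, T) => [|[x y] /= [[m Hm ->] [n Hn ->]]].
    by split; exists N => // n Nn; exists n.
  by rewrite -ball_normE /ball_ /=; exact: HN.
move=> /cvg_ex[l /cvgrPdist_lt vl]; exists l => e /vl [N _ HN].
by exists N => n /HN.
Qed.

Lemma nrm_le_ReIm (z : R[i]) : nrm z <= `|complex.Re z| + `|complex.Im z|.
Proof.
have -> : z = (complex.Re z)%:C + 'i%C * (complex.Im z)%:C by rewrite -complexE.
apply: le_trans (nrmD _ _) _; rewrite nrmM nrmi mul1r !nrmC.
by case: z => a b /=; rewrite !(mul0r, mulr0, mul1r, addr0, add0r, subr0, subrr).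
Qed.

Lemma ImB (x y : R[i]) : complex.Im (x - y) = complex.Im x - complex.Im y.
Proof. by case: x; case: y. Qed.

Lemma cauchys_complex (u : nat -> R[i]) : cauchys u -> exists l, cvs u l.
Proof.
move=> cu.
have [a Ha] : exists l, forall e, 0 < e -> exists N, forall n, (N <= n)%N ->
    `|l - complex.Re (u n)| < e.
  apply: cauchy_real => e /cu[N HN]; exists N => m n Nm Nn; rewrite -ReB.
  exact: le_lt_trans (Re_le_nrm _) (HN _ _ Nm Nn).
have [b Hb] : exists l, forall e, 0 < e -> exists N, forall n, (N <= n)%N ->
    `|l - complex.Im (u n)| < e.
  apply: cauchy_real => e /cu[N HN]; exists N => m n Nm Nn; rewrite -ImB.
  exact: le_lt_trans (Im_le_nrm _) (HN _ _ Nm Nn).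
exists (a +i* b)%C => e e0; have e2 : 0 < e / 2 by rewrite divr_gt0.
have [N HN] := Ha _ e2; have [N' HN'] := Hb _ e2.
exists (maxn N N') => n; rewrite geq_max => /andP[/HN h /HN' h'].
apply: le_lt_trans (nrm_le_ReIm _) _; rewrite ReB ImB /= (splitr e).
exact: ltrD.
Qed.

Lemma cvs_uniq (V : normedZmodType R[i]) (u : nat -> V) l l' :
  cvs u l -> cvs u l' -> l = l'.
Proof.
move=> h h'; apply/eqP; rewrite -subr_eq0; apply/eqP/nrm_small => e e0.
have e2 : 0 < e / 2 by rewrite divr_gt0.
have [N HN] := h _ e2; have [N' HN'] := h' _ e2.
have := HN _ (leq_maxl N N'); have := HN' _ (leq_maxr N N').
have := nrm_tri (u (maxn N N')) l l'; rewrite [nrm (u _ - l')]nrmBC; lra.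
Qed.

Lemma cvs_cst (V : normedZmodType R[i]) (l : V) : cvs (fun=> l) l.
Proof. by move=> e e0; exists 0%N => n _; rewrite subrr nrm0. Qed.

Lemma cvsD (V : normedZmodType R[i]) (u v : nat -> V) l k :
  cvs u l -> cvs v k -> cvs (fun n => u n + v n) (l + k).
Proof.
move=> h h' e e0; have e2 : 0 < e / 2 by rewrite divr_gt0.
have [N HN] := h _ e2; have [N' HN'] := h' _ e2.
exists (maxn N N') => n; rewrite geq_max => /andP[/HN a /HN' b].
by rewrite opprD addrACA (splitr e) (le_lt_trans (nrmD _ _)) // ltrD.
Qed.

Lemma cvs_bound (V W : normedZmodType R[i]) (u : nat -> V) (v : nat -> W) l k (M : R) :
  cvs u l -> (forall n, nrm (k - v n) <= M * nrm (l - u n)) -> cvs v k.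
Proof.
move=> h b e e0; have d0 : 0 < e / (`|M| + 1) by rewrite divr_gt0 // ltr_wpDl.
have [N HN] := h _ d0; exists N => n /HN hn; apply: le_lt_trans (b n) _.
apply: (@le_lt_trans _ _ ((`|M| + 1) * nrm (l - u n))).
  by rewrite ler_wpM2r ?nrm_ge0 // (le_trans (ler_norm M)) // lerDl.
by rewrite mulrC -ltr_pdivlMr // ltr_wpDl.
Qed.

Lemma cvsZ (u : nat -> R[i]) l c : cvs u l -> cvs (fun n => c * u n) (c * l).
Proof. by move=> h; apply: (cvs_bound (M := nrm c) h) => n; rewrite -mulrBr nrmM. Qed.

Lemma cvs_conj (u : nat -> R[i]) l : cvs u l -> cvs (fun n => conjc (u n)) (conjc l).
Proof. by move=> h; apply: (cvs_bound (M := 1) h) => n; rewrite -conjcB nrmJ mul1r. Qed.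

Lemma cvs_ge0 (u : nat -> R[i]) l : cvs u l -> (forall n, 0 <= u n) -> 0 <= l.
Proof.
move=> h u0; rewrite lecE /=; apply/andP; split.
  have -> : complex.Im l = 0.
    apply/eqP; rewrite -normr_eq0 eq_le normr_ge0 andbT.
    apply: (@le_eps _ _ _ 1) => e /h[N /(_ N (leqnn _)) hN]; rewrite add0r mul1r.
    have := Im_le_nrm (l - u N); rewrite ImB (ger0_Im (u0 N)) subr0.
    by move=> k; exact: le_trans k (ltW hN).
  by [].
rewrite leNgt; apply/negP => l0.
have /h[N /(_ N (leqnn _)) hN] : 0 < - complex.Re l by rewrite oppr_gt0.
have := Re_le_nrm (l - u N); rewrite ReB => k.
have := u0 N; rewrite lecE /= => /andP[_ r0].
by have := lerNnormlW (le_refl `|complex.Re l - complex.Re (u N)|); lra.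
Qed.

End Limits.

Section Completion.
Variables (R : realType) (V : lmodType R[i]) (b : V -> V -> R[i]).
Hypothesis sb : semi_inner b.

Let p x := Num.sqrt (complex.Re (b x x)).

Let p0 x : 0 <= p x. Proof. exact: sqrtr_ge0. Qed.

Let pE x : p x ^+ 2 = complex.Re (b x x).
Proof. by rewrite sqr_sqrtr // (si_Re_ge0 sb). Qed.

Let cs x y : nrm (b x y) <= p x * p y.
Proof.
rewrite -(ler_pXn2r (n := 2)) ?nnegrE ?nrm_ge0 ?mulr_ge0 //.
by rewrite exprMn !pE; exact: cauchy_schwarz.
Qed.

Let pD x y : p (x + y) <= p x + p y.
Proof.
rewrite -(ler_pXn2r (n := 2)) ?nnegrE ?addr_ge0 //.
rewrite pE sqrrD (siDl sb) !(siDr sb) !ReD !pE (si_conj sb x y).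
have -> : complex.Re (conjc (b x y)) = complex.Re (b x y) by case: (b x y).
by have := cs x y; have := Re_le (b x y); rewrite mulr2n; lra.
Qed.

Let pZ c x : p (c *: x) = nrm c * p x.
Proof.
rewrite /p (siZl sb) (siZr sb) mulrA -nrm_sqr Re_realM sqrtrM ?exprn_ge0 ?nrm_ge0 //.
by rewrite sqrtr_sqr ger0_norm ?nrm_ge0.
Qed.

Let bcau (s : nat -> V) := forall e : R, 0 < e ->
  exists N, forall m n, (N <= m)%N -> (N <= n)%N -> p (s m - s n) < e.

Let bcau_bound s : bcau s -> exists C N, 0 <= C /\ forall n, (N <= n)%N -> p (s n) <= C.
Proof.
move=> /(_ _ ltr01)[N HN]; exists (1 + p (s N)), N; split; first by rewrite addr_ge0.
by move=> n /HN/(_ (leqnn _)) h; have := pD (s n - s N) (s N); rewrite subrK; lra.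
Qed.

Let bcauZ c s t : bcau s -> bcau t -> bcau (fun n => c *: s n + t n).
Proof.
move=> cs1 ct e e0; have c0 := nrm_ge0 c.
have [|N HN] := cs1 (e / 2 / (nrm c + 1)); first by rewrite !divr_gt0 // ltr_wpDl.
have [|N' HN'] := ct (e / 2); first by rewrite divr_gt0.
exists (maxn N N') => m n; rewrite !geq_max => /andP[m1 m2] /andP[n1 n2].
have -> : c *: s m + t m - (c *: s n + t n) = c *: (s m - s n) + (t m - t n) by lmod.
have := mul_lt_div c0 (p0 (s m - s n)) c0 (lexx _) (HN _ _ m1 n1).
have := HN' _ _ m2 n2; have := pD (c *: (s m - s n)) (t m - t n).
by rewrite pZ; lra.
Qed.

(* Completion as the functionals [w |-> lim b w (s n)], [s] a Cauchy sequence. *)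
Let represents (s : nat -> V) (f : V -> R[i]) :=
  bcau s /\ forall w, cvs (fun n => b w (s n)) (f w).

(** [b (s n) (s n)] splits into [b (s n - s N) (s n)], small by the Cauchy property, and
    [b (s N) (s n)], small by weak convergence. Hence a functional determines its sequence up to
    null sequences. *)
Let null s : bcau s -> (forall w, cvs (fun n => b w (s n)) 0) ->
  forall e, 0 < e -> exists N, forall n, (N <= n)%N -> p (s n) < e.
Proof.
move=> cs1 s0 e e0; have [C [N0 [C0 HC]]] := bcau_bound cs1.
have d0 : 0 < e ^+ 2 / 2 / (C + 1) by rewrite !divr_gt0 ?exprn_gt0 // ltr_wpDl.
have [N1 HN1] := cs1 _ d0; pose N := maxn N0 N1.
have [|N2 HN2] := s0 (s N) (e ^+ 2 / 2); first by rewrite divr_gt0 ?exprn_gt0.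
exists (maxn N N2) => n; rewrite geq_max => /andP[nN /HN2]; rewrite sub0r nrmN => h2.
move: nN; rewrite geq_max => /andP[n0 n1].
rewrite -(ltr_pXn2r (n := 2)) ?nnegrE ?(ltW e0) // pE.
have -> : b (s n) (s n) = b (s n - s N) (s n) + b (s N) (s n) by rewrite (siBl sb) subrK.
apply: le_lt_trans (Re_le _) _; apply: le_lt_trans (nrmD _ _) _.
have := cs (s n - s N) (s n); have := HN1 _ _ n1 (leq_maxr N0 N1); have := HC _ n0.
rewrite ltr_pdivlMr ?ltr_wpDl //; have := p0 (s n - s N); have := p0 (s n).
by move: (e ^+ 2) (p _) (p _) (nrm _) (nrm _) h2 => *; nra.
Qed.

Let represents_uniq s t f : represents s f -> represents t f ->
  forall e, 0 < e -> exists N, forall n, (N <= n)%N -> p (s n - t n) < e.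
Proof.
move=> [cs1 sf] [ct tf].
have h := null (s := fun n => (-1) *: t n + s n) (bcauZ (-1) ct cs1).
move=> e e0; have [|N HN] := h _ _ e0; last first.
  by exists N => n /HN; rewrite scaleN1r addrC.
move=> w; have -> : (0 : R[i]) = (-1) * f w + f w by rewrite mulN1r addNr.
have := cvsD (cvsZ (-1) (tf w)) (sf w).
by congr (cvs _ _); apply/funext => n; rewrite (siDr sb) (siZr sb).
Qed.

Let pairing_cauchy s t : bcau s -> bcau t -> cauchys (fun n => b (s n) (t n)).
Proof.
move=> c1 c2 e e0; have [C [N0 [C0 HC]]] := bcau_bound c1.
have [D [N0' [D0 HD]]] := bcau_bound c2.
have d1 : 0 < e / 2 / (D + 1) by rewrite !divr_gt0 // ltr_wpDl.
have d2 : 0 < e / 2 / (C + 1) by rewrite !divr_gt0 // ltr_wpDl.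
have [N1 HN1] := c1 _ d1; have [N2 HN2] := c2 _ d2.
exists (maxn (maxn N0 N0') (maxn N1 N2)) => m n.
rewrite !geq_max => /andP[/andP[m1 m2] /andP[m3 m4]] /andP[/andP[n1 n2] /andP[n3 n4]].
have -> : b (s m) (t m) - b (s n) (t n) = b (s m - s n) (t m) + b (s n) (t m - t n).
  by rewrite (siBl sb) (siBr sb); ring.
apply: le_lt_trans (nrmD _ _) _.
have := cs (s m - s n) (t m); have := cs (s n) (t m - t n).
have := HN1 _ _ m3 n3; have := HN2 _ _ m4 n4; have := HC _ n1; have := HD _ m2.
rewrite !ltr_pdivlMr ?ltr_wpDl //.
have := p0 (s m - s n); have := p0 (t m); have := p0 (s n); have := p0 (t m - t n).
move: (p (s n)) (p (t m)) (p _) (p _) (nrm _) (nrm _) => *.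
by nra.
Qed.

Let pairing_uniq s t s' t' f g l : represents s f -> represents t g ->
  represents s' f -> represents t' g ->
  cvs (fun n => b (s n) (t n)) l -> cvs (fun n => b (s' n) (t' n)) l.
Proof.
move=> rs rt rs' rt' h e e0.
have [C [N0 [C0 HC]]] := bcau_bound rs.1.
have [D [N0' [D0 HD]]] := bcau_bound rt'.1.
have d1 : 0 < e / 3 / (D + 1) by rewrite !divr_gt0 // ltr_wpDl.
have d2 : 0 < e / 3 / (C + 1) by rewrite !divr_gt0 // ltr_wpDl.
have [N1 HN1] := represents_uniq rs rs' d1; have [N2 HN2] := represents_uniq rt rt' d2.
have [|N3 HN3] := h (e / 3); first by rewrite divr_gt0.
exists (maxn (maxn N0 N0') (maxn N1 (maxn N2 N3))) => n.
rewrite !geq_max => /andP[/andP[n1 n2] /andP[n3 /andP[n4 n5]]].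
have -> : l - b (s' n) (t' n) = (l - b (s n) (t n))
    + (b (s n - s' n) (t' n) + b (s n) (t n - t' n)).
  by rewrite (siBl sb) (siBr sb); ring.
apply: le_lt_trans (nrmD _ _) _.
have := nrmD (b (s n - s' n) (t' n)) (b (s n) (t n - t' n)).
have := cs (s n - s' n) (t' n); have := cs (s n) (t n - t' n); have := HN3 _ n5.
have := mul_lt_div D0 (p0 (s n - s' n)) (p0 (t' n)) (HD _ n2) (HN1 _ n3).
have := mul_lt_div C0 (p0 (t n - t' n)) (p0 (s n)) (HC _ n1) (HN2 _ n4).
by rewrite [p (t' n) * _]mulrC; lra.
Qed.

Definition in_completion (f : V -> R[i]) := exists s, represents s f.

(** Equivalent Cauchy sequences give the same functional, so that equality of functions replaces a
    quotient. *)
Definition completion := {f : V -> R[i] | in_completion f}.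
Local Notation T := completion.

HB.instance Definition _ := gen_eqMixin T.
HB.instance Definition _ := gen_choiceMixin T.

Let in_completionZ c f g : in_completion f -> in_completion g ->
  in_completion (fun w => c * f w + g w).
Proof.
move=> [s [cs1 sf]] [t [ct tg]]; exists (fun n => c *: s n + t n); split.
  exact: bcauZ.
move=> w; have := cvsD (cvsZ c (sf w)) (tg w).
by congr (cvs _ _); apply/funext => n; rewrite (siDr sb) (siZr sb).
Qed.

Let represents_cst v : represents (fun=> v) (b^~ v).
Proof.
split=> [e e0|w]; last exact: cvs_cst.
by exists 0%N => *; rewrite subrr /p (si0r sb) sqrtr0.
Qed.

Let in_completion_cst v : in_completion (b^~ v).
Proof. by exists (fun=> v). Qed.

Let in_completion0 : in_completion (fun=> 0).
Proof.
exists (fun=> 0); have := represents_cst 0; congr (represents _ _).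
by apply/funext => w; rewrite (si0r sb).
Qed.

Let ext (f g : T) : (forall w, sval f w = sval g w) -> f = g.
Proof.
case: f g => f pf [g pg] /= h; have e : f = g by apply/funext.
by case: _ / e pg => pg; congr (exist _ _ _); exact: Prop_irrelevance.
Qed.

Let zero : T := exist _ _ in_completion0.
Let comb (c : R[i]) (f g : T) : T := exist _ _ (in_completionZ c (svalP f) (svalP g)).
Let add (f g : T) := comb 1 f g.
Let opp (f : T) := comb (-1) f zero.
Let scale c (f : T) := comb c f zero.

Let addA : associative add.
Proof. by move=> f g h; apply: ext => w /=; ring. Qed.
Let addC : commutative add.
Proof. by move=> f g; apply: ext => w /=; ring. Qed.
Let add0 : left_id zero add.
Proof. by move=> f; apply: ext => w /=; ring. Qed.
Let addN : left_inverse zero opp add.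
Proof. by move=> f; apply: ext => w /=; ring. Qed.

HB.instance Definition _ := GRing.isZmodule.Build T addA addC add0 addN.

Let scaleA a c (f : T) : scale a (scale c f) = scale (a * c) f.
Proof. by apply: ext => w /=; ring. Qed.
Let scale1 : left_id 1 scale.
Proof. by move=> f; apply: ext => w /=; ring. Qed.
Let scaleDr : right_distributive scale +%R.
Proof. by move=> c f g; apply: ext => w /=; ring. Qed.
Let scaleDl (f : T) : {morph scale^~ f : a c / a + c}.
Proof. by move=> a c; apply: ext => w /=; ring. Qed.

HB.instance Definition _ := GRing.Zmodule_isLmodule.Build R[i] T scaleA scale1 scaleDr scaleDl.

Let combE c (f g : T) w : sval (c *: f + g) w = c * sval f w + sval g w.
Proof. by rewrite /=; ring. Qed.

Let ip_ex (f g : T) : exists l, forall s t, represents s (sval f) ->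
  represents t (sval g) -> cvs (fun n => b (s n) (t n)) l.
Proof.
have [s rs] := svalP f; have [t rt] := svalP g.
have [l sl] := cauchys_complex (pairing_cauchy rs.1 rt.1).
by exists l => s' t' rs' rt'; exact: pairing_uniq rs rt rs' rt' sl.
Qed.

Let ip f g : R[i] := sval (cid (ip_ex f g)).

Let ipP (f g : T) s t : represents s (sval f) -> represents t (sval g) ->
  cvs (fun n => b (s n) (t n)) (ip f g).
Proof. by move=> rs rt; exact: (svalP (cid (ip_ex f g))). Qed.

Let representsZ c (f g : T) s t : represents s (sval f) -> represents t (sval g) ->
  represents (fun n => c *: s n + t n) (sval (c *: f + g)).
Proof.
move=> [cs1 sf] [ct tg]; split; first exact: bcauZ.
move=> w; rewrite combE; have := cvsD (cvsZ c (sf w)) (tg w).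
by congr (cvs _ _); apply/funext => n; rewrite (siDr sb) (siZr sb).
Qed.

Let ip_scalar f : scalar (ip f).
Proof.
move=> c g h; have [s rs] := svalP f; have [t rt] := svalP g; have [u ru] := svalP h.
apply: cvs_uniq (ipP rs (representsZ c rt ru)) _.
have := cvsD (cvsZ c (ipP rs rt)) (ipP rs ru).
by congr (cvs _ _); apply/funext => n; rewrite (siDr sb) (siZr sb).
Qed.

Let ip_conj f g : ip g f = conjc (ip f g).
Proof.
have [s rs] := svalP f; have [t rt] := svalP g.
apply: cvs_uniq (ipP rt rs) _; have := cvs_conj (ipP rs rt).
by congr (cvs _ _); apply/funext => n; rewrite -(si_conj sb).
Qed.

Let ip_ge0 f : 0 <= ip f f.
Proof.
have [s rs] := svalP f; apply: cvs_ge0 (ipP rs rs) _ => n.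
exact: (si_ge0 sb).
Qed.

Let ip_semi : semi_inner ip.
Proof. by split=> //; exact: ip_ge0. Qed.

Definition to_completion v : T := exist _ _ (in_completion_cst v).

Let ip_cst (f : T) v : ip (to_completion v) f = sval f v.
Proof.
have [s rs] := svalP f; apply: cvs_uniq (@ipP (to_completion v) f _ _ (represents_cst v) rs) _.
exact: rs.2.
Qed.

Let pp f := Num.sqrt (complex.Re (ip f f)).

Let ppE f : pp f ^+ 2 = complex.Re (ip f f).
Proof. by rewrite sqr_sqrtr // (si_Re_ge0 ip_semi). Qed.

Let csT f g : nrm (ip f g) <= pp f * pp g.
Proof.
rewrite -(ler_pXn2r (n := 2)) ?nnegrE ?nrm_ge0 ?mulr_ge0 ?sqrtr_ge0 //.
by rewrite exprMn !ppE; exact: (cauchy_schwarz ip_semi).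
Qed.

Let norm f : R[i] := (pp f)%:C.

Let norm_tri f g : norm (f + g) <= norm f + norm g.
Proof.
rewrite -rmorphD lecR -(ler_pXn2r (n := 2)) ?nnegrE ?addr_ge0 ?sqrtr_ge0 //.
rewrite ppE sqrrD (siDl ip_semi) !(siDr ip_semi) !ReD !ppE (si_conj ip_semi f g).
have -> : complex.Re (conjc (ip f g)) = complex.Re (ip f g) by case: (ip f g).
by have := csT f g; have := Re_le (ip f g); rewrite mulr2n; lra.
Qed.

Let normZ (l : R[i]) f : norm (l *: f) = `|l| * norm f.
Proof.
rewrite nrmE -rmorphM /norm /pp (siZl ip_semi) (siZr ip_semi) mulrA -nrm_sqr Re_realM.
by rewrite sqrtrM ?exprn_ge0 ?nrm_ge0 // sqrtr_sqr ger0_norm ?nrm_ge0.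
Qed.

Let norm_eq0 f : norm f = 0 -> f = 0.
Proof.
move=> [f0]; apply: ext => w /=; apply: nrm_eq0; apply/le_anti.
rewrite nrm_ge0 andbT -ip_cst.
by apply: le_trans (csT _ _) _; rewrite f0 mulr0.
Qed.

HB.instance Definition _ := Lmodule_isNormed.Build R[i] T norm_tri normZ norm_eq0.

Let nrm_pp (f : T) : nrm f = pp f. Proof. by []. Qed.

Let to_completion_approx (f : T) (e : R) : 0 < e -> exists v, nrm (f - to_completion v) < e.
Proof.
move=> e0; have [s rs] := svalP f.
have e2 : 0 < e / 2 by rewrite divr_gt0.
have [N HN] := rs.1 _ e2; exists (s N).
suff : nrm (f - to_completion (s N)) <= e / 2 by move=> h; apply: le_lt_trans h _; lra.
have r1 : represents (fun n => (-1) *: s N + s n) (sval (f - to_completion (s N))).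
  have := representsZ (-1) (represents_cst (s N) : represents _ (sval (to_completion (s N)))) rs.
  by congr (represents _ (sval _)); rewrite scaleN1r addrC.
rewrite nrm_pp -(ler_pXn2r (n := 2)) ?nnegrE ?sqrtr_ge0 ?(ltW e2) // ppE.
have h := ipP r1 r1.
apply: (@le_eps _ _ _ 1) => d /h[N' HN']; rewrite mul1r.
have := HN' (maxn N N') (leq_maxr _ _).
set z := b _ _ => hz.
have : complex.Re z <= (e / 2) ^+ 2.
  rewrite /z -pE ler_pXn2r ?nnegrE ?(ltW e2) // scaleN1r addrC.
  by apply: ltW; apply: HN; rewrite ?leq_maxl.
by have := Re_le (ip (f - to_completion (s N)) (f - to_completion (s N)) - z); rewrite ReB; lra.
Qed.

Let to_completion_ip v w : ip (to_completion v) (to_completion w) = b v w.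
Proof. by rewrite ip_cst. Qed.

Let to_completionZ c v w : to_completion (c *: v + w) = c *: to_completion v + to_completion w.
Proof. by apply: ext => u; rewrite combE /= (siDr sb) (siZr sb). Qed.

Let to_completion_nrm v : nrm (to_completion v) = p v.
Proof. by rewrite nrm_pp /pp to_completion_ip. Qed.

Let complete_seq (u : nat -> T) : cauchys u -> exists l, cvs u l.
Proof.
move=> cu.
have /choice[v Hv] n : exists v, nrm (u n - to_completion v) < n.+1%:R^-1.
  by apply: to_completion_approx; rewrite invr_gt0.
have toB x y : to_completion x - to_completion y = to_completion (x - y).
  have := to_completionZ (-1) y x; rewrite !scaleN1r ![- _ + _]addrC => ->.
  by [].
have cv : bcau v.
  move=> e e0; have e3 : 0 < e / 3 by rewrite divr_gt0.
  have [N HN] := invn_small e3; have [N' HN'] := cu _ e3.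
  exists (maxn N N') => m n; rewrite !geq_max => /andP[m1 m2] /andP[n1 n2].
  rewrite -to_completion_nrm -toB.
  have := HN _ m1; have := HN _ n1; have := HN' _ _ m2 n2; have := Hv m; have := Hv n.
  have := nrm_tri (u m) (to_completion (v m)) (to_completion (v n)).
  have := nrm_tri (u n) (u m) (to_completion (v n)).
  rewrite [nrm (to_completion _ - u _)]nrmBC.
  by move: (m.+1%:R^-1) (n.+1%:R^-1) => *; lra.
have lim w : exists l, cvs (fun n => b w (v n)) l.
  apply: cauchys_complex => e e0.
  have d0 : 0 < e / (p w + 1) by rewrite divr_gt0 // ltr_wpDl.
  have [N HN] := cv _ d0; exists N => m n Nm Nn; rewrite -(siBr sb).
  apply: le_lt_trans (cs _ _) _; have := HN _ _ Nm Nn.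
  rewrite ltr_pdivlMr ?ltr_wpDl //; have := p0 w; have := p0 (v m - v n).
  by move: (p w) (p _) => *; nra.
have [f Hf] := choice lim.
have rf : represents v f by [].
have inf : in_completion f by exists v.
pose l : T := exist _ _ inf.
have rl : represents v (sval l) by [].
exists l => e e0; have e2 : 0 < e / 2 by rewrite divr_gt0.
have [N HN] := invn_small e2; have e4 : 0 < e / 4%:R by rewrite divr_gt0.
have [N' HN'] := cv _ e4.
exists (maxn N N') => n; rewrite geq_max => /andP[n1 n2].
have h1 : nrm (l - to_completion (v n)) <= e / 4%:R.
  have r1 : represents (fun m => (-1) *: v n + v m) (sval (l - to_completion (v n))).
    have := representsZ (-1) (represents_cst (v n) : represents _ (sval (to_completion (v n)))) rl.
    by congr (represents _ (sval _)); rewrite scaleN1r addrC.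
  rewrite nrm_pp -(ler_pXn2r (n := 2)) ?nnegrE ?sqrtr_ge0 ?(ltW e4) // ppE.
  have h := ipP r1 r1.
  apply: (@le_eps _ _ _ 1) => d /h[M HM]; rewrite mul1r.
  have := HM (maxn N' M) (leq_maxr _ _).
  set z := b _ _ => hz.
  have : complex.Re z <= (e / 4%:R) ^+ 2.
    rewrite /z -pE ler_pXn2r ?nnegrE ?(ltW e4) // scaleN1r addrC.
    by apply: ltW; apply: HN'; rewrite ?leq_maxl.
  by have := Re_le (ip (l - to_completion (v n)) (l - to_completion (v n)) - z); rewrite ReB; lra.
have := HN _ n1; have := Hv n; have := nrm_tri (to_completion (v n)) l (u n).
by rewrite [nrm (to_completion _ - u _)]nrmBC; move: (n.+1%:R^-1) => *; lra.
Qed.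

HB.instance Definition _ := Uniform_isComplete.Build T (seq_complete complete_seq).

Let ip_norm (f : T) : ip f f = `|f| ^+ 2.
Proof. by rewrite nrmE nrm_pp -rmorphXn /= ppE (si_real ip_semi). Qed.

HB.instance Definition _ := isHilbertSpace.Build R T ip_scalar ip_conj ip_norm.

Lemma completion_exists : exists (H : hilbertSpace R) (j : V -> H),
  [/\ linear j, forall v w, inner (j v) (j w) = b v w
    & forall x (e : R), 0 < e -> exists v, nrm (x - j v) < e].
Proof.
exists (completion : hilbertSpace R), to_completion; split.
- exact: to_completionZ.
- exact: to_completion_ip.
- exact: to_completion_approx.
Qed.

End Completion.

(** * Hilbert spaces *)

Section HilbertSpaces.
Variable R : realType.

Lemma inner_si (H : hilbertSpace R) : semi_inner (@inner R H).
Proof.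
split=> [x|x y|x]; [exact: inner_linear | exact: inner_conj |].
by rewrite inner_norm exprn_ge0.
Qed.

Section Inner.
Variable H : hilbertSpace R.
Implicit Types x y z : H.

Lemma ipDr x y z : inner x (y + z) = inner x y + inner x z.
Proof. exact: (siDr (inner_si H)). Qed.
Lemma ipDl x y z : inner (x + y) z = inner x z + inner y z.
Proof. exact: (siDl (inner_si H)). Qed.
Lemma ipZr c x y : inner x (c *: y) = c * inner x y.
Proof. exact: (siZr (inner_si H)). Qed.
Lemma ipZl c x y : inner (c *: x) y = conjc c * inner x y.
Proof. exact: (siZl (inner_si H)). Qed.
Lemma ipNr x y : inner x (- y) = - inner x y.
Proof. exact: (siNr (inner_si H)). Qed.
Lemma ipNl x y : inner (- x) y = - inner x y.
Proof. exact: (siNl (inner_si H)). Qed.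
Lemma ip0r x : inner x 0 = 0. Proof. exact: (si0r (inner_si H)). Qed.
Lemma ip0l x : inner 0 x = 0. Proof. exact: (si0l (inner_si H)). Qed.
Lemma ipBr x y z : inner x (y - z) = inner x y - inner x z.
Proof. exact: (siBr (inner_si H)). Qed.
Lemma ipBl x y z : inner (x - y) z = inner x z - inner y z.
Proof. exact: (siBl (inner_si H)). Qed.

Lemma ip_nrm x : inner x x = (nrm x ^+ 2)%:C.
Proof. by rewrite inner_norm nrmE -rmorphXn. Qed.

Lemma nrm_ip x : nrm x ^+ 2 = complex.Re (inner x x).
Proof. by rewrite ip_nrm. Qed.

Lemma ip_le x y : nrm (inner x y) <= nrm x * nrm y.
Proof.
rewrite -(ler_pXn2r (n := 2)) ?nnegrE ?nrm_ge0 ?mulr_ge0 ?nrm_ge0 //.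
by rewrite exprMn !nrm_ip; exact: (cauchy_schwarz (inner_si H)).
Qed.

Lemma ip_eq0 x : inner x x = 0 -> x = 0.
Proof. by rewrite ip_nrm => -[/eqP]; rewrite sqrf_eq0 => /eqP/nrm_eq0. Qed.

Lemma Re_ipC x y : complex.Re (inner y x) = complex.Re (inner x y).
Proof. by rewrite (inner_conj x y); case: (inner x y). Qed.

Lemma nrmD_sqr x y :
  nrm (x + y) ^+ 2 = nrm x ^+ 2 + complex.Re (inner x y) *+ 2 + nrm y ^+ 2.
Proof.
rewrite nrm_ip ipDl !ipDr !ReD -!nrm_ip (Re_ipC x y) mulr2n.
by rewrite !addrA.
Qed.

Lemma nrmB_sqr x y :
  nrm (x - y) ^+ 2 = nrm x ^+ 2 - complex.Re (inner x y) *+ 2 + nrm y ^+ 2.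
Proof. by rewrite nrmD_sqr ipNr ReN nrmN mulNrn. Qed.

End Inner.

Lemma lip_adh0 (V : normedModType R[i]) (W : normedZmodType R[i]) (f : V -> W) (M : R)
    (D : set V) x : (forall u v, nrm (f u - f v) <= M * nrm (u - v)) ->
  (forall u, D u -> f u = 0) -> adh D x -> f x = 0.
Proof.
move=> fM f0 ax; apply: nrm_eq0; apply/le_anti; rewrite nrm_ge0 andbT.
apply: (@le_eps _ _ _ `|M|) => e /ax[y Dy xy]; rewrite add0r.
have := fM x y; rewrite (f0 _ Dy) subr0 => h; apply: le_trans h _.
apply: le_trans (ler_wpM2r (nrm_ge0 _) (ler_norm M)) _.
by rewrite ler_wpM2l // ltW.
Qed.

Lemma linear_eq_dense (V W : normedModType R[i]) (f g : V -> W) (M N : R) (D : set V) :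
  linear f -> linear g -> (forall x, nrm (f x) <= M * nrm x) ->
  (forall x, nrm (g x) <= N * nrm x) -> (forall x, D x -> f x = g x) ->
  forall x, adh D x -> f x = g x.
Proof.
move=> lf lg bf bg fg x ax; apply/eqP; rewrite -subr_eq0; apply/eqP.
apply: (@lip_adh0 _ _ (fun x => f x - g x) (M + N) D) ax => [u v|u Du].
  have -> : f u - g u - (f v - g v) = f (u - v) - g (u - v).
    by rewrite (linB lf) (linB lg); lmod.
  by apply: le_trans (nrmB _ _) _; rewrite mulrDl lerD.
by rewrite fg // subrr.
Qed.

Lemma ip_dense (H : hilbertSpace R) (D : set H) z : (forall x, adh D x) ->
  (forall y, D y -> inner y z = 0) -> z = 0.
Proof.
move=> dense D0; apply: ip_eq0.
apply: (@lip_adh0 _ _ (fun y => inner y z) (nrm z) D) (dense z) => // u v.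
by rewrite -ipBl mulrC ip_le.
Qed.

Section Orthogonal.
Variables (H : hilbertSpace R) (z : H).

End Orthogonal.

Lemma projection (H : hilbertSpace R) (L : set H) : is_subspace L -> closed L ->
  exists P : H -> H, [/\ linear P, forall x, L (P x), forall x, L x -> P x = x,
    forall x y, inner (P x) y = inner x (P y) & forall x, nrm (P x) <= nrm x].
Proof.
move=> sL /closedP cL.
have near x : exists y, L y /\ forall z, L z -> inner z (x - y) = 0.
  pose E := [set nrm (x - y) ^+ 2 | y in L].
  have lbE : lbound E 0 by move=> _ [y _ <-]; rewrite exprn_ge0 ?nrm_ge0.
  have iE : has_inf E.
    by split; [exists (nrm (x - 0) ^+ 2); exists 0 => //; exact: sL.1 | exists 0].
  pose d := inf E.
  have dle y : L y -> d <= nrm (x - y) ^+ 2.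
    by move=> Ly; apply: ge_inf; [exists 0 | exists y].
  have /choice[u Hu] n : exists y, L y /\ nrm (x - y) ^+ 2 < d + n.+1%:R^-1.
    have [|_ [y Ly <-] h] := @inf_adherent R E n.+1%:R^-1 _ iE; last by exists y.
    by rewrite invr_gt0.
  have cu : cauchys u.
    move=> e e0; have d0 : 0 < e ^+ 2 / 4%:R by rewrite divr_gt0 // exprn_gt0.
    have [N HN] := invn_small d0; exists N => m n /HN hm /HN hn.
    rewrite -(ltr_pXn2r (n := 2)) ?nnegrE ?nrm_ge0 ?(ltW e0) //.
    have [Lm um] := Hu m; have [Ln un] := Hu n.
    (* The midpoint of [u m] and [u n] lies in [L]; by the parallelogram law, [|u m - u n|^2] is
       below [2 / (m + 1) + 2 / (n + 1)]. *)
    have := dle _ (subspaceZ 2^-1 sL (subspaceD sL Lm Ln)).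
    have -> : x - 2^-1 *: (u m + u n) = 2^-1 *: ((x - u m) + (x - u n)) by lmod.
    rewrite nrmZ nrm_half exprMn.
    have -> : u m - u n = (x - u n) - (x - u m) by lmod.
    rewrite nrmB_sqr nrmD_sqr Re_ipC !(mulr2n (complex.Re _)).
    move: um un hm hn; move: (m.+1%:R^-1) (n.+1%:R^-1) (complex.Re _) (nrm (x - u m) ^+ 2) (nrm (x - u n) ^+ 2) => *.
    by lra.
  have [y Hy] := cauchys_cvs cu.
  have Ly : L y by apply: cL; apply: cvs_adh Hy _ => n; case: (Hu n).
  have yd : nrm (x - y) ^+ 2 <= d.
    apply: (@le_eps _ _ _ (2 * nrm (x - y) + 4%:R)) => e e0.
    pose e1 := Num.min e 1.
    have e10 : 0 < e1 by rewrite lt_min e0 ltr01.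
    have [N HN] := Hy _ e10; have [N' HN'] := invn_small e10.
    have := HN _ (leq_maxl N N'); have := HN' _ (leq_maxr N N').
    have [_] := Hu (maxn N N'); have := nrm_tri (u (maxn N N')) x y.
    have := nrm_tri y x (u (maxn N N')); rewrite [nrm (u _ - y)]nrmBC.
    have e1e : e1 <= e by rewrite ge_min lexx.
    have e11 : e1 <= 1 by rewrite ge_min lexx orbT.
    have := nrm_ge0 (x - y); have := nrm_ge0 (x - u (maxn N N')).
    have := nrm_ge0 (y - u (maxn N N')).
    move: (nrm (x - y)) (nrm (x - u _)) (nrm (y - u _)) ((maxn N N').+1%:R^-1) => a c f g *.
    have : a ^+ 2 <= (c + f) ^+ 2 by rewrite ler_pXn2r ?nnegrE //; lra.
    rewrite sqrrD mulr2n; nra.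
  exists y; split=> // z Lz.
  apply/eqP/negPn/negP => nz.
  (* Moving [y] by [t b z] changes the squared distance by [- 2 t |b|^2 + t^2 |b|^2 |z|^2], which is
     negative since [t |z|^2 < 1]. *)
  pose b := inner z (x - y); pose t := (nrm z ^+ 2 + 1)^-1.
  have t0 : 0 < t by rewrite invr_gt0 ltr_wpDl // exprn_ge0 // nrm_ge0.
  have := dle _ (subspaceD sL Ly (subspaceZ (t%:C * b) sL Lz)).
  rewrite opprD addrA nrmB_sqr ipZr nrmZ nrmM nrmC exprMn.
  have -> : t%:C * b * inner (x - y) z = (t * nrm b ^+ 2)%:C.
    by rewrite (inner_conj z) -mulrA -/b [b * _]mulrC -nrm_sqr -rmorphM.
  rewrite /= (gtr0_norm t0) exprMn.
  have b0 : 0 < nrm b ^+ 2.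
    by rewrite exprn_gt0 // lt_neqAle nrm_ge0 andbT eq_sym; apply: contra nz => /eqP/nrm_eq0/eqP.
  have tz : t * nrm z ^+ 2 < 1.
    by rewrite mulrC ltr_pdivrMr ?mul1r ?ltrDl ?ltr_wpDl ?exprn_ge0 ?nrm_ge0.
  move: (nrm z ^+ 2) (nrm b ^+ 2) tz b0 => n c tn c0 h.
  have : t ^+ 2 * c * n < t * c.
    have -> : t ^+ 2 * c * n = (t * c) * (t * n) by ring.
    by rewrite gtr_pMr // mulr_gt0.
  have tc : 0 < t * c by rewrite mulr_gt0.
  by rewrite mulr2n in h; lra.
have [P HP] := choice near.
have uniq x y : L y -> (forall z, L z -> inner z (x - y) = 0) -> y = P x.
  move=> Ly oy; have [LP oP] := HP x; apply/eqP; rewrite -subr_eq0; apply/eqP/ip_eq0.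
  have Ld : L (y - P x) by apply: subspaceB.
  have := oP _ Ld; have := oy _ Ld.
  have -> : x - P x = (x - y) + (y - P x) by lmod.
  by move=> h; rewrite (ipDr _ (x - y)) h add0r.
have adj x y : inner (P x) y = inner (P x) (P y).
  have [LP _] := HP x; have [_ oP] := HP y.
  by apply/eqP; rewrite -subr_eq0 -ipBr oP.
exists P; split.
- move=> c x y; have [Lx ox] := HP x; have [Ly oy] := HP y.
  apply: esym; apply: uniq; first exact: sL.2.
  move=> z Lz; have -> : c *: x + y - (c *: P x + P y) = c *: (x - P x) + (y - P y) by lmod.
  by rewrite ipDr ipZr ox // oy // mulr0 addr0.
- by move=> x; case: (HP x).
- by move=> x Lx; apply: esym; apply: uniq => // z _; rewrite subrr ip0r.
- by move=> x y; rewrite adj (inner_conj (P y) x) [inner (P y) x]adj -inner_conj.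
- move=> x; have := ip_le (P x) x; rewrite adj ip_nrm nrmC ger0_norm ?exprn_ge0 ?nrm_ge0 //.
  have [->|n0] := eqVneq (nrm (P x)) 0; first by rewrite nrm_ge0.
  have np : 0 < nrm (P x) by rewrite lt_neqAle eq_sym n0 nrm_ge0.
  by rewrite expr2 ler_pM2l.
Qed.

Lemma riesz (H : hilbertSpace R) (f : H -> R[i]) (M : R) : scalar f ->
  (forall x, nrm (f x) <= M * nrm x) -> exists y, forall x, f x = inner y x.
Proof.
move=> lf bf.
pose L := [set x | f x = 0].
have sL : is_subspace L.
  by split=> [|c x y /= x0 y0]; rewrite /L /= ?(scl0 lf) // lf x0 y0 mulr0 addr0.
have cL : closed L.
  apply/closedP => x; apply: (@lip_adh0 _ _ f M) => // u v.
  by rewrite -(sclB lf).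
have [P [lP LP PL aP _]] := projection sL cL.
have [f0|/existsNP[x0 fx0]] := pselect (forall x, f x = 0).
  by exists 0 => x; rewrite f0 ip0l.
pose n := x0 - P x0.
have fn : f n = f x0 by rewrite (sclB lf) (LP x0 : f _ = 0) subr0.
have on z : L z -> inner n z = 0.
  by move=> Lz; rewrite ipBl aP (PL z Lz) subrr.
have n0 : inner n n != 0.
  by apply/eqP => /ip_eq0 n0; apply: fx0; rewrite -fn n0 (scl0 lf).
exists (conjc (f n / inner n n) *: n) => x.
rewrite ipZl conjcK.
have : inner n (f n *: x - f x *: n) = 0.
  by apply: on; rewrite /L /= (sclB lf) !(sclZ lf) mulrC subrr.
by rewrite ipBr !ipZr => /eqP; rewrite subr_eq0 => /eqP e; rewrite mulrAC e mulfK.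
Qed.

(** Inner products are recovered from norms by polarisation. The clause on preimages holds because
    the inverse relation is isometric too and extends in the same way. *)
Lemma isometry_ext (H K : hilbertSpace R) (Rel : H -> K -> Prop) :
  (forall c x x' y y', Rel x y -> Rel x' y' -> Rel (c *: x + x') (c *: y + y')) ->
  (forall x y, Rel x y -> nrm y = nrm x) ->
  (forall x, adh [set u | exists v, Rel u v] x) ->
  exists S : H -> K, [/\ linear S, forall x y, inner (S x) (S y) = inner x y,
    forall x y, Rel x y -> S x = y,
    forall y, adh [set v | exists u, Rel u v] y -> exists x, S x = y
    & forall (L : set K), closed L -> (forall x y, Rel x y -> L y) -> forall x, L (S x)].
Proof.
move=> rZ rn dense.
have rM x y : Rel x y -> nrm y <= 1 * nrm x by move=> /rn ->; rewrite mul1r.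
have [S [lS Sc Sr]] := extend_dense rZ rM dense.
have Sn x : nrm (S x) = nrm x.
  apply/le_anti/andP; split.
    by have := rel_closureM rM (Sc x); rewrite normr1 mul1r.
  apply: (@le_eps _ _ _ 2) => e /(Sc x)[x' [y' [r xx yy]]].
  have := rn _ _ r; have := nrmD (x - x') x'; rewrite subrK.
  by have := nrmB (S x) (S x - y'); rewrite subKr; lra.
have Sre x y : complex.Re (inner (S x) (S y)) = complex.Re (inner x y).
  have := Sn (x + y); rewrite (linD lS) => h.
  have := congr1 (fun t => t ^+ 2) h; rewrite !nrmD_sqr !Sn mulr2n.
  by rewrite mulr2n; lra.
exists S; split=> //.
- move=> x y; apply/eqP; rewrite eq_complex Sre eqxx /=; apply/eqP.
  have := Sre x ('i%C *: y); rewrite (linZ lS) !ipZr ![_ * inner _ _]mulrC !ReiNIm.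
  by move/oppr_inj.
- move=> y ay.
  have [||x cx] := @rel_closure_total R K H (fun v u => Rel u v) 1 _ _ y ay.
  + by move=> *; exact: rZ.
  + by move=> v u /rn ->; rewrite mul1r.
  exists x; apply: (rel_closure_uniq rZ rM (Sc x)) => e /cx[v [u [r h1 h2]]].
  by exists u, v.
- move=> L /closedP cL rL x; apply: cL => e /(Sc x)[x' [y' [r _ yy]]].
  by exists y' => //; exact: rL r.
Qed.

Lemma isometry_nrm (H K : hilbertSpace R) (S : H -> K) :
  (forall x y, inner (S x) (S y) = inner x y) -> forall x, nrm (S x) = nrm x.
Proof.
move=> iS x; apply/eqP; rewrite -(@eqrXn2 _ 2) ?nrm_ge0 // !nrm_ip iS.
by [].
Qed.

End HilbertSpaces.

(** * Schur's lemma and the GNS construction *)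

Section Schur.
Variables (R : realType) (K : hilbertSpace R).

(** Irreducibility on [V] is expressed inside the ambient space, so that [V] is not made a Hilbert
    space of its own. *)
Definition subspace_irreducible (I : Type) (tau : I -> K -> K) (V : set K) :=
  forall L : set K, is_subspace L -> closed L -> L `<=` V ->
    (forall i x, L x -> L (tau i x)) -> (forall x, L x -> x = 0) \/ V `<=` L.

Variables (I : Type) (tau : I -> K -> K) (V : set K) (X : K -> K) (M : R).
Hypotheses (ltau : forall i, linear (tau i))
  (btau : forall i, exists m, forall x, nrm (tau i x) <= m * nrm x)
  (sV : is_subspace V) (cV : closed V) (tV : forall i x, V x -> V (tau i x))
  (irr : subspace_irreducible tau V)
  (lX : linear X) (bX : forall x, nrm (X x) <= M * nrm x)
  (aX : forall x y, inner (X x) y = inner x (X y))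
  (Xtau : forall i x, X (tau i x) = tau i (X x)) (XV : forall x, V x -> V (X x)).

(* On [V], [|X - c|] commutes with [tau] and [(|Z| - Z) (|Z| + Z) = 0], where
   [Z] is a multiple of [X - c]. *)
Lemma schur_dichotomy (c : R) :
  (forall x, V x -> c * nrm x ^+ 2 <= complex.Re (inner x (X x))) \/
  (forall x, V x -> complex.Re (inner x (X x)) <= c * nrm x ^+ 2).
Proof.
pose N := `|M| + `|c| + 1.
have N0 : 0 < N by rewrite ltr_wpDl // addr_ge0.
pose Z x := N^-1%:C *: (X x - c%:C *: x).
have lZ : linear Z by move=> k x y; rewrite /Z lX; lmod.
have cZ x : nrm (Z x) <= nrm x.
  rewrite nrmZ nrmC gtr0_norm ?invr_gt0 // mulrC ler_pdivrMr // mulrC.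
  apply: le_trans (nrmB _ _) _; rewrite nrmZ nrmC.
  have := bX x; have := nrm_ge0 x; have := ler_norm M; rewrite /N.
  by move: (nrm _) (nrm x) `|M| `|c| => p q m n *; nra.
have aZ x y : inner (Z x) y = inner x (Z y).
  by rewrite ipZl ipZr conjc_real ipBl ipBr ipZl ipZr conjc_real aX.
have Ztau i x : Z (tau i x) = tau i (Z x).
  by rewrite /Z Xtau (linZ (ltau i)) (linB (ltau i)) (linZ (ltau i)).
have ZV x : V x -> V (Z x).
  by move=> Vx; apply: subspaceZ => //; apply: subspaceB => //; [exact: XV | exact: subspaceZ].
(* For [X' = 1 - Z^2] the operator [Y = 1 - sqrt (1 - X')] is [1 - |Z|]; thus [x - Y x] is [|Z| x]
   and [D] below is [|Z| - Z]. *)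
pose X' x := x - Z (Z x).
have lX' : linear X' by move=> k x y; rewrite /X' !lZ; lmod.
have cX' x : nrm (X' x) <= nrm x.
  rewrite -(ler_pXn2r (n := 2)) ?nnegrE ?nrm_ge0 // nrmB_sqr -aZ -nrm_ip.
  have : nrm (Z (Z x)) ^+ 2 <= nrm (Z x) ^+ 2 by rewrite ler_pXn2r ?nnegrE ?nrm_ge0.
  have := exprn_ge0 2 (nrm_ge0 (Z x)); rewrite mulr2n; lra.
have [Y [[lY cY YX] [comm adj sub]]] := square_root_op lX' cX'.
have aY x y : inner (Y x) y = inner x (Y y).
  apply: (adj _ (fun x y => inner x y)) => *; rewrite ?ipDl ?ipDr ?ip_le //.
  by rewrite ipNl ipNr !aZ.
have Ytau i x : Y (tau i x) = tau i (Y x).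
  have [m bm] := btau i; apply: esym; apply: (comm (tau i) m) => // y.
  by rewrite /X' (linB (ltau i)) !Ztau.
have YZ x : Z (Y x) = Y (Z x).
  by apply: (comm Z 1) => // y; rewrite ?mul1r // /X' (linB lZ).
have YV x : V x -> V (Y x).
  by apply: (sub V) => // y Vy; apply: subspaceB => //; exact/ZV/ZV.
have PP x : x - Y x - Y (x - Y x) = Z (Z x).
  have : Y x + Y x - Y (Y x) = x - Z (Z x) by rewrite YX.
  move=> h; have -> : Z (Z x) = x - (Y x + Y x - Y (Y x)) by rewrite h; lmod.
  by rewrite (linB lY); lmod.
have Ppos x : 0 <= complex.Re (inner x (x - Y x)).
  rewrite ipBr ReB -nrm_ip subr_ge0; apply: le_trans (Re_le _) _.
  by apply: le_trans (ip_le _ _) _; rewrite expr2 ler_wpM2l ?nrm_ge0.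
pose D x := (x - Y x) - Z x.
have lD : linear D by move=> k x y; rewrite /D lY lZ; lmod.
have bD x : nrm (D x) <= 3 * nrm x.
  have := nrmB (x - Y x) (Z x); have := nrmB x (Y x); have := cY x; have := cZ x; lra.
have reZ x : complex.Re (inner x (X x)) = N * complex.Re (inner x (Z x)) + c * nrm x ^+ 2.
  rewrite ipZr ipBr ipZr Re_realM mulrA mulfV ?gt_eqF // mul1r ReB ip_nrm Re_realM /=.
  by rewrite subrK.
(* The kernel of [D] in [V] is invariant and contains the image of [|Z| + Z]. If it is zero, then
   [Z = - |Z|] on [V]; if it is [V], then [Z = |Z|]. *)
have [||||L0|VL] := irr (L := [set x | V x /\ D x = 0]).
- split; first by split; [exact: sV.1 | exact: lin0].
  move=> k x y [Vx Dx] [Vy Dy]; split; first exact: sV.2.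
  by rewrite lD Dx Dy scaler0 addr0.
- apply/closedP => x ax; split.
    by move/closedP: cV; apply; apply: adh_mono ax => y [].
  apply: (@lip_adh0 _ _ _ D 3 _ x _ _ ax) => [u v|u []//].
  by rewrite -(linB lD).
- by move=> x [].
- move=> i x [Vx Dx]; split; first exact: tV.
  have -> : D (tau i x) = tau i (D x).
    by rewrite /D Ytau Ztau !(linB (ltau i)).
  by rewrite Dx (lin0 (ltau i)).
- right=> x Vx; have : (x - Y x) + Z x = 0.
    apply: L0; split.
      apply: subspaceD => //; last exact: ZV.
      by apply: subspaceB => //; exact: YV.
    have gen w : Z w = Z x - Y (Z x) -> D (w + Z x) = (w - Y w) - Z (Z x).
      by move=> h; rewrite /D (linD lY) (linD lZ) h; lmod.
    by rewrite gen ?PP ?subrr // (linB lZ) YZ.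
  move/eqP; rewrite addr_eq0 => /eqP e; rewrite reZ gerDr.
  have := Ppos x; rewrite e ipNr ReN oppr_ge0 => h.
  by rewrite pmulr_rle0.
- left=> x Vx; have [_ /eqP] := VL x Vx; rewrite subr_eq0 => /eqP e.
  by rewrite reZ -e lerDr mulr_ge0 // ltW.
Qed.

(** By the dichotomy, the supremum [l] of the lower bounds of the quadratic form of [X] is also an
    upper bound, so the form is [l |x|^2] on [V], and evaluating that of [X - l] at [x + W x] gives
    [W x = 0]. The case [V = 0] is set apart because every real number is then a lower bound. *)
Lemma schur : exists l : R, forall x, V x -> X x = l%:C *: x.
Proof.
have [V0|/existsNP[v /not_implyP[Vv v0]]] := pselect (forall x, V x -> x = 0).
  by exists 0 => x /V0 ->; rewrite (lin0 lX) scaler0.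
have vp : 0 < nrm v.
  rewrite lt_neqAle nrm_ge0 andbT eq_sym; apply/eqP => /nrm_eq0; exact: v0.
have Rb x : `|complex.Re (inner x (X x))| <= `|M| * nrm x ^+ 2.
  apply: le_trans (Re_le_nrm _) _; apply: le_trans (ip_le _ _) _.
  rewrite expr2 mulrCA ler_wpM2l ?nrm_ge0 //.
  apply: le_trans (bX x) _; rewrite ler_wpM2r ?nrm_ge0 //; exact: ler_norm.
pose E := [set c : R | forall x, V x -> c * nrm x ^+ 2 <= complex.Re (inner x (X x))].
have sE : has_sup E.
  split.
    exists (- `|M|) => x _; rewrite mulNr; have := Rb x.
    by have := ler_norm (- complex.Re (inner x (X x))); rewrite normrN; lra.
  exists `|M| => c /(_ v Vv) h; have v2 : 0 < nrm v ^+ 2 by rewrite exprn_gt0.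
  rewrite -(ler_pM2r v2); apply: le_trans h _.
  exact: le_trans (ler_norm _) (Rb v).
pose l := sup E; exists l.
have Rl x : V x -> complex.Re (inner x (X x)) = l * nrm x ^+ 2.
  move=> Vx; apply/le_anti/andP; split.
    apply: (@le_eps _ _ _ (nrm x ^+ 2)) => e e0.
    have [h|h] := schur_dichotomy (l + e).
      have : l + e <= l by apply: ub_le_sup => //; case: sE.
      by rewrite gerDl leNgt e0.
    by have := h x Vx; rewrite mulrDl [nrm x ^+ 2 * e]mulrC.
  apply: (@le_eps _ _ _ (nrm x ^+ 2)) => e e0.
  have [c Ec lc] := sup_adherent e0 sE.
  have := Ec x Vx; have := exprn_ge0 2 (nrm_ge0 x).
  move: lc; rewrite -/l; move: (nrm x ^+ 2) (complex.Re _) => *; nra.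
move=> x Vx; pose W y := X y - l%:C *: y.
have lW : linear W by move=> k y z; rewrite /W lX; lmod.
have aW y z : inner (W y) z = inner y (W z).
  by rewrite ipBl ipBr ipZl ipZr conjc_real aX.
have W0 y : V y -> complex.Re (inner y (W y)) = 0.
  by move=> Vy; rewrite ipBr ipZr ReB Rl // Re_realM -nrm_ip subrr.
have VW : V (W x) by apply: subspaceB => //; [exact: XV | exact: subspaceZ].
have WE : W x = X x - l%:C *: x by [].
clearbody W.
have := W0 (x + W x) (subspaceD sV Vx VW).
rewrite (linD lW) ipDl !ipDr !ReD (W0 x Vx) (W0 _ VW) -(aW x (W x)) -!nrm_ip add0r addr0 => h.
have : nrm (W x) ^+ 2 = 0 by lra.
move/eqP; rewrite sqrf_eq0 => /eqP/nrm_eq0/eqP.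
by rewrite WE subr_eq0 => /eqP.
Qed.

End Schur.

Section Representations.
Variables (R : realType) (A : cstarAlgebra R).

Lemma bounded_continuous (V W : normedModType R[i]) (f : V -> W) (M : R) :
  linear f -> (forall x, nrm (f x) <= M * nrm x) -> continuous f.
Proof.
move=> lf bf x; apply/cvgrPdist_lt => e e0.
have [r er] : exists r, e = r%:C by exists (complex.Re e); rewrite re_real // ltW.
rewrite er in e0 *; rewrite ltcR in e0.
have M1 : 0 < `|M| + 1 by rewrite ltr_wpDl.
have d0 : 0 < (r / (`|M| + 1))%:C by rewrite ltcR divr_gt0.
apply: filterS (nbhsx_ballx x _ d0) => y; rewrite -ball_normE /ball_ /= !nrmE !ltcR => xy.
rewrite -(linB lf); apply: le_lt_trans (bf _) _.
apply: (@le_lt_trans _ _ ((`|M| + 1) * nrm (x - y))).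
  by rewrite ler_wpM2r ?nrm_ge0 // (le_trans (ler_norm M)) // lerDl.
by rewrite mulrC -ltr_pdivlMr.
Qed.

Section OneRep.
Variables (H : hilbertSpace R) (rho : A -> H -> H).
Hypothesis rep : is_representation rho.

Lemma rep_lin a : linear (rho a). Proof. by case: rep => /(_ a)[]. Qed.
Lemma rep_linl x : linear (rho^~ x). Proof. by case: rep. Qed.
Lemma repM a b x : rho (a ** b) x = rho a (rho b x). Proof. by case: rep. Qed.
Lemma rep_adj a x y : inner (rho (star a) x) y = inner x (rho a y).
Proof. by case: rep. Qed.
Lemma rep_adj' a x y : inner (rho a x) y = inner x (rho (star a) y).
Proof. by rewrite -rep_adj starK. Qed.

Lemma rep_sqr a x : inner (rho a x) (rho a x) = inner x (rho (star a ** a) x).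
Proof. by rewrite rep_adj' repM. Qed.

(** For a self-adjoint contraction [k], the difference [k^2 - k^4] has the form [star y ** y], so
    [|rho (k^2) x| <= |rho k x|]; with Cauchy-Schwarz, [|rho k x|^2 = <x, rho (k^2) x> <= |x| |rho k
    x|]. *)
Lemma rep_contr a x : nrm (rho a x) <= nrm a * nrm x.
Proof.
have K k : star k = k -> nrm k <= 1 -> nrm (rho k x) <= nrm x.
  move=> sk k1.
  have lk : linear (cmul k) by exact: cmul_linearr.
  have ak := sa_lmul sk.
  have ck b : nrm (k ** b) <= nrm b by exact: nrm_cmull_le.
  have [S [lS aS _ SS _]] := complementary_op lk ak ck.
  have E : star (k ** k) ** (k ** k) + star (S k) ** S k = star k ** k.
    by rewrite ak aS SS -cmulDr addrC subrK.
  have h : nrm (rho k (rho k x)) <= nrm (rho k x).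
    rewrite -(ler_pXn2r (n := 2)) ?nnegrE ?nrm_ge0 // -repM !nrm_ip !rep_sqr -E.
    rewrite (linD (rep_linl x)) ipDr ReD lerDl -rep_sqr -nrm_ip.
    by rewrite exprn_ge0 ?nrm_ge0.
  have : nrm (rho k x) ^+ 2 <= nrm x * nrm (rho k x).
    rewrite nrm_ip rep_adj' sk; apply: le_trans (Re_le _) _.
    by apply: le_trans (ip_le _ _) _; rewrite ler_wpM2l ?nrm_ge0.
  have := nrm_ge0 (rho k x); have := nrm_ge0 x.
  by move: (nrm _) (nrm _) => p q *; nra.
have [a0|an0] := eqVneq (nrm a) 0.
  by rewrite (nrm_eq0 a0) (lin0 (rep_linl x)) !nrm0 mul0r.
have ap : 0 < nrm a by rewrite lt_neqAle eq_sym an0 nrm_ge0.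
pose d := (nrm a)^-1%:C *: a.
have d1 : nrm d <= 1 by rewrite nrmZ nrmC gtr0_norm ?invr_gt0 // mulVf.
have ad : a = (nrm a)%:C *: d by rewrite scalerA -rmorphM mulfV // scale1r.
rewrite {1}ad (linZ (rep_linl x)) nrmZ nrmC ger0_norm ?nrm_ge0 // ler_wpM2l ?nrm_ge0 //.
have sdd : star (star d ** d) = star d ** d by rewrite !cexp.
have := K _ sdd; rewrite nrm_cstar expr_le1 ?nrm_ge0 // => /(_ d1) h.
rewrite -(ler_pXn2r (n := 2)) ?nnegrE ?nrm_ge0 // nrm_ip rep_sqr.
apply: le_trans (Re_le _) _; apply: le_trans (ip_le _ _) _.
by rewrite expr2 ler_wpM2l ?nrm_ge0.
Qed.

Lemma rep_bounded a : exists m, forall x, nrm (rho a x) <= m * nrm x.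
Proof. by exists (nrm a); exact: rep_contr. Qed.

Lemma vector_positive x : positive_functional (fun a => inner x (rho a x)).
Proof.
split=> [c a b|a]; first by rewrite (rep_linl x) ipDr ipZr.
by rewrite -rep_sqr ip_nrm ler0c exprn_ge0 ?nrm_ge0.
Qed.

Lemma vector_nrm x a : nrm (inner x (rho a x)) <= nrm x ^+ 2 * nrm a.
Proof.
apply: le_trans (ip_le _ _) _; rewrite expr2 -mulrA ler_wpM2l ?nrm_ge0 //.
by rewrite mulrC rep_contr.
Qed.

End OneRep.

Lemma state_near_one (g : A -> R[i]) (e : R) : is_state g -> 0 < e ->
  exists u, nrm u <= 1 /\ 1 - e < complex.Re (g u).
Proof.
move=> sg e0; have [lg _] := state_positive sg.
have [a ha] : exists a, (1 - e) * nrm a < nrm (g a).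
  apply: contrapT => /forallNP h.
  have : 1 <= 1 - e by apply: (state_max sg) => a; rewrite leNgt; apply/negP/h.
  by move=> ?; lra.
have [a0|an0] := eqVneq (nrm a) 0.
  by move: ha; rewrite (nrm_eq0 a0) (scl0 lg) !nrm0 mulr0 ltxx.
have ap : 0 < nrm a by rewrite lt_neqAle eq_sym an0 nrm_ge0.
have [g0|gn0] := eqVneq (nrm (g a)) 0.
  have : 1 - e < 0 by rewrite -(pmulr_llt0 _ ap) -g0.
  by exists 0; rewrite nrm0 (scl0 lg) ler01.
have gp : 0 < nrm (g a) by rewrite lt_neqAle eq_sym gn0 nrm_ge0.
pose c := (nrm (g a) * nrm a)^-1%:C * conjc (g a).
exists (c *: a); split.
  rewrite nrmZ nrmM nrmC nrmJ gtr0_norm ?invr_gt0 ?mulr_gt0 //.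
  by rewrite -mulrA mulVf ?mulf_neq0.
rewrite (sclZ lg) -mulrA -nrm_sqr -rmorphM /=.
have -> : (nrm (g a) * nrm a)^-1 * nrm (g a) ^+ 2 = nrm (g a) / nrm a by field; apply/andP.
by rewrite ltr_pdivlMr.
Qed.

(** The form [b] is that of the extension of [g] to the unitization, which makes the cyclic vector
    the class of [(1, 0)]. The orbit of [A] is still dense, since contractions [u] with [g u] close
    to 1 approximate this vector. *)
Lemma gns (g : A -> R[i]) : is_state g ->
  exists (K : hilbertSpace R) (tau : A -> K -> K) (Om : K),
  [/\ is_representation tau, forall a, g a = inner Om (tau a Om), nrm Om = 1
    & forall x, adh [set tau a Om | a in setT] x].
Proof.
move=> sg; have pg := state_positive sg; have [lg p0] := pg.
have F := functional_form pg.
have cg := state_nrm sg; have gs := functional_star pg cg; have gcs := functional_cs pg cg.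
pose V := (R[i]^o * A)%type : lmodType R[i].
pose b (x y : V) : R[i] := conjc x.1 * y.1 + conjc x.1 * g y.2 + conjc (g x.2) * y.1
   + g (star x.2 ** y.2).
have sb : semi_inner b.
  split.
  - move=> x c y z; rewrite /b /= !cexp !lg /=.
    have -> : c *: y.1 = c * y.1 by [].
    by ring.
  - move=> x y; rewrite /b !conjcD !conjcM !conjcK -(si_conj F x.2 y.2) /=.
    by ring.
  - move=> x; rewrite /b.
    have q0 := p0 x.2; have := gcs x.2; rewrite -[g (star _ ** _)](re_real q0) /=.
    move: (complex.Re _) (g x.2) => q z hq.
    (* Completing the square; the remaining term [q - |z|^2] is nonnegative by [functional_cs]. *)
    have -> : conjc x.1 * x.1 + conjc x.1 * z + conjc z * x.1 + q%:C =
      conjc (x.1 + z) * (x.1 + z) + (q%:C - conjc z * z) by rewrite conjcD; ring.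
    rewrite -!nrm_sqr -rmorphB addr_ge0 // ler0c ?exprn_ge0 ?nrm_ge0 //.
    by rewrite subr_ge0.
have [K [j [lj ij dj]]] := completion_exists sb.
pose z (a : A) : V := (0, a); pose Om := j ((1, 0) : V).
have lz c x y : z (c *: x + y) = c *: z x + z y by rewrite /z; congr (_, _); rewrite /= ?scaler0 ?mulr0 addr0.
have c0 a : conjc (z a).1 = 0 by exact: conjc0.
have c1 : conjc ((1, 0) : V).1 = 1 by exact: conjc1.
have izz x y : inner (j (z x)) (j (z y)) = g (star x ** y).
  by rewrite ij /b c0 !mul0r mulr0 !add0r.
have iOz y : inner Om (j (z y)) = g y.
  by rewrite ij /b c1 !mul1r star0 cmul0l !(scl0 lg) mulr0 add0r !addr0.
have OO : inner Om Om = 1.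
  by rewrite ij /b c1 star0 cmul0l !(scl0 lg) conjc0 !mul1r mul0r !addr0.
have dO (e : R) : 0 < e -> exists u, nrm (Om - j (z u)) < e.
  move=> e0; have d0 : 0 < e ^+ 2 / 2 by rewrite divr_gt0 // exprn_gt0.
  have [u [u1 gu]] := state_near_one sg d0; exists u.
  rewrite -(ltr_pXn2r (n := 2)) ?nnegrE ?nrm_ge0 ?(ltW e0) // nrmB_sqr !nrm_ip OO iOz izz /=.
  have : complex.Re (g (star u ** u)) <= 1.
    apply: le_trans (Re_le _) _; apply: le_trans (cg _) _; rewrite nrm_cstar.
    by rewrite expr_le1 ?nrm_ge0.
  by rewrite mulr2n; lra.
have dz x : adh [set j (z a) | a in setT] x.
  move=> e e0; have e2 : 0 < e / 2 by rewrite divr_gt0.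
  have [[al a] h] := dj x _ e2.
  have al0 := nrm_ge0 al.
  have [|u hu] := dO (e / 2 / (nrm al + 1)); first by rewrite divr_gt0 // ltr_wpDl.
  exists (j (z (al *: u + a))); first by exists (al *: u + a).
  have -> : x - j (z (al *: u + a)) = (x - j ((al, a) : V)) + al *: (Om - j (z u)).
    have -> : ((al, a) : V) = al *: ((1, 0) : V) + z a.
      rewrite /z; congr (_, _); last by rewrite /= scaler0 add0r.
      by rewrite addr0; symmetry; exact: mulr1.
    rewrite lz !lj -/Om; lmod.
  apply: le_lt_trans (nrmD _ _) _; rewrite (splitr e) nrmZ ltrD //.
  exact: (mul_lt_div al0 (nrm_ge0 _) al0 (lexx _) hu).
pose Rel c (x y : K) := exists a, x = j (z a) /\ y = j (z (c ** a)).
have RZ c k x x' y y' : Rel c x y -> Rel c x' y' -> Rel c (k *: x + x') (k *: y + y').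
  move=> [a [-> ->]] [a' [-> ->]]; exists (k *: a + a').
  by rewrite !cexp !lz !lj.
have RM c x y : Rel c x y -> nrm y <= nrm c * nrm x.
  move=> [a [-> ->]]; rewrite -(ler_pXn2r (n := 2)) ?nnegrE ?mulr_ge0 ?nrm_ge0 //.
  by rewrite exprMn !nrm_ip !izz; exact: functional_conj_le.
have /choice[tau Htau] : forall c : A, exists T : K -> K,
  [/\ linear T, forall x, nrm (T x) <= nrm c * nrm x
    & forall a, T (j (z a)) = j (z (c ** a))].
  move=> c.
  have [|T [lT Tc TR]] := extend_dense (RZ c) (RM c).
    move=> x; apply: adh_mono (dz x) => _ [a _ <-]; exists (j (z (c ** a))).
    by exists a.
  exists T; split=> // [x|a]; last by apply: TR; exists a.
  by have := rel_closureM (RM c) (Tc x); rewrite ger0_norm ?nrm_ge0.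
have lt c : linear (tau c) by case: (Htau c).
have bt c x : nrm (tau c x) <= nrm c * nrm x by case: (Htau c).
have tz c a : tau c (j (z a)) = j (z (c ** a)) by case: (Htau c).
have adj0 a x c : inner (tau (star a) x) (j (z c)) = inner x (tau a (j (z c))).
  apply/eqP; rewrite -subr_eq0; apply/eqP.
  apply: (@lip_adh0 R K _ (fun x => inner (tau (star a) x) (j (z c)) - inner x (tau a (j (z c))))
    (nrm a * nrm (j (z c)) + nrm (tau a (j (z c)))) _ x _ _ (dz x)) => [u v|_ [d _ <-]].
    have -> : inner (tau (star a) u) (j (z c)) - inner u (tau a (j (z c))) -
      (inner (tau (star a) v) (j (z c)) - inner v (tau a (j (z c)))) =
      inner (tau (star a) (u - v)) (j (z c)) - inner (u - v) (tau a (j (z c))).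
      by rewrite (linB (lt _)) !ipBl; ring.
    apply: le_trans (nrmB _ _) _; rewrite mulrDl lerD //.
      apply: le_trans (ip_le _ _) _; rewrite mulrAC ler_wpM2r ?nrm_ge0 //.
      by apply: le_trans (bt _ _) _; rewrite nrm_star.
    by rewrite mulrC ip_le.
  by rewrite !tz !izz !cexp subrr.
have adj a x y : inner (tau (star a) x) y = inner x (tau a y).
  apply/eqP; rewrite -subr_eq0; apply/eqP.
  apply: (@lip_adh0 R K _ (fun y => inner (tau (star a) x) y - inner x (tau a y))
    (nrm (tau (star a) x) + nrm x * nrm a) _ y _ _ (dz y)) => [u v|_ [d _ <-]].
    have -> : inner (tau (star a) x) u - inner x (tau a u) -
      (inner (tau (star a) x) v - inner x (tau a v)) =
      inner (tau (star a) x) (u - v) - inner x (tau a (u - v)).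
      by rewrite (linB (lt _)) !ipBr; ring.
    apply: le_trans (nrmB _ _) _; rewrite mulrDl lerD ?ip_le //.
    by apply: le_trans (ip_le _ _) _; rewrite -mulrA ler_wpM2l ?nrm_ge0.
  by rewrite adj0 subrr.
have tO a : tau a Om = j (z a).
  apply/eqP; rewrite -subr_eq0; apply/eqP; apply: (ip_dense dz) => _ [c _ <-].
  rewrite ipBr izz -adj tz inner_conj iOz -gs !cexp.
  by rewrite subrr.
have nO : nrm Om = 1.
  by apply/eqP; rewrite -(@eqrXn2 _ 2) ?nrm_ge0 // nrm_ip OO expr1n.
exists K, tau, Om; split=> //.
- split.
  + move=> a; split=> //; exact: bounded_continuous (lt a) (bt a).
  + move=> x c a a'.
    apply: (@linear_eq_dense R K K (tau (c *: a + a')) (fun x => c *: tau a x + tau a' x)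
      (nrm (c *: a + a')) (nrm c * nrm a + nrm a') _ _ _ _ _ _ x (dz x)) => //.
    * by move=> k u v; rewrite !lt; lmod.
    * move=> u; apply: le_trans (nrmD _ _) _; rewrite mulrDl lerD // nrmZ -mulrA.
      by rewrite ler_wpM2l ?nrm_ge0.
    * by move=> _ [d _ <-]; rewrite !tz !cexp lz lj.
  + move=> a a' x.
    apply: (@linear_eq_dense R K K (tau (a ** a')) (fun x => tau a (tau a' x))
      (nrm (a ** a')) (nrm a * nrm a') _ _ _ _ _ _ x (dz x)) => //.
    * by move=> k u v; rewrite !lt.
    * move=> u; apply: le_trans (bt _ _) _; rewrite -mulrA ler_wpM2l ?nrm_ge0 //.
    * by move=> _ [d _ <-]; rewrite !tz !cexp.
  + by move=> a x y; rewrite adj.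
- by move=> a; rewrite tO iOz.
- by move=> x; apply: adh_mono (dz x) => _ [a _ <-]; exists a; rewrite // tO.
Qed.

End Representations.

(** * Irreducible representations and pure states *)

Section Irreducible.
Variables (R : realType) (A : cstarAlgebra R).

Lemma setT_ideal : is_ideal (@setT A).
Proof. by split=> //; split. Qed.

Section Orbit.
Variables (H : hilbertSpace R) (rho : A -> H -> H).
Hypothesis rep : is_representation rho.

Lemma orbit_subspace (J : set A) x : is_subspace J ->
  is_subspace [set rho a x | a in J].
Proof.
move=> sJ; split; first by exists 0; [exact: sJ.1 | rewrite (lin0 (rep_linl rep x))].
move=> c _ _ [a Ja <-] [b Jb <-]; exists (c *: a + b); first exact: sJ.2.
by rewrite (rep_linl rep x).
Qed.

Lemma cyclic_span x : (forall y, adh [set rho a x | a in setT] y) <->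
  closed_span [set rho a x | a in setT] = setT.
Proof.
have [sT' _ _ _] := setT_ideal; have sT := orbit_subspace x sT'; split=> h.
  apply/seteqP; split=> // y _; have /closedP := @closed_closed_span _ _ [set rho a x | a in setT].
  by apply; apply: adh_mono (h y); exact: sub_closed_span.
by move=> y; apply: closed_span_adh => //; rewrite h.
Qed.

(** The closure of [J x] is invariant. If it were zero, [x] would lie in the vectors killed by [J],
    again a closed invariant subspace, which is neither zero nor everything. *)
Lemma irr_ideal_cyclic (J : set A) x : is_irreducible rho -> is_ideal J ->
  (exists a y, J a /\ rho a y <> 0) -> x <> 0 ->
  forall y, adh [set rho a x | a in J] y.
Proof.
move=> [_ irr] [sJ cJ Jl Jr] [a0 [y0 [Ja0 ay0]]] x0 y.
pose L := adh [set rho a x | a in J].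
have iL a z : L z -> L (rho a z).
  apply: (adh_image (rep_lin rep a) (rep_contr rep a)) => _ [b Jb <-].
  by exists (a ** b); [exact: Jl | rewrite (repM rep)].
have [L0|LT] := irr L (subspace_adh (orbit_subspace x sJ)) (@adh_closed _ _ _) iL; last first.
  by rewrite -/(L y) LT.
pose Z := [set z | forall a, J a -> rho a z = 0].
have sZ : is_subspace Z.
  split=> [a _|c u v u0 v0 a Ja]; first by rewrite (lin0 (rep_lin rep a)).
  by rewrite (rep_lin rep a) u0 // v0 // scaler0 addr0.
have cZ : closed Z.
  apply/closedP => z az a Ja.
  apply: (@lip_adh0 _ _ _ (rho a) (nrm a) Z z) az => [u v|u]; last exact.
  by rewrite -(linB (rep_lin rep a)) rep_contr.
have iZ a z : Z z -> Z (rho a z).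
  by move=> Zz b Jb; rewrite -(repM rep) Zz //; exact: Jr.
have Zx : Z x.
  move=> a Ja; have : L (rho a x) by apply: adh_sub; exists a.
  by rewrite L0.
have [Z0|ZT] := irr Z sZ cZ iZ; first by move: Zx; rewrite Z0.
have Zy : Z y0 by rewrite ZT.
by case: ay0; exact: Zy.
Qed.

Lemma irr_cyclic x : is_irreducible rho -> x <> 0 ->
  forall y, adh [set rho a x | a in setT] y.
Proof.
move=> irr; apply: (irr_ideal_cyclic irr setT_ideal).
by have [[a [y ay]] _] := irr; exists a, y.
Qed.

Lemma nrm1_neq0 (x : H) : nrm x = 1 -> x <> 0.
Proof. by move=> x1 x0; move: x1; rewrite x0 nrm0 => /esym/eqP; rewrite oner_eq0. Qed.

Lemma cyclic_unit x (e : R) : (forall y, adh [set rho a x | a in setT] y) -> 0 < e ->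
  exists u, nrm u <= 1 /\ nrm (x - rho u x) < e.
Proof.
move=> cx e0; have e3 : 0 < e / 3 by rewrite divr_gt0.
have [_ [a _ <-] xa] := cx x _ e3.
have d0 : 0 < e / 3 / (nrm x + 1) by rewrite divr_gt0 // ltr_wpDl ?nrm_ge0.
have [u [c [su _ u1 _ au]]] := approx_right_unit (star a) d0.
have {}au : nrm (a - u ** a) < e / 3 / (nrm x + 1) by rewrite -nrm_star !cexp su.
exists u; split=> //.
have h1 : nrm (rho a x - rho (u ** a) x) < e / 3.
  rewrite -(linB (rep_linl rep x)); apply: le_lt_trans (rep_contr rep _ _) _.
  rewrite mulrC.
  exact: (mul_lt_div (nrm_ge0 x) (nrm_ge0 _) (nrm_ge0 x) (lexx _) au).
have h2 : nrm (rho (u ** a) x - rho u x) < e / 3.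
  rewrite (repM rep) -(linB (rep_lin rep u)); apply: le_lt_trans (rep_contr rep _ _) _.
  apply: le_lt_trans xa; rewrite nrmBC ler_piMl ?nrm_ge0 //.
have := nrm_tri (rho a x) x (rho u x); have := nrm_tri (rho (u ** a) x) (rho a x) (rho u x).
by move: xa h1 h2; lra.
Qed.

Lemma vector_state x : (forall y, adh [set rho a x | a in setT] y) -> nrm x = 1 ->
  is_state (fun a => inner x (rho a x)).
Proof.
move=> cx x1; apply: is_state_nrm; first exact: vector_positive.
  by move=> a; have := vector_nrm rep x a; rewrite x1 expr1n mul1r.
move=> M hM.
have key (e : R) : 0 < e -> exists u : A, nrm u <= 1 /\ 1 - e < M * nrm u.
  move=> e0; have [u [u1 xu]] := cyclic_unit cx e0; exists u; split=> //.
  have := hM u; have := ip_le x (x - rho u x); rewrite x1 mul1r ipBr ip_nrm x1 expr1n => h1 h2.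
  have := nrmD (1 - inner x (rho u x)) (inner x (rho u x)); rewrite subrK nrm1.
  by move: h1 h2 xu; lra.
have M0 : 0 <= M.
  rewrite leNgt; apply/negP => M0; have [u [_]] := key 1 ltr01; rewrite subrr.
  by rewrite ltNge mulr_le0_ge0 ?nrm_ge0 // ltW.
apply: (@le_eps _ _ _ 1) => e e0; rewrite mul1r.
have [u [u1 h]] := key e e0.
have : M * nrm u <= M by rewrite ler_piMr.
by move: h; lra.
Qed.

(* [g (a^* b) = <a x, T b x>] with a bounded operator [T] commuting with [rho],
   hence scalar. *)
Lemma irr_dominated x (g : A -> R[i]) (c : R) : is_irreducible rho -> nrm x = 1 ->
  is_state g ->
  (forall a, complex.Re (g (star a ** a)) <= c ^+ 2 * nrm (rho a x) ^+ 2) ->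
  forall a, g a = inner x (rho a x).
Proof.
move=> irr x1 sg dom.
have cx := irr_cyclic irr (nrm1_neq0 x1).
have [K [tau [Om [rept gE O1 cO]]]] := gns sg.
have pg := state_positive sg; have [lg p0] := pg.
pose Rel (u : H) (v : K) := exists a, u = rho a x /\ v = tau a Om.
have RZ k u u' v v' : Rel u v -> Rel u' v' -> Rel (k *: u + u') (k *: v + v').
  move=> [a [-> ->]] [b [-> ->]]; exists (k *: a + b).
  by rewrite (rep_linl rep) (rep_linl rept).
have RM u v : Rel u v -> nrm v <= `|c| * nrm u.
  move=> [a [-> ->]]; rewrite -(ler_pXn2r (n := 2)) ?nnegrE ?mulr_ge0 ?nrm_ge0 //.
  rewrite exprMn real_normK ?num_real // nrm_ip (rep_sqr rept) -gE; exact: dom.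
have [|S [lS Sc SR]] := extend_dense RZ RM.
  by move=> y; apply: adh_mono (cx y) => _ [a _ <-]; exists (tau a Om), a.
have bS y : nrm (S y) <= `|c| * nrm y.
  by have := rel_closureM RM (Sc y); rewrite normr_id.
have Sa a : S (rho a x) = tau a Om by apply: SR; exists a.
have Srho a y : S (rho a y) = tau a (S y).
  apply: (@linear_eq_dense R H K (fun y => S (rho a y)) (fun y => tau a (S y))
    (`|c| * nrm a) (nrm a * `|c|) _ _ _ _ _ _ y (cx y)).
  - by move=> k u v; rewrite (rep_lin rep) lS.
  - by move=> k u v; rewrite lS (rep_lin rept).
  - by move=> u; apply: le_trans (bS _) _; rewrite -mulrA ler_wpM2l ?rep_contr.
  - by move=> u; apply: le_trans (rep_contr rept _ _) _; rewrite -mulrA ler_wpM2l ?nrm_ge0.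
  - by move=> _ [b _ <-]; rewrite -(repM rep) !Sa (repM rept).
have /choice[T HT] y : exists t, forall z, inner (S y) (S z) = inner t z.
  apply: (@riesz _ _ _ (nrm (S y) * `|c|)) => [k u v|u]; first by rewrite lS ipDr ipZr.
  by apply: le_trans (ip_le _ _) _; rewrite -mulrA ler_wpM2l ?nrm_ge0.
have ext (u v : H) : (forall z, inner u z = inner v z) -> u = v.
  by move=> h; apply/eqP; rewrite -subr_eq0; apply/eqP/ip_eq0; rewrite ipBl h subrr.
have [l Hl] : exists l : R, forall y, setT y -> T y = l%:C *: y.
  apply: (@schur R H A rho setT T (`|c| ^+ 2)) => //.
  - exact: rep_lin.
  - by move=> a; exists (nrm a); exact: rep_contr.
  - move=> L sL cL _ iL; have [-> |->] := irr.2 L sL cL iL; [left=> y // | by right].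
  - move=> k u v; apply: ext => z; rewrite ipDl ipZl -!HT lS ipDl ipZl.
    by [].
  - move=> y; have [y0|yn0] := eqVneq (nrm (T y)) 0.
      by rewrite y0 mulr_ge0 ?nrm_ge0 // exprn_ge0.
    have yp : 0 < nrm (T y) by rewrite lt_neqAle eq_sym yn0 nrm_ge0.
    rewrite -(ler_pM2l yp) -expr2 nrm_ip -HT.
    apply: le_trans (Re_le _) _; apply: le_trans (ip_le _ _) _.
    have := bS y; have := bS (T y); have := nrm_ge0 (S y); have := nrm_ge0 (S (T y)).
    have := nrm_ge0 y; have := nrm_ge0 (T y); have := normr_ge0 c.
    move: (nrm (S y)) (nrm (S _)) (nrm y) (nrm _) `|c| => p q r s t *.
    have -> : s * (t ^+ 2 * r) = (t * r) * (t * s) by ring.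
    by rewrite ler_pM.
  - by move=> u v; rewrite -HT (inner_conj (T v) u) -HT -inner_conj.
  - move=> a y; apply: ext => z; rewrite -HT Srho (rep_adj' rept) -Srho HT.
    by rewrite (rep_adj' rep).
have fl a b : g (star a ** b) = l%:C * inner (rho a x) (rho b x).
  rewrite gE (repM rept) -(rep_adj' rept) -!Sa HT Hl // ipZl conjc_real.
  by [].
have gl a : g a = l%:C * inner x (rho a x).
  apply/eqP; rewrite -subr_eq0; apply/eqP/nrm_small => e e0.
  have d0 : 0 < e / (`|l| + 1 + 1) by rewrite divr_gt0 // ltr_wpDl ?addr_ge0.
  have [u [k [su _ u1 _ au]]] := approx_right_unit (star a) d0.
  have {}au : nrm (a - u ** a) < e / (`|l| + 1 + 1) by rewrite -nrm_star !cexp su.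
  have := fl u a; rewrite su (rep_adj' rep) su -(repM rep) => h.
  have -> : g a - l%:C * inner x (rho a x) =
      g (a - u ** a) - l%:C * inner x (rho (a - u ** a) x).
    by rewrite (sclB lg) (linB (rep_linl rep x)) ipBr h; ring.
  have l1 : 0 <= `|l| + 1 by rewrite addr_ge0.
  apply: le_lt_trans (mul_lt_div l1 (nrm_ge0 _) l1 (lexx _) au).
  apply: le_trans (nrmB _ _) _; rewrite nrmM nrmC mulrDl mul1r addrC lerD ?(state_nrm sg) //.
  by rewrite ler_wpM2l //; have := vector_nrm rep x (a - u ** a); rewrite x1 expr1n mul1r.
have sf := vector_state cx x1.
have l0 : 0 <= l.
  have [a ha] : exists a, rho a x != 0.
    have [u [_ xu]] := cyclic_unit cx ltr01; exists u; apply/eqP => u0.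
    by move: xu; rewrite u0 subr0 x1 ltxx.
  have := p0 a; rewrite fl ip_nrm -rmorphM ler0c pmulr_lge0 //.
  by rewrite exprn_gt0 // lt_neqAle nrm_ge0 andbT eq_sym; apply: contra ha => /eqP/nrm_eq0 ->.
(* Both functionals are states, hence of norm 1, and their ratio [l] must be 1. *)
have l1 : 1 <= l.
  apply: (state_max sg) => a; rewrite gl nrmM nrmC ger0_norm // ler_wpM2l //.
  exact: (state_nrm sf).
have l2 : 1 <= l^-1.
  apply: (state_max sf) => a.
  have lp : 0 < l by rewrite (lt_le_trans ltr01).
  rewrite mulrC ler_pdivlMr // mulrC.
  by have := state_nrm sg a; rewrite gl nrmM nrmC ger0_norm.
have le1 : l = 1.
  apply/le_anti; rewrite l1 andbT -[l]invrK invf_le1 //.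
  by rewrite (lt_le_trans ltr01).
by move=> a; rewrite gl le1 mul1r.
Qed.

(** A component [g] of weight [k] satisfies [k g <= f] on elements [star a ** a], so [irr_dominated]
    applies with [c^2 = 1 / k]. *)
Lemma irr_pure x : is_irreducible rho -> nrm x = 1 ->
  pure_states (fun a => inner x (rho a x)).
Proof.
move=> irr x1; have cx := irr_cyclic irr (nrm1_neq0 x1).
have sf := vector_state cx x1; split=> // g h k sg sh k0 k1 E.
have k10 : 0 < 1 - k by rewrite subr_gt0.
have fE a : nrm (rho a x) ^+ 2 = complex.Re (inner x (rho (star a ** a) x)).
  by rewrite nrm_ip (rep_sqr rep).
have ge0 g' a : is_state g' -> 0 <= complex.Re (g' (star a ** a)).
  by move=> /state_positive[_ /(_ a)]; rewrite lecE => /andP[].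
have dom g' h' (t : R) : is_state g' -> is_state h' -> 0 < t -> 0 < 1 - t ->
  (forall a, inner x (rho a x) = t%:C * g' a + (1 - t)%:C * h' a) ->
  forall a, g' a = inner x (rho a x).
  move=> sg' sh' t0 t1 E'; apply: (@irr_dominated _ _ (Num.sqrt t^-1)) => // a.
  rewrite sqr_sqrtr ?invr_ge0 ?(ltW t0) // fE E' ReD !Re_realM.
  rewrite mulrDr mulKf ?gt_eqF // lerDl !mulr_ge0 ?invr_ge0 ?(ltW t0) ?(ltW t1) //.
  exact: ge0.
split; apply/funext.
  exact: dom sg sh k0 k10 E.
apply: (dom h g (1 - k)) => //; rewrite ?subKr // => a.
by rewrite E addrC.
Qed.

End Orbit.

(** A closed invariant subspace [L] splits the cyclic vector into [x1'] in [L] and [x2] orthogonal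
    to [L], and [f] into two vector functionals of masses [|x1'|^2] and [|x2|^2]. If both masses are
    positive, purity and cyclicity give [x1' = |x1'|^2 x], so [x] lies in [L]. *)
Lemma pure_gns (f : A -> R[i]) : pure_states f ->
  exists (rho : irrep A) (x : irrep_space rho),
  [/\ forall a, f a = inner x (rho a x), nrm x = 1
    & forall y, adh [set rho a x | a in setT] y].
Proof.
move=> [sf pf]; have [H [rho [x [rep fE x1 cx]]]] := gns sf.
suff irr : is_irreducible rho.
  by exists (Irrep rep irr), x.
split.
  have [u [_ xu]] := cyclic_unit rep cx ltr01; exists u, x => u0.
  by move: xu; rewrite u0 subr0 x1 ltxx.
move=> L sL cL iL; have [P [lP LP PL aP cP]] := projection sL cL.
pose x1' := P x; pose x2 := x - P x.
have o12 y : L y -> inner y x2 = 0.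
  by move=> Ly; rewrite ipBr -(aP y) PL // subrr.
have cross a : inner x1' (rho a x2) = 0.
  by rewrite -(rep_adj rep) o12 //; exact/iL/LP.
have cross' a : inner x2 (rho a x1') = 0.
  by rewrite inner_conj o12 ?conjc0 //; exact/iL/LP.
have xE : x = x1' + x2 by rewrite addrC subrK.
have fs a : f a = inner x1' (rho a x1') + inner x2 (rho a x2).
  by rewrite fE {1 2}xE (linD (rep_lin rep a)) ipDl !ipDr cross cross' addr0 add0r.
have LT : L x -> L = setT.
  move=> Lx; apply/seteqP; split=> // y _; have /closedP := cL; apply.
  by apply: adh_mono (cx y) => _ [a _ <-]; exact: iL.
have n12 : nrm x1' ^+ 2 + nrm x2 ^+ 2 = 1.
  have := nrmD_sqr x1' x2; rewrite -xE x1 o12 ?mul0rn ?addr0 ?expr1n //.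
  exact: LP.
have [n1|n1] := eqVneq (nrm x1') 0.
  left; apply/seteqP; split=> [y Ly|y ->]; last exact: sL.1.
  apply: (ip_dense cx) => _ [a _ <-]; rewrite (rep_adj' rep).
  by rewrite -(PL _ (iL _ _ Ly)) -aP -/x1' (nrm_eq0 n1) ip0l.
have [n2|n2] := eqVneq (nrm x2) 0.
  right; apply: LT; rewrite xE (nrm_eq0 n2) addr0; exact: LP.
right; apply: LT.
have p1 : 0 < nrm x1' ^+ 2 by rewrite exprn_gt0 // lt_neqAle eq_sym n1 nrm_ge0.
have p2 : 0 < nrm x2 ^+ 2 by rewrite exprn_gt0 // lt_neqAle eq_sym n2 nrm_ge0.
have st (y y' : H) (t : R) : t = nrm y ^+ 2 -> 0 < t -> t + nrm y' ^+ 2 = 1 ->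
  (forall a, f a = inner y (rho a y) + inner y' (rho a y')) ->
  is_state (fun a => t^-1%:C * inner y (rho a y)).
  move=> tE t0 t1 fE'; apply: is_state_nrm.
  - split=> [c a b|a]; first by rewrite (rep_linl rep y) ipDr ipZr; ring.
    rewrite -(rep_sqr rep) ip_nrm -rmorphM ler0c mulr_ge0 ?invr_ge0 ?(ltW t0) //.
    by rewrite exprn_ge0 ?nrm_ge0.
  - move=> a; rewrite nrmM nrmC gtr0_norm ?invr_gt0 // mulrC ler_pdivrMr //.
    by rewrite mulrC tE; exact: vector_nrm.
  - move=> M hM; have t'0 : 0 <= nrm y' ^+ 2 by rewrite exprn_ge0 ?nrm_ge0.
    suff : 1 <= M * t + nrm y' ^+ 2 by nra.
    apply: (state_max sf) => a; rewrite fE'; apply: le_trans (nrmD _ _) _.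
    rewrite mulrDl lerD ?vector_nrm //.
    have := hM a; rewrite nrmM nrmC gtr0_norm ?invr_gt0 // mulrC ler_pdivrMr //.
    by rewrite mulrAC.
have [] := pf (fun a => (nrm x1' ^+ 2)^-1%:C * inner x1' (rho a x1'))
    (fun a => (nrm x2 ^+ 2)^-1%:C * inner x2 (rho a x2)) (nrm x1' ^+ 2).
- by apply: (st x1' x2) => //.
- by apply: (st x2 x1') => //; [rewrite addrC | move=> a; rewrite fs addrC].
- by [].
- by move: n12; lra.
- move=> a; rewrite fs; have -> : 1 - nrm x1' ^+ 2 = nrm x2 ^+ 2 by move: n12; lra.
  by rewrite !mulrA -!rmorphM !mulfV ?gt_eqF // !mul1r.
move=> fe _.
have : x1' - (nrm x1' ^+ 2)%:C *: x = 0.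
  apply: (ip_dense cx) => _ [a _ <-]; rewrite inner_conj ipBl ipZl conjc_real -fE -fe.
  rewrite mulrA -rmorphM mulfV ?gt_eqF // mul1r xE (linD (rep_lin rep a)) ipDr cross addr0.
  by rewrite subrr conjc0.
move/eqP; rewrite subr_eq0 => /eqP xe.
have -> : x = (nrm x1' ^+ 2)^-1%:C *: x1'.
  by rewrite {2}xe scalerA -rmorphM mulVf ?gt_eqF // scale1r.
by apply: subspaceZ => //; exact: LP.
Qed.

Lemma cyclic_equivalence (H K : hilbertSpace R) (rho : A -> H -> H) (sigma : A -> K -> K) x y :
  is_representation rho -> is_representation sigma ->
  (forall z, adh [set rho a x | a in setT] z) -> (forall z, adh [set sigma a y | a in setT] z) ->
  (forall a, inner x (rho a x) = inner y (sigma a y)) ->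
  exists U : H -> K, [/\ linear U, range U = setT,
    forall u v, inner (U u) (U v) = inner u v & forall a u, U (rho a u) = sigma a (U u)].
Proof.
move=> rr rs cx cy E.
pose Rel (u : H) (v : K) := exists a, u = rho a x /\ v = sigma a y.
have [||dense|U [lU iU UR Ur _]] := @isometry_ext R H K Rel.
- move=> k u u' v v' [a [-> ->]] [b [-> ->]]; exists (k *: a + b).
  by rewrite (rep_linl rr) (rep_linl rs).
- move=> u v [a [-> ->]]; apply/eqP; rewrite -(@eqrXn2 _ 2) ?nrm_ge0 // !nrm_ip.
  by rewrite (rep_sqr rr) (rep_sqr rs) E.
- by apply: adh_mono (cx dense) => _ [a _ <-]; exists (sigma a y), a.
have Ua a : U (rho a x) = sigma a y by apply: UR; exists a.
exists U; split=> //.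
- apply/seteqP; split=> // v _; have [|u <-] := Ur v; last by exists u.
  by apply: adh_mono (cy v) => _ [a _ <-]; exists (rho a x), a.
- move=> a u.
  apply: (@linear_eq_dense R H K (fun u => U (rho a u)) (fun u => sigma a (U u))
    (nrm a) (nrm a) _ _ _ _ _ _ u (cx u)).
  + by move=> k v w; rewrite (rep_lin rr) lU.
  + by move=> k v w; rewrite lU (rep_lin rs).
  + by move=> v; rewrite (isometry_nrm iU) rep_contr.
  + by move=> v; apply: le_trans (rep_contr rs _ _) _; rewrite (isometry_nrm iU).
  + by move=> _ [b _ <-]; rewrite -(repM rr) !Ua (repM rs).
Qed.

Lemma ueq_refl (rho : irrep A) : unitarily_equivalent rho rho.
Proof. by exists id; split=> //; apply/seteqP; split=> // x _; exists x. Qed.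

Lemma ueq_sym (rho sigma : irrep A) :
  unitarily_equivalent rho sigma -> unitarily_equivalent sigma rho.
Proof.
move=> [U [lU UT iU Ur]].
have /choice[V HV] y : exists x, U x = y.
  by have : range U y by [rewrite UT]; case=> x _ <-; exists x.
have Uinj x y : U x = U y -> x = y.
  move=> h; apply/eqP; rewrite -subr_eq0; apply/eqP/ip_eq0.
  by rewrite -iU (linB lU) h subrr ip0r.
exists V; split.
- by move=> c x y; apply: Uinj; rewrite lU !HV.
- by apply/seteqP; split=> // x _; exists (U x) => //; apply: Uinj.
- by move=> x y; rewrite -iU !HV.
- by move=> a x; apply: Uinj; rewrite Ur !HV.
Qed.

Lemma ueq_trans (rho sigma tau : irrep A) : unitarily_equivalent rho sigma ->
  unitarily_equivalent sigma tau -> unitarily_equivalent rho tau.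
Proof.
move=> [U [lU UT iU Ur]] [V [lV VT iV Vr]]; exists (V \o U); split.
- by move=> c x y /=; rewrite lU lV.
- apply/seteqP; split=> // z _.
  have : range V z by rewrite VT.
  case=> y _ <-; have : range U y by rewrite UT.
  by case=> x _ <-; exists x.
- by move=> x y /=; rewrite iV.
- by move=> a x /=; rewrite Ur Vr.
Qed.

Definition spectrum_of (rho : irrep A) : spectrum A :=
  exist _ (irrep_class rho) (ex_intro _ rho erefl).

Lemma spectrum_of_mem rho : sval (spectrum_of rho) rho.
Proof. exact: ueq_refl. Qed.

Lemma spectrum_ueq (x : spectrum A) rho sigma :
  sval x rho -> sval x sigma -> unitarily_equivalent rho sigma.
Proof.
have [tau ->] : exists tau, sval x = irrep_class tau := svalP x.
move=> h h'; exact: ueq_trans (ueq_sym h) h'.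
Qed.

Lemma spectrum_mem (x : spectrum A) rho sigma :
  sval x rho -> unitarily_equivalent rho sigma -> sval x sigma.
Proof.
have [tau ->] : exists tau, sval x = irrep_class tau := svalP x.
by move=> h h'; exact: ueq_trans h h'.
Qed.

Lemma spectrum_ex (x : spectrum A) : exists rho, sval x rho.
Proof.
have [tau ->] : exists tau, sval x = irrep_class tau := svalP x.
by exists tau; exact: ueq_refl.
Qed.

Lemma spectrum_eq (x y : spectrum A) rho : sval x rho -> sval y rho -> x = y.
Proof.
move=> xr yr; have e : sval x = sval y.
  apply/funext => sigma; apply/propext; split=> h.
    by apply: spectrum_mem yr _; exact: spectrum_ueq xr h.
  by apply: spectrum_mem xr _; exact: spectrum_ueq yr h.
case: x y e {xr yr} => x px [y py] /= e.
by case: _ / e py => py; congr (exist _ _ _); exact: Prop_irrelevance.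
Qed.

Lemma spectrum_openP (J : set A) (x : spectrum A) rho : sval x rho ->
  spectrum_open J x <-> exists a xi, J a /\ rho a xi <> 0.
Proof.
move=> xr; split=> [[sigma xs [a [xi [Ja axi]]]]|h]; last by exists rho.
have [U [lU _ iU Ur]] := spectrum_ueq xs xr.
exists a, (U xi); split=> //; rewrite -Ur => h; apply: axi.
by apply: ip_eq0; rewrite -iU h ip0r.
Qed.

Lemma gns_class_uniq (f : A -> R[i]) (x y : spectrum A) :
  is_GNS_class f x -> is_GNS_class f y -> x = y.
Proof.
move=> [rho [xr [u [cu fu]]]] [sigma [ys [v [cv fv]]]].
have rr := irrep_rep rho; have rs := irrep_rep sigma.
apply: (spectrum_eq (rho := sigma)) => //; apply: spectrum_mem xr _.
apply: (cyclic_equivalence rr rs (x := u) (y := v)).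
- exact/(cyclic_span rr).
- exact/(cyclic_span rs).
- by move=> a; rewrite -fu -fv.
Qed.

End Irreducible.

(** * Hilbert bimodules *)

Section GeneratedIsometry.
Variables (R : realType) (A : cstarAlgebra R).

Definition hform (V : normedModType R[i]) (b : V -> V -> A) :=
  [/\ forall x, linear (b x), forall x y, star (b x y) = b y x,
      forall x, nrm (b x x) = nrm x ^+ 2 & forall x y, nrm (b x y) <= nrm x * nrm y].

Lemma hform_eq0 (V : normedModType R[i]) (b : V -> V -> A) x : hform b -> b x x = 0 -> x = 0.
Proof.
move=> [_ _ n _] b0; have := n x; rewrite b0 nrm0 => /esym/eqP.
by rewrite sqrf_eq0 => /eqP/nrm_eq0.
Qed.

Variables (V W : completeNormedModType R[i]) (bV : V -> V -> A) (bW : W -> W -> A).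
Variables (I : Type) (f : I -> V) (g : I -> W).

(** The linear span of the pairs [(f i, g i)], a relation because the [f i] may be linearly
    dependent. *)
Inductive generated_rel : V -> W -> Prop :=
| generated_rel0 : generated_rel 0 0
| generated_relD c i v w :
    generated_rel v w -> generated_rel (c *: f i + v) (c *: g i + w).

Lemma generated_relZ c v v' w w' : generated_rel v w -> generated_rel v' w' ->
  generated_rel (c *: v + v') (c *: w + w').
Proof.
move=> r r'; elim: r => [|k i v0 w0 _ IH]; first by rewrite !scaler0 !add0r.
by rewrite !scalerDr !scalerA -!addrA; exact: generated_relD.
Qed.

Hypotheses (hV : hform bV) (hW : hform bW).
Hypothesis fg : forall i k, bV (f i) (f k) = bW (g i) (g k).

Lemma generated_rel_form v w v' w' : generated_rel v w -> generated_rel v' w' ->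
  bV v v' = bW w w'.
Proof.
have [lV sV _ _] := hV; have [lW sW _ _] := hW.
move=> r r'; have key i : bV v (f i) = bW w (g i).
  rewrite -sV -[RHS]sW; congr star; elim: r => [|k j v0 w0 _ IH].
    by rewrite (lin0 (lV _)) (lin0 (lW _)).
  by rewrite lV lW IH fg.
elim: r' => [|k j v0 w0 _ IH]; first by rewrite (lin0 (lV _)) (lin0 (lW _)).
by rewrite lV lW IH key.
Qed.

Lemma generated_relM v w : generated_rel v w -> nrm w <= 1 * nrm v.
Proof.
move=> r; have [_ _ nV _] := hV; have [_ _ nW _] := hW.
rewrite mul1r -(ler_pXn2r (n := 2)) ?nnegrE ?nrm_ge0 // -nV -nW.
by rewrite (generated_rel_form r r).
Qed.

Lemma rel_closure_lin (U : normedModType R[i]) (phi : V -> U) (psi : W -> U) (M N : R) x y :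
  linear phi -> linear psi -> (forall x, nrm (phi x) <= M * nrm x) ->
  (forall y, nrm (psi y) <= N * nrm y) -> (forall i, phi (f i) = psi (g i)) ->
  rel_closure generated_rel x y -> phi x = psi y.
Proof.
move=> lp lq bp bq E xy.
have gen v w : generated_rel v w -> phi v = psi w.
  elim=> [|c i v0 w0 _ IH]; first by rewrite (lin0 lp) (lin0 lq).
  by rewrite lp lq IH E.
apply/eqP; rewrite -subr_eq0; apply/eqP/nrm_small => e e0.
have MN : 0 < `|M| + `|N| + 1 by rewrite ltr_wpDl // addr_ge0.
have [|u [v [uv xu yv]]] := xy (e / (`|M| + `|N| + 1)); first by rewrite divr_gt0.
have -> : phi x - psi y = phi (x - u) - psi (y - v).
  by rewrite (linB lp) (linB lq) (gen _ _ uv); lmod.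
apply: le_lt_trans (nrmB _ _) _.
apply: (@le_lt_trans _ _ ((`|M| + `|N|) * (e / (`|M| + `|N| + 1)))); last first.
  by rewrite mulrA ltr_pdivrMr // mulrC ltr_pM2l // ltrDl.
rewrite mulrDl lerD //.
  apply: le_trans (bp _) _; apply: (@le_trans _ _ (`|M| * nrm (x - u))).
    by rewrite ler_wpM2r ?nrm_ge0 ?ler_norm.
  by rewrite ler_wpM2l // ltW.
apply: le_trans (bq _) _; apply: (@le_trans _ _ (`|N| * nrm (y - v))).
  by rewrite ler_wpM2r ?nrm_ge0 ?ler_norm.
by rewrite ler_wpM2l // ltW.
Qed.

Lemma rel_closure_span x y : rel_closure generated_rel x y -> closed_span (range g) y.
Proof.
move=> xy; have /closedP := @closed_closed_span _ _ (range g); apply=> e e0.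
have [u [v [uv xu yv]]] := xy e e0; exists v => //.
elim: uv => [|c i v0 w0 _ IH]; first by have [] := subspace_span (range g).
have [_] := subspace_span (range g); apply=> //; apply: sub_closed_span; by exists i.
Qed.

Lemma rel_closure_ex x : closed_span (range f) x -> exists y, rel_closure generated_rel x y.
Proof.
move=> fx; apply: (rel_closure_total generated_relZ generated_relM).
apply: (@closed_span_adh _ _ [set u | exists v, generated_rel u v] x).
  split=> [|c u u' [v uv] [v' uv']]; first by exists 0; exact: generated_rel0.
  by exists (c *: v + v'); exact: generated_relZ.
apply: (closed_span_ind _ _ _ fx); [exact: subspace_span | exact: closed_closed_span |].
move=> _ [i _ <-]; apply: sub_closed_span; exists (g i).
rewrite -[f i]scale1r -[g i]scale1r -[1 *: f i]addr0 -[1 *: g i]addr0.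
by apply: generated_relD; exact: generated_rel0.
Qed.

End GeneratedIsometry.

Section GeneratedIsometryMap.
Variables (R : realType) (A : cstarAlgebra R).
Variables (V W : completeNormedModType R[i]) (bV : V -> V -> A) (bW : W -> W -> A).
Variables (I : Type) (f : I -> V) (g : I -> W).
Hypotheses (hV : hform bV) (hW : hform bW).
Hypothesis fg : forall i k, bV (f i) (f k) = bW (g i) (g k).
Let D := closed_span (range f).

(** Families with the same Gram matrix have isometric closed spans. The maps [j1], [jmap] and
    [theta] are all obtained in this way, and the last clause reduces their further properties to
    generators. *)
Lemma generated_isometry : exists T : V -> W,
  [/\ forall c x y, D x -> D y -> T (c *: x + y) = c *: T x + T y,
      forall x y, D x -> D y -> bW (T x) (T y) = bV x y,
      forall i, T (f i) = g i,
      T @` D = closed_span (range g)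
    & forall (U : normedModType R[i]) (phi : V -> U) (psi : W -> U) (M N : R),
        linear phi -> linear psi -> (forall x, nrm (phi x) <= M * nrm x) ->
        (forall y, nrm (psi y) <= N * nrm y) -> (forall i, phi (f i) = psi (g i)) ->
        forall x, D x -> phi x = psi (T x)].
Proof.
have rZ := @generated_relZ _ V W I f g.
have rM := generated_relM hV hW fg.
have [lV sV _ nV] := hV; have [lW sW _ nW] := hW.
have key (x : V) : exists y, D x -> rel_closure (generated_rel f g) x y.
  have [Dx|nDx] := pselect (D x); last by exists 0.
  by have [y xy] := rel_closure_ex hV hW fg Dx; exists y.
have [T HT] := choice key.
have sD : is_subspace D by exact: subspace_span.
have Df i : D (f i) by apply: sub_closed_span; exists i.
have Tf i : T (f i) = g i.
  apply: (rel_closure_uniq rZ rM (HT _ (Df i))); apply: rel_closure_sub.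
  rewrite -[f i]scale1r -[g i]scale1r -[1 *: f i]addr0 -[1 *: g i]addr0.
  by apply: generated_relD; exact: generated_rel0.
have ext (U : normedModType R[i]) (phi : V -> U) (psi : W -> U) (M N : R) :
  linear phi -> linear psi -> (forall x, nrm (phi x) <= M * nrm x) ->
  (forall y, nrm (psi y) <= N * nrm y) -> (forall i, phi (f i) = psi (g i)) ->
  forall x, D x -> phi x = psi (T x).
  by move=> lp lq bp bq E x Dx; exact: (rel_closure_lin lp lq bp bq E (HT _ Dx)).
have b1 i y : D y -> bV (f i) y = bW (g i) (T y).
  exact: (ext _ _ _ _ _ (lV _) (lW _) (nV _) (nW _) (fg i)).
have b2 x y : D x -> D y -> bW (T x) (T y) = bV x y.
  move=> Dx Dy; symmetry; apply: (ext _ _ _ _ _ (lV _) (lW _) (nV _) (nW _) _ y Dy) => i.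
  by rewrite -sV b1 // sW.
exists T; split=> //.
  move=> c x y Dx Dy; apply: (rel_closure_uniq rZ rM (HT _ _)); first exact: sD.2.
  by apply: rel_closureZ => //; exact: HT.
apply/seteqP; split=> [_ [x Dx <-]|w gw]; first exact: rel_closure_span (HT _ Dx).
(* Surjectivity: the inverse relation supplies [x]. Then [T x] and [w] have the same products with
   all [g i], and their difference lies in the span of the [g i]. *)
have [x wx] := rel_closure_ex hW hV (fun i k => esym (fg i k)) gw.
have Dx : D x := rel_closure_span wx.
exists x => //.
have b3 i : bV (f i) x = bW (g i) w.
  symmetry; apply: (rel_closure_lin (lW _) (lV _) (nW _) (nV _)) wx => k.
  by rewrite fg.
have key0 : forall u, closed_span (range g) u -> bW (T x - w) u = 0.
  apply: (@closed_span_image _ _ _ _ _ (lW (T x - w)) (nW _) (range g) [set 0]).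
  - exact: subspace_zero.
  - exact: closed_zero.
  - move=> _ [i _ <-] /=; rewrite -sW (linB (lW _)) -b1 // b3 subrr.
    by rewrite star0.
apply/eqP; rewrite -subr_eq0; apply/eqP; apply: (hform_eq0 hW); apply: key0.
apply: (subspaceB (subspace_span _) _ gw).
exact: (rel_closure_span (HT _ Dx)).
Qed.

End GeneratedIsometryMap.

Section Ideals.
Variables (R : realType) (A : cstarAlgebra R).

Lemma ideal_gen_ideal (X : set A) : is_ideal (ideal_gen X).
Proof.
split; last 2 first.
- by move=> a x Jx L [iL XL]; case: (iL) => _ _ Ll _; apply: Ll; exact: Jx.
- by move=> a x Jx L [iL XL]; case: (iL) => _ _ _ Lr; apply: Lr; exact: Jx.
- split=> [L [[[]]] //|c x y Jx Jy L [iL XL]].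
  by case: (iL) => sL _ _ _; apply: sL.2; [exact: Jx | exact: Jy].
- apply/closedP => x ax L [iL XL]; case: (iL) => _ /closedP cL _ _.
  by apply: cL; apply: adh_mono ax => y; apply.
Qed.

Lemma sub_ideal_gen (X : set A) : X `<=` ideal_gen X.
Proof. by move=> x Xx L [_]; apply. Qed.

Lemma ideal_gen_ind (X J : set A) : is_ideal J -> X `<=` J -> ideal_gen X `<=` J.
Proof. by move=> iJ XJ x; apply. Qed.

Lemma ideal_cstar (J : set A) a : is_ideal J -> J (star a ** a) -> J a.
Proof.
move=> [sJ /closedP cJ Jl Jr] Ja; apply: cJ => e e0.
have [u [c [_ uE _ _ au]]] := approx_right_unit a e0.
by exists (a ** u) => //; rewrite uE; exact/Jl/Jr.
Qed.

Lemma ideal_annihilator (J : set A) d : is_ideal J -> J d ->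
  (forall a, J a -> d ** a = 0) -> d = 0.
Proof. by move=> iJ Jd da; apply: cstar_eq0'; apply: da; exact: ideal_star. Qed.

Lemma ideal_annihilator' (J : set A) d : is_ideal J -> J d ->
  (forall a, J a -> a ** d = 0) -> d = 0.
Proof. by move=> iJ Jd da; apply: cstar_eq0; apply: da; exact: ideal_star. Qed.

Lemma algebra_form : hform (fun a b : A => star a ** b).
Proof.
split=> [x||x|x y].
- exact: cmul_linearr.
- by move=> x y; rewrite !cexp.
- exact: nrm_cstar.
- by rewrite -(nrm_star x) nrm_cmul.
Qed.

End Ideals.

Section Bimodule.
Variables (R : realType) (A : cstarAlgebra R) (E : hilbertBimodule A).
Implicit Types (x y z : E) (a b : A).

Lemma rip_ractl x y a : rip (ract x a) y = star a ** rip x y.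
Proof. by rewrite -rip_star rip_ract starM rip_star. Qed.

Lemma lip_lactr x y a : lip x (lact a y) = lip x y ** star a.
Proof. by rewrite -lip_star lip_lact starM lip_star. Qed.

Lemma rip_semilinear c x y z : rip (c *: x + y) z = conjc c *: rip x z + rip y z.
Proof. by rewrite -rip_star rip_linearr starD starZ !rip_star. Qed.

Lemma nrm_rip x : nrm (rip x x) = nrm x ^+ 2.
Proof. by apply: complexI; rewrite rmorphXn /= -!nrmE rip_norm. Qed.

Lemma nrm_lip x : nrm (lip x x) = nrm x ^+ 2.
Proof. by apply: complexI; rewrite rmorphXn /= -!nrmE lip_norm. Qed.

Lemma rip_eq0 x : rip x x = 0 -> x = 0.
Proof.
move=> h; have := nrm_rip x; rewrite h nrm0 => /esym/eqP.
by rewrite sqrf_eq0 => /eqP/nrm_eq0.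
Qed.

Lemma rip_ext x y : (forall z, rip x z = rip y z) -> x = y.
Proof.
move=> h; apply/eqP; rewrite -subr_eq0; apply/eqP/rip_eq0.
rewrite -[x - y in X in rip X _](addrC (- y)) -scaleN1r rip_semilinear.
by rewrite conjcN conjc1 !scaleN1r h addNr.
Qed.

(** Adjointability comes from the compatibility of the two inner products: by [lip_rip] the
    difference [d] satisfies [ract z d = 0], so right inner products annihilate it, and [star d] is
    a difference of such products. *)
Lemma rip_adj a x y : rip (lact a x) y = rip x (lact (star a) y).
Proof.
apply/eqP; rewrite -subr_eq0; set d := _ - _.
have xd z : ract z d = 0.
  rewrite /d (linB (ract_linearr z)) -!lip_rip lip_lactr -lactA subrr.
  by [].
have rd z w : rip z w ** d = 0.
  by rewrite -rip_ract xd (lin0 (rip_linearr z)).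
apply/eqP/cstar_eq0; rewrite {1}/d starB !rip_star cmulDl cmulNl !rd.
by rewrite subrr.
Qed.

Lemma lip_adj a x y : lip (ract x a) y = lip x (ract y (star a)).
Proof.
apply/eqP; rewrite -subr_eq0; set d := _ - _.
have dx z : lact d z = 0.
  rewrite /d (linB (lact_linearl z)) !lip_rip rip_ractl starK -ractA subrr.
  by [].
have rd z w : d ** lip z w = 0.
  by rewrite -lip_lact dx (lin0 (lip_linearl w)).
apply/eqP/cstar_eq0'; rewrite {2}/d starB !lip_star cmulDr cmulNr !rd.
by rewrite subrr.
Qed.

Lemma nrm_ract x a : nrm (ract x a) <= nrm x * nrm a.
Proof.
rewrite -(ler_pXn2r (n := 2)) ?nnegrE ?mulr_ge0 ?nrm_ge0 //.
rewrite -nrm_rip rip_ract rip_ractl exprMn -nrm_rip.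
have h1 := nrm_cmul (star a ** rip x x) a; have h2 := nrm_cmul (star a) (rip x x).
rewrite nrm_star in h2; have := nrm_ge0 a; move: h1 h2.
by move: (nrm (_ ** a)) (nrm (star a ** _)) (nrm a) (nrm (rip _ _)) => *; nra.
Qed.

Lemma nrm_lact x a : nrm (lact a x) <= nrm a * nrm x.
Proof.
rewrite -(ler_pXn2r (n := 2)) ?nnegrE ?mulr_ge0 ?nrm_ge0 //.
rewrite -nrm_lip lip_lact lip_lactr exprMn -nrm_lip.
have h1 := nrm_cmul a (lip x x ** star a); have h2 := nrm_cmul (lip x x) (star a).
rewrite nrm_star in h2; have := nrm_ge0 a; move: h1 h2.
by move: (nrm (a ** _)) (nrm (_ ** star a)) (nrm a) (nrm (lip _ _)) => *; nra.
Qed.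

(* Cauchy-Schwarz: with [lip x x = b^* b], [|<x, y>|^2 = |<b y, b y>|]. *)
Lemma nrm_rip_le x y : nrm (rip x y) <= nrm x * nrm y.
Proof.
rewrite -(ler_pXn2r (n := 2)) ?nnegrE ?mulr_ge0 ?nrm_ge0 //.
rewrite -nrm_cstar rip_star -rip_ract -lip_rip exprMn.
have [b bE] := lip_positive x; have := nrm_lip x; rewrite bE nrm_cstar => nb.
rewrite -lactA -rip_adj nrm_rip -nb -exprMn.
by rewrite ler_pXn2r ?nnegrE ?mulr_ge0 ?nrm_ge0 // nrm_lact.
Qed.

Lemma nrm_lip_le x y : nrm (lip x y) <= nrm x * nrm y.
Proof.
rewrite -(ler_pXn2r (n := 2)) ?nnegrE ?mulr_ge0 ?nrm_ge0 //.
rewrite -nrm_cstar' lip_star -lip_lact lip_rip exprMn.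
have [b bE] := rip_positive y; have := nrm_rip y; rewrite bE nrm_cstar => nb.
rewrite -ractA lip_adj nrm_lip -nb -exprMn.
by rewrite ler_pXn2r ?nnegrE ?mulr_ge0 ?nrm_ge0 // -(nrm_star b) nrm_ract.
Qed.

Lemma rip_form : hform (@rip R A E).
Proof.
split; [exact: rip_linearr | exact: rip_star | exact: nrm_rip | exact: nrm_rip_le].
Qed.

Lemma sI_rip x y : sI E (rip x y).
Proof. by apply: sub_ideal_gen; exists x, y. Qed.

Lemma rI_lip x y : rI E (lip x y).
Proof. by apply: sub_ideal_gen; exists x, y. Qed.

Lemma sI_ideal : is_ideal (sI E). Proof. exact: ideal_gen_ideal. Qed.
Lemma rI_ideal : is_ideal (rI E). Proof. exact: ideal_gen_ideal. Qed.

Lemma sI_span a : sI E a -> closed_span [set a | exists x y : E, a = rip x y] a.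
Proof.
apply: ideal_gen_ind; last exact: sub_closed_span.
split; [exact: subspace_span | exact: closed_closed_span | move=> b | move=> b].
- apply: (@closed_span_image _ _ _ _ _ (cmul_linearr b) (nrm_cmul b)).
  + exact: subspace_span.
  + exact: closed_closed_span.
  + move=> _ [x [y ->]]; apply: sub_closed_span; exists (ract x (star b)), y.
    by rewrite rip_ractl starK.
- apply: (@closed_span_image _ _ _ (cmul^~ b) (nrm b) (cmul_linearl b)).
  + by move=> a'; rewrite mulrC nrm_cmul.
  + exact: subspace_span.
  + exact: closed_closed_span.
  + by move=> _ [x [y ->]]; apply: sub_closed_span; exists x, (ract y b); rewrite rip_ract.
Qed.

Lemma ract_unit x (e : R) : 0 < e -> exists u,
  [/\ sI E u, nrm u <= 1 & nrm (x - ract x u) < e].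
Proof.
move=> e0; have e2 : 0 < e ^+ 2 / 2 by rewrite divr_gt0 // exprn_gt0.
have [u [c [su uE u1 _ au]]] := approx_right_unit (rip x x) e2.
have [_ _ Jl Jr] := sI_ideal.
exists u; split=> //; first by rewrite uE rip_star; exact: (Jr _ _ (Jr _ _ (sI_rip x x))).
rewrite -(ltr_pXn2r (n := 2)) ?nnegrE ?nrm_ge0 ?(ltW e0) // -nrm_rip.
set d := rip x x - rip x x ** u in au.
have -> : rip (x - ract x u) (x - ract x u) = d - u ** d.
  rewrite (linB (rip_linearr _)) rip_ract -rip_star (linB (rip_linearr x)) rip_ract.
  by rewrite /d !cexp rip_star su; lmod.
apply: le_lt_trans (nrmB _ _) _; have := nrm_cmul u d; have := nrm_ge0 d.
by move: u1 au; move: (nrm u) (nrm d) (nrm (u ** d)) => *; nra.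
Qed.

Lemma lact_unit x (e : R) : 0 < e -> exists u,
  [/\ rI E u, nrm u <= 1 & nrm (x - lact u x) < e].
Proof.
move=> e0; have e2 : 0 < e ^+ 2 / 2 by rewrite divr_gt0 // exprn_gt0.
have [u [c [su uE u1 _ au]]] := approx_right_unit (lip x x) e2.
have [_ _ Jl Jr] := rI_ideal.
exists u; split=> //; first by rewrite uE lip_star; exact: (Jr _ _ (Jr _ _ (rI_lip x x))).
rewrite -(ltr_pXn2r (n := 2)) ?nnegrE ?nrm_ge0 ?(ltW e0) // -nrm_lip.
set d := lip x x - lip x x ** u in au.
have -> : lip (x - lact u x) (x - lact u x) = d - u ** d.
  rewrite (linB (lip_linearl _)) lip_lact -lip_star (linB (lip_linearl x)) lip_lact.
  by rewrite /d !cexp lip_star su; lmod.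
apply: le_lt_trans (nrmB _ _) _; have := nrm_cmul u d; have := nrm_ge0 d.
by move: u1 au; move: (nrm u) (nrm d) (nrm (u ** d)) => *; nra.
Qed.

End Bimodule.

Section Tensor.
Variables (R : realType) (A : cstarAlgebra R) (E F G : hilbertBimodule A).
Variable m : E -> F -> G.
Hypothesis mT : tensor_iso m.

Lemma tensor_linl y : linear (m^~ y). Proof. by case: mT => -[]. Qed.
Lemma tensor_linr x : linear (m x). Proof. by case: mT => -[]. Qed.
Lemma tensor_lact a x y : m (lact a x) y = lact a (m x y).
Proof. by case: mT => _ []. Qed.
Lemma tensor_ract x y a : m x (ract y a) = ract (m x y) a.
Proof. by case: mT => _ []. Qed.
Lemma tensor_rip x y x' y' : rip (m x y) (m x' y') = rip y (lact (rip x x') y').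
Proof. by case: mT. Qed.
Lemma tensor_total : closed_span [set z | exists x y, z = m x y] = setT.
Proof. by case: mT. Qed.

Lemma tensor_ind (L : set G) : is_subspace L -> closed L -> (forall x y, L (m x y)) ->
  forall z, L z.
Proof.
move=> sL cL mL z; have : closed_span [set z | exists x y, z = m x y] z by rewrite tensor_total.
by apply: closed_span_ind => // _ [x [y ->]].
Qed.

Lemma tensor_image (U : normedModType R[i]) (phi : G -> U) (M : R) (L : set U) :
  linear phi -> (forall z, nrm (phi z) <= M * nrm z) -> is_subspace L -> closed L ->
  (forall x y, L (phi (m x y))) -> forall z, L (phi z).
Proof.
move=> lp bp sL cL h; apply: tensor_ind => //; first exact: subspace_preimage.
exact: closed_preimage bp _ cL.
Qed.

Lemma tensor_eq (U : normedModType R[i]) (phi psi : G -> U) (M N : R) :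
  linear phi -> linear psi -> (forall z, nrm (phi z) <= M * nrm z) ->
  (forall z, nrm (psi z) <= N * nrm z) ->
  (forall x y, phi (m x y) = psi (m x y)) -> forall z, phi z = psi z.
Proof.
move=> lp lq bp bq h z; apply/eqP; rewrite -subr_eq0; apply/eqP.
apply: (tensor_image (phi := fun z => phi z - psi z) (M := M + N) (L := [set 0])).
- by move=> c u v; rewrite lp lq; lmod.
- by move=> u; rewrite mulrDl (le_trans (nrmB _ _)) // lerD.
- exact: subspace_zero.
- exact: closed_zero.
- by move=> x y /=; rewrite h subrr.
Qed.

Lemma nrm_tensor x y : nrm (m x y) <= nrm x * nrm y.
Proof.
rewrite -(ler_pXn2r (n := 2)) ?nnegrE ?mulr_ge0 ?nrm_ge0 //.
rewrite -nrm_rip tensor_rip exprMn -nrm_rip.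
apply: le_trans (nrm_rip_le _ _) _; rewrite expr2 mulrCA.
by rewrite ler_wpM2l ?nrm_ge0 // nrm_lact.
Qed.

Lemma nrm_tensorC x y : nrm (m x y) <= nrm y * nrm x.
Proof. by rewrite mulrC nrm_tensor. Qed.

Lemma tensor_sI : sI G `<=` sI F.
Proof.
have [sF cF Fl Fr] := sI_ideal F.
have k1 x y z : sI F (rip (m x y) z).
  apply: (@closed_span_image _ _ _ _ _ (rip_linearr (m x y)) (nrm_rip_le (m x y))
    [set z | exists x y, z = m x y]) => //; last by rewrite tensor_total.
  by move=> _ [x' [y' ->]]; rewrite tensor_rip; exact: sI_rip.
apply: ideal_gen_ind; first exact: sI_ideal.
move=> _ [z [z' ->]].
apply: (@closed_span_image _ _ _ _ _ (rip_linearr z) (nrm_rip_le z)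
    [set z | exists x y, z = m x y]) => //; last by rewrite tensor_total.
move=> _ [x [y ->]]; rewrite -rip_star; apply: (ideal_star (sI_ideal F)); exact: k1.
Qed.

End Tensor.

Section IdempotentBimodule.
Variables (R : realType) (A : cstarAlgebra R) (E : hilbertBimodule A) (m : E -> E -> E).
Hypotheses (mT : tensor_iso m) (mA : forall x y z, m (m x y) z = m x (m y z)).

(* [lip (m x y') y] is the image of [x lip y' y] under the isomorphism
   [E . r(E) -> r(E)] of bimodules that [E (x) E = E] induces. *)
Lemma idempotent_rI : rI E `<=` sI E.
Proof.
have [sE cE El Er] := sI_ideal E.
have key x y' y x1 y1' y1 : sI E (star (lip (m x y') y) ** lip (m x1 y1') y1).
  rewrite lip_star -lip_lact lip_rip (tensor_rip mT) -lip_rip lip_lact.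
  rewrite -[lip (lact _ _) _]lip_star lip_lactr.
  rewrite starM starK lip_star.
  by apply: (El _ _); apply: (Er _ _); exact: sI_rip.
have lq (c : A) y1 : linear (fun z : E => c ** lip z y1).
  by move=> k u v; rewrite lip_linearl !cexp.
have bq (c : A) y1 (z : E) : nrm (c ** lip z y1) <= nrm c * nrm y1 * nrm z.
  rewrite -mulrA (mulrC (nrm y1)); apply: le_trans (nrm_cmul _ _) _.
  by rewrite ler_wpM2l ?nrm_ge0 ?nrm_lip_le.
have k1 x y' y (z1 : E) y1 : sI E (star (lip (m x y') y) ** lip z1 y1).
  by apply: (tensor_image mT (lq _ y1) (bq _ y1) sE cE).
have k2 (z y z1 y1 : E) : sI E (star (lip z y) ** lip z1 y1).
  apply: (tensor_image mT (lq _ y1) (bq _ y1) sE cE) => x y'.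
  rewrite -[X in sI E X]starK; apply: (ideal_star (sI_ideal E)).
  by rewrite starM starK; exact: k1.
apply: ideal_gen_ind; first exact: sI_ideal.
by move=> _ [z [y ->]]; apply: (ideal_cstar (sI_ideal E)); exact: k2.
Qed.

(** The left action of [rI E] is nondegenerate, and [rI E] lies in [sI E], which right inner
    products span. *)
Lemma idempotent_dense x : closed_span [set lact (rip p.1.1 p.1.2) p.2 | p in @setT (E * E * E)] x.
Proof.
have /closedP := @closed_closed_span _ _ [set lact (rip p.1.1 p.1.2) p.2 | p in @setT (E * E * E)].
apply=> e e0; have [u [/idempotent_rI/sI_span u_ _ xu]] := lact_unit x e0.
exists (lact u x) => //.
apply: (@closed_span_image _ _ _ (lact^~ x) (nrm x) (lact_linearl x) _ _ _ _ _ _ _ u_).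
- by move=> a; rewrite mulrC nrm_lact.
- exact: subspace_span.
- exact: closed_closed_span.
- by move=> _ [y [z ->]]; apply: sub_closed_span; exists (y, z, x).
Qed.

(** The value of [j] on the generator [lact (rip x x') y] is forced: it must be [star (j x) ** j x'
    ** j y = star (j x) ** j (m x' y) = rip x (m x' y)]. *)
Lemma idempotent_iso : exists j : E -> A,
  [/\ linear j /\ range j = sI E, forall x y, star (j x) ** j y = rip x y,
      forall a x, j (lact a x) = a ** j x, forall x a, j (ract x a) = j x ** a
    & forall x y, m x y = lact (j x) y].
Proof.
pose f (p : E * E * E) := lact (rip p.1.1 p.1.2) p.2.
pose g (p : E * E * E) := rip p.1.1 (m p.1.2 p.2).
have fg p q : rip (f p) (f q) = star (g p) ** g q.
  case: p q => [[x x'] y] [[x1 x1'] y1]; rewrite /f /g /=.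
  rewrite rip_adj rip_star lactA [in RHS]rip_star -[RHS]rip_ract -[in RHS]lip_rip.
  by rewrite -(tensor_lact mT) (tensor_rip mT) lip_rip rip_ract.
have [T [Tl Ti Tf Tr Tx]] := generated_isometry (rip_form E) (algebra_form A) fg.
have D x : closed_span (range f) x by exact: idempotent_dense.
have lT : linear T by move=> c x y; exact: Tl.
have nT x : nrm (T x) <= 1 * nrm x.
  rewrite mul1r -(ler_pXn2r (n := 2)) ?nnegrE ?nrm_ge0 //.
  by rewrite -nrm_cstar Ti // nrm_rip.
exists T; split.
- split=> //; have <- : closed_span (range f) = setT by apply/seteqP; split=> // x _; exact: D.
  rewrite Tr; apply/seteqP; split=> a.
    have [sE cE _ _] := sI_ideal E.
    by apply: closed_span_ind => // _ [p _ <-]; exact: sI_rip.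
  move/sI_span; apply: closed_span_ind; [exact: subspace_span | exact: closed_closed_span |].
  move=> _ [x [y ->]].
  apply: (tensor_image mT (rip_linearr x) (nrm_rip_le x)).
  + exact: subspace_span.
  + exact: closed_closed_span.
  + by move=> x' y'; apply: sub_closed_span; exists (x, x', y').
- by move=> x y; exact: Ti.
- move=> a x; apply: (Tx _ (fun x => T (lact a x)) (cmul a) (1 * nrm a) (nrm a)) => //.
  + by move=> c y z; rewrite lact_linearr lT.
  + exact: cmul_linearr.
  + by move=> y; rewrite -mulrA; apply: le_trans (nT _) _; rewrite !mul1r nrm_lact.
  + exact: nrm_cmul.
  move=> [[x1 x'] y].
  have -> : lact a (f (x1, x', y)) = f (ract x1 (star a), x', y).
    by rewrite /f /= rip_ractl starK lactA.
  by rewrite Tf /g /= rip_ractl starK.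
- move=> x a; apply: (Tx _ (fun x => T (ract x a)) (cmul^~ a) (1 * nrm a) (nrm a)) => //.
  + by move=> c y z; rewrite ract_linearl lT.
  + exact: cmul_linearl.
  + move=> y; rewrite -mulrA; apply: le_trans (nT _) _; rewrite !mul1r mulrC; exact: nrm_ract.
  + by move=> y; rewrite mulrC nrm_cmul.
  move=> [[x1 x'] y].
  have -> : ract (f (x1, x', y)) a = f (x1, x', ract y a) by rewrite /f /= lractA.
  by rewrite Tf /g /= (tensor_ract mT) rip_ract.
- move=> x y; apply: (Tx _ (m^~ y) (lact^~ y) (nrm y) (nrm y)) => //.
  + exact: (tensor_linl mT).
  + exact: lact_linearl.
  + by move=> z; exact: nrm_tensorC.
  + by move=> z; rewrite mulrC nrm_lact.
  move=> [[x1 x'] y']; rewrite /f /g /= (tensor_lact mT).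
  have key z w u : rip (lact (rip x1 z) w) u = rip (m z w) (m x1 u).
    by rewrite rip_adj rip_star (tensor_rip mT).
  by apply: rip_ext => w; rewrite !key mA.
Qed.

End IdempotentBimodule.

(** * The maps [j1], [jmap] and [theta] *)

Section InverseMonoid.
Variable S : inverseMonoidType.
Implicit Types s t u v e f : S.
Local Open Scope group_scope.

Lemma idem_inv e : e * e = e -> e^-1 = e.
Proof. by move=> ee; symmetry; apply: invg_unique; rewrite !ee. Qed.

Lemma idem_prod e f : e * e = e -> f * f = f -> (e * f) * (e * f) = e * f.
Proof.
move=> ee ff; have := mulgVg (e * f); rewrite invgM (idem_inv ee) (idem_inv ff).
rewrite !mulgA -(mulgA e f f) ff -(mulgA (e * f) e e) ee.
by [].
Qed.

Lemma idem_comm e f : e * e = e -> f * f = f -> e * f = f * e.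
Proof.
move=> ee ff; have := idem_inv (idem_prod ee ff).
by rewrite invgM (idem_inv ee) (idem_inv ff).
Qed.

Lemma idemVg v : (v^-1 * v) * (v^-1 * v) = v^-1 * v.
Proof. by rewrite mulgA mulVgV. Qed.

Lemma nat_le_refl t : nat_le t t.
Proof. by exists (t^-1 * t); rewrite idemVg mulgA mulgVg. Qed.

Lemma nat_le1 v : nat_le v 1 -> v * v = v.
Proof. by move=> [e [ee ->]]; rewrite mul1g. Qed.

Lemma idem_nat_le1 v : v * v = v -> nat_le v 1.
Proof. by move=> vv; exists v; rewrite mul1g. Qed.

Lemma nat_le_trans t u v : nat_le t u -> nat_le u v -> nat_le t v.
Proof.
move=> [e [ee ->]] [f [ff ->]]; exists (f * e); split; first exact: idem_prod.
by rewrite mulgA.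
Qed.

Lemma nat_leE v t : nat_le v t -> t * (v^-1 * v) = v.
Proof.
move=> [e [ee ->]]; rewrite invgM (idem_inv ee).
have c := idem_comm ee (idemVg t).
rewrite -(mulgA e) [t^-1 * _]mulgA [e * _]mulgA c -(mulgA _ e e) ee.
by rewrite !mulgA mulgVg.
Qed.

Lemma nat_le_idemE v t : nat_le v t -> v * v = v -> t * v = v.
Proof. by move=> vt vv; have := nat_leE vt; rewrite (idem_inv vv) vv. Qed.

End InverseMonoid.

Section Action.
Variables (R : realType) (S : inverseMonoidType) (A : cstarAlgebra R).
Variable E : bimodule_action S A.
Implicit Types t u v s e : S.

(** The product [mu] transported along an equality of indices, so that associativity and the unit
    laws become equations within one fibre. *)
Definition fmul t u s (h : (t * u)%g = s) (x : E t) (y : E u) : E s :=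
  eq_rect _ (fun s => E s : Type) (mu x y) s h.

Lemma Tagged_mul t u s (h : (t * u)%g = s) (x : E t) (y : E u) :
  Tagged (fiber E) (fmul h x y) = Tagged (fiber E) (mu x y).
Proof. by case: _ / h. Qed.

Lemma mul_Tagged t u s (h : (t * u)%g = s) (x : E t) (y : E u) (z : E s) :
  Tagged (fiber E) (mu x y) = Tagged (fiber E) z <-> fmul h x y = z.
Proof.
rewrite -(Tagged_mul h); split=> [|-> //].
exact: (@eq_from_Tagged S (fiber E)).
Qed.

Lemma mul_tensor t u s (h : (t * u)%g = s) : tensor_iso (fmul h).
Proof. by case: _ / h; exact: mu_tensor. Qed.

Lemma mul_assoc t u v a b s (h1 : (t * u)%g = a) (h2 : (a * v)%g = s) (h3 : (u * v)%g = b)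
  (h4 : (t * b)%g = s) (x : E t) (y : E u) (z : E v) :
  fmul h2 (fmul h1 x y) z = fmul h4 x (fmul h3 y z).
Proof.
subst a b; apply/mul_Tagged; rewrite Tagged_mul mu_assoc.
by case: _ / h4 {h2}.
Qed.

Lemma mul_unitl t (h : (1 * t)%g = t) a (x : E t) : fmul h (unit_iso E a) x = lact a x.
Proof. by apply/mul_Tagged; exact: mu_unitl. Qed.

Lemma mul_unitr t (h : (t * 1)%g = t) a (x : E t) : fmul h x (unit_iso E a) = ract x a.
Proof. by apply/mul_Tagged; exact: mu_unitr. Qed.

Section Idempotent.
Variables (e : S) (ee : (e * e)%g = e).

(** [is_j1] does not mention inner products. The description is therefore identified with the [j]
    constructed above: both values lie in [sI (E e)] and act on [E e] in the same way, so their
    difference annihilates this ideal. *)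
Lemma j1_spec : is_j1 (@j1 _ _ _ E e) /\
  forall x y : E e, star (j1 x) ** j1 y = rip x y.
Proof.
have mA (x y z : E e) : fmul ee (fmul ee x y) z = fmul ee x (fmul ee y z) by exact: mul_assoc.
have [j [[lj rj] ij jl jr jm]] := idempotent_iso (mul_tensor ee) mA.
have ij1 : is_j1 j.
  split=> //; last by move=> x y; apply/(mul_Tagged ee); exact: jm.
  split=> // x y xy; apply/eqP; rewrite -subr_eq0; apply/eqP/rip_eq0.
  by rewrite -ij (linB lj) xy subrr cmul0r.
have : is_j1 (@j1 _ _ _ E e) by apply: (getPex (P := [set j | is_j1 j])); exists j.
move=> ij1'; split=> //; have [_ rj' _ _ jm'] := ij1'.
suff jE x : j1 x = j x by move=> x y; rewrite !jE.
apply/eqP; rewrite -subr_eq0; apply/eqP; have iE := sI_ideal (E e); have [sE _ _ _] := iE.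
apply: (ideal_annihilator iE).
  by apply: (subspaceB sE); [rewrite -rj'; exists x | rewrite -rj; exists x].
move=> a; rewrite -rj => -[y _ <-]; rewrite -jl (linB (lact_linearl y)) -jm.
by have /(mul_Tagged ee) <- := jm' x y; rewrite subrr (lin0 lj).
Qed.

Lemma j1_linear : linear (@j1 _ _ _ E e). Proof. by case: j1_spec => -[[]]. Qed.
Lemma j1_inj : injective (@j1 _ _ _ E e). Proof. by case: j1_spec => -[[]]. Qed.
Lemma j1_range : range (@j1 _ _ _ E e) = sI (E e). Proof. by case: j1_spec => -[]. Qed.
Lemma j1_lact a (x : E e) : j1 (lact a x) = a ** j1 x. Proof. by case: j1_spec => -[]. Qed.
Lemma j1_ract (x : E e) a : j1 (ract x a) = j1 x ** a. Proof. by case: j1_spec => -[]. Qed.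
Lemma j1_rip (x y : E e) : star (j1 x) ** j1 y = rip x y. Proof. by case: j1_spec. Qed.
Lemma j1_mul (x y : E e) : fmul ee x y = lact (j1 x) y.
Proof. by apply/mul_Tagged; case: j1_spec => -[]. Qed.
Lemma j1_mul' (x y : E e) : fmul ee x y = ract x (j1 y).
Proof. by apply: j1_inj; rewrite j1_mul j1_lact j1_ract. Qed.
Lemma nrm_j1 (x : E e) : nrm (j1 x) = nrm x.
Proof.
apply/eqP; rewrite -(@eqrXn2 _ 2) ?nrm_ge0 //.
by rewrite -nrm_cstar j1_rip nrm_rip.
Qed.
Lemma sI_j1 (x : E e) : sI (E e) (j1 x). Proof. by rewrite -j1_range; exists x. Qed.

Lemma idem_rI : rI (E e) `<=` sI (E e).
Proof.
by apply: (idempotent_rI (mul_tensor ee)).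
Qed.

(** By associativity this holds for [c] in the products of [E e] and [E u], which span [E u] because
    [e u = u]. *)
Lemma mul_idem u (h : (e * u)%g = u) (y : E e) (c : E u) : fmul h y c = lact (j1 y) c.
Proof.
have T := mul_tensor h.
apply: (tensor_eq T (tensor_linr T y) (lact_linearr (j1 y)) (nrm_tensor T y)
  (fun z => nrm_lact z (j1 y))) => x z.
rewrite -(mul_assoc ee) // j1_mul.
exact: (tensor_lact T).
Qed.

Lemma sI_annihilator d : sI (E e) d -> (forall c : E e, lact d c = 0) -> d = 0.
Proof.
move=> Ed dc; apply: (ideal_annihilator (sI_ideal (E e))) => // a.
by rewrite -j1_range => -[y _ <-]; rewrite -j1_lact dc (lin0 j1_linear).
Qed.

End Idempotent.

(** [star (j1 y) ** rip x x' ** j1 y'] is the right inner product of [mu x y] and [mu x' y']; to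
    reach [a ** b], apply [ideal_cstar] to [star b ** star a ** a ** b]. *)
Lemma sI_prod e f a b : (e * e)%g = e -> (f * f)%g = f -> sI (E e) a -> sI (E f) b ->
  sI (E (e * f)%g) (a ** b).
Proof.
move=> ee ff ea fb; have [sJ cJ Jl Jr] := sI_ideal (E (e * f)%g).
suff key (y y' : E f) c : sI (E e) c -> sI (E (e * f)%g) (star (j1 y) ** c ** j1 y').
  move: fb; rewrite -(j1_range ff) => -[y _ <-].
  apply: (ideal_cstar (sI_ideal _)); rewrite starM !cmulA -(cmulA _ (star a)).
  by apply: key; have [_ _ El _] := sI_ideal (E e); exact: El.
move=> /sI_span; move: c.
have lq : linear (fun c : A => star (j1 y) ** c ** j1 y') by move=> k u v; rewrite !cexp.
apply: (closed_span_image (M := nrm (j1 y) * nrm (j1 y')) lq) => // [c|].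
  apply: le_trans (nrm_cmul _ _) _; rewrite mulrAC ler_wpM2r ?nrm_ge0 //.
  by apply: le_trans (nrm_cmul _ _) _; rewrite nrm_star.
move=> _ [x [x' ->]]; rewrite -cmulA -(j1_lact ff) (j1_rip ff).
by rewrite -(tensor_rip (mu_tensor E e f)); exact: sI_rip.
Qed.

Lemma sI_source v : sI (E v) = sI (E (v^-1 * v)%g).
Proof.
apply/seteqP; split.
  by apply: (tensor_sI (mul_tensor (t := v) (u := (v^-1 * v)%g) (s := v) _)); rewrite mulgA mulgVg.
exact: (tensor_sI (mu_tensor E v^-1%g v)).
Qed.

Lemma jmap_spec t v : nat_le v t -> is_jmap (@jmap _ _ _ E t v).
Proof.
move=> vt; apply: (getPex (P := [set j | is_jmap j])).
have h := nat_leE vt; have ee := idemVg v; have mT := mul_tensor h.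
pose f (p : E t * E (v^-1 * v)%g) := fmul h p.1 p.2.
pose g (p : E t * E (v^-1 * v)%g) := ract p.1 (j1 p.2).
have fg p q : rip (f p) (f q) = rip (g p) (g q).
  case: p q => [x y] [x' y']; rewrite /f /g /= (tensor_rip mT).
  by rewrite rip_ract rip_ractl -cmulA -(j1_lact ee) (j1_rip ee).
have [T [Tl Ti Tf Tr Tx]] := generated_isometry (rip_form _) (rip_form _) fg.
have D z : closed_span (range f) z.
  apply: (tensor_ind mT); [exact: subspace_span | exact: closed_closed_span |].
  by move=> x y; apply: sub_closed_span; exists (x, y).
exists T; split=> [c x y|x|x y z /(mul_Tagged h) <-]; first exact: Tl.
  rewrite !nrmE; congr (_%:C); apply/eqP.
  by rewrite -(@eqrXn2 _ 2) ?nrm_ge0 // -!nrm_rip Ti.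
exact: (Tf (x, y)).
Qed.

Definition idem_below t := {v : S | nat_le v t /\ nat_le v 1%g}.

Lemma idem_below_idem t (v : idem_below t) : (sval v * sval v)%g = sval v.
Proof. by case: v => v [vt v1] /=; exact: nat_le1. Qed.

Lemma idem_below_mul t (v : idem_below t) : (t * sval v)%g = sval v.
Proof.
have vv := idem_below_idem v; case: v vv => v [vt v1] /= vv.
exact: nat_le_idemE.
Qed.

Lemma I1_ideal t : is_ideal (I1 E t).
Proof.
split; [exact: subspace_span | exact: closed_closed_span | move=> a | move=> a].
- apply: (closed_span_image (cmul_linearr a) (nrm_cmul a)).
  + exact: subspace_span.
  + exact: closed_closed_span.
  move=> x [v vP Ex]; apply: sub_closed_span; exists v => //.
  by have [_ _ El _] := sI_ideal (E v); exact: El.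
- apply: (closed_span_image (M := nrm a) (cmul_linearl a)).
  + by move=> x; rewrite mulrC nrm_cmul.
  + exact: subspace_span.
  + exact: closed_closed_span.
  move=> x [v vP Ex]; apply: sub_closed_span; exists v => //.
  by have [_ _ _ Er] := sI_ideal (E v); exact: Er.
Qed.

Lemma sI_I1 t (v : idem_below t) : sI (E (sval v)) `<=` I1 E t.
Proof. by move=> a va; apply: sub_closed_span; exists (sval v) => //; exact: (svalP v). Qed.

Lemma mod_ideal_act (G : hilbertBimodule A) (J : set A) x : is_ideal J -> mod_ideal G J x ->
  (forall a, mod_ideal G J (lact a x)) /\ (forall a, mod_ideal G J (ract x a)).
Proof.
move=> [_ _ _ Jr] Dx; split=> a.
  apply: (closed_span_image (lact_linearr a) (M := nrm a) _ _ _ _ Dx).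
  - by move=> y; exact: nrm_lact.
  - exact: subspace_span.
  - exact: closed_closed_span.
  - move=> _ [y [b [Jb ->]]]; apply: sub_closed_span; exists (lact a y), b.
    by rewrite lractA.
apply: (closed_span_image (ract_linearl a) (M := nrm a) _ _ _ _ Dx).
- by move=> y; rewrite mulrC nrm_ract.
- exact: subspace_span.
- exact: closed_closed_span.
- move=> _ [y [b [Jb ->]]]; apply: sub_closed_span; exists y, (b ** a).
  by rewrite ractA; split=> //; exact: Jr.
Qed.

Section Theta.
Variable t : S.
(** The generators of the domain of [theta] are [ract x (j1 y)] with [y] in [E v]; as [t v = v], the
    product of [x] and [y] lies in [E v], and [j1] of it is the required value. Since one index set
    serves all [v], the gluing is contained in the comparison of Gram matrices. *)
Let I := {v : idem_below t & (E t * E (sval v))%type}.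
Let f (p : I) := ract (tagged p).1 (j1 (tagged p).2).
Let g (p : I) := j1 (fmul (idem_below_mul (tag p)) (tagged p).1 (tagged p).2).

(* Both sides act in the same way on [E (v v')], and they lie in its source ideal. *)
Let fg (p q : I) : rip (f p) (f q) = star (g p) ** g q.
Proof.
case: p q => v [x y] [v' [x' y']]; rewrite /f /g /=.
have vv := idem_below_idem v; have vv' := idem_below_idem v'.
pose u := (sval v * sval v')%g.
have uu : (u * u)%g = u by exact: idem_prod.
have vu : (sval v * u)%g = u by rewrite /u mulgA vv.
have v'u : (sval v' * u)%g = u by rewrite /u (idem_comm vv vv') mulgA vv'.
have tu : (t * u)%g = u by rewrite /u mulgA idem_below_mul.
have act (w : idem_below t) (ww : (sval w * u)%g = u) (x0 : E t) (y0 : E (sval w)) (c : E u) :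
    lact (j1 (fmul (idem_below_mul w) x0 y0)) c = fmul tu x0 (lact (j1 y0) c).
  rewrite -(mul_idem (idem_below_idem w) ww) (mul_assoc _ _ ww tu).
  by rewrite (mul_idem (idem_below_idem w)).
apply/eqP; rewrite -subr_eq0; apply/eqP; apply: (sI_annihilator uu).
  have iu := sI_ideal (E u); have [su cu _ _] := iu.
  apply: (subspaceB su).
    rewrite rip_ract rip_ractl -!cmulA; apply: sI_prod => //.
      by apply: (ideal_star (sI_ideal _)); exact: sI_j1.
    by rewrite -(j1_lact vv'); exact: sI_j1.
  apply: sI_prod => //; last exact: sI_j1.
  by apply: (ideal_star (sI_ideal _)); exact: sI_j1.
move=> c; apply/eqP; rewrite (linB (lact_linearl c)) subr_eq0; apply/eqP/rip_ext => z.
rewrite -[lact (star _ ** _) c]lactA [RHS]rip_adj starK !act // (tensor_rip (mul_tensor tu)).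
by rewrite rip_ract rip_ractl -!lactA !rip_adj starK rip_star.
Qed.

Let span_f : closed_span (range f) = mod_ideal (E t) (I1 E t).
Proof.
apply/seteqP; split; apply: closed_span_ind;
  try exact: subspace_span; try exact: closed_closed_span.
- move=> _ [[v [x y]] _ <-]; apply: sub_closed_span; exists x, (j1 y); split=> //.
  by apply: sI_I1; apply: sI_j1; exact: idem_below_idem.
move=> _ [x [a [Ia ->]]].
apply: (closed_span_image (ract_linearr x) (nrm_ract x) _ _ _ Ia).
- exact: subspace_span.
- exact: closed_closed_span.
move=> b [v vP]; rewrite -(j1_range (nat_le1 vP.2)) => -[y _ <-].
apply: sub_closed_span.
by exists (existT (fun v : idem_below t => (E t * E (sval v))%type) (exist _ v vP) (x, y)).
Qed.

Let span_g : closed_span (range g) = I1 E t.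
Proof.
apply/seteqP; split; apply: closed_span_ind;
  try exact: subspace_span; try exact: closed_closed_span.
- move=> _ [[v [x y]] _ <-]; apply: sI_I1; apply: sI_j1; exact: idem_below_idem.
move=> b [v vP]; have vv := nat_le1 vP.2; rewrite -(j1_range vv) => -[z _ <-].
have h := idem_below_mul (exist _ v vP : idem_below t).
apply: (tensor_image (mul_tensor h) (phi := @j1 _ _ _ E v) (M := 1)).
- exact: j1_linear.
- by move=> x; rewrite mul1r nrm_j1.
- exact: subspace_span.
- exact: closed_closed_span.
move=> x y; apply: sub_closed_span.
exists (existT (fun v : idem_below t => (E t * E (sval v))%type) (exist _ v vP) (x, y)) => //.
by rewrite /g /=; congr (j1 (fmul _ _ _)); exact: Prop_irrelevance.
Qed.

(* The cast accounts for [v^-1 v = v] being only a propositional equality. *)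
Let theta_jmap_cast (T : E t -> A) : (forall p : I, T (f p) = g p) ->
  forall v (vP : nat_le v t /\ nat_le v 1%g) e (he : e = v) (h : (t * e)%g = v)
    (x : E t) (y : E e), T (ract x (j1 y)) = j1 (fmul h x y).
Proof.
move=> Tf v vP e he; subst e => h x y.
rewrite (Tf (existT (fun v : idem_below t => (E t * E (sval v))%type) (exist _ v vP) (x, y))).
by rewrite /g /=; congr (j1 (fmul _ _ _)); exact: Prop_irrelevance.
Qed.

Lemma theta_spec : is_theta (@theta _ _ _ E t).
Proof.
apply: (getPex (P := [set th | is_theta th])).
have [T [Tl Ti Tf Tr Tx]] := generated_isometry (rip_form _) (algebra_form A) fg.
move: Tl Ti Tr Tx; rewrite span_f span_g => Tl Ti Tr Tx.
have [sD cD] : is_subspace (mod_ideal (E t) (I1 E t)) /\ closed (mod_ideal (E t) (I1 E t)).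
  by split; [exact: subspace_span | exact: closed_closed_span].
have nT x : mod_ideal (E t) (I1 E t) x -> nrm (T x) = nrm x.
  move=> Dx; apply/eqP; rewrite -(@eqrXn2 _ 2) ?nrm_ge0 //.
  by rewrite -nrm_cstar Ti // nrm_rip.
have IT x : mod_ideal (E t) (I1 E t) x -> I1 E t (T x) by move=> Dx; rewrite -Tr; exists x.
have [sJ _ _ _] := I1_ideal t.
have IB a b : I1 E t a -> I1 E t b -> I1 E t (a - b) by exact: subspaceB.
(* [T] maps onto the ideal, so an element of the ideal is determined by its products with the
   [star (T u)]. *)
have null d : I1 E t d -> (forall u : E t, mod_ideal (E t) (I1 E t) u -> star (T u) ** d = 0) -> d = 0.
  move=> Id h; apply: (ideal_annihilator' (I1_ideal t) Id) => b Ib.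
  have := ideal_star (I1_ideal t) Ib; rewrite -Tr => -[u Du uE].
  by rewrite -[b]starK -uE h.
have Df p : mod_ideal (E t) (I1 E t) (f p) by rewrite -span_f; apply: sub_closed_span; exists p.
exists T; split=> //.
- by split=> // x Dx; rewrite !nrmE nT.
- move=> a x Dx; have Dax := (mod_ideal_act (I1_ideal t) Dx).1 a.
  apply/eqP; rewrite -subr_eq0; apply/eqP/(null _ (IB _ _ (IT _ Dax) _)) => [|u Du].
    by have [_ _ Il _] := I1_ideal t; apply: (Il _ _); exact: IT.
  rewrite (linB (cmul_linearr _)) Ti //; apply/eqP; rewrite subr_eq0; apply/eqP.
  apply: (Tx A (fun x => rip u (lact a x)) (fun b => star (T u) ** (a ** b))
    (nrm u * nrm a) (nrm (T u) * nrm a)) => //.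
  + by move=> c y z; rewrite lact_linearr rip_linearr.
  + by move=> c y z; rewrite !cexp.
  + by move=> y; apply: le_trans (nrm_rip_le _ _) _; rewrite -mulrA ler_wpM2l ?nrm_ge0 ?nrm_lact.
  + move=> y; apply: le_trans (nrm_cmul _ _) _.
    by rewrite nrm_star -mulrA ler_wpM2l ?nrm_ge0 ?nrm_cmul.
  move=> [v [y z]]; have vv := idem_below_idem v.
  have fE : lact a (f (existT _ v (y, z))) = f (existT _ v (lact a y, z)).
    by rewrite /f /= lractA.
  rewrite fE -Ti // !Tf.
  by rewrite /g /= (tensor_lact (mul_tensor _)) j1_lact.
- move=> x a Dx; have Dax := (mod_ideal_act (I1_ideal t) Dx).2 a.
  apply/eqP; rewrite -subr_eq0; apply/eqP/(null _ (IB _ _ (IT _ Dax) _)) => [|u Du].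
    by have [_ _ _ Ir] := I1_ideal t; apply: (Ir _ _); exact: IT.
  by rewrite (linB (cmul_linearr _)) cmulA !Ti // rip_ract subrr.
move=> v y vt v1; have [lj nj jj] := jmap_spec vt.
have h := nat_leE vt; have vv := nat_le1 v1.
have {}nj (z : E v) : nrm (jmap t z) = nrm z by apply: complexI; rewrite -!nrmE nj.
have Dj z : mod_ideal (E t) (I1 E t) (@jmap _ _ _ E t v z).
  apply: (tensor_image (mul_tensor h) (phi := @jmap _ _ _ E t v) (M := 1)) => // [z'|x y'].
    by rewrite mul1r nj.
  rewrite (jj x y' (fmul h x y')) ?Tagged_mul //; apply: sub_closed_span.
  exists x, (j1 y'); split=> //; apply: (sI_I1 (v := exist _ v (conj vt v1))).
  by rewrite sI_source; apply: sI_j1; exact: idemVg.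
apply: (tensor_eq (mul_tensor h) (phi := fun y => T (jmap t y)) (psi := @j1 _ _ _ E v) (M := 1) (N := 1)).
- by move=> c z z'; rewrite lj Tl.
- exact: j1_linear.
- by move=> z; rewrite mul1r nT // nj.
- by move=> z; rewrite mul1r nrm_j1.
move=> x z; rewrite (jj x z (fmul h x z)) ?Tagged_mul //.
apply: (theta_jmap_cast Tf) => //.
by rewrite (idem_inv vv).
Qed.

End Theta.

End Action.

(** * Covariant representations *)

Section ClosedSubalgebra.
Variables (R : realType) (D : cstarAlgebra R) (L : set D).
Hypotheses (sL : is_subspace L) (cL : closed L).
Hypotheses (mL : forall x y, L x -> L y -> L (x ** y)) (stL : forall x, L x -> L (star x)).

(** The closed span of the fibres in a crossed product has to be a C*-algebra of its own before the
    universal property can be applied to it. *)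
Definition closed_subalgebra := {x : D | L x}.
Local Notation T := closed_subalgebra.

HB.instance Definition _ := gen_eqMixin T.
HB.instance Definition _ := gen_choiceMixin T.

Let ext (x y : T) : sval x = sval y -> x = y.
Proof. by case: x y => x Lx [y Ly] /= e; subst y; congr exist; exact: Prop_irrelevance. Qed.

Let zero : T := exist _ 0 sL.1.
Let add (x y : T) : T := exist _ _ (subspaceD sL (svalP x) (svalP y)).
Let opp (x : T) : T := exist _ _ (subspaceN sL (svalP x)).
Let scale (c : R[i]) (x : T) : T := exist _ _ (subspaceZ c sL (svalP x)).

Let addA : associative add. Proof. by move=> x y z; apply: ext; exact: addrA. Qed.
Let addC : commutative add. Proof. by move=> x y; apply: ext; exact: addrC. Qed.
Let add0 : left_id zero add. Proof. by move=> x; apply: ext; exact: add0r. Qed.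
Let addN : left_inverse zero opp add. Proof. by move=> x; apply: ext; exact: addNr. Qed.

HB.instance Definition _ := GRing.isZmodule.Build T addA addC add0 addN.

Let scaleA a c (x : T) : scale a (scale c x) = scale (a * c) x.
Proof. by apply: ext; exact: scalerA. Qed.
Let scale1 : left_id 1 scale.
Proof. by move=> x; apply: ext; exact: scale1r. Qed.
Let scaleDr : right_distributive scale +%R.
Proof. by move=> a x y; apply: ext; exact: scalerDr. Qed.
Let scaleDl (x : T) : {morph scale^~ x : a c / a + c}.
Proof. by move=> a c; apply: ext; exact: scalerDl. Qed.

HB.instance Definition _ := GRing.Zmodule_isLmodule.Build R[i] T scaleA scale1 scaleDr scaleDl.

Let norm (x : T) : R[i] := `|sval x|.
Let norm_tri (x y : T) : norm (x + y) <= norm x + norm y.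
Proof. exact: ler_normD. Qed.
Let normZ (c : R[i]) (x : T) : norm (c *: x) = `|c| * norm x.
Proof. exact: normrZ. Qed.
Let norm_eq0 (x : T) : norm x = 0 -> x = 0.
Proof. by move=> x0; apply: ext; exact: normr0_eq0. Qed.

HB.instance Definition _ := Lmodule_isNormed.Build R[i] T norm_tri normZ norm_eq0.

Let complete_seq (u : nat -> T) : cauchys u -> exists l, cvs u l.
Proof.
move=> cu; have [l ul] : exists l, cvs (fun n => sval (u n)) l by apply: cauchys_cvs.
have Ll : L l.
  by have /closedP := cL; apply; apply: (cvs_adh ul) => n; exact: (svalP (u n)).
by exists (exist _ l Ll).
Qed.

HB.instance Definition _ := Uniform_isComplete.Build T (seq_complete complete_seq).

Let cm (x y : T) : T := exist _ _ (mL (svalP x) (svalP y)).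
Let st (x : T) : T := exist _ _ (stL (svalP x)).

Let cmA : associative cm. Proof. by move=> x y z; apply: ext; exact: cmulA. Qed.
Let cm_linl b : linear (cm^~ b).
Proof. by move=> c x y; apply: ext; exact: cmul_linearl. Qed.
Let cm_linr a : linear (cm a).
Proof. by move=> c x y; apply: ext; exact: cmul_linearr. Qed.
Let cm_norm a b : `|cm a b| <= `|a| * `|b|. Proof. exact: cmul_norm. Qed.
Let st_sl (c : R[i]) a b : st (c *: a + b) = conjc c *: st a + st b.
Proof. by apply: ext; exact: star_semilinear. Qed.
Let stK : involutive st. Proof. by move=> x; apply: ext; exact: starK. Qed.
Let stM a b : st (cm a b) = cm (st b) (st a). Proof. by apply: ext; exact: starM. Qed.
Let st_cstar a : `|cm (st a) a| = `|a| ^+ 2. Proof. exact: cstar_identity. Qed.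

HB.instance Definition _ := isCStarAlgebra.Build R T cmA cm_linl cm_linr cm_norm
  st_sl stK stM st_cstar.

Lemma closed_subalgebra_exists : exists (D' : cstarAlgebra R) (j : D' -> D),
  [/\ star_hom j, injective j & range j = L].
Proof.
exists (closed_subalgebra : cstarAlgebra R), sval; split.
- by split.
- by move=> x y; exact: ext.
- apply/seteqP; split=> [_ [x _ <-]|x Lx]; first exact: (svalP x).
  by exists (exist _ x Lx).
Qed.

End ClosedSubalgebra.

Section Unit.
Variables (R : realType) (S : inverseMonoidType) (A : cstarAlgebra R).
Variable E : bimodule_action S A.

Lemma unit_linear : linear (unit_iso E). Proof. by case: (unit_isoP E) => -[]. Qed.
Lemma unit_lact a b : unit_iso E (a ** b) = lact a (unit_iso E b).
Proof. by case: (unit_isoP E). Qed.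
Lemma unit_rip a b : rip (unit_iso E a) (unit_iso E b) = star a ** b.
Proof. by case: (unit_isoP E). Qed.
Lemma unit_lip a b : lip (unit_iso E a) (unit_iso E b) = a ** star b.
Proof. by case: (unit_isoP E). Qed.
Lemma sI_unit a : sI (E 1%g) a.
Proof. by apply: (ideal_cstar (sI_ideal _)); rewrite -unit_rip; exact: sI_rip. Qed.

Lemma j1_unit a : j1 (unit_iso E a) = a.
Proof.
have h : (1 * 1 = 1 :> S)%g by rewrite mulg1.
apply/eqP; rewrite -subr_eq0; apply/eqP; apply: (sI_annihilator h); first exact: sI_unit.
by move=> c; rewrite (linB (lact_linearl c)) -(j1_mul h) mul_unitl subrr.
Qed.

Lemma I1_unit a : I1 E 1%g a.
Proof.
apply: sub_closed_span; exists 1%g; last exact: sI_unit.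
by split; exact: nat_le_refl.
Qed.

Lemma theta_mul t v (vt : nat_le v t) (v1 : nat_le v 1%g) (h : (t * v)%g = v)
  (x : E t) (y : E v) : theta (ract x (j1 y)) = j1 (fmul h x y).
Proof.
(* [jmap] is specified on [E (v^-1 v)], which becomes [E v] only after the index is generalised. *)
suff key e (he : (v^-1 * v)%g = e) (h' : (t * e)%g = v) (y' : E e) :
  theta (ract x (j1 y')) = j1 (fmul h' x y').
  by apply: key; rewrite (idem_inv (nat_le1 v1)) nat_le1.
subst e; have [_ _ jj] := jmap_spec E vt.
rewrite -(jj x y' (fmul h' x y')) ?Tagged_mul //.
by have [_ _ _ _ ->] := theta_spec E t.
Qed.

Lemma theta_unit a b : theta (ract (unit_iso E a) b) = a ** b.
Proof.
have h : (1 * 1 = 1 :> S)%g by rewrite mulg1.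
rewrite -{1}(j1_unit b) (theta_mul (nat_le_refl _) (nat_le_refl _) h).
by rewrite mul_unitl -unit_lact j1_unit.
Qed.

Lemma theta_I1 t (x : E t) a : I1 E t a -> I1 E t (theta (ract x a)).
Proof.
move=> Ia; have [_ [_ tr] _ _ _] := theta_spec E t.
rewrite -[X in X (theta _)]tr; exists (ract x a) => //.
by apply: sub_closed_span; exists x, a.
Qed.

Section Er.
Variables (D : cstarAlgebra R) (pi : forall t, E t -> D).
Variable (Er : D -> (A -> R[i]) -> R[i]).
Hypothesis ErP : is_Er pi Er.

Lemma bounded_functional_nrm (f : A -> R[i]) : bounded_functional f ->
  exists M : R, 0 <= M /\ forall a, nrm (f a) <= M * nrm a.
Proof.
move=> [_ [M fM]]; exists (nrm M); split=> [|a]; first exact: nrm_ge0.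
have := fM a; rewrite !nrmE => h; have : 0 <= M * (nrm a)%:C.
  by apply: le_trans h; rewrite ler0c nrm_ge0.
by move/nrm_ge0E => e; move: h; rewrite lecE -e nrmM nrmC ger0_norm ?nrm_ge0 // => /andP[].
Qed.

Lemma Er_unit f a : bounded_functional f -> Er (pi (unit_iso E a)) f = f a.
Proof.
move=> bf; have [lf _] := bf; have [M [M0 fM]] := bounded_functional_nrm bf.
have [_ _ _ _ ErC] := ErP.
have [T [F [u au]]] := approx_unit_exists (I1_ideal E 1%g).
have [FF _ aul _] := au.
have h := ErC _ (unit_iso E a) T F u au f bf.
apply: (cvg_unique _ h); first exact: norm_hausdorff.
have -> : (fun i => f (theta (ract (unit_iso E a) (u i))) : R[i]^o) = (fun i => f (a ** u i)).
  by apply/funext => i; rewrite theta_unit.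
have := aul a (I1_unit a) => /cvgrPdist_lt ha.
apply/cvgrPdist_lt => c c0.
have [e eE] : exists e, c = e%:C :> R[i] by exists (complex.Re c); rewrite re_real // ltW.
have ep : 0 < e by rewrite -ltcR -eE.
have M1 : 0 < M + 1 by rewrite ltr_wpDl.
have := ha (e / (M + 1))%:C; rewrite ltcR divr_gt0 // => /(_ isT).
apply: filterS => i; rewrite -(sclB lf) eE !nrmE !ltcR => hi.
apply: le_lt_trans (fM _) _.
exact: (mul_lt_div M0 (nrm_ge0 _) M0 (lexx _) hi).
Qed.

(** The values of [theta] lie in [I1 E t], so the net that converges to the value of [Er] is
    constantly zero. *)
Lemma Er_kill f t (x : E t) : bounded_functional f -> (forall a, I1 E t a -> f a = 0) ->
  Er (pi x) f = 0.
Proof.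
move=> bf f0; have [_ _ _ _ ErC] := ErP.
have [T [F [u au]]] := approx_unit_exists (I1_ideal E t).
have [FF uI _ _] := au.
have h := ErC _ x T F u au f bf.
apply: (cvg_unique _ h); first exact: norm_hausdorff.
have -> : (fun i => f (theta (ract x (u i))) : R[i]^o) = (fun i => 0).
  by apply/funext => i; rewrite f0 //; apply: theta_I1; case: (uI i).
exact: cvg_cst.
Qed.

End Er.

Section Covariant.
Variables (D : cstarAlgebra R) (P : forall t, E t -> D).
Hypothesis Pcov : covariant P.
Let P1 a := P (unit_iso E a).

Lemma cov_linear t : linear (@P t). Proof. by case: Pcov. Qed.

Lemma cov_mul t u s (h : (t * u)%g = s) (x : E t) (y : E u) : P x ** P y = P (fmul h x y).
Proof. by case: _ / h; case: Pcov => _ ->. Qed.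

Lemma cov_rip t (x y : E t) : star (P x) ** P y = P1 (rip x y).
Proof. by case: Pcov. Qed.

Lemma cov_lip t (x y : E t) : P x ** star (P y) = P1 (lip x y).
Proof. by case: Pcov. Qed.

Lemma cov_lact t a (x : E t) : P1 a ** P x = P (lact a x).
Proof. by rewrite (cov_mul (mul1g t)) mul_unitl. Qed.

Lemma cov_ract t (x : E t) a : P x ** P1 a = P (ract x a).
Proof. by rewrite (cov_mul (mulg1 t)) mul_unitr. Qed.

(** That [P1] preserves the involution is derived. For [d = star (P1 a) - P1 (star a)], the relation
    for right inner products gives [d ** P1 b = 0], and the one for left inner products then gives
    [d ** star d = 0]. *)
Lemma cov_hom : star_hom P1.
Proof.
have lP : linear P1 by move=> c a b; rewrite /P1 unit_linear cov_linear.
have mP a b : P1 (a ** b) = P1 a ** P1 b by rewrite cov_lact -unit_lact.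
split=> // a; apply/eqP; rewrite eq_sym -subr_eq0; apply/eqP/cstar_eq0'.
have k1 b : (star (P1 a) - P1 (star a)) ** P1 b = 0.
  by rewrite cmulDl cmulNl cov_rip unit_rip -mP subrr.
have k2 : P1 (star a) ** star (P1 (star a)) = P1 (star a ** a).
  by rewrite [LHS]cov_lip unit_lip starK.
rewrite [star (_ - _)]starB starK cmulDr k1 add0r cmulNr -[X in - X]starK starM starK.
by rewrite starB starK cmulDr cmulNr k2 mP subrr star0 oppr0.
Qed.

Lemma cov_contr t (x : E t) : nrm (P x) <= nrm x.
Proof.
rewrite -(ler_pXn2r (n := 2)) ?nnegrE ?nrm_ge0 // -nrm_cstar cov_rip -nrm_rip.
exact: (star_hom_contr cov_hom).
Qed.

(** The difference [d] is annihilated from the left by the images of [E e], hence by that of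
    [sI (E e)]. Both [P x] and [P1 (j1 x)] are approximately or exactly reached through this ideal,
    so [star d ** d = 0]. *)
Lemma cov_idem e (x : E e) : (e * e)%g = e -> P x = P1 (j1 x).
Proof.
move=> ee; apply/eqP; rewrite -subr_eq0; set d := _ - _.
have [lP mP sP] := cov_hom.
have k1 (y : E e) : P y ** d = 0.
  by rewrite /d cmulDr cmulNr (cov_mul ee) cov_ract j1_mul' // subrr.
have k2 a : sI (E e) a -> P1 a ** d = 0.
  move=> /sI_span; move: a.
  apply: (@closed_span_image _ _ _ (fun a => P1 a ** d) (nrm d) _ _ _ [set 0]).
  - by move=> c a b; rewrite lP cmulDl cmulZl.
  - move=> a; apply: le_trans (nrm_cmul _ _) _; rewrite mulrC ler_wpM2l ?nrm_ge0 //.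
    exact: (star_hom_contr cov_hom).
  - exact: subspace_zero.
  - exact: closed_zero.
  - by move=> _ [y [z ->]] /=; rewrite -cov_rip -cmulA k1 cmul0r.
apply/eqP/cstar_eq0/nrm_small => r r0.
have r1 : 0 < r / (nrm d + 1) by rewrite divr_gt0 // ltr_wpDl ?nrm_ge0.
have [u [Eu _ xu]] := lact_unit x r1.
have h1 : star (P (lact u x)) ** d = 0.
  rewrite -cov_lact starM -sP -cmulA k2 ?cmul0r //.
  by apply: (ideal_star (sI_ideal _)); exact: (idem_rI ee).
have h2 : star (P1 (j1 x)) ** d = 0.
  by rewrite -sP k2 //; apply: (ideal_star (sI_ideal _)); exact: sI_j1.
have -> : star d ** d = star (P x) ** d.
  by rewrite {1}/d starB cmulDl cmulNl h2 subr0.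
have -> : star (P x) ** d = star (P (x - lact u x)) ** d.
  have -> : P (x - lact u x) = P x - P (lact u x) by exact: (linB (@cov_linear _)).
  by rewrite [in RHS]starB [RHS]cmulDl cmulNl h1 subr0.
apply: le_lt_trans (nrm_cmul _ _) _; rewrite nrm_star mulrC.
apply: (mul_lt_div (nrm_ge0 d) (nrm_ge0 _) (nrm_ge0 d) (lexx _)).
exact: le_lt_trans (cov_contr _) xu.
Qed.

Lemma cov_theta t v (vt : nat_le v t) (v1 : nat_le v 1%g) (h : (t * v)%g = v)
  (x : E t) (y : E v) : P x ** P1 (j1 y) = P1 (j1 (fmul h x y)).
Proof.
have vv := nat_le1 v1; rewrite -!cov_idem //.
exact: cov_mul.
Qed.

(** Approximate [x] by [ract x u] with [u] in [sI (E t)]. The factor [star u] is a limit of sums of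
    products of [y] in [E t^-1] and [z] in [E t], and [P z ** star (P x)] lies in the image of [A];
    so the adjoint lies in the image of [E t^-1]. *)
Lemma cov_star t (x : E t) :
  closed_span [set d | exists t (x : E t), d = P x] (star (P x)).
Proof.
set X := [set d | _]; set L := closed_span X.
have sL : is_subspace L := subspace_span X.
have cL : closed L := @closed_closed_span _ _ X.
have /closedP := cL; apply=> e e0.
have [u [Eu _ xu]] := ract_unit x e0.
exists (star (P (ract x u))); last first.
  rewrite -starB nrm_star -(linB (@cov_linear _)).
  exact: le_lt_trans (cov_contr _) xu.
have ee := idemVg t; have [lP mP sP] := cov_hom.
rewrite -cov_ract starM -sP.
have : sI (E t) (star u) by apply: (ideal_star (sI_ideal _)).
rewrite sI_source -(j1_range E ee) => -[w _ <-]; rewrite -cov_idem //.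
apply: (tensor_image (mu_tensor E t^-1%g t) (phi := fun w => P w ** star (P x))
  (M := nrm (P x)) _ _ sL cL).
- by move=> c y z; rewrite cov_linear !cexp.
- move=> y; apply: le_trans (nrm_cmul _ _) _; rewrite nrm_star mulrC.
  by rewrite ler_wpM2l ?nrm_ge0 // cov_contr.
move=> y z; case: Pcov => _ <- _ _; rewrite -cmulA cov_lip cov_ract.
by apply: sub_closed_span; exists t^-1%g, (ract y (lip z x)).
Qed.

End Covariant.

(** The closed span is a C*-algebra through which [pi] factors. The universal property gives a map
    [h] to it, and uniqueness makes [j \o h] the identity. *)
Lemma crossed_product_span (D : cstarAlgebra R) (pi : forall t, E t -> D) :
  is_crossed_product pi -> closed_span [set d | exists t (x : E t), d = pi t x] = setT.
Proof.
move=> [cov univ]; set X := [set d | _]; set L := closed_span X.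
have sL : is_subspace L := subspace_span X.
have cL : closed L := @closed_closed_span _ _ X.
have mL x y : L x -> L y -> L (x ** y).
  move=> Lx Ly.
  apply: (closed_span_image (cmul_linearl y) (M := nrm y) _ sL cL _ Lx).
    by move=> z; rewrite mulrC nrm_cmul.
  move=> _ [t [a ->]].
  apply: (closed_span_image (cmul_linearr _) (nrm_cmul _) sL cL _ Ly).
  move=> _ [u [b ->]]; apply: sub_closed_span; exists (t * u)%g, (mu a b).
  by case: cov => _ ->.
have stL x : L x -> L (star x).
  have lst : is_subspace [set x | L (star x)].
    split=> [|c a b La Lb] /=; first by rewrite star0; exact: sL.1.
    by rewrite star_semilinear; exact: sL.2.
  apply: (@closed_span_ind _ _ X [set x | L (star x)]) => //.
    apply/closedP => y ay /=; have /closedP := cL; apply=> e /ay[z Lz yz].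
    by exists (star z) => //; rewrite -starB nrm_star.
  by move=> _ [t [a ->]]; exact: cov_star.
have [D' [j [jh ji jr]]] := closed_subalgebra_exists sL cL mL stL.
have [lj mj sj] := jh.
have /choice[rho0 Hrho] (p : {t : S & E t}) : exists d', j d' = pi (tag p) (tagged p).
  have : range j (pi (tag p) (tagged p)).
    by rewrite jr; apply: sub_closed_span; exists (tag p), (tagged p).
  by case=> d' _ <-; exists d'.
pose rho t (x : E t) : D' := rho0 (existT _ t x).
have Hr t (x : E t) : j (rho t x) = pi t x by rewrite /rho Hrho.
have [c1 c2 c3 c4] := cov.
have rcov : covariant rho.
  split=> [t c x y|t u x y|t x y|t x y]; apply: ji.
  - by rewrite lj !Hr c1.
  - by rewrite mj !Hr c2.
  - by rewrite mj sj !Hr c3.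
  - by rewrite mj sj !Hr c4.
have [h [[[lh mh sh] hE] _]] := univ D' rho rcov.
have [k [_ kU]] := univ D pi cov.
have e1 : k = j \o h.
  apply: kU; split=> [|t x /=]; last by rewrite hE Hr.
  by split=> [c x y|x y|x] /=; rewrite ?lh ?lj ?mh ?mj ?sh ?sj.
have e2 : k = id by apply: kU; split=> //; split.
apply/seteqP; split=> // d _; rewrite -jr; exists (h d) => //.
by have := congr1 (fun f => f d) e1; rewrite e2.
Qed.

End Unit.

(** * Weak density of vector states *)

Section UltraLimits.
Variables (R : realType) (T : Type) (U : set_system T).
Context {UU : UltraFilter U}.

Definition ultralimit (u : T -> R[i]) (l : R[i]) :=
  forall e : R, 0 < e -> U [set t | nrm (l - u t) < e].

Lemma ultralimit_real (u : T -> R) (M : R) : U [set t | `|u t| <= M] ->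
  exists l, forall e, 0 < e -> U [set t | `|l - u t| < e].
Proof.
move=> uM; pose E := [set r | U [set t | r <= u t]].
have sE : has_sup E.
  split.
    exists (- M); apply: filterS uM => t /=; rewrite ler_norml => /andP[] //.
  exists M => r Er; have [t [/= h1 h2]] := filter_ex (filterI Er uM).
  by apply: le_trans h1 _; apply: le_trans h2; exact: ler_norm.
exists (sup E) => e e0.
have [r Er rl] := sup_adherent e0 sE.
have [h|h] := in_ultra_setVsetC [set t | sup E + e / 2 <= u t] UU.
  have : sup E + e / 2 <= sup E by apply: ub_le_sup => //; exact: sE.2.
  by move=> ?; lra.
apply: filterS (filterI Er h) => t [/= h1 /negP]; rewrite -ltNge => h2.
by rewrite ltr_norml; apply/andP; split; lra.
Qed.

Lemma ultralimit_ex (u : T -> R[i]) (M : R) : U [set t | nrm (u t) <= M] ->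
  exists l, ultralimit u l.
Proof.
move=> uM.
have [|a Ha] := @ultralimit_real (fun t => complex.Re (u t)) M.
  by apply: filterS uM => t /=; apply: le_trans; exact: Re_le_nrm.
have [|b Hb] := @ultralimit_real (fun t => complex.Im (u t)) M.
  by apply: filterS uM => t /=; apply: le_trans; exact: Im_le_nrm.
exists (a +i* b)%C => e e0; have e2 : 0 < e / 2 by rewrite divr_gt0.
apply: filterS (filterI (Ha _ e2) (Hb _ e2)) => t [/= h1 h2].
apply: le_lt_trans (nrm_le_ReIm _) _; rewrite (splitr e).
by move: h1 h2; case: (u t) => x y /= h1 h2; rewrite ltrD.
Qed.

Lemma ultralimit_uniq u l l' : ultralimit u l -> ultralimit u l' -> l = l'.
Proof.
move=> ul ul'; apply/eqP; rewrite -subr_eq0; apply/eqP/nrm_small => e e0.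
have e2 : 0 < e / 2 by rewrite divr_gt0.
have [t [/= h1 h2]] := filter_ex (filterI (ul _ e2) (ul' _ e2)).
by rewrite (le_lt_trans (nrm_tri (u t) _ _)) // (splitr e) ltrD // nrmBC.
Qed.

Lemma ultralimit_ext u v l : U [set t | u t = v t] -> ultralimit u l -> ultralimit v l.
Proof. by move=> uv ul e e0; apply: filterS (filterI uv (ul _ e0)) => t [/= ->]. Qed.

Lemma ultralimit_cst c : ultralimit (fun=> c) c.
Proof. by move=> e e0; apply: filterE => t /=; rewrite subrr nrm0. Qed.

Lemma ultralimit_lin c u v l m : ultralimit u l -> ultralimit v m ->
  ultralimit (fun t => c * u t + v t) (c * l + m).
Proof.
move=> ul vm e e0; have e2 : 0 < e / 2 by rewrite divr_gt0.
have e3 : 0 < e / 2 / (nrm c + 1) by rewrite divr_gt0 // ltr_wpDl ?nrm_ge0.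
apply: filterS (filterI (ul _ e3) (vm _ e2)) => t [/= h1 h2].
have -> : c * l + m - (c * u t + v t) = c * (l - u t) + (m - v t) by ring.
apply: le_lt_trans (nrmD _ _) _; rewrite (splitr e) ltrD // nrmM.
exact: (mul_lt_div (nrm_ge0 c) (nrm_ge0 _) (nrm_ge0 c) (lexx _) h1).
Qed.

Lemma ultralimit_sum n (u : 'I_n -> T -> R[i]) (l : 'I_n -> R[i]) :
  (forall j, ultralimit (u j) (l j)) ->
  ultralimit (fun t => \sum_j u j t) (\sum_j l j).
Proof.
move=> ul; elim: (index_enum _) => [|j r IH].
  rewrite big_nil; apply: ultralimit_ext (ultralimit_cst 0).
  by apply: filterE => t /=; rewrite big_nil.
rewrite big_cons -[l j]mul1r; apply: ultralimit_ext (ultralimit_lin 1 (ul j) IH).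
by apply: filterE => t /=; rewrite big_cons mul1r.
Qed.

Lemma ultralimit_nrm u v l m : U [set t | nrm (u t) <= complex.Re (v t)] ->
  ultralimit u l -> ultralimit v m -> nrm l <= complex.Re m.
Proof.
move=> uv ul vm; apply: (@le_eps _ _ _ 2) => e e0.
have [t [/= h1 [h2 h3]]] := filter_ex (filterI uv (filterI (ul _ e0) (vm _ e0))).
have := nrmD (l - u t) (u t); rewrite subrK.
have := Re_le (v t - m); rewrite ReB nrmBC.
by move: h1 h2 h3; lra.
Qed.

Lemma ultralimit_Re u v l m : U [set t | complex.Re (u t) <= complex.Re (v t)] ->
  ultralimit u l -> ultralimit v m -> complex.Re l <= complex.Re m.
Proof.
move=> uv ul vm; apply: (@le_eps _ _ _ 2) => e e0.
have [t [/= h1 [h2 h3]]] := filter_ex (filterI uv (filterI (ul _ e0) (vm _ e0))).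
have := Re_le (l - u t); rewrite ReB.
have := Re_le (v t - m); rewrite ReB nrmBC.
by move: h1 h2 h3; lra.
Qed.

Lemma nrm_le_Re (c : R[i]) : nrm c <= complex.Re c -> 0 <= c.
Proof.
move=> h; have c0 := le_trans (nrm_ge0 c) h; rewrite lecE c0 andbT.
have := nrm_sqr c; case: c h c0 => x y /= h c0 /(congr1 (@complex.Re R)) /= e.
rewrite -sqrf_eq0 eq_le sqr_ge0 andbT.
have : nrm (x +i* y)%C ^+ 2 <= x ^+ 2 by rewrite ler_pXn2r ?nnegrE ?nrm_ge0.
by rewrite e; lra.
Qed.

Lemma ultralimit_ge0 u l : U [set t | 0 <= u t] -> ultralimit u l -> 0 <= l.
Proof.
move=> u0 ul; apply: nrm_le_Re; apply: (ultralimit_nrm _ ul ul).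
by apply: filterS u0 => t /= h; rewrite (nrm_ge0E h).
Qed.

End UltraLimits.

Section WeakDensity.
Variables (R : realType) (A : cstarAlgebra R).

Definition vector_states (Pd : spectrum A -> Prop) : set (A -> R[i]) :=
  [set psi | exists x (rho : irrep A) (eta : irrep_space rho),
    [/\ Pd x, sval x rho, nrm eta = 1 & forall a, psi a = inner eta (rho a eta)]].

Lemma vector_states_pure Pd psi : vector_states Pd psi -> pure_states psi.
Proof.
move=> [x [rho [eta [_ _ e1 E]]]].
have -> : psi = fun a => inner eta (rho a eta) by apply/funext.
exact: (irr_pure (irrep_rep rho) (irrep_irr rho)).
Qed.

Lemma vector_states_state Pd psi : vector_states Pd psi -> is_state psi.
Proof. by case/vector_states_pure. Qed.

Section Fixed.
Variable Pd : spectrum A -> Prop.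
Hypothesis denseP : spectrum_dense Pd.
Variables (f : A -> R[i]) (rho : irrep A) (xi : irrep_space rho).
Hypotheses (fE : forall a, f a = inner xi (rho a xi)) (xi1 : nrm xi = 1)
  (cxi : forall y, adh [set rho a xi | a in setT] y).

Let rep := irrep_rep rho.

(** The elements killed by all representations in [Pd] form an ideal, which contains [c]. If [rho c]
    were nonzero, the open set of this ideal would be nonempty and would contain a point of [Pd]. *)
Lemma vector_states_kernel c :
  (forall psi b, vector_states Pd psi -> psi (star b ** star c ** c ** b) = 0) ->
  forall y, rho c y = 0.
Proof.
move=> h; apply: contrapT => /existsNP[y0 cy0].
pose K := [set c | forall x (sigma : irrep A) (eta : irrep_space sigma), Pd x -> sval x sigma ->
  sigma c eta = 0].
have iK : is_ideal K.
  split.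
  - split=> [x s eta _ _|k u v Ku Kv x s eta Px xs].
      exact: (lin0 (rep_linl (irrep_rep s) eta)).
    by rewrite (rep_linl (irrep_rep s)) (Ku x) // (Kv x) // scaler0 addr0.
  - apply/closedP => u uK x s eta Px xs.
    apply: (@lip_adh0 _ _ _ (fun u : A => s u eta) (nrm eta) K u) uK => [v w|v Kv].
      by rewrite -(linB (rep_linl (irrep_rep s) eta)) mulrC; exact: (rep_contr (irrep_rep s)).
    exact: Kv Px xs.
  - move=> a u Ku x s eta Px xs.
    by rewrite (repM (irrep_rep s)) (Ku x) // (lin0 (rep_lin (irrep_rep s) a)).
  - by move=> a u Ku x s eta Px xs; rewrite (repM (irrep_rep s)) (Ku x).
have Kc : K c.
  move=> x s eta Px xs; apply: contrapT => ce.
  have e0 : nrm eta != 0.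
    by apply/eqP => /nrm_eq0 e0; apply: ce; rewrite e0 (lin0 (rep_lin (irrep_rep s) c)).
  have ep : 0 < nrm eta by rewrite lt_neqAle eq_sym e0 nrm_ge0.
  pose w := (nrm eta)^-1%:C *: eta.
  have w1 : nrm w = 1 by rewrite nrmZ nrmC gtr0_norm ?invr_gt0 // mulVf.
  have cw := irr_cyclic (irrep_rep s) (irrep_irr s) (nrm1_neq0 w1).
  have vs : vector_states Pd (fun a => inner w (s a w)) by exists x, s, w.
  apply: ce; apply: (@lip_adh0 _ _ _ (s c) (nrm c) _ eta _ _ (cw eta)) => [u v|_ [b _ <-]].
    by rewrite -(linB (rep_lin (irrep_rep s) c)); exact: (rep_contr (irrep_rep s)).
  apply: ip_eq0; have := h _ b vs.
  by rewrite -!cmulA !(repM (irrep_rep s)) -!(rep_adj' (irrep_rep s)).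
have [y [[r' xr' [a [v [Ka av]]]] Py]] : exists y, spectrum_open K y /\ Pd y.
  apply: denseP => //; exists (spectrum_of rho); exists rho; first exact: spectrum_of_mem.
  by exists c, y0.
by apply: av; exact: Ka Py xr'.
Qed.

Lemma vector_states_order_sa a (s : R) : star a = a ->
  (forall psi, vector_states Pd psi -> complex.Re (psi a) <= s) -> complex.Re (f a) <= s.
Proof.
move=> sa bnd.
have N0 : 0 < nrm a + `|s| + 1 by rewrite ltr_wpDl // addr_ge0 ?nrm_ge0.
pose N := nrm a + `|s| + 1; rewrite -/N in N0.
pose X (b : A) := N^-1%:C *: (a ** b - s%:C *: b).
have lX : linear X by move=> c u v; rewrite /X !cexp; lmod.
have aX : sa_op X.
  by move=> u v; rewrite /X !cexp !conjc_real sa.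
have cX b : nrm (X b) <= nrm b.
  rewrite nrmZ nrmC gtr0_norm ?invr_gt0 // mulrC ler_pdivrMr // mulrC.
  apply: le_trans (nrmB _ _) _; rewrite nrmZ nrmC.
  have := nrm_cmul a b; have := nrm_ge0 b; rewrite /N.
  by move: (nrm (_ ** _)) (nrm b) (nrm a) `|s| => *; nra.
have [P [Q [[lP lQ aQ QQ PP] [XP PQ]]]] := abs_op lX aX cX.
have aP u v : star (P u) ** v = star u ** P v by rewrite -!QQ !aQ.
(* [P = |X|], and [X <= 0] in the representations of [Pd], so these kill [P + X]. *)
have main b y : rho (P b + X b) y = 0.
  pose c := P b + X b.
  have Xc : X c = P c by rewrite /c (linD lX) (linD lP) XP PP addrC.
  have cPc : star c ** P c = star (Q c) ** Q c by rewrite -QQ aQ.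
  have cc : star c ** c = star (Q b) ** Q c + star (Q b) ** Q c.
    rewrite {1}/c starD cmulDl aP aX Xc -QQ -aQ.
    by [].
  apply: vector_states_kernel => psi d [x [sg [eta [Px xs e1 psiE]]]].
  have rs := irrep_rep sg.
  (* [star (Q c) ** Q c = star c ** P c = star c ** X c], which is at most 0 in [sg] by the bound
     for the vector state at the normalised [sg c w]. Then [star c ** c = 2 star (Q b) ** Q c]
     vanishes there. *)
  have Q0 w : sg (Q c) w = 0.
    have [->|wn] := pselect (w = 0); first exact: (lin0 (rep_lin rs _)).
    apply: nrm_eq0; apply/eqP; rewrite -sqrf_eq0 eq_le exprn_ge0 ?nrm_ge0 // andbT.
    rewrite nrm_ip (rep_sqr rs) -cPc -Xc.
    have -> : star c ** X c = N^-1%:C *: (star c ** a ** c - s%:C *: (star c ** c)).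
      by rewrite /X !cexp.
    rewrite (linZ (rep_linl rs w)) ipZr Re_realM pmulr_rle0 ?invr_gt0 //.
    rewrite (linB (rep_linl rs w)) (linZ (rep_linl rs w)) ipBr ipZr ReB Re_realM subr_le0.
    rewrite -(rep_sqr rs) -cmulA !(repM rs) -(rep_adj' rs).
    set z := sg c w; have [z0|zn] := eqVneq (nrm z) 0.
      by rewrite (nrm_eq0 z0) !ip0l mulr0.
    have zp : 0 < nrm z by rewrite lt_neqAle eq_sym zn nrm_ge0.
    pose z' := (nrm z)^-1%:C *: z.
    have z1 : nrm z' = 1 by rewrite nrmZ nrmC gtr0_norm ?invr_gt0 // mulVf.
    have := bnd (fun a => inner z' (sg a z')); rewrite /z' => /(_ _) hb.
    have {}hb : complex.Re (inner z' (sg a z')) <= s by apply: hb; exists x, sg, z'.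
    rewrite -nrm_ip; move: hb; rewrite /z' (linZ (rep_lin rs a)) ipZl ipZr conjc_real.
    rewrite !Re_realM mulrA -expr2 exprVn mulrC ler_pdivrMr ?exprn_gt0 //.
  have -> : star d ** star c ** c ** d = star d ** (star c ** c) ** d by rewrite !cmulA.
  rewrite cc psiE !(repM rs) (linD (rep_linl rs _)) !(repM rs) Q0.
  by rewrite (lin0 (rep_lin rs _)) addr0 (lin0 (rep_lin rs _)) ip0r.
have key b : complex.Re (inner (rho b xi) (rho a (rho b xi))) <= s * nrm (rho b xi) ^+ 2.
  have h : inner (rho b xi) (rho (X b) xi) = - inner xi (rho (star (Q b) ** Q b) xi).
    have := main b xi; rewrite (linD (rep_linl rep xi)) => /eqP.
    rewrite addrC addr_eq0 => /eqP ->; rewrite ipNr; congr (- _).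
    by rewrite aQ QQ (repM rep) (rep_adj' rep).
  have : complex.Re (inner (rho b xi) (rho (X b) xi)) <= 0.
    by rewrite h ReN oppr_le0 -(rep_sqr rep) -nrm_ip exprn_ge0 ?nrm_ge0.
  rewrite /X (linZ (rep_linl rep xi)) ipZr Re_realM pmulr_rle0 ?invr_gt0 //.
  rewrite (linB (rep_linl rep xi)) (linZ (rep_linl rep xi)) ipBr ipZr ReB Re_realM subr_le0.
  by rewrite (repM rep) -nrm_ip.
(* [X] is an operator on [A], so the inequality is available only at vectors [rho b xi]; [xi] itself
   is approximated by [rho u xi]. *)
rewrite fE; apply: (@le_eps _ _ _ (2 * nrm a + 2 * `|s|)) => e e0.
have [u [u1 xu]] := cyclic_unit rep cxi e0.
set y := rho u xi in xu *.
have ky : complex.Re (inner y (rho a y)) <= s * nrm y ^+ 2 := key u.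
have y1 : nrm y <= 1.
  by apply: le_trans (rep_contr rep _ _) _; rewrite xi1 mulr1.
have y0 : 1 - nrm y < e.
  by have := nrmD (xi - y) y; rewrite subrK xi1; move: xu; lra.
have d1 : nrm (inner (xi - y) (rho a xi)) <= nrm a * e.
  apply: le_trans (ip_le _ _) _; rewrite mulrC ler_pM ?nrm_ge0 ?(ltW xu) //.
  by apply: le_trans (rep_contr rep _ _) _; rewrite xi1 mulr1.
have d2 : nrm (inner y (rho a (xi - y))) <= nrm a * e.
  apply: le_trans (ip_le _ _) _; rewrite -[leRHS]mul1r ler_pM ?nrm_ge0 //.
  apply: le_trans (rep_contr rep _ _) _; rewrite ler_pM ?nrm_ge0 ?(ltW xu) //.
have -> : inner xi (rho a xi) =
    inner (xi - y) (rho a xi) + inner y (rho a (xi - y)) + inner y (rho a y).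
  by rewrite (linB (rep_lin rep a)) ipBr ipBl; ring.
rewrite !ReD; have := Re_le (inner (xi - y) (rho a xi)); have := Re_le (inner y (rho a (xi - y))).
have : s * nrm y ^+ 2 <= s + 2 * `|s| * e.
  have := ler_norm (- s); rewrite normrN; have := nrm_ge0 y; have := normr_ge0 s.
  move: y0 y1; move: (nrm y) `|s| => p q h1 h2 q0 p0 h3.
  have h4 : 0 <= 1 - p ^+ 2 by nra.
  have h5 : 1 - p ^+ 2 <= 2 * e by nra.
  have : - s * (1 - p ^+ 2) <= q * (1 - p ^+ 2) by rewrite ler_wpM2r.
  have : q * (1 - p ^+ 2) <= q * (2 * e) by rewrite ler_wpM2l.
  by lra.
by move: ky d1 d2; lra.
Qed.

Lemma state_real_part (g : A -> R[i]) a : is_state g ->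
  complex.Re (g (2^-1 *: (a + star a))) = complex.Re (g a).
Proof.
move=> sg; have pg := state_positive sg; have [lg _] := pg.
have h : (2^-1 : R[i]) = (2^-1 : R)%:C by rewrite fmorphV /= rmorph_nat.
rewrite h (sclZ lg) (sclD lg) (functional_star pg (state_nrm sg)) Re_realM ReD.
have -> : complex.Re (conjc (g a)) = complex.Re (g a) by case: (g a).
by field.
Qed.

Lemma vector_states_order a (s : R) :
  (forall psi, vector_states Pd psi -> complex.Re (psi a) <= s) -> complex.Re (f a) <= s.
Proof.
have sf : is_state f.
  have -> : f = fun a => inner xi (rho a xi) by apply/funext.
  exact: (vector_state rep cxi xi1).
move=> h; rewrite -(state_real_part a sf); apply: vector_states_order_sa.
  rewrite starZ starD starK addrC; congr (_ *: _).
  have -> : (2^-1 : R[i]) = (2^-1 : R)%:C by rewrite fmorphV /= rmorph_nat.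
  exact: conjc_real.
by move=> psi vp; rewrite (state_real_part a (vector_states_state vp)); exact: h.
Qed.

Lemma Re_lincomb (g : A -> R[i]) m (d : 'I_m -> R) (h : 'I_m -> A) : scalar g ->
  complex.Re (g (\sum_j (d j)%:C *: h j)) = \sum_j d j * complex.Re (g (h j)).
Proof.
move=> lg; rewrite (scl_sum lg) (big_morph (@complex.Re R) (@ReD R) erefl).
by apply: eq_bigr => j _; rewrite (sclZ lg) Re_realM.
Qed.

Section HalfPlanes.
Variables (n : nat) (k : 'I_n -> A) (s : 'I_n -> R).

(* Convex combinations of states violating one of the inequalities
   [complex.Re (psi (k j)) < s j], grouped by [j]; [L j] is the mass of the group [j]. *)
Definition outer_combination (G : 'I_n -> A -> R[i]) (L : 'I_n -> R) :=
  [/\ forall j, positive_functional (G j), forall j a, nrm (G j a) <= L j * nrm a,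
      forall j, L j * s j <= complex.Re (G j (k j)), forall j, 0 <= L j
    & \sum_j L j = 1].

Definition total (G : 'I_n -> A -> R[i]) (a : A) := \sum_j G j a.

Lemma total_scalar G L : outer_combination G L -> scalar (total G).
Proof.
move=> [pG _ _ _ _] c a b; rewrite /total mulr_sumr -big_split /=.
by apply: eq_bigr => j _; have [lG _] := pG j; rewrite lG.
Qed.

Lemma outer_combination_convex G L G' L' (t : R) : 0 <= t -> t <= 1 ->
  outer_combination G L -> outer_combination G' L' ->
  outer_combination (fun j a => (1 - t)%:C * G j a + t%:C * G' j a)
    (fun j => (1 - t) * L j + t * L' j).
Proof.
move=> t0 t1 [pG nG hG L0 sL] [pG' nG' hG' L0' sL'].
have t1' : 0 <= 1 - t by rewrite subr_ge0.
split=> [j|j a|j|j|].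
- have [lG p0] := pG j; have [lG' p0'] := pG' j; split=> [c a b|a].
    by rewrite lG lG'; ring.
  by rewrite addr_ge0 // mulr_ge0 ?ler0c.
- apply: le_trans (nrmD _ _) _; rewrite !nrmM !nrmC !ger0_norm // [leRHS]mulrDl -!mulrA.
  by rewrite lerD // ler_wpM2l.
- by rewrite ReD !Re_realM [leLHS]mulrDl -!mulrA lerD // ler_wpM2l.
- by rewrite addr_ge0 // mulr_ge0.
- by rewrite big_split /= -!mulr_sumr sL sL' !mulr1 subrK.
Qed.

Lemma total_convex G G' (t : R) a :
  total (fun j a => (1 - t)%:C * G j a + t%:C * G' j a) a =
  (1 - t)%:C * total G a + t%:C * total G' a.
Proof. by rewrite /total big_split /= -!mulr_sumr. Qed.

Hypothesis outer : forall psi, vector_states Pd psi -> exists j, s j <= complex.Re (psi (k j)).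

Lemma vector_state_outer psi : vector_states Pd psi ->
  exists G L, outer_combination G L /\ forall a, total G a = psi a.
Proof.
move=> vp; have [j hj] := outer vp; have sp := vector_states_state vp.
exists (fun i a => if i == j then psi a else 0), (fun i => if i == j then 1 else 0).
split; last by move=> a; rewrite /total -big_mkcond big_pred1_eq.
split=> [i|i a|i|i|].
- case: eqP => _; first exact: state_positive.
  by split=> // c a b; rewrite mulr0 addr0.
- case: eqP => _; first by rewrite mul1r (state_nrm sp).
  by rewrite nrm0 mul0r.
- by case: eqP => [->|_] /=; rewrite ?mul1r ?mul0r.
- by case: eqP.
- by rewrite -big_mkcond big_pred1_eq.
Qed.

Lemma outer_exists : exists G L, outer_combination G L.
Proof.
have [y [[sg ysg [a [eta [_ ae]]]] Py]] : exists y, spectrum_open setT y /\ Pd y.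
  apply: denseP; first exact: setT_ideal.
  exists (spectrum_of rho); exists rho; first exact: spectrum_of_mem.
  by have [[a [y ay]] _] := irrep_irr rho; exists a, y.
have e0 : nrm eta != 0.
  by apply/eqP => /nrm_eq0 e0; apply: ae; rewrite e0 (lin0 (rep_lin (irrep_rep sg) a)).
have ep : 0 < nrm eta by rewrite lt_neqAle eq_sym e0 nrm_ge0.
pose w := (nrm eta)^-1%:C *: eta.
have w1 : nrm w = 1 by rewrite nrmZ nrmC gtr0_norm ?invr_gt0 // mulVf.
have vs : vector_states Pd (fun a => inner w (sg a w)) by exists y, sg, w.
by have [G [L [oG _]]] := vector_state_outer vs; exists G, L.
Qed.

Lemma total_nrm G L a : outer_combination G L -> nrm (total G a) <= nrm a.
Proof.
move=> [_ nG _ _ sL]; rewrite -[leRHS]mul1r -sL mulr_suml /total.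
elim/big_ind2: _ => // [|x1 x2 y1 y2 h1 h2]; first by rewrite nrm0.
by apply: le_trans (nrmD _ _) _; exact: lerD.
Qed.

(* A near minimiser of the distance to [f] cannot be strictly separated from [f]. *)
Lemma outer_approx m (h : 'I_m -> A) (e : R) : 0 < e ->
  exists G L, outer_combination G L /\
    \sum_j (complex.Re (total G (h j)) - complex.Re (f (h j))) ^+ 2 < e.
Proof.
move=> e0.
pose F G := \sum_j (complex.Re (total G (h j)) - complex.Re (f (h j))) ^+ 2.
pose V := [set r : R | exists G L, outer_combination G L /\ r = F G].
have V0 : V !=set0 by have [G [L oG]] := outer_exists; exists (F G); exists G, L.
have Vlb : lbound V 0.
  by move=> _ [G [L [_ ->]]]; apply: sumr_ge0 => j _; exact: sqr_ge0.
have iV : has_inf V by split=> //; exists 0.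
pose M := \sum_j (2 * nrm (h j)) ^+ 2.
have M0 : 0 <= M by apply: sumr_ge0 => j _; exact: sqr_ge0.
(* [M] bounds the squared length of every displacement [z], and [G] is chosen within [t^2] of the
   infimum. A step of size [t] towards [psi] gives [0 <= t^2 + 2 t <d, z> + t^2 M]; testing against
   [a], the combination of the [h j] with coefficients [d j], this yields
   [F G <= t (1 + M) / 2 < t (M + 3) <= e]. *)
pose t := Num.min 1 (e / (M + 3)).
have M3 : 0 < M + 3 by rewrite ltr_wpDl.
have t0 : 0 < t by rewrite lt_min ltr01 divr_gt0.
have t1 : t <= 1 by rewrite ge_min lexx.
have te : t * (M + 3) <= e by rewrite -ler_pdivlMr // ge_min lexx orbT.
have [_ [G [L [oG ->]]] FG] := inf_adherent (exprn_gt0 2 t0) iV.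
exists G, L; split=> //; rewrite -/(F G).
pose d j := complex.Re (total G (h j)) - complex.Re (f (h j)).
pose a := \sum_j ((d j)%:C *: h j).
have lT := total_scalar oG.
have key psi : vector_states Pd psi ->
    complex.Re (total G a) - t * (1 + M) / 2 <= complex.Re (psi a).
  move=> vp; have [G' [L' [oG' GE]]] := vector_state_outer vp.
  have [lp _] := state_positive (vector_states_state vp).
  pose z j := complex.Re (psi (h j)) - complex.Re (total G (h j)).
  have zM : \sum_j z j ^+ 2 <= M.
    apply: ler_sum => j _; rewrite -(real_normK (num_real (z j))).
    rewrite ler_pXn2r ?nnegrE ?mulr_ge0 ?nrm_ge0 //.
    apply: le_trans (ler_normB _ _) _; rewrite mulr_natl mulr2n lerD //.
      by apply: le_trans (Re_le_nrm _) _; exact: (state_nrm (vector_states_state vp)).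
    by apply: le_trans (Re_le_nrm _) _; exact: (total_nrm _ oG).
  have inflb : inf V <= F (fun j a => (1 - t)%:C * G j a + t%:C * G' j a).
    apply: (ge_inf iV.2); exists (fun j a => (1 - t)%:C * G j a + t%:C * G' j a),
      (fun j => (1 - t) * L j + t * L' j); split=> //.
    by apply: outer_combination_convex => //; exact: ltW.
  have FE : F (fun j a => (1 - t)%:C * G j a + t%:C * G' j a) =
      F G + 2 * t * \sum_j d j * z j + t ^+ 2 * \sum_j z j ^+ 2.
    rewrite !mulr_sumr -!big_split /=; apply: eq_bigr => j _.
    by rewrite total_convex GE ReD !Re_realM /d /z; ring.
  have sE : \sum_j d j * z j = complex.Re (psi a) - complex.Re (total G a).
    by rewrite !Re_lincomb // -sumrB; apply: eq_bigr => j _; rewrite /z mulrBr.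
  rewrite FE sE in inflb; move: zM inflb FG.
  move: (\sum_j z j ^+ 2) (complex.Re (psi a)) (complex.Re (total G a)) => w p q zM inflb FG'.
  have : 0 <= t ^+ 2 + 2 * t * (p - q) + t ^+ 2 * w by move: inflb FG'; lra.
  have -> : t ^+ 2 + 2 * t * (p - q) + t ^+ 2 * w = t * (t + 2 * (p - q) + t * w) by ring.
  rewrite pmulr_rge0 // => h1; have : t * w <= t * M by rewrite ler_pM2l.
  by move: h1; lra.
have fa : complex.Re (total G a) - t * (1 + M) / 2 <= complex.Re (f a).
  have lf : scalar f by move=> c u v; rewrite !fE (rep_linl rep xi) ipDr ipZr.
  suff : complex.Re (f (- a)) <= - (complex.Re (total G a) - t * (1 + M) / 2).
    by rewrite (sclN lf) ReN lerN2.
  apply: vector_states_order => psi vp.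
  have [lp _] := state_positive (vector_states_state vp).
  by rewrite (sclN lp) ReN lerN2; exact: key.
have -> : F G = complex.Re (total G a) - complex.Re (f a).
  have lf : scalar f by move=> c u v; rewrite !fE (rep_linl rep xi) ipDr ipZr.
  by rewrite !Re_lincomb // -sumrB; apply: eq_bigr => j _; rewrite -mulrBr.
have : t * (1 + M) / 2 < t * (M + 3).
  rewrite -mulrA ltr_pM2l //; lra.
by move: fa te; lra.
Qed.

Lemma outer_approx_seq (l : seq A) (e : R) : 0 < e ->
  exists G L, outer_combination G L /\ forall a, a \in l -> nrm (total G a - f a) < e.
Proof.
(* Real parts at [i a] control the imaginary parts at [a]. *)
move=> e0; pose l' := l ++ [seq 'i%C *: a | a <- l].
have e2 : 0 < (e / 2) ^+ 2 by rewrite exprn_gt0 // divr_gt0.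
have [G [L [oG h]]] := outer_approx (fun j : 'I_(size l') => nth 0 l' j) e2.
exists G, L; split=> //.
have lG := total_scalar oG.
have lf : scalar f by move=> c u v; rewrite !fE (rep_linl rep xi) ipDr ipZr.
have key a : a \in l' -> `|complex.Re (total G a) - complex.Re (f a)| < e / 2.
  move=> al; have il : (index a l' < size l')%N by rewrite index_mem.
  rewrite -(ltr_pXn2r (n := 2)) ?nnegrE ?divr_ge0 ?(ltW e0) // real_normK ?num_real //.
  apply: le_lt_trans h; rewrite (bigD1 (Ordinal il)) //= nth_index // lerDl.
  by apply: sumr_ge0 => j _; exact: sqr_ge0.
move=> a al; apply: le_lt_trans (nrm_le_ReIm _) _; rewrite (splitr e) ltrD //.
  rewrite ReB; apply: key; by rewrite mem_cat al.
have : 'i%C *: a \in l' by rewrite mem_cat map_f ?orbT.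
move/key; rewrite (sclZ lG) (sclZ lf) -ReB -mulrBr.
by case: (total G a - f a) => u v /=; rewrite mul0r mul1r sub0r normrN.
Qed.

End HalfPlanes.

Lemma halfplane_density n (k : 'I_n -> A) (s : 'I_n -> R) :
  (forall j, complex.Re (f (k j)) < s j) ->
  exists psi, vector_states Pd psi /\ forall j, complex.Re (psi (k j)) < s j.
Proof.
move=> fs; apply: contrapT => no.
have outer psi : vector_states Pd psi -> exists j, s j <= complex.Re (psi (k j)).
  move=> vp; apply: contrapT => /forallNP h; apply: no; exists psi; split=> // j.
  by rewrite ltNge; apply/negP; exact: h.
pose T := (('I_n -> A -> R[i]) * ('I_n -> R))%type.
pose Bs (p : seq A * R) := [set q : T | outer_combination k s q.1 q.2 /\
  forall a, a \in p.1 -> nrm (total q.1 a - f a) < p.2].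
pose Fl := filter_from [set p : seq A * R | 0 < p.2] Bs.
have FF : ProperFilter Fl.
  apply: filter_from_proper.
    apply: filter_from_filter; first by exists ([::], 1) => /=.
    move=> [l1 e1] [l2 e2] /= e10 e20; exists (l1 ++ l2, Num.min e1 e2).
      by rewrite /= lt_min e10.
    move=> q [oq hq] /=; split; split=> // a al; have := hq a; rewrite mem_cat al ?orbT lt_min.
      by move=> /(_ isT)/andP[].
    by move=> /(_ isT)/andP[].
  by move=> [l e] /= e0; have [G [L [oG hG]]] := outer_approx_seq outer l e0; exists (G, L).
have [U [UU FU]] := ultraFilterLemma FF.
have UB l e : 0 < e -> U (Bs (l, e)) by move=> e0; apply: FU; exists (l, e).
have Uo : U [set q | outer_combination k s q.1 q.2].
  by apply: filterS (UB [::] 1 ltr01) => q [].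
have /choice[g gE] (ja : 'I_n * A) : exists c, ultralimit U (fun q : T => q.1 ja.1 ja.2) c.
  case: ja => j a; apply: (@ultralimit_ex _ _ _ _ _ (nrm a)).
  apply: filterS Uo => q oq /=; have [_ nG _ L0 sL] := oq.
  apply: le_trans (nG j a) _; rewrite ler_piMl ?nrm_ge0 // -sL (bigD1 j) //= lerDl.
  exact: sumr_ge0.
have /choice[c cE] j : exists c, ultralimit U (fun q : T => (q.2 j)%:C) c.
  apply: (@ultralimit_ex _ _ _ _ _ 1); apply: filterS Uo => q [_ _ _ L0 sL] /=.
  by rewrite nrmC ger0_norm // -sL (bigD1 j) //= lerDl; exact: sumr_ge0.
pose L j := complex.Re (c j).
have c0 j : 0 <= c j.
  by apply: (ultralimit_ge0 _ (cE j)); apply: filterS Uo => q [_ _ _ L0 _] /=; rewrite ler0c.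
have cL j : c j = (L j)%:C by rewrite /L re_real.
have pg j : positive_functional (fun a => g (j, a)).
  split=> [k0 a b|a].
    apply: (ultralimit_uniq (u := fun q : T => q.1 j (k0 *: a + b)) (gE (j, _))).
    apply: ultralimit_ext (ultralimit_lin k0 (gE (j, a)) (gE (j, b))).
    by apply: filterS Uo => q [pG _ _ _ _] /=; have [lG _] := pG j; rewrite lG.
  apply: (ultralimit_ge0 _ (gE (j, star a ** a))).
  by apply: filterS Uo => q [pG _ _ _ _] /=; have [_] := pG j.
have ng j a : nrm (g (j, a)) <= L j * nrm a.
  have h := @ultralimit_lin _ _ _ UU (nrm a)%:C _ _ _ _ (cE j) (@ultralimit_cst _ _ _ UU 0).
  have -> : L j * nrm a = complex.Re ((nrm a)%:C * c j + 0) by rewrite addr0 Re_realM mulrC.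
  apply: (ultralimit_nrm _ (gE (j, a)) h).
  by apply: filterS Uo => q [_ nG _ _ _] ; rewrite /mkset addr0 Re_realM /= mulrC.
have sg j : L j * s j <= complex.Re (g (j, k j)).
  have h := @ultralimit_lin _ _ _ UU (s j)%:C _ _ _ _ (cE j) (@ultralimit_cst _ _ _ UU 0).
  have -> : L j * s j = complex.Re ((s j)%:C * c j + 0) by rewrite addr0 Re_realM mulrC.
  apply: (ultralimit_Re _ h (gE (j, k j))).
  by apply: filterS Uo => q [_ _ hG _ _] ; rewrite /mkset addr0 Re_realM /= mulrC.
have sL : \sum_j L j = 1.
  have : \sum_j c j = 1.
    apply: (ultralimit_uniq (ultralimit_sum cE)).
    apply: ultralimit_ext (@ultralimit_cst _ _ _ UU 1).
    by apply: filterS Uo => q [_ _ _ _ sL] /=; rewrite -rmorph_sum sL.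
  move/(congr1 (@complex.Re R)); rewrite (big_morph (@complex.Re R) (@ReD R) erefl).
  by [].
have gf a : \sum_j g (j, a) = f a.
  apply: (ultralimit_uniq (ultralimit_sum (fun j => gE (j, a)))) => e e0.
  by apply: filterS (UB [:: a] e e0) => q [_ /(_ a)] /=; rewrite inE eqxx nrmBC => ->.
have L0 j : 0 <= L j by have := c0 j; rewrite cL ler0c.
have [j Lj] : exists j, 0 < L j.
  apply: contrapT => /forallNP h; have : \sum_j L j = 0.
    by apply: big1 => j _; apply/le_anti; rewrite L0 andbT leNgt; apply/negP; exact: h.
  by rewrite sL => /eqP; rewrite oner_eq0.
have sf : is_state f.
  have -> : f = fun a => inner xi (rho a xi) by apply/funext.
  exact: (vector_state rep cxi xi1).
have Li : 0 < (L j)^-1 by rewrite invr_gt0.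
have sp : is_state (fun a => (L j)^-1%:C * g (j, a)).
  have [lg p0] := pg j; apply: is_state_nrm.
  - split=> [k0 a b|a]; first by rewrite lg; ring.
    by rewrite mulr_ge0 // ler0c ltW.
  - by move=> a; rewrite nrmM nrmC gtr0_norm // mulrC ler_pdivrMr // mulrC.
  - move=> M hM; suff : 1 <= L j * M + (1 - L j) by move: Lj; nra.
    apply: (state_max sf) => a; rewrite -gf (bigD1 j) //=; apply: le_trans (nrmD _ _) _.
    rewrite mulrDl lerD //.
      have := hM a; rewrite nrmM nrmC gtr0_norm // mulrC ler_pdivrMr //.
      by rewrite mulrC mulrA.
    have -> : 1 - L j = \sum_(i | i != j) L i by rewrite -sL (bigD1 j) //= addrAC subrr add0r.
    rewrite mulr_suml.
    elim/big_ind2: _ => // [|x1 x2 y1 y2 h1 h2]; first by rewrite nrm0.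
    by apply: le_trans (nrmD _ _) _; exact: lerD.
(* The group [j] is dominated by [f] on elements [star a ** a], so irreducibility identifies its
   normalisation with [f]; but the group inherits [s j <= Re] at [k j], against the hypothesis on
   [f]. *)
have phiE := irr_dominated rep (irrep_irr rho) xi1 sp (c := Num.sqrt (L j)^-1).
have {}phiE a : (L j)^-1%:C * g (j, a) = f a.
  rewrite fE; apply: phiE => {}a; rewrite sqr_sqrtr; last exact: ltW.
  rewrite Re_realM ler_pM2l //.
  rewrite nrm_ip (rep_sqr rep) -fE -gf (big_morph (@complex.Re R) (@ReD R) erefl).
  rewrite (bigD1 j) //= lerDl; apply: sumr_ge0 => i _.
  by have [_ /(_ a)] := pg i; rewrite lecE => /andP[].
have := sg j; have := fs j; rewrite -phiE Re_realM.
rewrite mulrC ltr_pdivrMr // mulrC => h1 h2.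
by move: (lt_le_trans h1 h2); rewrite ltxx.
Qed.

End Fixed.
End WeakDensity.

Section WeakClosure.
Variables (R : realType) (A : cstarAlgebra R).
Implicit Type W : set (A -> R[i]).

Lemma closure_ptws W (f : A -> R[i]) :
  (forall (l : seq A) (e : R), 0 < e ->
    exists psi, W psi /\ forall a, a \in l -> nrm (f a - psi a) < e) ->
  @closure {ptws A -> R[i]^o} W f.
Proof.
move=> near.
pose B (p : seq A * R) := [set psi | W psi /\ forall a, a \in p.1 -> nrm (f a - psi a) < p.2].
pose F := filter_from [set p : seq A * R | 0 < p.2] B.
have FF : ProperFilter F.
  apply: filter_from_proper.
    apply: filter_from_filter; first by exists ([::], 1) => /=.
    move=> [l1 e1] [l2 e2] /= e10 e20; exists (l1 ++ l2, Num.min e1 e2).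
      by rewrite /= lt_min e10.
    move=> q [Wq hq] /=; split; split=> // a al; have := hq a; rewrite mem_cat al ?orbT lt_min.
      by move=> /(_ isT)/andP[].
    by move=> /(_ isT)/andP[].
  by move=> [l e] /= e0; have [psi [Wp hp]] := near l e e0; exists psi.
have Ff : {ptws, F --> (f : A -> R[i]^o)}.
  apply/(@pointwise_cvgP A R[i]^o F f) => a.
  apply/cvgrPdist_lt => c c0.
  have [e eE] : exists e, c = e%:C :> R[i] by exists (complex.Re c); rewrite re_real // ltW.
  exists ([:: a], e); first by rewrite /= -ltcR -eE.
  by move=> psi [_ /(_ a)] /=; rewrite inE eqxx eE nrmE ltcR; apply.
move=> V Vf; have FV : F V by exact: Ff.
have FW : F W by exists ([::], 1) => //= psi [].
exact: filter_ex (filterI FW FV).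
Qed.

Lemma closure_ptws_near W (f : A -> R[i]) a (e : R) : @closure {ptws A -> R[i]^o} W f ->
  0 < e -> exists psi, W psi /\ nrm (f a - psi a) < e.
Proof.
move=> clf e0.
have [psi [Wp hp]] : W `&` [set psi | nrm (f a - psi a) < e] !=set0.
  apply: clf.
  pose N := @nbhs _ {ptws A -> R[i]^o} f.
  have FN : Filter N by exact: nbhs_filter.
  have Nf : {ptws, N --> (f : A -> R[i]^o)} by move=> V.
  have := (@pointwise_cvgP A R[i]^o N f FN).1 Nf a.
  move=> /cvgrPdist_lt /(_ e%:C); rewrite ltcR => /(_ e0) h.
  by apply: (@filterS _ N _ _ _ _ h) => psi /=; rewrite nrmE ltcR.
by exists psi.
Qed.

Lemma vector_states_dense (Pd : spectrum A -> Prop) (f : A -> R[i]) :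
  spectrum_dense Pd -> pure_states f -> @closure {ptws A -> R[i]^o} (vector_states Pd) f.
Proof.
move=> dP pf; have [rho [xi [fE xi1 cxi]]] := pure_gns pf.
have [lf _] := state_positive pf.1.
apply: closure_ptws => l e e0; have e2 : 0 < e / 2 by rewrite divr_gt0.
(* Multiples by [i] control imaginary parts; negatives turn one-sided bounds into two-sided ones. *)
pose l1 := l ++ [seq 'i%C *: a | a <- l].
pose l2 := l1 ++ [seq - a | a <- l1].
have [|psi [vp h]] := @halfplane_density _ _ Pd dP f rho xi fE xi1 cxi _
  (fun j : 'I_(size l2) => nth 0 l2 j) (fun j => complex.Re (f (nth 0 l2 j)) + e / 2).
  by move=> j; rewrite ltrDl.
exists psi; split=> //.
have [lp _] := state_positive (vector_states_state vp).
have key a : a \in l1 -> `|complex.Re (f a) - complex.Re (psi a)| < e / 2.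
  move=> al.
  have k1 b : b \in l2 -> complex.Re (psi b) < complex.Re (f b) + e / 2.
    move=> bl; have il : (index b l2 < size l2)%N by rewrite index_mem.
    by have := h (Ordinal il); rewrite /= nth_index.
  have := k1 a; rewrite mem_cat al => /(_ isT); have := k1 (- a).
  rewrite mem_cat map_f ?orbT // => /(_ isT); rewrite (sclN lp) (sclN lf) !ReN => h1 h2.
  by rewrite ltr_norml; apply/andP; split; lra.
move=> a al; apply: le_lt_trans (nrm_le_ReIm _) _; rewrite (splitr e) ltrD //.
  by rewrite ReB; apply: key; rewrite mem_cat al.
have : 'i%C *: a \in l1 by rewrite mem_cat map_f ?orbT.
move/key; rewrite (sclZ lp) (sclZ lf) -ReB -mulrBr.
by case: (f a - psi a) => u v /=; rewrite mul0r mul1r sub0r normrN.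
Qed.

End WeakClosure.

(** * Germs and induced representations *)

Section Germs.
Variables (R : realType) (S : inverseMonoidType) (A : cstarAlgebra R).
Variable E : bimodule_action S A.

(** [J2] acts on [u] with dense range; if all products acted by zero, [rho a u] would vanish. *)
Lemma spectrum_open_prod (J1 J2 J3 : set A) (x : spectrum A) : is_ideal J2 ->
  spectrum_open J1 x -> spectrum_open J2 x ->
  (forall a b, J1 a -> J2 b -> J3 (a ** b)) -> spectrum_open J3 x.
Proof.
move=> i2 [rho xr [a [u [J1a au]]]] /(spectrum_openP _ xr) [b [v [J2b bv]]] J123.
have rep := irrep_rep rho.
exists rho => //; apply: contrapT => no; apply: au.
have [->|u0] := pselect (u = 0); first exact: (lin0 (rep_lin rep a)).
have cu := irr_ideal_cyclic rep (irrep_irr rho) i2 (ex_intro _ b (ex_intro _ v (conj J2b bv))) u0.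
apply: (@lip_adh0 _ _ _ (rho a) (nrm a) _ u _ _ (cu u)) => [w w'|_ [d Jd <-]].
  by rewrite -(linB (rep_lin rep a)) (rep_contr rep).
rewrite -(repM rep); apply: contrapT => h; apply: no.
by exists (a ** d), u; split=> //; exact: J123.
Qed.

(** A witness [w] of membership in one germ is replaced by [w v], which lies below both [t] and [1]
    and whose source ideal still supports [x]. *)
Lemma germ_eq1 t v (x : spectrum A) : nat_le v t -> nat_le v 1%g ->
  spectrum_open (sI (E v)) x -> germ E t x = germ E 1%g x.
Proof.
move=> vt v1 xv; have vv := nat_le1 v1.
have tv := nat_le_idemE vt vv.
have meet w : spectrum_open (sI (E w)) x -> spectrum_open (sI (E (w * v)%g)) x.
  move=> xw; apply: (spectrum_open_prod (sI_ideal (E v)) xw xv) => a b.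
  rewrite (sI_source _ w) (sI_source _ (w * v)%g) => wa vb.
  have -> : ((w * v)^-1 * (w * v) = (w^-1 * w) * v)%g.
    rewrite invgM (idem_inv vv) -(mulgA v) (mulgA _ w) (mulgA v).
    by rewrite (idem_comm vv (idemVg w)) -mulgA vv.
  by apply: sI_prod => //; exact: idemVg.
have le w : nat_le (w * v)%g w by exists v.
apply/funext => -[s y]; apply/propext; rewrite /germ /=.
split=> -[-> [w [wt ws xw]]]; split=> //; exists (w * v)%g; split; try exact: meet.
- have [f [ff wE]] := wt; apply: idem_nat_le1.
  have -> : (w * v = v * f)%g by rewrite wE -mulgA (idem_comm ff vv) mulgA tv.
  exact: idem_prod.
- exact: nat_le_trans (le w) ws.
- have ww := nat_le1 wt; exists (v * w)%g; split; first exact: idem_prod.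
  by rewrite mulgA tv (idem_comm ww vv).
- exact: nat_le_trans (le w) ws.
Qed.

(** The two ends of the arrow are given by different representatives of one class; conjugation by
    unitaries places both on the space of [rho]. *)
Lemma induced_model (F : hilbertBimodule A) (x : spectrum A) (rho : irrep A) :
  induced F x x -> sval x rho -> exists m : F -> irrep_space rho -> irrep_space rho,
  [/\ forall xi, linear (m^~ xi), forall z, linear (m z),
      forall z xi z' xi', inner (m z xi) (m z' xi') = inner xi (rho (rip z z') xi'),
      forall a z xi, rho a (m z xi) = m (lact a z) xi
    & closed_span [set eta | exists z xi, eta = m z xi] = setT].
Proof.
move=> [_ [r [s [xr xs [m [m1 m2 mi ma mt]]]]]] xrho.
have [V [lV VT iV Vr]] := spectrum_ueq xrho xr.
have [W [lW WT iW Wr]] := spectrum_ueq xs xrho.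
exists (fun z xi => W (m z (V xi))); split.
- by move=> xi c z z'; rewrite m1 lW.
- by move=> z c xi xi'; rewrite lV m2 lW.
- by move=> z xi z' xi'; rewrite iW mi -Vr iV.
- by move=> a z xi; rewrite -Wr ma.
- apply/seteqP; split=> // y _; have : range W y by rewrite WT.
  case=> w _ <-.
  have : closed_span [set eta | exists z xi, eta = m z xi] w by rewrite mt.
  apply: (closed_span_image (M := 1) lW).
  + by move=> u; rewrite mul1r (isometry_nrm iW).
  + exact: subspace_span.
  + exact: closed_closed_span.
  + move=> _ [z [xi ->]]; apply: sub_closed_span.
    have : range V xi by rewrite VT.
    by case=> xi' _ <-; exists z, xi'.
Qed.

End Germs.

(** * Unique extension and isotropy *)

Lemma projection_comm (R : realType) (K : hilbertSpace R) (L : set K) (P T T' : K -> K) :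
  (forall x, L (P x)) -> (forall x, L x -> P x = x) ->
  (forall x y, inner (P x) y = inner x (P y)) ->
  (forall x, L x -> L (T x)) -> (forall x, L x -> L (T' x)) ->
  (forall x y, inner (T x) y = inner x (T' y)) -> forall x, P (T x) = T (P x).
Proof.
move=> PL PE aP TL TL' aT x; apply/eqP; rewrite -subr_eq0; apply/eqP/ip_eq0.
suff h y : inner (P (T x)) y = inner (T (P x)) y by rewrite ipBl h subrr.
have e1 := PE _ (TL' _ (PL y)); have e2 := PE _ (TL _ (PL x)).
by rewrite aP aT -e1 -aP -aT -aP e2.
Qed.

Section UniqueExtension.
Variables (R : realType) (S : inverseMonoidType) (A : cstarAlgebra R).
Variables (E : bimodule_action S A) (B : cstarAlgebra R) (Q : forall t : S, E t -> B).
Hypothesis Qcov : covariant Q.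
Hypothesis Qspan : closed_span [set b | exists t (z : E t), b = Q z] = setT.
Let i (a : A) : B := Q (unit_iso E a).
(** The one trace of the reduced crossed product in this section; it is obtained from [Er] in
    [reduced_extension]. *)
Hypothesis Qext : forall f : A -> R[i], is_state f -> exists g : B -> R[i],
  [/\ is_state g, forall a, g (i a) = f a
    & forall t (z : E t), (forall a, I1 E t a -> f a = 0) -> g (Q z) = 0].

Lemma extension_is_state (f : A -> R[i]) (g : B -> R[i]) : is_state f -> positive_functional g ->
  (forall b, nrm (g b) <= nrm b) -> (forall a, g (i a) = f a) -> is_state g.
Proof.
move=> sf pg cg gf; apply: is_state_nrm => // M hM.
have [M0|M0] := leP 0 M.
  apply: (state_max sf) => a; rewrite -gf; apply: le_trans (hM _) _.
  by rewrite ler_wpM2l // (star_hom_contr (cov_hom Qcov)).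
have : 1 <= 0 :> R; last by rewrite ler10.
apply: (state_max sf) => a; rewrite -gf mul0r; apply: le_trans (hM _) _.
by rewrite mulr_le0_ge0 ?nrm_ge0 // ltW.
Qed.

Lemma no_germ_kill (f : A -> R[i]) (x : spectrum A) (rho : irrep A) (xi : irrep_space rho) t :
  sval x rho -> (forall a, f a = inner xi (rho a xi)) ->
  (forall v, nat_le v t -> nat_le v 1%g -> ~ spectrum_open (sI (E v)) x) ->
  forall a, I1 E t a -> f a = 0.
Proof.
move=> xr fE no a; have rep := irrep_rep rho.
have lf : linear (fun a => rho a xi) := rep_linl rep xi.
suff key : I1 E t a -> rho a xi = 0 by move=> /key h; rewrite fE h ip0r.
apply: (@closed_span_image _ _ _ (fun a => rho a xi) (nrm xi) lf _ _ [set 0]).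
- by move=> b; rewrite mulrC (rep_contr rep).
- exact: subspace_zero.
- exact: closed_zero.
- move=> b [v [vt v1] vb] /=; apply: contrapT => h; apply: (no v) => //.
  by exists rho => //; exists b, xi.
Qed.

Lemma unique_extension_trivial_isotropy (f : A -> R[i]) : uniquely_extending i f ->
  exists2 x, is_GNS_class f x & trivial_isotropy E x.
Proof.
move=> [pf [g [[sg gf] gU]]]; have [rho [xi [fE xi1 cxi]]] := pure_gns pf.
have rep := irrep_rep rho; have sf := pf.1.
pose x := spectrum_of rho; have xr : sval x rho by exact: spectrum_of_mem.
exists x; first by exists rho; split=> //; exists xi; split=> //; exact/(cyclic_span rep).
move=> _ [t [xt -> ind]].
have [[v [vt v1 xv]]|no] := pselect (exists v, [/\ nat_le v t, nat_le v 1%g & spectrum_open (sI (E v)) x]).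
  exact: germ_eq1 vt v1 xv.
exfalso.
have kill := no_germ_kill xr fE (t := t).
have {}kill a : I1 E t a -> f a = 0.
  by apply: kill => v vt v1 xv; apply: no; exists v.
have [g0 [sg0 g0f g0Q]] := Qext sf.
have {}g0Q z : g0 (Q (z : E t)) = 0 by exact: g0Q.
have [m [m1 m2 mi ma mt]] := induced_model ind xr.
have [K [tau [Om [rt g0E O1 cO]]]] := gns sg0.
have mbal z a : m z (rho a xi) = m (ract z a) xi.
  apply/eqP; rewrite -subr_eq0; apply/eqP/ip_eq0.
  rewrite !(ipBl, ipBr) !mi !rip_ract !rip_ractl.
  by rewrite !(repM rep) -!(rep_adj' rep) !subrr.
(* The norms agree because [<m z xi, m z xi>] and [<Q z Om, Q z Om>] are both [f (rip z z)]. The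
   resulting isometry [W] intertwines the actions of [A] and has range orthogonal to [Om], as [g0]
   vanishes on the fibre. *)
pose Rel (u : irrep_space rho) (w : K) := exists z, u = m z xi /\ w = tau (Q (z : E t)) Om.
have RZ c u u' w w' : Rel u w -> Rel u' w' -> Rel (c *: u + u') (c *: w + w').
  move=> [z [-> ->]] [z' [-> ->]]; exists (c *: z + z').
  by rewrite m1 (cov_linear Qcov) (rep_linl rt).
have Rn u w : Rel u w -> nrm w = nrm u.
  move=> [z [-> ->]]; apply/eqP; rewrite -(@eqrXn2 _ 2) ?nrm_ge0 // !nrm_ip.
  by rewrite (rep_sqr rt) -g0E (cov_rip Qcov) [g0 _]g0f fE mi.
have dense u : adh [set u | exists w, Rel u w] u.
  have s1 : is_subspace [set u | exists w, Rel u w].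
    split=> [|c u1 u2 [w1 r1] [w2 r2]]; last by exists (c *: w1 + w2); exact: RZ.
    by exists (tau (Q (0 : E t)) Om), 0; rewrite (lin0 (m1 xi)).
  have : closed_span [set eta | exists z xi, eta = m z xi] u by rewrite mt.
  apply: closed_span_ind; [exact: subspace_adh | exact: adh_closed |].
  move=> _ [z [y ->]].
  have bz y' : nrm (m z y') <= nrm z * nrm y'.
    rewrite -(ler_pXn2r (n := 2)) ?nnegrE ?mulr_ge0 ?nrm_ge0 // nrm_ip mi exprMn -nrm_rip.
    apply: le_trans (Re_le _) _; apply: le_trans (ip_le _ _) _.
    rewrite expr2 mulrCA ler_wpM2l ?nrm_ge0 //.
    exact: (rep_contr rep).
  apply: (adh_image (m2 z) bz _ (cxi y)) => _ [a _ <-].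
  by exists (tau (Q (ract z a)) Om), (ract z a).
have [W [lW iW WR _ WL]] := isometry_ext RZ Rn dense.
have Wz z : W (m z xi) = tau (Q z) Om by apply: WR; exists z.
pose eta := W xi.
have WA a u : W (rho a u) = tau (i a) (W u).
  apply: (linear_eq_dense (f := fun u => W (rho a u)) (g := fun u => tau (i a) (W u))
    (M := nrm a) (N := nrm (i a)) _ _ _ _ _ (dense u)).
  - by move=> c v v'; rewrite (rep_lin rep) lW.
  - by move=> c v v'; rewrite lW (rep_lin rt).
  - by move=> v; rewrite (isometry_nrm iW) (rep_contr rep).
  - by move=> v; apply: le_trans (rep_contr rt _ _) _; rewrite (isometry_nrm iW).
  - by move=> _ [_ [z [-> _]]]; rewrite ma !Wz -(cov_lact Qcov) (repM rt).
have orth u : inner Om (W u) = 0.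
  apply: (@lip_adh0 _ _ _ (fun u => inner Om (W u)) 1 _ u _ _ (dense u)) => [v v'|].
    rewrite -ipBr -(linB lW); apply: le_trans (ip_le _ _) _.
    by rewrite O1 (isometry_nrm iW).
  by move=> _ [_ [z [-> _]]]; rewrite Wz -g0E g0Q.
have eta1 : nrm eta = 1 by rewrite (isometry_nrm iW).
have ee a : inner eta (tau (i a) eta) = f a by rewrite -WA iW fE.
have oe a : inner Om (tau (i a) eta) = 0 by rewrite -WA orth.
have eo a : inner eta (tau (i a) Om) = 0.
  have [_ _ si] := cov_hom Qcov.
  by rewrite -(rep_adj rt) -si inner_conj oe conjc0.
pose w c := c *: Om + eta.
pose om c b := (2^-1 : R)%:C * inner (w c) (tau b (w c)).
have omE c b : om c b = (2^-1 : R)%:C * (conjc c * c * inner Om (tau b Om) +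
    conjc c * inner Om (tau b eta) + c * inner eta (tau b Om) + inner eta (tau b eta)).
  rewrite /om /w (rep_lin rt) !ipDl !ipDr !ipZl !ipZr; congr (_ * _); ring.
have omg c : conjc c * c = 1 -> om c = g.
  move=> c1; suff : is_state (om c) /\ forall a, om c (i a) = f a by case/gU.
  have omf a : om c (i a) = f a.
    rewrite omE c1 oe eo ee -g0E [g0 _]g0f !mulr0 !addr0 mul1r.
    have -> : f a + f a = 2 * f a by ring.
    by rewrite mulrA -(rmorph_nat (real_complex R)) -rmorphM mulVf ?mul1r ?pnatr_eq0.
  split=> //; apply: (extension_is_state sf) omf.
    have [lv pv] := vector_positive rt (w c); split=> [k a b|b].
      by rewrite /om lv; ring.
    by rewrite mulr_ge0 // ler0c invr_ge0.
  move=> b; rewrite nrmM nrmC gtr0_norm ?invr_gt0 // mulrC ler_pdivrMr //.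
  apply: le_trans (vector_nrm rt _ _) _; rewrite mulrC ler_wpM2l ?nrm_ge0 //.
  rewrite /w nrmD_sqr eta1 ipZl orth mulr0 mul0rn addr0 nrmZ O1 mulr1 expr1n.
  have := nrm_sqr c; rewrite c1 => /(congr1 (@complex.Re R)) /= ->.
  by [].
have two : (2^-1 : R)%:C != 0 :> R[i] by rewrite fmorph_eq0 invr_eq0 pnatr_eq0.
(* For [q = <Om, b eta>] and [r = <eta, b Om>], comparing [c = 1] with [c = -1] gives [q + r = 0],
   and comparing [c = 1] with [c = i] then gives [q = r]. *)
have cross b : inner Om (tau b eta) = 0.
  have c1 : conjc (1 : R[i]) * 1 = 1 by rewrite conjc1 mulr1.
  have cm1 : conjc (-1 : R[i]) * -1 = 1 by rewrite conjcN conjc1 mulrNN mulr1.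
  have ci : conjc ('i%C : R[i]) * 'i%C = 1 by rewrite conjc_i mulNr -expr2 sqr_i opprK.
  have h1 := congr1 (fun h => h b) (etrans (omg _ c1) (esym (omg _ cm1))).
  have h2 := congr1 (fun h => h b) (etrans (omg _ c1) (esym (omg _ ci))).
  move: h1 h2; rewrite /= !omE => /(mulfI two) h1 /(mulfI two).
  move: h1; rewrite c1 cm1 ci conjc1 conjcN conjc1 conjc_i.
  move: (inner Om (tau b Om)) (inner Om (tau b eta)) (inner eta (tau b Om)) (inner eta (tau b eta)).
  move=> p q r s h1 h2.
  have i2 : ('i%C : R[i]) * 'i%C = -1 by rewrite -expr2 sqr_i.
  have qr : q + r = 0.
    have : 2 * (q + r) = 0 by move: h1 => /eqP; rewrite -subr_eq0 => /eqP <-; ring.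
    by move/eqP; rewrite mulf_eq0 pnatr_eq0 => /eqP.
  have h3 : 'i%C * (q - r) = 0.
    have -> : 'i%C * (q - r) = - (- 'i%C * q + 'i%C * r) by ring.
    have : - 'i%C * q + 'i%C * r = q + r.
      by apply: (@addrI _ (1 * p)); apply: (@addIr _ s); rewrite !addrA; move: h2; rewrite !mul1r => <-.
    by move=> ->; rewrite qr oppr0.
  have : 'i%C * ('i%C * (q - r)) = 0 by rewrite h3 mulr0.
  rewrite mulrA i2 mulN1r => /eqP; rewrite oppr_eq0 subr_eq0 => /eqP qr'.
  have : 2 * q = 0 by rewrite mulr_natl mulr2n {2}qr'.
  by move/eqP; rewrite mulf_eq0 pnatr_eq0 => /eqP.
apply: (nrm1_neq0 eta1); apply: (ip_dense cO) => _ [b _ <-].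
by rewrite (rep_adj' rt) cross.
Qed.

Section Extensions.
Variables (f : A -> R[i]) (rho : irrep A) (xi : irrep_space rho).
Hypotheses (fE : forall a, f a = inner xi (rho a xi)) (xi1 : nrm xi = 1)
  (cxi : forall y, adh [set rho a xi | a in setT] y).
Variable g : B -> R[i].
Hypotheses (sg : is_state g) (gf : forall a, g (i a) = f a).
Variables (K : hilbertSpace R) (tau : B -> K -> K) (Om : K).
Hypotheses (rt : is_representation tau) (gE : forall b, g b = inner Om (tau b Om))
  (O1 : nrm Om = 1).

Let rep := irrep_rep rho.

Lemma gns_embedding : exists J : irrep_space rho -> K,
  [/\ linear J, forall x y, inner (J x) (J y) = inner x y, J xi = Om,
    forall a x, J (rho a x) = tau (i a) (J x)
    & forall w, adh [set tau (i a) Om | a in setT] w -> exists x, J x = w].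
Proof.
have [li mi si] := cov_hom Qcov.
pose Rel (u : irrep_space rho) (w : K) := exists a, u = rho a xi /\ w = tau (i a) Om.
have RZ c u u' w w' : Rel u w -> Rel u' w' -> Rel (c *: u + u') (c *: w + w').
  move=> [a [-> ->]] [a' [-> ->]]; exists (c *: a + a').
  by rewrite (rep_linl rep) /i li (rep_linl rt).
have Rn u w : Rel u w -> nrm w = nrm u.
  move=> [a [-> ->]]; apply/eqP; rewrite -(@eqrXn2 _ 2) ?nrm_ge0 // !nrm_ip.
  by rewrite (rep_sqr rt) (rep_sqr rep) /i -si -mi -gE [g _]gf fE.
have dense u : adh [set u | exists w, Rel u w] u.
  by apply: adh_mono (cxi u) => _ [a _ <-]; exists (tau (i a) Om), a.
have [J [lJ iJ JR Jr _]] := isometry_ext RZ Rn dense.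
have Ja a : J (rho a xi) = tau (i a) Om by apply: JR; exists a.
have nJ := isometry_nrm iJ.
exists J; split=> //; last first.
- move=> w Vw; apply: Jr; apply: adh_mono Vw => _ [a _ <-].
  by exists (rho a xi), a.
- move=> a x; apply: (linear_eq_dense (f := fun u => J (rho a u)) (g := fun u => tau (i a) (J u))
    (M := nrm a) (N := nrm (i a)) _ _ _ _ _ (cxi x)).
  + by move=> c v v'; rewrite (rep_lin rep) lJ.
  + by move=> c v v'; rewrite lJ (rep_lin rt).
  + by move=> v; rewrite nJ (rep_contr rep).
  + by move=> v; apply: le_trans (rep_contr rt _ _) _; rewrite nJ.
  + by move=> _ [b _ <-]; rewrite -(repM rep) !Ja /i mi (repM rt).
- apply/eqP; rewrite -subr_eq0; apply/eqP/nrm_small => e e0.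
  (* The bound [e^2 / 8] gives [|u Om - Om|^2 <= 2 - 2 Re (f u) < (e / 2)^2]; it is the step from
     closeness in [H] to closeness in [K]. *)
  have e3 : 0 < Num.min (e / 2) (e ^+ 2 / 8).
    by rewrite lt_min !divr_gt0 // exprn_gt0.
  have [u [u1]] := cyclic_unit rep cxi e3; rewrite lt_min => /andP[xu1 xu2].
  have h1 : nrm (J xi - tau (i u) Om) < e / 2 by rewrite -Ja -(linB lJ) nJ.
  have h2 : nrm (tau (i u) Om - Om) < e / 2.
    rewrite -(ltr_pXn2r (n := 2)) ?nnegrE ?nrm_ge0 ?divr_ge0 ?(ltW e0) //.
    rewrite nrmB_sqr O1 expr1n.
    have t1 : nrm (tau (i u) Om) <= 1.
      apply: le_trans (rep_contr rt _ _) _; rewrite O1 mulr1.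
      exact: le_trans (star_hom_contr (cov_hom Qcov) _) u1.
    have fu : complex.Re (inner (tau (i u) Om) Om) = complex.Re (f u).
      by rewrite Re_ipC -gE [g _]gf.
    have : 1 - e ^+ 2 / 8 < complex.Re (f u).
      have -> : complex.Re (f u) = 1 - complex.Re (inner xi (xi - rho u xi)).
        by rewrite ipBr -fE ip_nrm xi1 expr1n ReB /=; ring.
      have := Re_le (inner xi (xi - rho u xi)); have := ip_le xi (xi - rho u xi).
      by rewrite xi1 mul1r; move: xu2; lra.
    have := nrm_ge0 (tau (i u) Om); rewrite fu mulr2n expr_div_n.
    by move: t1; move: (nrm _) (complex.Re _) => p q; nra.
  by rewrite (le_lt_trans (nrm_tri (tau (i u) Om) _ _)) // (splitr e) ltrD.
Qed.

(** [Q z ** i (j1 y)] is the image under [i] of an element of [A], so [f] fixes its value. Inserting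
    [i (j1 y)] before [Om] costs as much as replacing [xi] by [rho (j1 y) xi]. *)
Lemma extension_near_idem t (z : E t) v (h : (t * v)%g = v) (y : E v) (e : R) :
  nat_le v t -> nat_le v 1%g -> nrm (xi - rho (j1 y) xi) <= e ->
  nrm (g (Q z) - f (j1 (fmul h z y))) <= nrm z * e.
Proof.
move=> vt v1 xe; have [J [lJ iJ JO Ja Jr]] := gns_embedding.
have -> : f (j1 (fmul h z y)) = g (Q z ** i (j1 y)).
  by rewrite (cov_theta Qcov vt v1 h) [RHS]gf.
rewrite !gE (repM rt) -ipBr -(linB (rep_lin rt _)) -JO -Ja -(linB lJ).
apply: le_trans (ip_le _ _) _; rewrite (isometry_nrm iJ) xi1 mul1r.
apply: le_trans (rep_contr rt _ _) _; rewrite (isometry_nrm iJ) ler_pM ?nrm_ge0 //.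
exact: cov_contr.
Qed.

Let V t := adh [set tau (Q (z : E t)) Om | z in setT].

Let V_subspace t : is_subspace (V t).
Proof.
apply: subspace_adh; split; first by exists 0; rewrite // (lin0 (cov_linear Qcov (t := t))) (lin0 (rep_linl rt Om)).
move=> c _ _ [z _ <-] [z' _ <-]; exists (c *: z + z') => //.
by rewrite (cov_linear Qcov) (rep_linl rt).
Qed.

Let V_mem t (z : E t) : V t (tau (Q z) Om).
Proof. by apply: adh_sub; exists z. Qed.

Let V_inv t a w : V t w -> V t (tau (i a) w).
Proof.
apply: (adh_image (rep_lin rt _) (rep_contr rt _)) => _ [z _ <-].
by exists (lact a z); rewrite // -(cov_lact Qcov) (repM rt).
Qed.

Let V_J t J (z : E t) u : linear J -> (forall x y, inner (J x) (J y) = inner x y) -> J xi = Om ->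
  (forall a x, J (rho a x) = tau (i a) (J x)) -> V t (tau (Q z) (J u)).
Proof.
move=> lJ iJ JO Ja.
apply: (adh_image (M := nrm (Q z)) (f := fun u => tau (Q z) (J u)) _ _ _ (cxi u)).
- by move=> c v v'; rewrite lJ (rep_lin rt).
- by move=> v; rewrite -(isometry_nrm iJ) (rep_contr rt).
move=> _ [a _ <-]; exists (ract z a) => //.
by rewrite Ja JO -(cov_ract Qcov) (repM rt).
Qed.

(** Invariant subspaces [L] of [V t] are compared with [L'], the vectors of [H] that [E t] sends
    into [L]. If [L'] is everything, [L] contains [V t]; if it is zero, then [star (Q z)] kills [L]
    for every [z], so [L] is orthogonal to [V t]. *)
Lemma fiber_irreducible t :
  subspace_irreducible (fun a => tau (i a)) (V t).
Proof.
have [J [lJ iJ JO Ja Jr]] := gns_embedding; have [li mi si] := cov_hom Qcov.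
move=> L sL cL LV iL.
pose L' := [set u | forall z : E t, L (tau (Q z) (J u))].
have sL' : is_subspace L'.
  split=> [z|c u v Lu Lv z]; first by rewrite (lin0 lJ) (lin0 (rep_lin rt _)); exact: sL.1.
  by rewrite lJ (rep_lin rt); apply: sL.2; [exact: Lu | exact: Lv].
have cL' : closed L'.
  apply/closedP => u uL z; have /closedP := cL; apply.
  apply: (adh_image (M := nrm (Q z)) (f := fun u => tau (Q z) (J u)) _ _ _ uL).
  - by move=> c v v'; rewrite lJ (rep_lin rt).
  - by move=> v; rewrite -(isometry_nrm iJ) (rep_contr rt).
  - by move=> v; apply.
have iL' a u : L' u -> L' (rho a u).
  by move=> Lu z; rewrite Ja -(repM rt) (cov_ract Qcov); exact: Lu.
have [L0|LT] := (irrep_irr rho).2 L' sL' cL' iL'; last first.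
  right=> w Vw; have /closedP := cL; apply; apply: adh_mono Vw => _ [z _ <-].
  by rewrite -JO; have : L' xi by [rewrite LT]; apply.
left=> w Lw.
(* [Q z]^* maps [V t] into the range of [J] *)
have star_range (z : E t) w' : V t w' -> exists u, J u = tau (star (Q z)) w'.
  move=> Vw'; apply: Jr; apply: (adh_image (rep_lin rt _) (rep_contr rt _)) Vw' => _ [z' _ <-].
  by exists (rip z z'); rewrite // /i -(cov_rip Qcov) (repM rt).
have zero (z : E t) : tau (star (Q z)) w = 0.
  have [u uE] := star_range z w (LV w Lw).
  have : L' u.
    move=> z'; rewrite uE -(repM rt) (cov_lip Qcov); exact: iL.
  by rewrite L0 => u0; rewrite -uE u0 (lin0 lJ).
apply: ip_eq0; apply: (@lip_adh0 _ _ _ (fun v => inner v w) (nrm w) _ w _ _ (LV w Lw)) => [u v|].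
  by rewrite -ipBl mulrC ip_le.
by move=> _ [z _ <-]; rewrite (rep_adj' rt) zero ip0r.
Qed.

(** The intertwiner is the projection [P0] onto the closure of [A Om], restricted to [V t] and
    divided by the square root of the Schur scalar; it is nonzero since
    [<Om, Q z0 Om> = g (Q z0)]. *)
Lemma extension_induced t (z0 : E t) : g (Q z0) <> 0 ->
  induced (E t) (spectrum_of rho) (spectrum_of rho).
Proof.
move=> gz0; have [J [lJ iJ JO Ja Jr]] := gns_embedding; have [li mi si] := cov_hom Qcov.
pose L0 := adh [set tau (i a) Om | a in setT].
have J0 u : L0 (J u).
  apply: (adh_image (M := 1) lJ _ _ (cxi u)) => [v|_ [a _ <-]].
    by rewrite mul1r (isometry_nrm iJ).
  by exists a; rewrite // Ja JO.
have sL0 : is_subspace L0.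
  apply: subspace_adh; split; first by exists 0; rewrite // /i (lin0 li) (lin0 (rep_linl rt Om)).
  by move=> k _ _ [a _ <-] [b _ <-]; exists (k *: a + b); rewrite // /i li (rep_linl rt).
have [P0 [lP0 P0L P0E aP0 cP0]] := projection sL0 (@adh_closed _ _ _).
have [Pt [lPt PtV PtE aPt cPt]] := projection (V_subspace t) (@adh_closed _ _ _).
have L0i a w : L0 w -> L0 (tau (i a) w).
  apply: (adh_image (rep_lin rt _) (rep_contr rt _)) => _ [b _ <-].
  by exists (a ** b); rewrite // /i mi (repM rt).
have comm0 a w : P0 (tau (i a) w) = tau (i a) (P0 w).
  apply: (projection_comm P0L P0E aP0 (T' := tau (i (star a)))) => //; try exact: L0i.
  by move=> u v; rewrite /i si (rep_adj' rt).
have commt a w : Pt (tau (i a) w) = tau (i a) (Pt w).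
  apply: (projection_comm PtV PtE aPt (T' := tau (i (star a)))); try by move=> *; exact: V_inv.
  by move=> u v; rewrite /i si (rep_adj' rt).
(* The compression of [P0] to [V t] is self-adjoint and commutes with [A]; once it is the scalar
   [l], the map [P0] multiplies inner products on [V t] by [l]. *)
have [l Hl] : exists l : R, forall w, V t w -> Pt (P0 (Pt w)) = l%:C *: w.
  apply: (@schur R K A (fun a => tau (i a)) (V t) (fun w => Pt (P0 (Pt w))) 1).
  - by move=> a; exact: rep_lin.
  - by move=> a; exact: rep_bounded.
  - exact: V_subspace.
  - exact: adh_closed.
  - by move=> a w; exact: V_inv.
  - exact: fiber_irreducible.
  - by move=> c u v; rewrite lPt lP0 lPt.
  - move=> u; rewrite mul1r; apply: le_trans (cPt _) _; apply: le_trans (cP0 _) _; exact: cPt.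
  - by move=> u v; rewrite aPt aP0 aPt.
  - by move=> a u; rewrite commt comm0 commt.
  - by move=> u _; exact: PtV.
have P0l u w : V t u -> V t w -> inner (P0 u) (P0 w) = l%:C * inner u w.
  move=> Vu Vw; rewrite aP0 P0E; last exact: P0L.
  by rewrite -{1}(PtE _ Vu) aPt -{1}(PtE _ Vw) Hl // ipZr.
pose w0 := tau (Q z0) Om.
have P0w : P0 w0 != 0.
  have JOm : P0 Om = Om by rewrite -JO; apply: P0E.
  have e : inner Om w0 = inner (P0 Om) w0 by rewrite JOm.
  by apply/eqP => h; apply: gz0; rewrite gE -/w0 e aP0 h ip0r.
have l0 : 0 < l.
  have := P0l w0 w0 (V_mem z0) (V_mem z0); rewrite !ip_nrm -rmorphM => /complexI e.
  have : 0 < nrm (P0 w0) ^+ 2.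
    by rewrite exprn_gt0 // lt_neqAle nrm_ge0 andbT eq_sym; apply: contra P0w => /eqP/nrm_eq0 ->.
  by rewrite e; have := nrm_ge0 w0; move: (nrm w0) => r; nra.
pose c : R[i] := (Num.sqrt l)^-1%:C.
have cc : conjc c * (c * l%:C) = 1.
  rewrite /c conjc_real -!rmorphM mulrA -invfM -expr2 sqr_sqrtr ?ltW // mulVf ?gt_eqF //.
have /choice[Ji HJi] w : exists u, J u = P0 w by apply: Jr; exact: P0L.
have Jinj u v : J u = J v -> u = v.
  move=> e; apply/eqP; rewrite -subr_eq0; apply/eqP/ip_eq0.
  by rewrite -iJ (linB lJ) e subrr ip0l.
pose m (z : E t) u := c *: Ji (tau (Q z) (J u)).
have Jm (z : E t) u : J (m z u) = c *: P0 (tau (Q z) (J u)) by rewrite (linZ lJ) HJi.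
have VJ (z : E t) u : V t (tau (Q z) (J u)) by exact: V_J.
have mi' (z : E t) u (z' : E t) u' : inner (m z u) (m z' u') = inner u (rho (rip z z') u').
  rewrite -iJ !Jm ipZl ipZr P0l // -[RHS]iJ Ja /i -(cov_rip Qcov) (repM rt) -(rep_adj' rt).
  by rewrite (mulrA c) (mulrA (conjc c)) cc mul1r.
have ma a (z : E t) u : rho a (m z u) = m (lact a z) u.
  apply: Jinj; rewrite Ja !Jm (linZ (rep_lin rt _)) -comm0 -(cov_lact Qcov) (repM rt).
  by [].
have m0 : m z0 xi != 0.
  apply/eqP => h; have := Jm z0 xi; rewrite h (lin0 lJ) JO => /esym/eqP.
  rewrite scaler_eq0 (negbTE P0w) orbF /c fmorph_eq0 invr_eq0 sqrtr_eq0 leNgt l0.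
  by [].
have xr := spectrum_of_mem rho.
split.
  exists rho => //; exists (rip z0 z0), xi; split; first exact: sI_rip.
  by move=> h; move/eqP: m0; apply; apply: ip_eq0; rewrite mi' h ip0r.
exists rho, rho; split=> //; exists m; split=> //.
- move=> u k z z'; apply: Jinj; rewrite lJ !Jm (cov_linear Qcov) (rep_linl rt) lP0.
  by rewrite scalerDr !scalerA mulrC.
- move=> z k u u'; apply: Jinj; rewrite lJ !Jm lJ (rep_lin rt) lP0.
  by rewrite scalerDr !scalerA mulrC.
- pose X := [set eta | exists z u, eta = m z u].
  have iX a u : closed_span X u -> closed_span X (rho a u).
    apply: (closed_span_image (rep_lin rep a) (rep_contr rep a)).
    + exact: subspace_span.
    + exact: closed_closed_span.
    + by move=> _ [z [v ->]]; apply: sub_closed_span; exists (lact a z), v.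
  have [h|//] := (irrep_irr rho).2 _ (subspace_span X) (@closed_closed_span _ _ X) iX.
  have : closed_span X (m z0 xi) by apply: sub_closed_span; exists z0, xi.
  by rewrite h => e; move/eqP: m0.
Qed.

End Extensions.

Lemma trivial_isotropy_unique_extension (f : A -> R[i]) x : pure_states f ->
  is_GNS_class f x -> trivial_isotropy E x -> uniquely_extending i f.
Proof.
move=> pf fx tx; split=> //; have sf := pf.1.
have [rho [xi [fE xi1 cxi]]] := pure_gns pf; have rep := irrep_rep rho.
have xr : x = spectrum_of rho.
  apply: gns_class_uniq fx _; exists rho; split; first exact: spectrum_of_mem.
  by exists xi; split=> //; exact/(cyclic_span rep).
subst x.
have [g0 [sg0 g0f _]] := Qext sf; exists g0; split=> // g [sg gf].
suff key t (z : E t) : g0 (Q z) = g (Q z).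
  have [lg _] := state_positive sg; have [lg0 _] := state_positive sg0.
  apply/funext => b; have : closed_span [set b | exists t (z : E t), b = Q z] b by rewrite Qspan.
  have ld : linear (fun b => g0 b - g b : R[i]^o).
    move=> c u v; rewrite lg lg0 scalerBr; rewrite opprD addrACA.
    by [].
  move=> hb; apply/eqP; rewrite -subr_eq0; apply/eqP.
  apply: (@closed_span_image _ _ _ (fun b => g0 b - g b : R[i]^o) 2 ld _ _ [set 0]) hb.
  - move=> u; apply: le_trans (nrmB _ _) _; rewrite mulr_natl mulr2n lerD // state_nrm //.
  - exact: subspace_zero.
  - exact: closed_zero.
  - by move=> _ [t [z ->]] /=; rewrite key subrr.
have [K [tau [Om [rt gE O1 cO]]]] := gns sg.
have [K0 [tau0 [Om0 [rt0 g0E O10 cO0]]]] := gns sg0.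
have [[v [vt v1 xv]]|no] := pselect
    (exists v, [/\ nat_le v t, nat_le v 1%g & spectrum_open (sI (E v)) (spectrum_of rho)]).
  have vv := nat_le1 v1; have h := nat_le_idemE vt vv.
  apply/eqP; rewrite -subr_eq0; apply/eqP/nrm_small => e e0.
  have z1 : 0 < nrm z + 1 by rewrite ltr_wpDl ?nrm_ge0.
  have d0 : 0 < e / 2 / (nrm z + 1) by rewrite !divr_gt0.
  have [a [y [va ay]]] := (spectrum_openP _ (spectrum_of_mem rho)).1 xv.
  have [_ [u uv <-] xu] := irr_ideal_cyclic rep (irrep_irr rho) (sI_ideal (E v))
    (ex_intro _ a (ex_intro _ y (conj va ay))) (nrm1_neq0 xi1) xi d0.
  move: uv xu; rewrite -(j1_range E vv) => -[w _ <-] xu.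
  have h1 := extension_near_idem fE xi1 cxi gf rt gE O1 z h vt v1 (lexx _).
  have h2 := extension_near_idem fE xi1 cxi g0f rt0 g0E O10 z h vt v1 (lexx _).
  have h3 : nrm z * nrm (xi - rho (j1 w) xi) < e / 2.
    exact: (mul_lt_div (nrm_ge0 z) (nrm_ge0 _) (nrm_ge0 z) (lexx _) xu).
  have := nrm_tri (f (j1 (fmul h z w))) (g0 (Q z)) (g (Q z)).
  rewrite (nrmBC (f _) (g _)); move: (h1 w) (h2 w) h3; lra.
have zero g' (K' : hilbertSpace R) (tau' : B -> K' -> K') (Om' : K') : is_state g' -> (forall a, g' (i a) = f a) ->
    is_representation tau' -> (forall b, g' b = inner Om' (tau' b Om')) -> nrm Om' = 1 ->
    g' (Q z) = 0.
  move=> sg' gf' rt' gE' O1'; apply: contrapT => gz.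
  have ind := extension_induced fE xi1 cxi gf' rt' gE' O1' gz.
  (* The arrow [[t, x]] is an isotropy arrow, hence the unit; a witness of this equality is a
     [v <= t, 1] whose source ideal supports [x], excluded in the present case. *)
  have ge : germ E t (spectrum_of rho) = germ E 1%g (spectrum_of rho).
    by apply: tx; exists t; split=> //; exact: ind.1.
  have : germ E t (spectrum_of rho) (t, spectrum_of rho).
    split=> //; exists t; split; [exact: nat_le_refl | exact: nat_le_refl | exact: ind.1].
  by rewrite ge => -[_ [v [v1 vt xv]]]; apply: no; exists v.
by rewrite (zero g K tau Om) // (zero g0 K0 tau0 Om0).
Qed.

End UniqueExtension.

(** * Extensions obtained from the expectation, and the three equivalences *)

Section Quotients.
Variables (R : realType) (S : inverseMonoidType) (A : cstarAlgebra R).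
Variable E : bimodule_action S A.

Lemma covariant_comp (D B : cstarAlgebra R) (pi : forall t, E t -> D) (p : D -> B) :
  star_hom p -> covariant pi -> covariant (fun t (z : E t) => p (pi t z)).
Proof.
move=> [lp mp sp] [c1 c2 c3 c4]; split=> [t c x y|t u x y|t x y|t x y].
- by rewrite c1 lp.
- by rewrite -mp c2.
- by rewrite -sp -mp c3.
- by rewrite -sp -mp c4.
Qed.

Lemma surjective_span (D B : cstarAlgebra R) (pi : forall t, E t -> D) (p : D -> B) :
  star_hom p -> range p = setT -> closed_span [set d | exists t (z : E t), d = pi t z] = setT ->
  closed_span [set b | exists t (z : E t), b = p (pi t z)] = setT.
Proof.
move=> hp pT piT; have [lp _ _] := hp; apply/seteqP; split=> // b _.
have : range p b by rewrite pT.
case=> d _ <-; have : closed_span [set d | exists t (z : E t), d = pi t z] d by rewrite piT.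
apply: (closed_span_image (M := 1) lp).
- by move=> u; rewrite mul1r (star_hom_contr hp).
- exact: subspace_span.
- exact: closed_closed_span.
- by move=> _ [t [z ->]]; apply: sub_closed_span; exists t, z.
Qed.

Lemma state_bounded (f : A -> R[i]) : is_state f -> bounded_functional f.
Proof.
move=> sf; have [lf _ nf _] := sf; split=> //; exists 1 => a.
by rewrite mul1r; exact: nf.
Qed.

(** The value at [b] is that of [Er] at any preimage: an element killed by [p] is killed by [q],
    hence by [Er]. Positivity is the case of 1-by-1 matrices of complete positivity. *)
Lemma reduced_extension (D Dr B : cstarAlgebra R) (pi : forall t, E t -> D) (q : D -> Dr)
    (p : D -> B) (r : B -> Dr) (f : A -> R[i]) :
  covariant pi -> is_reduced_crossed_product pi q -> star_hom p -> range p = setT ->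
  star_hom r -> (forall d, r (p d) = q d) -> is_state f ->
  exists g : B -> R[i],
  [/\ is_state g, forall a, g (p (pi 1%g (unit_iso E a))) = f a
    & forall t (z : E t), (forall a, I1 E t a -> f a = 0) -> g (p (pi t z)) = 0].
Proof.
move=> cpi [hq _ [Er [ErP qEr _]]] hp pT hr rpq sf.
have [lp mp sp] := hp; have [lq _ _] := hq; have [lr _ _] := hr.
have bf := state_bounded sf; have [_ Er2 Er3 Er4 _] := ErP.
have lE : scalar (Er^~ f) by exact: Er2.
have [lf p0f nf _] := sf.
have pE d : 0 <= Er (star d ** d) f.
  have := Er4 1 (fun _ _ => f) (fun _ _ => bf) _ (fun=> d).
  by rewrite !big_ord1; apply=> a; rewrite !big_ord1; exact: p0f.
have nE d : nrm (Er d f) <= nrm d.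
  rewrite -lecR -!nrmE -[leRHS]mul1r; apply: Er3 => // a.
  by rewrite mul1r; exact: nf.
have /choice[s Hs] b : exists d, p d = b.
  by have : range p b by [rewrite pT]; case=> d _ <-; exists d.
have well d d' : p d = p d' -> Er d f = Er d' f.
  move=> e; apply/eqP; rewrite -subr_eq0 -(sclB lE); apply/eqP.
  have : q (d - d') = 0 by rewrite -rpq (linB lp) e subrr (lin0 lr).
  by move=> h; apply: qEr.
pose g b := Er (s b) f.
have gE d : g (p d) = Er d f by apply: well; rewrite Hs.
have lg : scalar g.
  by move=> c a b; rewrite -lE /g; apply: well; rewrite lp !Hs.
have pg b : 0 <= g (star b ** b).
  by rewrite -(Hs b) -sp -mp gE.
(* [Er] is contractive for the norm of the full crossed product, which dominates that of [B]. The
   inequality [|g b|^2 <= g (star b ** b)] does not involve norms, passes to [B], and gives back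
   contractivity there. *)
have cg b : nrm (g b) <= nrm b.
  apply: functional_contr => // {}b; rewrite -(Hs b) -sp -mp !gE.
  exact: (functional_cs (conj lE pE) nE).
have gf a : g (p (pi 1%g (unit_iso E a))) = f a by rewrite gE (Er_unit ErP).
exists g; split=> //.
  exact: (extension_is_state (covariant_comp hp cpi) sf).
by move=> t z kill; rewrite gE (Er_kill ErP).
Qed.

Lemma GNS_class_ex (f : A -> R[i]) : pure_states f -> exists x, is_GNS_class f x.
Proof.
move=> pf; have [rho [xi [fE _ cxi]]] := pure_gns pf.
exists (spectrum_of rho), rho; split; first exact: spectrum_of_mem.
by exists xi; split=> //; exact/(cyclic_span (irrep_rep rho)).
Qed.

Lemma unit_vector (rho : irrep A) a (u : irrep_space rho) : rho a u <> 0 ->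
  exists w : irrep_space rho, nrm w = 1 /\ rho a w <> 0.
Proof.
move=> au; have rep := irrep_rep rho.
have u0 : nrm u != 0.
  by apply/eqP => /nrm_eq0 u0; apply: au; rewrite u0 (lin0 (rep_lin rep a)).
have up : 0 < nrm u by rewrite lt_neqAle eq_sym u0 nrm_ge0.
exists ((nrm u)^-1%:C *: u); rewrite nrmZ nrmC gtr0_norm ?invr_gt0 // mulVf //.
split=> //; rewrite (linZ (rep_lin rep a)) => /eqP.
by rewrite scaler_eq0 fmorph_eq0 invr_eq0 (negbTE u0) /= => /eqP.
Qed.

Lemma vector_GNS_class (rho : irrep A) (w : irrep_space rho) x : sval x rho -> nrm w = 1 ->
  is_GNS_class (fun a => inner w (rho a w)) x.
Proof.
move=> xr w1; have rep := irrep_rep rho; exists rho; split=> //; exists w; split=> //.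
exact/(cyclic_span rep)/(irr_cyclic rep (irrep_irr rho))/nrm1_neq0.
Qed.

Section FromUniqueExtension.
Variables (B : cstarAlgebra R) (i : A -> B).
Hypothesis unique_extension : forall f : A -> R[i], pure_states f ->
  (uniquely_extending i f <-> exists2 x, is_GNS_class f x & trivial_isotropy E x).

Lemma extension_property_principal : extension_property i <-> principal E.
Proof.
split=> [ext x|pr].
  have [rho xr] := spectrum_ex x.
  have [[a [u au]] _] := irrep_irr rho.
  have [w [w1 _]] := unit_vector au.
  have pw := irr_pure (irrep_rep rho) (irrep_irr rho) w1.
  have : uniquely_extending i (fun a => inner w (rho a w)) by rewrite ext.
  move=> /(unique_extension pw)[y fy ty].
  by rewrite (gns_class_uniq (vector_GNS_class xr w1) fy).
apply/seteqP; split=> [f []//|f pf].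
have [x fx] := GNS_class_ex pf; apply/(unique_extension pf).
by exists x => //; exact: pr.
Qed.

Lemma almost_extension_property_principal :
  almost_extension_property i <-> topologically_principal E.
Proof.
split=> [ext J iJ [x [rho xr [a [u [Ja au]]]]]|tp f pf].
  have [w [w1 aw]] := unit_vector au; have rep := irrep_rep rho.
  (* [b] lies in [J] and [f b] is nonzero; a state closer to [f] at [b] than [|f b|] does not vanish
     at [b], so its class lies in the open set of [J]. *)
  pose f a := inner w (rho a w); pose b := star a ** a.
  have pw : pure_states f := irr_pure rep (irrep_irr rho) w1.
  have fb : 0 < nrm (f b).
    rewrite lt_neqAle nrm_ge0 andbT eq_sym; apply/eqP => /nrm_eq0 h.
    by apply: aw; apply: ip_eq0; rewrite (rep_sqr rep).
  have [f' [uf' near]] := closure_ptws_near b (ext f pw) fb.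
  have [y fy ty] := (unique_extension uf'.1).1 uf'; exists y; split=> //.
  have [sg [ysg [v [_ f'E]]]] := fy; exists sg => //; exists b, v.
  split; first by case: iJ => _ _ Jl _; exact: Jl.
  by move=> h; move: near; rewrite f'E h ip0r subr0 ltxx.
have := vector_states_dense tp pf; apply: closure_subset => psi vp.
have pp := vector_states_pure vp; apply/(unique_extension pp).
have [x [rho [w [tx xr w1 psiE]]]] := vp; exists x => //.
have -> : psi = fun a => inner w (rho a w) by apply/funext.
exact: vector_GNS_class.
Qed.

End FromUniqueExtension.
End Quotients.

Theorem theorem5p11 (R : realType) (S : inverseMonoidType) (A : cstarAlgebra R)
    (E : bimodule_action S A)
    (AS : cstarAlgebra R) (pi : forall t : S, E t -> AS)
    (AS_full : is_crossed_product pi)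
    (ASr : cstarAlgebra R) (q : AS -> ASr)
    (ASr_reduced : is_reduced_crossed_product pi q)
    (B : cstarAlgebra R) (p : AS -> B) (r : B -> ASr)
    (p_hom : star_hom p) (p_surj : range p = setT)
    (r_hom : star_hom r) (r_surj : range r = setT)
    (rp_q : forall d : AS, r (p d) = q d) :
  let i : A -> B := fun a => p (pi 1%g (unit_iso E a)) in
  [/\ forall f : A -> R[i], pure_states f ->
        (uniquely_extending i f <->
         exists2 x : spectrum A, is_GNS_class f x & trivial_isotropy E x),
      almost_extension_property i <-> topologically_principal E
    & extension_property i <-> principal E].
Proof.
move=> i; have cov := AS_full.1.
pose Q t (z : E t) := p (pi t z).
have Qcov : covariant Q := covariant_comp p_hom cov.
have Qspan := surjective_span p_hom p_surj (crossed_product_span AS_full).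
have Qext f := reduced_extension cov ASr_reduced p_hom p_surj r_hom rp_q (f := f).
have ue f : pure_states f -> (uniquely_extending i f <->
    exists2 x : spectrum A, is_GNS_class f x & trivial_isotropy E x).
  move=> pf; split; first exact: (unique_extension_trivial_isotropy Qcov Qext).
  by case=> x; exact: (trivial_isotropy_unique_extension Qcov Qspan Qext pf).
split=> //; first exact: almost_extension_property_principal.
exact: extension_property_principal.
Qed.
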